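(* Let $(M,g)$ be a smooth, compact Riemannian manifold of dimension $n$ and let $k$ be a positive integer such that $2k<n$. Then $\mathcal{A}(M)=K_0(n,k)>0$. In particular, for any $\epsilon>0$ there exists $B_\epsilon\in\mathbb{R}$ such that for all $u\in H_k^2(M)$ one has $$\left(\int_M|u|^{2_k^\sharp}\,dv_g\right)^{\frac{2}{2_k^\sharp}}\le (K_0(n,k)+\epsilon)\int_M(\Delta_g^{k/2}u)^2\,dv_g+B_\epsilon\|u\|_{H_{k-1}^2}^2.$$
   Context: $M$ is without boundary, $\Delta_g:=-\mathrm{div}_g(\nabla)$, $2_k^\sharp:=\frac{2n}{n-2k}$. $\Delta_g^{l/2}u:=\Delta_g^m u$ if $l=2m$ is even and $\Delta_g^{l/2}u:=\nabla\Delta_g^m u$ if $l=2m+1$ is odd (squares are then $g$-squared norms). For $l\ge 0$, $H_l^2(M)$ is the completion of $C^\infty(M)$ for the norm $\|u\|_{H_l^2}^2:=\sum_{\alpha=0}^l\int_M(\Delta_g^{\alpha/2}u)^2\,dv_g$. $\mathcal{A}(M)$ is the infimum of all $A\in\mathbb{R}$ for which there exists $B\in\mathbb{R}$ such that for all $u\in H_k^2(M)$: $\|u\|_{L^{2_k^\sharp}}^2\le A\int_M(\Delta_g^{k/2}u)^2\,dv_g+B\|u\|_{H_{k-1}^2}^2$. $\mathscr{D}^{k,2}(\mathbb{R}^n)$ is the completion of $C_c^\infty(\mathbb{R}^n)$ for the norm $u\mapsto\|\Delta^{k/2}u\|_2$, and $K_0(n,k)$ is defined by $\frac{1}{K_0(n,k)}:=\inf_{u\in\mathscr{D}^{k,2}(\mathbb{R}^n)\setminus\{0\}}\frac{\int_{\mathbb{R}^n}(\Delta^{k/2}u)^2dx}{\left(\int_{\mathbb{R}^n}|u|^{2_k^\sharp}dx\right)^{2/2_k^\sharp}}$.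 *)

(* Defs.v *)
From HB Require Import structures.
From mathcomp Require Import all_boot all_order all_algebra.
From mathcomp Require Import all_classical all_reals all_analysis.
Import Order.TTheory GRing.Theory Num.Theory numFieldNormedType.Exports.

Set Implicit Arguments.
Unset Strict Implicit.
Unset Printing Implicit Defensive.

Local Open Scope classical_set_scope.
Local Open Scope ring_scope.

Definition tuple_cons {T : Type} n (p : T * n.-tuple T) : n.+1.-tuple T :=
  [tuple of p.1 :: p.2].

Section tuple_measure_step.
Context {R : realType} d (T : measurableType d) (n : nat).
Context (m1 : {sigma_finite_measure set T -> \bar R}).
Context (m2 : {sigma_finite_measure set (n.-tuple T) -> \bar R}).

Definition tuple_measureS : set (n.+1.-tuple T) -> \bar R :=
  pushforward (m1 \x m2)%E (@tuple_cons T n).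

Let measurable_tuple_cons : measurable_fun setT (@tuple_cons T n).
Proof.
by apply: measurable_cons; [exact: measurable_fst|exact: measurable_snd].
Qed.

Let tuple_measureS0 : tuple_measureS set0 = 0%E.
Proof. by rewrite /tuple_measureS /pushforward preimage_set0 measure0. Qed.

Let tuple_measureS_ge0 A : (0 <= tuple_measureS A)%E.
Proof. exact: measure_ge0. Qed.

Let tuple_measureS_sigma_additive : semi_sigma_additive tuple_measureS.
Proof. exact: measure_semi_sigma_additive. Qed.

HB.instance Definition _ := isMeasure.Build _ _ _ tuple_measureS
  tuple_measureS0 tuple_measureS_ge0 tuple_measureS_sigma_additive.

Let tuple_measureS_sigma_finite : sigma_finite setT tuple_measureS.
Proof.
have /sigma_finiteP[F [FT ndF Foo]] := sigma_finiteT m1.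
have /sigma_finiteP[G [GT ndG Goo]] := sigma_finiteT m2.
pose uncons (t : n.+1.-tuple T) := (thead t, [tuple of behead t]).
exists (fun k => uncons @^-1` (F k `*` G k)).
  rewrite -preimage_bigcup; apply/esym; rewrite -subTset => t _ /=.
  have [i _ Fi] : (\bigcup_k F k) (thead t) by rewrite -FT.
  have [j _ Gj] : (\bigcup_k G k) [tuple of behead t] by rewrite -GT.
  exists (maxn i j) => //; split => /=.
    by move: Fi; exact/subsetPset/ndF/leq_maxl.
  by move: Gj; exact/subsetPset/ndG/leq_maxr.
move=> k; have [mF Fk] := Foo k; have [mG Gk] := Goo k; split.
  rewrite -[X in measurable X]setTI.
  have muncons : measurable_fun setT uncons.
    by apply: measurable_fun_pair; [exact: measurable_tnth|exact: measurable_behead].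
  by apply: muncons => //; exact: measurableX.
rewrite /tuple_measureS /pushforward -comp_preimage.
rewrite (_ : uncons \o _ = id) ?preimage_id; last first.
  by apply/funext => -[x t] /=; congr pair; apply/val_inj.
by rewrite product_measure1E// lte_mul_pinfty// ge0_fin_numE.
Qed.

HB.instance Definition _ := Measure_isSigmaFinite.Build _ _ _ tuple_measureS
  tuple_measureS_sigma_finite.

End tuple_measure_step.

(* n-dimensional Lebesgue measure, as an iterated product of the one on [R] *)
Fixpoint lebesgue_tuple {R : realType} n :
    {sigma_finite_measure set (n.-tuple (measurableTypeR R)) -> \bar R} :=
  match n with
  | 0 => @dirac _ (0.-tuple (measurableTypeR R)) [tuple] R
  | m.+1 => tuple_measureS (@lebesgue_measure R) (lebesgue_tuple m)
  end.

Definition rV_of_tuple {R : realType} n (t : n.-tuple (measurableTypeR R)) :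
  'rV[R]_n := \row_i (tnth t i : R).

Section calculus.
Context {R : realType} {n : nat}.
Implicit Types (f : 'rV[R]_n -> R) (U : set 'rV[R]_n).

Definition partial (i : 'I_n) f : 'rV[R]_n -> R :=
  fun x => derive f x (delta_mx ord0 i).

(* Meaningful for [U] open. *)
Definition smooth_on U f : Prop :=
  forall (s : seq 'I_n) (x : 'rV[R]_n), U x ->
    differentiable (foldr partial f s) x.

(* Riemannian calculus in coordinates: [G x] is the matrix of the metric
   at [x], vector fields are given by their components. *)
Variable G : 'rV[R]_n -> 'M[R]_n.

Definition volume_density (x : 'rV[R]_n) : R := Num.sqrt (\det (G x)).

Definition gradient f : 'I_n -> 'rV[R]_n -> R :=
  fun i x => \sum_(j < n) invmx (G x) i j * partial j f x.

Definition divergence (X : 'I_n -> 'rV[R]_n -> R) : 'rV[R]_n -> R :=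
  fun x => (volume_density x)^-1 *
    \sum_(i < n) partial i (fun y => volume_density y * X i y) x.

Definition laplacian f : 'rV[R]_n -> R := fun x => - divergence (gradient f) x.

Definition gradient_sqnorm f : 'rV[R]_n -> R :=
  fun x => \sum_(i < n) \sum_(j < n) G x i j * gradient f i x * gradient f j x.

End calculus.

(* The integrand [(Delta^(l/2) u)^2], for a Laplacian [lap] and a squared norm
   of the gradient [gradsq]. *)
Definition half_laplacian_sq {R : realType} {T : Type}
    (lap gradsq : (T -> R) -> T -> R) (l : nat) (u : T -> R) : T -> R :=
  let v := iter l./2 lap u in if odd l then gradsq v else fun x => v x ^+ 2.

Definition critical_exponent (R : realType) (n k : nat) : R :=
  (2 * n)%:R / (n%:R - (2 * k)%:R).

Section euclidean.
Context {R : realType} (n k : nat).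

Let p : R := critical_exponent R n k.
Let dx := @lebesgue_tuple R n.

Definition euclidean_half_laplacian_sq (l : nat) (u : 'rV[R]_n -> R) :
    'rV[R]_n -> R :=
  half_laplacian_sq (laplacian (fun=> 1%:M)) (gradient_sqnorm (fun=> 1%:M)) l u.

Definition euclidean_energy (u : 'rV[R]_n -> R) : R :=
  \int[dx]_t euclidean_half_laplacian_sq k u (rV_of_tuple t).

Definition test_function (u : 'rV[R]_n -> R) : Prop :=
  smooth_on setT u /\ compact (closure [set x | u x != 0]).

(* An element of the completion of [C_c^oo(R^n)] is given by a Cauchy sequence,
   together with the function that it represents: by Sobolev's inequality such
   a sequence converges in [L^p], [p] the critical exponent. *)
Record homogeneous_sobolev := HomogeneousSobolev {
  hs_fun :> 'rV[R]_n -> R;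
  hs_seq : nat -> 'rV[R]_n -> R;
  hs_test : forall i, test_function (hs_seq i);
  hs_cauchy : forall e : R, 0 < e -> exists N : nat, forall i j : nat,
    (N <= i)%N -> (N <= j)%N ->
    euclidean_energy (fun x => hs_seq i x - hs_seq j x) < e;
  hs_measurable : measurable_fun setT (hs_fun \o @rV_of_tuple R n);
  hs_cvg : (\int[dx]_t
    (`|hs_seq i (rV_of_tuple t) - hs_fun (rV_of_tuple t)| `^ p)%:E)%E
      @[i --> \oo] --> 0%E }.

Definition hs_energy (u : homogeneous_sobolev) : R :=
  limn (fun i => euclidean_energy (hs_seq u i)).

Definition sobolev_quotient (u : homogeneous_sobolev) : R :=
  hs_energy u / (\int[dx]_t `|u (rV_of_tuple t)| `^ p) `^ (2 / p).

(* [hs_energy u != 0] says that [u] is a nonzero element of the completion.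
   Pitfall: [inf] is [0] on sets without infimum and [0^-1 = 0]; hence
   [0 < K0] says that the infimum is a genuine one and is positive. *)
Definition K0 : R :=
  (inf [set sobolev_quotient u | u in [set u | hs_energy u != 0]])^-1.

End euclidean.

Record riemannian_manifold (R : realType) (n : nat) := RiemannianManifold {
  manifold_space :> ptopologicalType;
  manifold_hausdorff : hausdorff_space manifold_space;
  manifold_second_countable : @second_countable manifold_space;
  chart_index : Type;
  chart_dom : chart_index -> set manifold_space;
  chart : chart_index -> manifold_space -> 'rV[R]_n;
  chart_inv : chart_index -> 'rV[R]_n -> manifold_space;
  chart_dom_open : forall i, open (chart_dom i);
  chart_dom_cover : forall p, exists i, chart_dom i p;
  chart_cod_open : forall i, open (chart i @` chart_dom i);
  chartK : forall i p, chart_dom i p -> chart_inv i (chart i p) = p;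
  chart_continuous : forall i, {within chart_dom i, continuous (chart i)};
  chart_inv_continuous : forall i,
    {within chart i @` chart_dom i, continuous (chart_inv i)};
  transition_smooth : forall i j (a : 'I_n),
    smooth_on (chart i @` (chart_dom i `&` chart_dom j))
      (fun x => chart j (chart_inv i x) ord0 a);
  metric : chart_index -> 'rV[R]_n -> 'M[R]_n;
  metric_smooth : forall i (a b : 'I_n),
    smooth_on (chart i @` chart_dom i) (fun x => metric i x a b);
  metric_sym : forall i x, (chart i @` chart_dom i) x ->
    (metric i x)^T = metric i x;
  metric_posdef : forall i x, (chart i @` chart_dom i) x ->
    forall v : 'rV[R]_n, v != 0 -> 0 < (v *m metric i x *m v^T) ord0 ord0;
  (* [g_i(v, v) = g_j(df v, df v)]; row vectors: [df v] is [v *m 'J f x] *)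
  metric_transition : forall i j x,
    (chart i @` (chart_dom i `&` chart_dom j)) x ->
    let f := fun y => chart j (chart_inv i y) in
    metric i x = 'J f x *m metric j (f x) *m ('J f x)^T }.

Definition borel {R : realType} {n : nat} (M : riemannian_manifold R n) :=
  g_sigma_algebraType (@open M).

Section manifold.
Context {R : realType} {n : nat} (M : riemannian_manifold R n).
Implicit Types u : M -> R.

Definition chart_at (p : M) : chart_index M := projT1 (cid (chart_dom_cover p)).

Definition smooth u : Prop := forall i : chart_index M,
  smooth_on (chart i @` chart_dom i) (u \o chart_inv i).

Definition manifold_laplacian u : M -> R := fun p =>
  let i := chart_at p in laplacian (metric i) (u \o chart_inv i) (chart i p).

Definition manifold_gradient_sqnorm u : M -> R := fun p =>
  let i := chart_at p in
  gradient_sqnorm (metric i) (u \o chart_inv i) (chart i p).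

Definition manifold_half_laplacian_sq (l : nat) u : M -> R :=
  half_laplacian_sq manifold_laplacian manifold_gradient_sqnorm l u.

(* [mu] is [dv_g]: in every chart it has density [sqrt (det g)]. *)
Definition is_riemannian_volume (mu : {measure set (borel M) -> \bar R}) :
    Prop :=
  forall (i : chart_index M) (A : set (borel M)),
    measurable A -> A `<=` chart_dom i ->
    mu A = (\int[@lebesgue_tuple R n]_(t in
              [set t | (chart i @` A) (rV_of_tuple t)])
            (volume_density (metric i) (rV_of_tuple t))%:E)%E.

Section sobolev.
Variable mu : {measure set (borel M) -> \bar R}.

Definition energy (l : nat) u : R :=
  \int[mu]_p manifold_half_laplacian_sq l u p.

Definition sobolev_sqnorm (l : nat) u : R := \sum_(a < l.+1) energy a u.

(* An element of the completion [H_l^2(M)] of [C^oo(M)] is given by a Cauchy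
   sequence, together with the function that it represents, its limit in
   [L^2]. *)
Record sobolev (l : nat) := Sobolev {
  sobolev_fun :> M -> R;
  sobolev_seq : nat -> M -> R;
  sobolev_smooth : forall i, smooth (sobolev_seq i);
  sobolev_cauchy : forall e : R, 0 < e -> exists N : nat, forall i j : nat,
    (N <= i)%N -> (N <= j)%N ->
    sobolev_sqnorm l (fun p => sobolev_seq i p - sobolev_seq j p) < e;
  sobolev_measurable : measurable_fun [set: borel M] sobolev_fun;
  sobolev_cvg : (\int[mu]_p ((sobolev_seq i p - sobolev_fun p) ^+ 2)%:E)%E
    @[i --> \oo] --> 0%E }.

(* Extensions by continuity; meaningful for [a <= l] and [m <= l]. *)
Definition sobolev_energy (l a : nat) (u : sobolev l) : R :=
  limn (fun i => energy a (sobolev_seq u i)).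

Definition completion_sqnorm (l m : nat) (u : sobolev l) : R :=
  limn (fun i => sobolev_sqnorm m (sobolev_seq u i)).

(* Pitfall: this is [0] if the set is empty or unbounded below. *)
Definition best_constant (k : nat) : R :=
  inf [set A : R | exists B : R, forall u : sobolev k,
    ('N[mu]_((critical_exponent R n k)%:E) [EFin \o (u : borel M -> R)] ^+ 2
     <= (A * sobolev_energy k u + B * completion_sqnorm k.-1 u)%:E)%E].

End sobolev.
End manifold.

(* Main.v *)
Require Import Defs.
From HB Require Import structures.
From mathcomp Require Import all_boot all_order all_algebra.
From mathcomp Require Import all_classical all_reals all_analysis.
From mathcomp Require Import measurable_realfun ring lra.
Import Order.TTheory GRing.Theory Num.Theory numFieldNormedType.Exports.

(* Positivity of [K0] is the Sobolev inequality on R^n, proved by Gagliardo's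
   induction on the dimension and iterated over the order of derivation.

   Upper bound.  A linear change of variables carries the sharp Euclidean
   inequality to every constant metric.  On a small coordinate ball the metric
   is close to a constant one; freezing its coefficients costs an arbitrarily
   small multiple of the energy of order [k], by elliptic coercivity, and lower
   order terms, which an interior estimate bounds by energies of order less
   than [k].  With a finite partition [sum_i eta_i^2 = 1] subordinate to such
   balls, Minkowski's inequality in [L^(p/2)] gives
   [||u||_p^2 <= sum_i ||eta_i u||_p^2], and [sum_i eta_i^2 = 1] reassembles the
   leading terms into the global energy.  Truncation passes the inequality from
   smooth functions to the completion, where only [L^2] convergence is known.

   Lower bound.  In a chart, test the inequality on [v(y / lambda)] with
   [lambda] tending to [0]: the metric becomes constant and the lower order
   terms vanish, which leaves the Euclidean inequality with constant [A].

   That the Laplacian does not depend on the chart is read off its weak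
   formulation, since gradient products and integrals are chart independent. *)

Set Implicit Arguments.
Unset Strict Implicit.
Unset Printing Implicit Defensive.

Local Open Scope classical_set_scope.
Local Open Scope ring_scope.

(** Nearly every integrand is continuous with bounded support ([cc]), so integrals are real numbers
    and linearity is free. Order [m] is measured by [Dsq m], the squares of all partial derivatives
    of that order, against [jet m], the orders below. Integration by parts gives [Dsq k] and the
    polyharmonic energy the same integral; this is why a Sobolev inequality obtained one derivative
    at a time bears on [K0]. The completions are a source of obstacles. An element of nonzero energy
    must have a nonzero [L^p] norm, for otherwise its quotient would be the default value [0] of a
    division by [0] and spoil the infimum; a duality argument excludes this. On the manifold only
    [L^2] convergence is given, so membership in [L^p] is a conclusion. Charts are another.
    [manifold_laplacian] uses at each point an arbitrarily chosen chart, so it can be neither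
    iterated nor integrated before chart independence is known, and [mu] is specified only on
    subsets of chart domains, so that even finiteness of the volume has to be derived from
    compactness. *)

Local Notation X := (@rV_of_tuple _ _).
Local Notation tup R n := (n.-tuple (measurableTypeR R)).
Local Notation dx := lebesgue_tuple.

(** * Integration over row vectors *)

Section borel_structure_of_row_vectors.
Context {R : realType}.

Definition tuple_of_rV n (x : 'rV[R]_n) : n.-tuple (measurableTypeR R) :=
  [tuple x ord0 i | i < n].

Lemma tuple_of_rVK n : cancel (@tuple_of_rV n) X.
Proof. by move=> x; apply/rowP => i; rewrite mxE tnth_mktuple. Qed.

Lemma ball_rVP n (x y : 'rV[R]_n) (e : R) : 0 < e ->
  ball x e y <-> forall i, `|x ord0 i - y ord0 i| < e.
Proof.
move=> e0; split=> [[_ h] i|h]; first exact: h.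
by split=> // i j; rewrite ord1; exact: h.
Qed.

(** Tuples carry the product sigma-algebra, while openness of [U] refers to the sup norm of row
    vectors. [U] is the union of the boxes with rational centre and half-width [1/(m+1)] that it
    contains, a countable family. *)
Lemma measurable_preimage_rV n (U : set 'rV[R]_n) :
  open U -> measurable (@rV_of_tuple R n @^-1` U).
Proof.
move=> oU.
pose box (q : {ffun 'I_n -> rat}) (m : nat) : set 'rV[R]_n :=
  [set x | forall i, `|x ord0 i - ratr (q i)| < m.+1%:R^-1].
have mbox q m : measurable (@rV_of_tuple R n @^-1` box q m).
  rewrite (_ : _ @^-1` _ = \big[setI/setT]_(i < n)
      (fun t : n.-tuple (measurableTypeR R) => tnth t i) @^-1`
        [set s : measurableTypeR R | `|s - ratr (q i)| < m.+1%:R^-1]).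
    apply: bigsetI_measurable => i _; rewrite -[_ @^-1` _]setTI.
    apply: measurable_tnth => //.
    rewrite (_ : [set _ | _] = ball (ratr (q i) : R) (m.+1%:R^-1)); last first.
      by apply/seteqP; split=> s /=; rewrite /ball/= distrC.
    exact: measurable_ball.
  rewrite -bigcap_seq; apply/seteqP; split=> t /=.
    by move=> h i _ /=; have := h i; rewrite mxE.
  by move=> h i; rewrite mxE; apply: h => /=; rewrite mem_index_enum.
rewrite (_ : _ @^-1` U = \bigcup_(qm : {ffun 'I_n -> rat} * nat)
   (if `[< box qm.1 qm.2 `<=` U >] then @rV_of_tuple R n @^-1` box qm.1 qm.2 else set0)).
  apply: countable_bigcupT_measurable => //= -[q m] /=.
  by case: ifP.
apply/seteqP; split=> [t /= Ut|t [[q m] _] /=]; last first.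
  by case: ifPn => // /asboolP h /h.
have /nbhs_ballP[e /= e0 he] : nbhs (X t) U by apply: open_nbhs_nbhs.
(* A box of half-width [1/(m+1)] around a rational point within [1/(m+1)] of [t] stays within
   [2/(m+1)] of [t]. *)
have [m hm] : exists m, 2 * m.+1%:R^-1 < e.
  have := near_infty_natSinv_lt (PosNum (divr_gt0 e0 (ltr0n R 2))).
  move=> [m _ /(_ m (leqnn m))] /= hm; exists m.
  by rewrite -ltr_pdivlMl// mulrC.
have m0 : 0 < m.+1%:R^-1 :> R by [].
have hq (i : 'I_n) : exists q : rat, `|tnth t i - ratr q| < m.+1%:R^-1 :> R.
  set s : R := tnth t i.
  have /rat_in_itvoo[q] : s - m.+1%:R^-1 < s + m.+1%:R^-1 :> R.
    by rewrite ltrBlDr -addrA ltrDl addr_gt0.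
  rewrite in_itv/= => /andP[h1 h2]; exists q.
  rewrite -/s; move: s (m.+1%:R^-1) (ratr q) h1 h2 => s e1 q1 h1 h2.
  by rewrite ltr_norml; apply/andP; split; lra.
have {}hq (i : 'I_n) : {q : rat | `|tnth t i - ratr q| < m.+1%:R^-1 :> R}.
  exact/cid/hq.
exists ([ffun i => projT1 (hq i)], m) => //=.
rewrite ifT; first by move=> i; rewrite mxE ffunE; case: (hq i).
apply/asboolP => x xb; apply: he; apply/ball_rVP => // i.
have := xb i; rewrite ffunE; case: (hq i) => q /= h h2.
rewrite mxE; apply: le_lt_trans hm; rewrite mulr2n mulrDl mul1r.
apply: le_trans (lerD (ltW h) (ltW h2)); rewrite [X in _ <= _ + X]distrC.
exact: ler_distD.
Qed.

(** Row vectors are given no sigma-algebra: measurability of a map into them is expressed by its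
    coordinates, and measurability of a map out of them by composition with [X]. *)
Lemma measurable_rV_fun d (T : measurableType d) n (g : T -> 'rV[R]_n)
    d' (T' : measurableType d') (f : 'rV[R]_n -> T') :
  (forall i, measurable_fun setT (fun t => g t ord0 i : measurableTypeR R)) ->
  measurable_fun setT (f \o @rV_of_tuple R n) -> measurable_fun setT (f \o g).
Proof.
move=> mg mf.
rewrite (_ : f \o g = (f \o X) \o (@tuple_of_rV n \o g)); last first.
  by apply/funext => t /=; rewrite tuple_of_rVK.
apply: measurableT_comp => //; apply/measurable_fun_tnthP => i.
by apply: eq_measurable_fun (mg i) => t _ /=; rewrite tnth_mktuple.
Qed.

Lemma continuous_measurable_rV n (f : 'rV[R]_n -> R) :
  continuous f -> measurable_fun setT (f \o @rV_of_tuple R n).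
Proof.
move=> cf; apply: (measurability _ (RGenOInfty.measurableE R)) => /= _ [_ [a ->] <-].
rewrite setTI comp_preimage; apply: measurable_preimage_rV.
apply: open_comp => // x _; exact: cf.
Qed.

End borel_structure_of_row_vectors.

(** * Tonelli's theorem and affine changes of variables *)

Section integral_over_row_vectors.
Context {R : realType}.
Local Open Scope ereal_scope.

Lemma ge0_integral_tupleS n (F : n.+1.-tuple (measurableTypeR R) -> \bar R) :
  measurable_fun [set: tup R n.+1] F -> (forall t, 0 <= F t) ->
  \int[@dx R n.+1]_t F t =
  \int[@dx R n]_t \int[@lebesgue_measure R]_s F (tuple_cons (s, t)).
Proof.
move=> mF F0; rewrite /= /tuple_measureS.
have mc : measurable_fun setT (@tuple_cons (measurableTypeR R) n).
  by apply: measurable_cons; [exact: measurable_fst|exact: measurable_snd].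
rewrite ge0_integral_pushforward//= preimage_setT.
rewrite (@fubini_tonelli2 _ _ _ _ R (@lebesgue_measure R) (@dx R n))//=.
exact: measurableT_comp.
Qed.

Lemma measurable_tuple_cons n :
  measurable_fun setT (@tuple_cons (measurableTypeR R) n).
Proof. by apply: measurable_cons; [exact: measurable_fst|exact: measurable_snd]. Qed.

(** The pushforward of Lebesgue measure by [s |-> a * s + b], multiplied by [a], agrees with
    Lebesgue measure on half-open intervals, hence on all measurable sets. *)
Lemma ge0_integral_affine1 (f : R -> \bar R) (a b : R) : (0 < a)%R ->
  measurable_fun setT (f : measurableTypeR R -> _) -> (forall x, 0 <= f x) ->
  a%:E * \int[@lebesgue_measure R]_s f (a * s + b)%R =
  \int[@lebesgue_measure R]_s f s.
Proof.
move=> a0 mf f0.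
have maff : measurable_fun setT (fun s : measurableTypeR R => (a * s + b)%R : measurableTypeR R).
  by apply: measurable_funD => //; exact: measurable_funM.
have na0 := ltW a0.
pose nu := mscale (NngNum na0) (pushforward (@lebesgue_measure R)
   (fun s : measurableTypeR R => (a * s + b)%R : measurableTypeR R)).
transitivity (\int[nu maff]_s f s).
  rewrite ge0_integral_mscale// ge0_integral_pushforward//=.
apply/esym; apply: eq_measure_integral => A mA _.
apply: lebesgue_measure_unique => //= _ [[u v] /= _ <-].
rewrite /nu /= /mscale /= /pushforward.
rewrite (_ : _ @^-1` _ = `]((u - b) / a), ((v - b) / a)]%classic)%R; last first.
  apply/seteqP; split=> s /=; rewrite !in_itv/= => /andP[h1 h2];
  apply/andP; split; move: h1 h2;
  rewrite ?ler_pdivlMr// ?ltr_pdivrMr// ; move=> *; lra.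
rewrite !lebesgue_measure_itv /= !lte_fin ltr_pM2r ?invr_gt0// ltrBlDr subrK.
case: ifPn => _; last by rewrite mule0.
rewrite -!EFinD -EFinM; congr EFin; field.
by rewrite gt_eqF.
Qed.

(** A property of [M] rather than a theorem about all matrices: it is established for lower
    triangular block matrices with positive diagonal, where the determinant needs no absolute
    value. *)
Definition affine_change n (M : 'M[R]_n) :=
  forall (v : 'rV[R]_n) (f : 'rV[R]_n -> \bar R),
    measurable_fun [set: tup R n] (f \o X) -> (forall x, 0 <= f x) ->
    (\det M)%:E * \int[@dx R n]_t f (X t *m M + v)%R = \int[@dx R n]_t f (X t).

Lemma X_tuple_cons n (s : measurableTypeR R) (t : tup R n) :
  X (tuple_cons (s, t)) = row_mx (s : R)%:M (X t) :> 'rV[R]_(1 + n).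
Proof.
apply/rowP => i; rewrite !mxE; case: splitP => j ij.
  by rewrite mxE ord1 (_ : i = ord0) ?tnth0 ?eqxx ?mulr1n//; apply/val_inj; rewrite /= ij ord1.
by rewrite mxE (_ : i = lift ord0 j) ?tnthS//; apply/val_inj; rewrite /= ij.
Qed.

Lemma measurable_affine n (f : 'rV[R]_n -> \bar R) (M : 'M[R]_n) v :
  measurable_fun [set: tup R n] (f \o X) ->
  measurable_fun [set: tup R n] (fun t => f (X t *m M + v)%R).
Proof.
move=> mf; apply: (@measurable_rV_fun R _ _ n (fun t : tup R n => X t *m M + v)%R) => // i.
under eq_fun do rewrite mxE mxE.
apply: measurable_funD => //; apply: measurable_sum => j.
under eq_fun do rewrite mxE.
by apply: measurable_funM => //; exact: measurable_tnth.
Qed.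

Lemma affine_change0 (M : 'M[R]_0) : affine_change M.
Proof.
move=> v f _ _; rewrite det_mx00 mul1e; apply: eq_integral => t _.
by congr f; apply/rowP => -[].
Qed.

(** A row vector [(s, x)] is sent to [(a s + x c, x M)]. At fixed [x] the integral in [s] is a
    one-dimensional affine change of variable, which removes [c]; the function of [x] that remains
    is handled by the hypothesis on [M]. *)
Lemma affine_change_block n (a : R) (c : 'cV[R]_n) (M : 'M[R]_n) : (0 < a)%R ->
  (0 <= \det M)%R -> affine_change M ->
  affine_change (block_mx a%:M 0 c M : 'M[R]_(1 + n)).
Proof.
move=> a0 detM0 hM v f mf f0.
have mfa := @measurable_affine _ f (block_mx a%:M 0 c M : 'M[R]_(1 + n)) v mf.
rewrite det_lblock det_scalar1.
pose v0 := (lsubmx v : 'rV_1) ord0 ord0; pose v' := rsubmx v : 'rV[R]_n.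
pose g (s : R) (x : 'rV[R]_n) := f (row_mx s%:M x : 'rV[R]_(1 + n)).
have fE (s : R) t : f (X (tuple_cons (s : measurableTypeR R, t)) *m
    (block_mx a%:M 0 c M : 'M[R]_(1 + n)) + v)%R =
    g (a * s + ((X t *m c) ord0 ord0 + v0))%R (X t *m M + v')%R.
  rewrite /g X_tuple_cons; congr f.
  have -> : (row_mx (s%:M : 'M[R]_1) (X t) *m
      (block_mx a%:M 0 c M : 'M[R]_(1 + n)) = row_mx (s%:M *m a%:M + X t *m c) (X t *m M))%R.
    by rewrite mul_row_block mulmx0 add0r.
  rewrite -[in LHS](hsubmxK v) add_row_mx; congr row_mx.
  apply/rowP => j; rewrite !ord1 -scalar_mxM !mxE eqxx !mulr1n.
  by rewrite /v0 [in RHS]mxE (mulrC s) addrA.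
have mg (x : 'rV[R]_n) : measurable_fun setT (g ^~ x : measurableTypeR R -> _).
  apply: (@measurable_rV_fun R _ _ n.+1 (fun s : measurableTypeR R => row_mx (s : R)%:M x : 'rV[R]_(1+n))) => // i.
  apply: (@eq_measurable_fun _ _ _ _ _ (fun s : measurableTypeR R => (row_mx (s : R)%:M x : 'rV[R]_(1+n)) ord0 i : R)) => //.
  under eq_fun do rewrite mxE; case: splitP => j _; last exact: measurable_cst.
  apply: (@eq_measurable_fun _ _ _ _ setT (@id R)) => // s _.
  by rewrite [j]ord1 mxE eqxx mulr1n.
have g0 (s : R) x : 0 <= g s x by exact: f0.
pose H x := \int[@lebesgue_measure R]_s g s x.
have HE t : \int[@lebesgue_measure R]_s f (X (tuple_cons (s, t))) = H (X t).
  by apply: eq_integral => s _; rewrite X_tuple_cons.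
have mH : measurable_fun [set: tup R n] (H \o X).
  have := @measurable_fun_fubini_tonelli_G _ _ _ _ R (@lebesgue_measure R)
    (fun z : measurableTypeR R * tup R n => f (X (tuple_cons z))).
  rewrite /fubini_G => h; have {}h := h (measurableT_comp mf (@measurable_tuple_cons n)) (fun _ => f0 _).
  by apply: eq_measurable_fun h => t _; rewrite /= HE.
have H0 x : 0 <= H x by apply: integral_ge0.
rewrite !ge0_integral_tupleS//.
under [RHS]eq_integral do rewrite HE.
have <- := hM v' H mH H0.
rewrite mulrC EFinM -muleA; congr (_ * _).
have mI : measurable_fun [set: tup R n] (fun t => \int[@lebesgue_measure R]_s
    f (X (tuple_cons (s, t)) *m (block_mx a%:M 0 c M : 'M[R]_(1 + n)) + v)%R).
  have := @measurable_fun_fubini_tonelli_G _ _ _ _ R (@lebesgue_measure R)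
    (fun z : measurableTypeR R * tup R n =>
      f (X (tuple_cons z) *m (block_mx a%:M 0 c M : 'M[R]_(1 + n)) + v)%R).
  rewrite /fubini_G => h; apply: h => //.
  by apply: (measurableT_comp mfa); exact: measurable_tuple_cons.
rewrite -ge0_integralZl_EFin//; last 2 first.
- by move=> t _; apply: integral_ge0.
- exact: ltW.
apply: eq_integral => t _.
under eq_integral do rewrite fE.
exact: (@ge0_integral_affine1 (g ^~ (X t *m M + v')%R)).
Qed.

(** With [a = 1] this is translation invariance; with general [a] it is the scaling law behind
    concentration. *)
Lemma affine_change_scalar n (a : R) : (0 < a)%R -> affine_change (a%:M : 'M[R]_n).
Proof.
move=> a0; elim: n => [|n IH]; first exact: affine_change0.
rewrite (_ : a%:M%R = (block_mx a%:M 0 0 a%:M : 'M[R]_(1 + n)))%R; last exact: scalar_mx_block.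
by apply: affine_change_block => //; rewrite det_scalar exprn_ge0// ltW.
Qed.

Lemma norm_rV_leP n (x : 'rV[R]_n) (r : R) : (0 <= r)%R ->
  (`|x| <= r)%R <-> (forall i, `|x ord0 i| <= r)%R.
Proof.
move=> r0; rewrite {1}/Num.norm /= mx_normrE; split.
  by move=> /bigmax_leP[_ h] i; exact: (h (ord0, i)).
by move=> h; apply/bigmax_leP; split => // -[i j] _; rewrite ord1.
Qed.

Lemma measurable_closed_ball_rV n (r : R) :
  measurable [set t : tup R n | (`|X t| <= r)%R].
Proof.
rewrite (_ : [set _ | _] = ~` (X @^-1` [set x : 'rV[R]_n | (r < `|x|)%R])).
  apply: measurableC; apply: measurable_preimage_rV.
  rewrite (_ : [set _ | _] = Num.norm @^-1` `]r, +oo[%classic); last first.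
    by apply/seteqP; split => x /=; rewrite in_itv/= andbT.
  by apply: open_comp => // x _; exact: norm_continuous.
by apply/seteqP; split => t /=; rewrite leNgt => /negP.
Qed.

Lemma lebesgue_tuple_closed_ball n (r : R) :
  @dx R n [set t | (`|X t| <= r)%R] < +oo.
Proof.
have [r0|r0] := leP 0%R r; last first.
  rewrite (_ : [set _ | _] = set0) ?measure0//.
  by apply/seteqP; split => // t /= /(le_trans (normr_ge0 _)); rewrite leNgt r0.
elim: n => [|n IH].
  rewrite /= (_ : [set _ | _] = setT) ?diracT ?ltry//.
  by apply/seteqP; split => // t _ /=; apply/norm_rV_leP => // -[].
rewrite /= /tuple_measureS /pushforward.
pose A := [set s : measurableTypeR R | (`|s : R| <= r)%R].
pose B := [set t : tup R n | (`|X t| <= r)%R].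
rewrite (_ : _ @^-1` _ = A `*` B); last first.
  apply/seteqP; split=> -[s t] /=.
    move=> /norm_rV_leP h; split; first by have := h r0 ord0; rewrite mxE.
    apply/norm_rV_leP => // i; have := h r0 (lift ord0 i).
    by rewrite !mxE tnthS.
  move=> [h1 /norm_rV_leP h2]; apply/norm_rV_leP => // i; rewrite mxE.
  case: (unliftP ord0 i) => [j ->|->//]; rewrite tnthS.
  by have := h2 r0 j; rewrite mxE.
have AE : A = `[(- r)%R, r]%classic.
  by apply/seteqP; split => s /=; rewrite /A/= in_itv/= ler_norml.
have mA : measurable A by rewrite AE; exact: measurable_itv.
have Afin : @lebesgue_measure R A < +oo.
  by rewrite AE lebesgue_measure_itv /=; case: ifP => // _; rewrite -?EFinD ltry.
have mB : measurable B by exact: measurable_closed_ball_rV.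
by rewrite product_measure1E// lte_mul_pinfty// ge0_fin_numE.
Qed.

End integral_over_row_vectors.

(** * Real integrals of continuous functions with bounded support *)

Section compactly_supported.
Context {R : realType}.

Definition cc n (f : 'rV[R]_n -> R) :=
  continuous f /\ exists r : R, forall x, r <= `|x| -> f x = 0.

Definition integral_rV n (f : 'rV[R]_n -> R) : R := \int[@dx R n]_t f (X t).

Lemma continuous_compose (T U V : topologicalType) (f : T -> U) (g : U -> V) :
  continuous f -> continuous g -> continuous (fun x => g (f x)).
Proof. by move=> cf cg x; exact: (continuous_comp (cf x) (cg _)). Qed.

Lemma compact_closed_ball_rV n (x : 'rV[R]_n) (r : R) : compact [set y | `|y - x| <= r].
Proof.
apply: bounded_closed_compact.
  exists (r + `|x|); split => //; first exact: num_real.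
  move=> M hM y /= h; apply: ltW; apply: le_lt_trans hM.
  by rewrite -{1}(subrK x y); apply: le_trans (ler_normD _ _) _; rewrite lerD2r.
rewrite (_ : [set _ | _] = (fun y => `|y - x|) @^-1` [set z | z <= r])//.
apply: closed_comp => [y _|]; last exact: closed_le.
apply: (continuous_compose _ (@norm_continuous _ _)) => {}y.
apply/(@cvgrPdist_le _ _ _ (nbhs y)) => e e0; near=> z.
rewrite opprB addrA subrK; near: z.
exact: (@cvgr_dist_le _ _ _ (nbhs y) _ id).
Unshelve. all: by end_near.
Qed.

Lemma cc_bounded n (f : 'rV[R]_n -> R) : cc f -> exists2 C, 0 <= C & forall x, `|f x| <= C.
Proof.
move=> [cf [r hr]].
have [|||c _ hc] := @EVT_max_rV R n (fun x => `|f x|) [set y | `|y - 0| <= `|r|].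
- by exists 0; rewrite /= subrr normr0.
- exact: compact_closed_ball_rV.
- apply: continuous_subspaceT => x.
  by apply: continuous_comp; [exact: cf|exact: norm_continuous].
exists (`|f c|) => // x; have [xr|rx] := leP `|x| `|r|.
  by apply: hc; rewrite inE /= subr0.
by rewrite hr ?normr0// ltW// (le_lt_trans (ler_norm r)).
Qed.

Lemma cc_integrable n (f : 'rV[R]_n -> R) : cc f ->
  (@dx R n).-integrable setT (EFin \o (f \o X)).
Proof.
move=> ccf; have [C C0 hC] := cc_bounded ccf; case: ccf => cf [r hr].
pose D := [set t : tup R n | `|X t| <= r].
have mD : measurable D by exact: measurable_closed_ball_rV.
have -> : EFin \o (f \o X) = (EFin \o (f \o X)) \_ D.
  apply/funext => t; rewrite patchE /=; case: ifPn => //; rewrite notin_setE /D/=.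
  by move=> /negP; rewrite -ltNge => /ltW /hr ->.
apply/(integrable_mkcond _ mD).
apply: measurable_bounded_integrable => //.
- exact: lebesgue_tuple_closed_ball.
- by apply: measurable_funS (continuous_measurable_rV cf).
- exists C; split; first exact: num_real.
  by move=> M CM x _ /=; apply: le_trans (ltW CM); exact: hC.
Qed.

Lemma continuousD_rV n (f g : 'rV[R]_n -> R) : continuous f -> continuous g ->
  continuous (fun x => f x + g x).
Proof. by move=> cf cg x; exact: (cvgD (cf x) (cg x)). Qed.

Lemma continuousM_rV n (f g : 'rV[R]_n -> R) : continuous f -> continuous g ->
  continuous (fun x => f x * g x).
Proof. by move=> cf cg x; exact: (cvgM (cf x) (cg x)). Qed.

Lemma ccD n (f g : 'rV[R]_n -> R) : cc f -> cc g -> cc (fun x => f x + g x).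
Proof.
move=> [cf [r hr]] [cg [s hs]]; split; first exact: continuousD_rV.
by exists (Num.max r s) => x; rewrite ge_max => /andP[/hr -> /hs ->]; rewrite addr0.
Qed.

Lemma cc_mull n (f g : 'rV[R]_n -> R) : continuous f -> cc g -> cc (fun x => f x * g x).
Proof.
move=> cf [cg [s hs]]; split; first exact: continuousM_rV.
by exists s => x /hs ->; rewrite mulr0.
Qed.

Lemma cc_mulr n (f g : 'rV[R]_n -> R) : cc f -> continuous g -> cc (fun x => f x * g x).
Proof.
by move=> cf cg; under eq_fun do rewrite mulrC; exact: cc_mull.
Qed.

Lemma ccZ n (a : R) (f : 'rV[R]_n -> R) : cc f -> cc (fun x => a * f x).
Proof. by apply: cc_mull; exact: cst_continuous. Qed.

Lemma ccN n (f : 'rV[R]_n -> R) : cc f -> cc (fun x => - f x).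
Proof. by move=> /(ccZ (-1)); under eq_fun do rewrite mulN1r. Qed.

Lemma ccB n (f g : 'rV[R]_n -> R) : cc f -> cc g -> cc (fun x => f x - g x).
Proof. by move=> cf /ccN; exact: ccD. Qed.

Lemma cc0 n : cc (fun _ : 'rV[R]_n => 0).
Proof. by split; [exact: cst_continuous|exists 0]. Qed.

Lemma cc_sum n I (s : seq I) (P : pred I) (f : I -> 'rV[R]_n -> R) :
  (forall i, P i -> cc (f i)) -> cc (fun x => \sum_(i <- s | P i) f i x).
Proof.
move=> h; elim: s => [|i s IH]; first by under eq_fun do rewrite big_nil; exact: cc0.
case Pi: (P i); under eq_fun do rewrite big_cons Pi; last by [].
by apply: ccD => //; exact: h.
Qed.

Lemma cc_comp n (g : R -> R) (f : 'rV[R]_n -> R) : continuous g -> g 0 = 0 ->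
  cc f -> cc (fun x => g (f x)).
Proof.
move=> cg g0 [cf [r hr]]; split; last by exists r => x /hr ->.
by move=> x; apply: continuous_comp; [exact: cf|exact: cg].
Qed.

Lemma integral_rVD n (f g : 'rV[R]_n -> R) : cc f -> cc g ->
  integral_rV (fun x => f x + g x) = integral_rV f + integral_rV g.
Proof. by move=> cf cg; rewrite /integral_rV RintegralD//; exact: cc_integrable. Qed.

Lemma integral_rVZ n (a : R) (f : 'rV[R]_n -> R) : cc f ->
  integral_rV (fun x => a * f x) = a * integral_rV f.
Proof. by move=> cf; rewrite /integral_rV RintegralZl//; exact: cc_integrable. Qed.

Lemma integral_rVN n (f : 'rV[R]_n -> R) : cc f ->
  integral_rV (fun x => - f x) = - integral_rV f.
Proof.
by move=> cf; rewrite -mulN1r -integral_rVZ//; under eq_fun do rewrite -mulN1r.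
Qed.

Lemma integral_rVB n (f g : 'rV[R]_n -> R) : cc f -> cc g ->
  integral_rV (fun x => f x - g x) = integral_rV f - integral_rV g.
Proof. by move=> cf cg; rewrite integral_rVD ?integral_rVN//; exact: ccN. Qed.

Lemma integral_rV0 n : integral_rV (fun _ : 'rV[R]_n => 0) = 0.
Proof. by rewrite /integral_rV Rintegral_cst// mul0r. Qed.

Lemma integral_rV_sum n I (s : seq I) (P : pred I) (f : I -> 'rV[R]_n -> R) :
  (forall i, P i -> cc (f i)) ->
  integral_rV (fun x => \sum_(i <- s | P i) f i x) = \sum_(i <- s | P i) integral_rV (f i).
Proof.
move=> h; elim: s => [|i s IH].
  by under eq_fun do rewrite big_nil; rewrite integral_rV0 big_nil.
rewrite big_cons; case Pi: (P i); under eq_fun do rewrite big_cons Pi; last exact: IH.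
by rewrite integral_rVD ?IH//; [exact: h|exact: cc_sum].
Qed.

Lemma integral_rV_ge0 n (f : 'rV[R]_n -> R) : (forall x, 0 <= f x) -> 0 <= integral_rV f.
Proof. by move=> f0; apply: Rintegral_ge0. Qed.

Lemma le_integral_rV n (f g : 'rV[R]_n -> R) : cc f -> cc g -> (forall x, f x <= g x) ->
  integral_rV f <= integral_rV g.
Proof. by move=> cf cg fg; apply: le_Rintegral => //; exact: cc_integrable. Qed.

Lemma integral_rVE n (f : 'rV[R]_n -> R) : cc f ->
  ((integral_rV f)%:E = \int[@dx R n]_t (f (X t))%:E)%E.
Proof.
move=> cf; rewrite fineK//; have := integrable_fin_num measurableT (cc_integrable cf).
exact.
Qed.

Lemma mulmx_bound n (M : 'M[R]_n) : exists2 C, 0 <= C & forall y : 'rV_n, `|y *m M| <= C * `|y|.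
Proof.
pose C := \sum_(i < n) \sum_(j < n) `|M j i|.
have C0 : 0 <= C by apply: sumr_ge0 => i _; apply: sumr_ge0.
exists C => // y; apply/norm_rV_leP; first exact: mulr_ge0.
move=> i; rewrite mxE; apply: le_trans (ler_norm_sum _ _ _) _.
apply: (@le_trans _ _ ((\sum_j `|M j i|) * `|y|)); last first.
  apply: ler_wpM2r => //; rewrite /C [X in _ <= X](bigD1 i)//=; apply: ler_wpDr => //.
  by apply: sumr_ge0 => j _; rewrite sumr_ge0.
rewrite mulr_suml; apply: ler_sum => j _; rewrite normrM mulrC ler_wpM2l//.
by move: j; apply/norm_rV_leP.
Qed.

Lemma continuous_affine n (M : 'M[R]_n) (v : 'rV[R]_n) : continuous (fun x : 'rV[R]_n => x *m M + v).
Proof.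
have [C C0 hC] := mulmx_bound M.
have C1 : 0 < C + 1 by rewrite ltr_wpDl.
move=> x; apply/(@cvgrPdist_le _ _ _ (nbhs x)) => e e0.
have eC : 0 < e / (C + 1) by rewrite divr_gt0.
near=> y; rewrite opprD addrACA subrr addr0 -mulmxBl; apply: le_trans (hC _) _.
apply: (@le_trans _ _ ((C + 1) * `|x - y|)); first by rewrite ler_wpM2r// lerDl.
rewrite mulrC -ler_pdivlMr//.
Unshelve. all: by end_near. Qed.

Lemma cc_affine n (f : 'rV[R]_n -> R) (M : 'M[R]_n) (v : 'rV[R]_n) :
  cc f -> M \in unitmx -> cc (fun x => f (x *m M + v)).
Proof.
move=> [cf [r hr]] uM; split.
  exact: (continuous_compose (@continuous_affine n M v) cf).
have [C C0 hC] := mulmx_bound (invmx M).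
exists ((C + 1) * (`|r| + `|v|)) => x hx; apply: hr.
rewrite leNgt; apply/negP => hlt.
have : `|x| <= C * (`|r| + `|v|).
  rewrite -{1}(mulmxK uM x); apply: le_trans (hC _) _; rewrite ler_wpM2l//.
  rewrite -[_ *m M](addrK v); apply: le_trans (ler_normB _ _) _.
  by rewrite lerD2r (le_trans (ltW hlt))// ler_norm.
have : 0 < `|r| + `|v|.
  rewrite (le_lt_trans (normr_ge0 (x *m M + v)))//.
  by rewrite (lt_le_trans hlt)// (le_trans (ler_norm r))// lerDl.
move: hx; rewrite mulrDl mul1r; lra.
Qed.

(** The nonnegative case applies to [max f 0] and [max (- f) 0], which are again continuous with
    bounded support and have difference [f]. *)
Lemma integral_rV_affine n (M : 'M[R]_n) (v : 'rV[R]_n) (f : 'rV[R]_n -> R) : affine_change M ->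
  0 < \det M -> cc f ->
  \det M * integral_rV (fun x => f (x *m M + v)) = integral_rV f.
Proof.
move=> hM d0 cf.
have h g : cc g -> (forall x, 0 <= g x) ->
    \det M * integral_rV (fun x => g (x *m M + v)) = integral_rV g.
  move=> cg g0; have mg : measurable_fun setT (EFin \o (g \o @rV_of_tuple R n)).
    by apply/measurable_EFinP; apply: continuous_measurable_rV; case: cg.
  have g0' x : (0 <= (EFin \o g) x)%E by rewrite lee_fin.
  have := hM v (EFin \o g) mg g0'.
  rewrite /= -integral_rVE// => /(congr1 fine) /= <-.
  rewrite /integral_rV /Rintegral.
  set J := integral _ _ _; have : (0 <= J)%E by apply: integral_ge0 => t _; rewrite lee_fin.
  case: J => [r||]//= _.
  (* Finiteness of the transformed integral is not yet at hand; if it were [+oo], both sides would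
     become [0] under [fine]. *)
  by rewrite gt0_muley ?lte_fin//= mulr0.
have cfp : cc (fun x => Num.max (f x) 0).
  apply: (@cc_comp n (fun y => Num.max y 0)) => //; last by rewrite maxxx.
  by move=> x; apply: continuous_max => //; exact: cvg_cst.
have cfn : cc (fun x => Num.max (- f x) 0).
  apply: (@cc_comp n (fun y => Num.max y 0) (fun x => - f x)) => //; [|by rewrite maxxx|exact: ccN].
  by move=> x; apply: continuous_max => //; exact: cvg_cst.
have fE x : f x = Num.max (f x) 0 - Num.max (- f x) 0.
  have [f0|f0] := leP (f x) 0.
    by rewrite max_l ?sub0r ?opprK// lerNr oppr0.
  by rewrite max_r ?subr0// lerNl oppr0 ltW.
have -> : integral_rV f = integral_rV (fun x => Num.max (f x) 0) - integral_rV (fun x => Num.max (- f x) 0).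
  by rewrite -integral_rVB//; congr integral_rV; apply/funext => x; exact: fE.
rewrite -(h _ cfp) => [|x]; last by rewrite le_max lexx orbT.
rewrite -(h _ cfn) => [|x]; last by rewrite le_max lexx orbT.
rewrite -mulrBr; congr (_ * _).
have dM : M \in unitmx by rewrite unitmxE unitfE gt_eqF.
rewrite -integral_rVB; [|exact: (cc_affine v cfp dM)|exact: (cc_affine v cfn dM)].
by congr integral_rV; apply/funext => x; exact: fE.
Qed.

End compactly_supported.

(** * Smooth functions *)

(* A sealed copy of [partial]: unification cannot unfold it down to a limit. *)
HB.lock Definition pderiv {R : realType} {n} (i : 'I_n) (f : 'rV[R]_n -> R) :
  'rV[R]_n -> R := partial i f.

Section smooth_calculus.
Context {R : realType}.

Lemma pderivE n : @partial R n = @pderiv R n.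
Proof. by rewrite unlock. Qed.

Lemma smooth_onP n (U : set 'rV[R]_n) f : smooth_on U f <->
  forall (s : seq 'I_n) x, U x -> differentiable (foldr pderiv f s) x.
Proof. by rewrite /smooth_on pderivE. Qed.

(** The little-o expansion of [f] at [x] is also one of [g], and [diff_unique] identifies the two
    differentials. *)
Lemma near_differentiable (V W : normedModType R) (f g : V -> W) (x : V) :
  {near x, f =1 g} -> differentiable f x -> differentiable g x /\ 'd g x = 'd f x :> (V -> W).
Proof.
move=> fg df.
have fgx : f x = g x by exact: nbhs_singleton fg.
have hg : g \o shift x = cst (g x) + 'd f x +o_ 0 id.
  apply/eqaddoP => e e0.
  have /eqaddoP /(_ e e0) := diff_locally df.
  have : \forall h \near 0, f (h + x) = g (h + x).
    move: fg; rewrite (near_shift 0 x); apply: filterS => h /=.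
    by rewrite subr0.
  move=> fgh dh; near=> h.
  suff -> : (g \o shift x - (cst (g x) + 'd f x)) h = (f \o shift x - (cst (f x) + 'd f x)) h.
    by near: h.
  rewrite !fctE /= fgx; congr (_ - _); apply/esym.
  by near: h.
have cf : continuous ('d f x) by exact: diff_continuous.
have dE : 'd g x = 'd f x :> (V -> W) by exact: diff_unique.
by split => //; apply/diff_locallyP; split; rewrite dE.
Unshelve. all: by end_near. Qed.

Lemma open_near (T : topologicalType) (U : set T) (x : T) (P : T -> Prop) :
  open U -> U x -> (forall y, U y -> P y) -> \forall y \near x, P y.
Proof. by move=> oU Ux h; apply: filterS h _; exact: open_nbhs_nbhs. Qed.

Section dim.
Context {n : nat}.
Implicit Types (f g : 'rV[R]_n -> R) (U : set 'rV[R]_n).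

Lemma partialE f x i : differentiable f x -> pderiv i f x = 'd f x (delta_mx ord0 i).
Proof. by move=> df; rewrite -pderivE /partial deriveE. Qed.

Lemma diffE_partial f x (v : 'rV[R]_n) : differentiable f x ->
  'd f x v = \sum_i v ord0 i * pderiv i f x.
Proof.
move=> df; rewrite {1}(row_sum_delta v) linear_sum; apply: eq_bigr => i _.
by rewrite linearZ partialE.
Qed.

Lemma eq_partial U f g i x : open U -> U x -> (forall y, U y -> f y = g y) ->
  pderiv i f x = pderiv i g x.
Proof.
by move=> oU Ux fg; rewrite -pderivE; apply: near_eq_derive; exact: open_near oU Ux _.
Qed.

Lemma eq_differentiable U f g x : open U -> U x -> (forall y, U y -> f y = g y) ->
  differentiable f x -> differentiable g x.
Proof.
move=> oU Ux fg df; suff [] : differentiable g x /\ 'd g x = 'd f x :> ('rV[R]_n -> R) by [].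
by apply: near_differentiable => //; exact: open_near oU Ux _.
Qed.

Lemma eq_partials U f g (s : seq 'I_n) x : open U -> U x -> (forall y, U y -> f y = g y) ->
  foldr pderiv f s x = foldr pderiv g s x.
Proof.
move=> oU Ux fg; elim: s x Ux => [|i s IH] x Ux /=; first exact: fg.
exact: eq_partial oU Ux _.
Qed.

(** Finite-order version of [smooth_on]. It gives closure properties an induction: by
    [smooth_uptoS], taking one partial derivative lowers [m] by one. *)
Definition smooth_upto m U f := forall (s : seq 'I_n) x, (size s <= m)%N -> U x ->
  differentiable (foldr pderiv f s) x.

Lemma smooth_uptoP U f : smooth_on U f <-> forall m, smooth_upto m U f.
Proof.
by rewrite smooth_onP; split=> [h m s x _|h s x]; [exact: h|exact: (h (size s))].
Qed.

Lemma smooth_upto0 U f : (forall x, U x -> differentiable f x) -> smooth_upto 0 U f.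
Proof. by move=> df [|//] x _; exact: df. Qed.

Lemma smooth_uptoS m U f : smooth_upto m.+1 U f <->
  (forall x, U x -> differentiable f x) /\ forall i, smooth_upto m U (pderiv i f).
Proof.
split=> [h|[h1 h2]].
  split=> [x Ux|i s x sm Ux]; first exact: (h [::]).
  by have := h (rcons s i) x; rewrite size_rcons foldr_rcons; apply.
move=> s x; case: (lastP s) => [|{}s i]; first by move=> _; exact: h1.
by rewrite size_rcons foldr_rcons; exact: h2.
Qed.

Lemma eq_smooth_upto m U f g : open U -> (forall y, U y -> f y = g y) ->
  smooth_upto m U f -> smooth_upto m U g.
Proof.
move=> oU fg sf s x sm Ux; apply: (eq_differentiable oU Ux); last exact: sf sm Ux.
by move=> y Uy; exact: eq_partials oU Uy _.
Qed.

Lemma eq_smooth_on U f g : open U -> (forall y, U y -> f y = g y) ->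
  smooth_on U f -> smooth_on U g.
Proof. by move=> oU fg /smooth_uptoP h; apply/smooth_uptoP => m; exact: eq_smooth_upto oU fg _. Qed.

(** The inductive step of the closure properties: a formula [k i] for the partial derivatives, valid
    on [U], is enough. *)
Lemma smooth_upto_intro m U h (k : 'I_n -> 'rV[R]_n -> R) : open U ->
  (forall x, U x -> differentiable h x) ->
  (forall i x, U x -> pderiv i h x = k i x) -> (forall i, smooth_upto m U (k i)) ->
  smooth_upto m.+1 U h.
Proof.
move=> oU dh hk sk; apply/smooth_uptoS; split => // i.
by apply: eq_smooth_upto (sk i) => // y Uy; rewrite hk.
Qed.

Lemma smooth_uptoW m U f : smooth_upto m.+1 U f -> smooth_upto m U f.
Proof. by move=> h s x sm; apply: h; exact: leqW. Qed.

Lemma smooth_on_diff U f x : smooth_on U f -> U x -> differentiable f x.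
Proof. by move=> /smooth_onP h; exact: (h [::]). Qed.

Lemma smooth_on_partial U f i : smooth_on U f -> smooth_on U (pderiv i f).
Proof.
move=> /smooth_onP h; apply/smooth_onP => s x Ux.
by have := h (rcons s i) x; rewrite foldr_rcons; apply.
Qed.

Lemma smooth_on_partials U f s : smooth_on U f -> smooth_on U (foldr pderiv f s).
Proof. by move=> sf; elim: s => // i s; exact: smooth_on_partial. Qed.

Lemma smooth_onS U U' f : U' `<=` U -> smooth_on U f -> smooth_on U' f.
Proof. by move=> UU h s x /UU; exact: h. Qed.

Lemma smooth_on_setU U U' f : smooth_on U f -> smooth_on U' f -> smooth_on (U `|` U') f.
Proof. by move=> h h' s x [|]; [exact: h|exact: h']. Qed.

Lemma smooth_on_cont U f x : smooth_on U f -> U x -> {for x, continuous f}.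
Proof. by move=> h Ux; apply: differentiable_continuous; exact: smooth_on_diff h Ux. Qed.

Lemma smooth_continuous f : smooth_on setT f -> continuous f.
Proof. by move=> h x; exact: smooth_on_cont h I. Qed.

Lemma partialD f g i x : differentiable f x -> differentiable g x ->
  pderiv i (fun y => f y + g y) x = pderiv i f x + pderiv i g x.
Proof. by move=> df dg; rewrite -pderivE; apply: deriveD; exact: diff_derivable. Qed.

Lemma partialM f g i x : differentiable f x -> differentiable g x ->
  pderiv i (fun y => f y * g y) x = f x * pderiv i g x + g x * pderiv i f x.
Proof. by move=> df dg; rewrite -pderivE; apply: deriveM; exact: diff_derivable. Qed.

Lemma partial_cst (a : R) i (x : 'rV[R]_n) : pderiv i (fun=> a) x = 0.
Proof. by rewrite -pderivE; exact: derive_cst. Qed.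

Lemma partialZ (a : R) f i x : differentiable f x ->
  pderiv i (fun y => a * f y) x = a * pderiv i f x.
Proof.
by move=> df; rewrite (@partialM (fun=> a))// partial_cst mulr0 addr0.
Qed.

Lemma differentiable_bigsum I (r : seq I) (P : pred I) (F : I -> 'rV[R]_n -> R) x :
  (forall j, P j -> differentiable (F j) x) ->
  differentiable (fun y => \sum_(j <- r | P j) F j y) x.
Proof.
move=> dF; elim: r => [|j r IH].
  have -> : (fun y => \sum_(j <- [::] | P j) F j y) = cst 0.
    by apply/funext => y; rewrite big_nil.
  exact: differentiable_cst.
case Pj: (P j); last first.
  have -> : (fun y => \sum_(i <- j :: r | P i) F i y) = fun y => \sum_(i <- r | P i) F i y.
    by apply/funext => y; rewrite big_cons Pj.
  exact: IH.
have -> : (fun y => \sum_(i <- j :: r | P i) F i y) = F j + fun y => \sum_(i <- r | P i) F i y.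
  by apply/funext => y; rewrite big_cons Pj.
by apply: differentiableD => //; exact: dF.
Qed.

Lemma partial_sum I (r : seq I) (P : pred I) (F : I -> 'rV[R]_n -> R) i x :
  (forall j, P j -> differentiable (F j) x) ->
  pderiv i (fun y => \sum_(j <- r | P j) F j y) x = \sum_(j <- r | P j) pderiv i (F j) x.
Proof.
move=> dF; elim: r => [|j r IH].
  by under [X in pderiv i X]eq_fun do rewrite big_nil; rewrite big_nil partial_cst.
case Pj: (P j); under [X in pderiv i X]eq_fun do rewrite big_cons Pj; last by rewrite big_cons Pj.
by rewrite big_cons Pj partialD ?IH//; [exact: dF|exact: differentiable_bigsum].
Qed.

Lemma smooth_upto_cst m U (a : R) : open U -> smooth_upto m U (fun=> a).
Proof.
move=> oU; elim: m a => [|m IH] a.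
  by apply: smooth_upto0 => x _; exact: differentiable_cst.
apply: (@smooth_upto_intro _ _ _ (fun _ _ => 0)) => // i x _.
exact: partial_cst.
Qed.

Lemma smooth_on_cst U (a : R) : open U -> smooth_on U (fun=> a).
Proof. by move=> oU; apply/smooth_uptoP => m; exact: smooth_upto_cst. Qed.

Lemma smooth_uptoD m U f g : open U -> smooth_upto m U f -> smooth_upto m U g ->
  smooth_upto m U (fun x => f x + g x).
Proof.
move=> oU; elim: m f g => [|m IH] f g sf sg.
  by apply: smooth_upto0 => x Ux; apply: differentiableD; [exact: (sf [::])|exact: (sg [::])].
have /smooth_uptoS[df sf'] := sf; have /smooth_uptoS[dg sg'] := sg.
apply: (@smooth_upto_intro _ _ _ (fun i x => pderiv i f x + pderiv i g x)) => //.
- by move=> x Ux; apply: differentiableD; [exact: df|exact: dg].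
- by move=> i x Ux; rewrite partialD//; [exact: df|exact: dg].
- by move=> i; exact: IH.
Qed.

Lemma smooth_uptoM m U f g : open U -> smooth_upto m U f -> smooth_upto m U g ->
  smooth_upto m U (fun x => f x * g x).
Proof.
move=> oU; elim: m f g => [|m IH] f g sf sg.
  by apply: smooth_upto0 => x Ux; apply: differentiableM; [exact: (sf [::])|exact: (sg [::])].
have /smooth_uptoS[df sf'] := sf; have /smooth_uptoS[dg sg'] := sg.
apply: (@smooth_upto_intro _ _ _
  (fun i x => f x * pderiv i g x + g x * pderiv i f x)) => //.
- by move=> x Ux; apply: differentiableM; [exact: df|exact: dg].
- by move=> i x Ux; rewrite partialM//; [exact: df|exact: dg].
- by move=> i; apply: smooth_uptoD => //; apply: IH => //; exact: smooth_uptoW.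
Qed.

Lemma smooth_onD U f g : open U -> smooth_on U f -> smooth_on U g ->
  smooth_on U (fun x => f x + g x).
Proof. by move=> oU /smooth_uptoP sf /smooth_uptoP sg; apply/smooth_uptoP => m; exact: smooth_uptoD. Qed.

Lemma smooth_onM U f g : open U -> smooth_on U f -> smooth_on U g ->
  smooth_on U (fun x => f x * g x).
Proof. by move=> oU /smooth_uptoP sf /smooth_uptoP sg; apply/smooth_uptoP => m; exact: smooth_uptoM. Qed.

Lemma smooth_onZ U (a : R) f : open U -> smooth_on U f -> smooth_on U (fun x => a * f x).
Proof. by move=> oU sf; apply: smooth_onM => //; exact: smooth_on_cst. Qed.

Lemma smooth_onN U f : open U -> smooth_on U f -> smooth_on U (fun x => - f x).
Proof. by move=> oU /(smooth_onZ (-1) oU); under eq_fun do rewrite mulN1r. Qed.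

Lemma smooth_onB U f g : open U -> smooth_on U f -> smooth_on U g ->
  smooth_on U (fun x => f x - g x).
Proof. by move=> oU sf sg; apply: smooth_onD => //; exact: smooth_onN. Qed.

Lemma smooth_upto_sum m U I (r : seq I) (P : pred I) (F : I -> 'rV[R]_n -> R) : open U ->
  (forall j, P j -> smooth_upto m U (F j)) -> smooth_upto m U (fun x => \sum_(j <- r | P j) F j x).
Proof.
move=> oU h; elim: r => [|j r IH].
  by under eq_fun do rewrite big_nil; exact: smooth_upto_cst.
case Pj: (P j); under eq_fun do rewrite big_cons Pj; last exact: IH.
by apply: smooth_uptoD => //; exact: h.
Qed.

Lemma smooth_on_sum U I (r : seq I) (P : pred I) (F : I -> 'rV[R]_n -> R) : open U ->
  (forall j, P j -> smooth_on U (F j)) -> smooth_on U (fun x => \sum_(j <- r | P j) F j x).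
Proof.
move=> oU h; apply/smooth_uptoP => m; apply: smooth_upto_sum => // j Pj.
by have /smooth_uptoP := h _ Pj; apply.
Qed.

Lemma smooth_on_prod U I (r : seq I) (P : pred I) (F : I -> 'rV[R]_n -> R) : open U ->
  (forall j, P j -> smooth_on U (F j)) -> smooth_on U (fun x => \prod_(j <- r | P j) F j x).
Proof.
move=> oU h; elim: r => [|j r IH].
  by under eq_fun do rewrite big_nil; exact: smooth_on_cst.
case Pj: (P j); under eq_fun do rewrite big_cons Pj; last exact: IH.
by apply: smooth_onM => //; exact: h.
Qed.

Lemma partial_coord (j i : 'I_n) x :
  pderiv i (fun y : 'rV[R]_n => y ord0 j) x = (j == i)%:R.
Proof.
rewrite partialE; last exact: differentiable_coord.
have @f : {linear 'rV[R]_n -> R}.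
  by exists (fun N : 'rV[R]_n => N ord0 j); do 2![eexists]; do ?[constructor];
     rewrite ?mxE// => ? *; rewrite ?mxE//; move=> ?; rewrite !mxE.
rewrite (_ : (fun _ => _) = f) // diff_lin; last exact: coord_continuous.
by rewrite /= mxE eqxx.
Qed.

Lemma smooth_on_coord U (j : 'I_n) : open U -> smooth_on U (fun y : 'rV[R]_n => y ord0 j).
Proof.
move=> oU; apply/smooth_uptoP => -[|m].
  by apply: smooth_upto0 => x _; exact: differentiable_coord.
apply: (@smooth_upto_intro _ _ _ (fun i _ => (j == i)%:R)) => // [x _|i x _|i].
- exact: differentiable_coord.
- exact: partial_coord.
- exact: smooth_upto_cst.
Qed.

(** A function of one variable is put in a family stable under differentiation, with [D] acting on
    the index, so that induction on the order only meets the chain rule. Instances: [flat_exp],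
    indexed by polynomials, and [a * t^b], indexed by [(a, b)]. *)
Lemma smooth_on_family (A : Type) (F : A -> R -> R) (D : A -> A) (V : set R) U
    (g : 'rV[R]_n -> R) a : open U ->
  (forall a t, V t -> is_derive t 1 (F a) (F (D a) t)) ->
  smooth_on U g -> (forall x, U x -> V (g x)) -> smooth_on U (fun x => F a (g x)).
Proof.
move=> oU dF sg UV.
have d1 b x : U x -> differentiable (F b) (g x).
  by move=> /UV /(dF b) [h _]; apply/derivable1_diffP.
have dFg b x : U x -> differentiable (fun x => F b (g x)) x.
  by move=> Ux; apply: differentiable_comp; [exact: smooth_on_diff sg Ux|exact: d1].
apply/smooth_uptoP => m; elim: m a => [|m IH] a; first by apply: smooth_upto0 => x; exact: dFg.
apply: (@smooth_upto_intro _ _ _ (fun i x => F (D a) (g x) * pderiv i g x)) => //.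
- exact: dFg.
- move=> i x Ux; have dg := smooth_on_diff sg Ux.
  rewrite partialE; last exact: dFg.
  rewrite (diff_comp dg (d1 a x Ux)) /= diff1E; last exact: d1.
  rewrite derive1E (@derive_val _ _ _ _ _ _ _ (dF a _ (UV _ Ux))).
  by rewrite -partialE// mulrC.
- move=> i; apply: smooth_uptoM => //.
  by have /smooth_uptoP := smooth_on_partial i sg; apply.
Qed.

End dim.

(** * The chain rule in several variables *)

Section composition.
Context {n p : nat}.

Lemma diff_components (phi : 'rV[R]_n -> 'rV[R]_p) x :
  (forall a, differentiable (fun y => phi y ord0 a) x) ->
  differentiable phi x /\ forall v a, 'd phi x v ord0 a = 'd (fun y => phi y ord0 a) x v.
Proof.
move=> dphi.
have dp : differentiable phi x.
  have -> : phi = \sum_(a < p) (fun y => phi y ord0 a *: delta_mx ord0 a).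
    by apply/funext => y; rewrite fct_sumE -row_sum_delta.
  by apply: differentiable_sum => a; exact: differentiableZl.
split => // v a.
have [f fE] : exists f : {linear 'rV[R]_p -> R}, f = (fun N => N ord0 a) :> (_ -> _).
  by unshelve eexists; [exists (fun N : 'rV[R]_p => N ord0 a); do 2![eexists]; do ?[constructor];
     rewrite ?mxE// => ? *; rewrite ?mxE//; move=> ?; rewrite !mxE|].
have cf : continuous f by rewrite fE; exact: coord_continuous.
have dff : differentiable (f : 'rV[R]_p -> R) (phi x) by exact: linear_differentiable.
have -> : (fun y => phi y ord0 a) = f \o phi by rewrite fE.
rewrite (diff_comp dp dff) /=; have -> : 'd (f : 'rV[R]_p -> R) (phi x) = f :> (_ -> _) by exact: diff_lin.
by rewrite fE.
Qed.

Lemma partial_comp (phi : 'rV[R]_n -> 'rV[R]_p) (f : 'rV[R]_p -> R) x i :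
  (forall a, differentiable (fun y => phi y ord0 a) x) -> differentiable f (phi x) ->
  differentiable (fun y => f (phi y)) x /\
  pderiv i (fun y => f (phi y)) x =
    \sum_a pderiv i (fun y => phi y ord0 a) x * pderiv a f (phi x).
Proof.
move=> dphi df; have [dp pE] := diff_components dphi.
have dc : differentiable (fun y => f (phi y)) x by exact: differentiable_comp.
split => //; rewrite partialE// (diff_comp dp df) /= diffE_partial//.
by apply: eq_bigr => a _; rewrite pE (@partialE _ (fun y => phi y ord0 a)).
Qed.

Lemma smooth_on_comp (U : set 'rV[R]_n) (W : set 'rV[R]_p)
    (phi : 'rV[R]_n -> 'rV[R]_p) (f : 'rV[R]_p -> R) : open U ->
  (forall a, smooth_on U (fun y => phi y ord0 a)) -> (forall x, U x -> W (phi x)) ->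
  smooth_on W f -> smooth_on U (fun y => f (phi y)).
Proof.
move=> oU sphi UW sf; apply/smooth_uptoP => m.
have dphi x a : U x -> differentiable (fun y => phi y ord0 a) x.
  by move=> Ux; exact: smooth_on_diff (sphi a) Ux.
have dc g x i : smooth_on W g -> U x -> differentiable (fun y => g (phi y)) x /\
    pderiv i (fun y => g (phi y)) x =
      \sum_a pderiv i (fun y => phi y ord0 a) x * pderiv a g (phi x).
  move=> sg Ux; apply: partial_comp; first by move=> a; exact: dphi.
  exact: smooth_on_diff sg (UW _ Ux).
(* [dc] provides differentiability only together with an index [i]; in source dimension [0] there is
   none, but there are no derivatives to take either. *)
case: (posnP n) => [n0|n0].
  move=> s x _ Ux; case: s => [|i s] /=; last first.
    by exfalso; move: (leq_ltn_trans (leq0n i) (ltn_ord i)); rewrite n0.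
  apply: differentiable_comp; last exact: smooth_on_diff sf (UW _ Ux).
  by have [] := @diff_components phi x (fun a => dphi x a Ux).
pose i0 := Ordinal n0.
elim: m f sf => [|m IH] f sf.
  by apply: smooth_upto0 => x Ux; exact: (dc _ _ i0 sf Ux).1.
apply: (@smooth_upto_intro _ _ _ _
  (fun i x => \sum_a pderiv i (fun y => phi y ord0 a) x * pderiv a f (phi x))) => //.
- by move=> x Ux; exact: (dc _ _ i0 sf Ux).1.
- by move=> i x Ux; exact: (dc _ _ i sf Ux).2.
- move=> i; apply: smooth_upto_sum => // a _; apply: smooth_uptoM => //.
    by have /smooth_uptoP := smooth_on_partial i (sphi a); apply.
  by apply: IH; exact: smooth_on_partial.
Qed.

End composition.

(** * Derivatives along coordinate lines and symmetry of second derivatives *)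

Section slices.
Context {n : nat}.
Implicit Types (f : 'rV[R]_n -> R) (U : set 'rV[R]_n).

Lemma is_derive_slice f (y v : 'rV[R]_n) (s : R) : differentiable f (s *: v + y) ->
  is_derive s 1 (fun t : R => f (t *: v + y)) ('d f (s *: v + y) v).
Proof.
move=> df.
have dg : is_diff s (fun t : R => t *: v + y) (fun t : R => t *: v).
  by apply: is_diff_eq; rewrite addr0.
have dl : differentiable (fun t : R => t *: v + y) s by exact: ex_diff.
have dc : differentiable (fun t : R => f (t *: v + y)) s by exact: differentiable_comp.
apply: DeriveDef; first exact/derivable1_diffP.
by rewrite deriveE// (diff_comp dl df) /= diff_val scale1r.
Qed.

Lemma is_derive_line f (y : 'rV[R]_n) i (s : R) : differentiable f (s *: delta_mx ord0 i + y) ->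
  is_derive s 1 (fun t : R => f (t *: delta_mx ord0 i + y))
    (pderiv i f (s *: delta_mx ord0 i + y)).
Proof. by move=> df; rewrite partialE//; exact: is_derive_slice. Qed.

Lemma mvt_line f (y : 'rV[R]_n) i (h : R) : 0 < h ->
  (forall s, 0 <= s <= h -> differentiable f (s *: delta_mx ord0 i + y)) ->
  exists2 s, 0 <= s <= h & f (h *: delta_mx ord0 i + y) - f y =
    pderiv i f (s *: delta_mx ord0 i + y) * h.
Proof.
move=> h0 df.
have d s : 0 <= s <= h -> is_derive s 1 (fun t : R => f (t *: delta_mx ord0 i + y))
    (pderiv i f (s *: delta_mx ord0 i + y)) by move=> hs; apply: is_derive_line; exact: df.
have [|||s hs E] := @MVT_segment R (fun t => f (t *: delta_mx ord0 i + y))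
   (fun s => pderiv i f (s *: delta_mx ord0 i + y)) 0 h.
- exact: ltW.
- by move=> s; rewrite in_itv/= => /andP[? ?]; apply: d; rewrite !ltW.
- apply: derivable_within_continuous => s; rewrite in_itv/= => hs.
  by have [] := d s hs.
exists s; first by move: hs; rewrite in_itv.
by move: E; rewrite subr0 scale0r add0r.
Qed.

(* Both mixed derivatives are limits of the second difference quotient, by the mean value theorem. *)
Lemma partialC U f i j x : open U -> smooth_on U f -> U x ->
  pderiv i (pderiv j f) x = pderiv j (pderiv i f) x.
Proof.
move=> oU sf Ux.
have mixed a b (e : R) : 0 < e -> exists2 d, 0 < d &
  forall h, 0 < h < d -> `|(f (h *: delta_mx ord0 a + (h *: delta_mx ord0 b + x)) -
     f (h *: delta_mx ord0 b + x) - (f (h *: delta_mx ord0 a + x) - f x)) -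
     pderiv b (pderiv a f) x * h ^+ 2| <= e * h ^+ 2.
  move=> e0.
  have sab : smooth_on U (pderiv b (pderiv a f)) by do 2 apply: smooth_on_partial.
  have := smooth_on_cont sab Ux; move=> /cvgrPdist_le /(_ e e0) /nbhs_ballP[d1 /= d10 hd1].
  have /nbhs_ballP[d2 /= d20 hd2] : nbhs x U by exact: open_nbhs_nbhs.
  pose d := Num.min d1 d2 / 2.
  have d0 : 0 < d by rewrite divr_gt0// lt_min d10.
  have bU (s t : R) : 0 <= s < d -> 0 <= t < d ->
      ball x (Num.min d1 d2) (s *: delta_mx ord0 a + (t *: delta_mx ord0 b + x)).
    move=> /andP[s0 sd] /andP[t0 td].
    rewrite -ball_normE /ball_ /= addrA opprD addrCA subrr addr0 normrN.
    apply: le_lt_trans (ler_normD _ _) _; rewrite !normrZ.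
    have nd (c : 'I_n) : `|delta_mx ord0 c : 'rV[R]_n| <= 1.
      by apply/norm_rV_leP => // k; rewrite mxE; case: eqP => //= _; case: eqP => //=; rewrite ?normr1 ?normr0.
    apply: (@le_lt_trans _ _ (s + t)).
      by apply: lerD; rewrite ger0_norm// ler_piMr.
    by rewrite [ltRHS](splitr) ltrD.
  have hU (s t : R) : 0 <= s < d -> 0 <= t < d -> U (s *: delta_mx ord0 a + (t *: delta_mx ord0 b + x)).
    move=> hs ht; apply: hd2; apply: le_ball (bU s t hs ht); by rewrite ge_min lexx orbT.
  exists d => // h /andP[h0 hd].
  (* The second difference is the increment of [F] in direction [a]. The mean value theorem for [F]
     in direction [a], then for [pderiv a f] in direction [b], yields [h^2] times a mixed derivative
     at an intermediate point, which lies in the ball since both steps are shorter than [d]. *)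
  pose F y := f (h *: delta_mx ord0 b + y) - f y.
  have h00 : 0 <= h < d by rewrite ltW.
  have sh t : 0 <= t <= h -> 0 <= t < d by move=> /andP[-> th]/=; exact: le_lt_trans hd.
  have dshift s : 0 <= s <= h -> differentiable (fun y => f (h *: delta_mx ord0 b + y)) (s *: delta_mx ord0 a + x) /\
     pderiv a (fun y => f (h *: delta_mx ord0 b + y)) (s *: delta_mx ord0 a + x) =
     pderiv a f (h *: delta_mx ord0 b + (s *: delta_mx ord0 a + x)).
    move=> hs; have Uy : U (h *: delta_mx ord0 b + (s *: delta_mx ord0 a + x)).
      by rewrite addrCA; apply: hU => //; exact: sh.
    have df := smooth_on_diff sf Uy.
    have dl : is_diff (s *: delta_mx ord0 a + x) (fun y => h *: delta_mx ord0 b + y) id.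
      by apply: is_diff_eq; rewrite add0r.
    have dl' : differentiable (fun y : 'rV[R]_n => h *: delta_mx ord0 b + y) (s *: delta_mx ord0 a + x) by exact: ex_diff.
    have dc := differentiable_comp dl' df; split; first exact: dc.
    by rewrite partialE// (diff_comp dl' df) /= diff_val partialE.
  have df0 s : 0 <= s <= h -> differentiable f (s *: delta_mx ord0 a + x).
    move=> hs; apply: smooth_on_diff sf _; have := hU s 0 (sh _ hs).
    by rewrite lexx d0 scale0r add0r; exact.
  have [|s hs] := @mvt_line F x a h h0.
    by move=> s hs; apply: differentiableB; [exact: (dshift s hs).1|exact: df0].
  rewrite {1 2}/F => E.
  have -> : f (h *: delta_mx ord0 a + (h *: delta_mx ord0 b + x)) -
     f (h *: delta_mx ord0 b + x) - (f (h *: delta_mx ord0 a + x) - f x) = F (h *: delta_mx ord0 a + x) - F x.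
    by rewrite /F [h *: delta_mx ord0 b + (h *: delta_mx ord0 a + x)]addrCA; ring.
  rewrite {1 2}/F E.
  have -> : pderiv a F (s *: delta_mx ord0 a + x) =
      pderiv a f (h *: delta_mx ord0 b + (s *: delta_mx ord0 a + x)) - pderiv a f (s *: delta_mx ord0 a + x).
    rewrite -(dshift s hs).2 -pderivE; apply: deriveB.
    - by apply: diff_derivable; exact: (dshift s hs).1.
    - by apply: diff_derivable; exact: df0.
  have [|t ht ->] := @mvt_line (pderiv a f) (s *: delta_mx ord0 a + x) b h h0.
    move=> t ht; apply: (smooth_on_diff (smooth_on_partial a sf)).
    by rewrite addrCA; apply: hU; exact: sh.
  rewrite -mulrA -expr2 -mulrBl normrM (@ger0_norm _ (h ^+ 2)) ?sqr_ge0//.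
  rewrite ler_wpM2r ?sqr_ge0// distrC; apply: hd1.
  rewrite addrCA; apply: le_ball (bU s t (sh _ hs) (sh _ ht)).
  by rewrite ge_min lexx.
apply/eqP; rewrite -subr_eq0 -normr_le0; apply/ler_addgt0Pr => e e0; rewrite add0r.
have e20 : 0 < e / 2 by rewrite divr_gt0.
have [d1 d10 h1] := mixed i j _ e20; have [d2 d20 h2] := mixed j i _ e20.
pose h := Num.min d1 d2 / 2.
have h0 : 0 < h by rewrite divr_gt0// lt_min d10.
have hlt : h < Num.min d1 d2 by rewrite ltr_pdivrMr// ltr_pMr ?ltr1n// lt_min d10.
have {}h1 := h1 h; have {}h2 := h2 h.
move: hlt; rewrite lt_min => /andP[hd1 hd2].
rewrite h0 hd1 in h1; rewrite h0 hd2 in h2.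
have {}h1 := h1 isT; have {}h2 := h2 isT.
rewrite -(ler_pM2r (exprn_gt0 2 h0)) -{1}(ger0_norm (ltW (exprn_gt0 2 h0))) -normrM.
move: h1 h2; rewrite [h *: delta_mx ord0 j + (h *: delta_mx ord0 i + x)]addrCA.
move: (f _) (f (h *: delta_mx ord0 j + x)) (f (h *: delta_mx ord0 i + x)) (f x) (h ^+ 2).
move: (pderiv i _ x) (pderiv j _ x) => A B D1 D2 D3 D4 H.
by rewrite !ler_norml => /andP[? ?] /andP[? ?]; apply/andP; split; lra.
Qed.

End slices.

End smooth_calculus.

(** * Bump functions and integration by parts *)

Section bump.
Context {R : realType}.

(** Monomial by monomial: [y^i <= i! * expR y] for [y >= 0], a term of the exponential series. *)
Lemma poly_exp_bound (p : {poly R}) :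
  exists2 C : R, 0 <= C & forall y, 0 <= y -> `|p.[y] * expR (- y)| <= C.
Proof.
exists (\sum_(i < size p) `|p`_i| * i`!%:R).
  by apply: sumr_ge0 => i _; apply: mulr_ge0.
move=> y y0; rewrite horner_coef mulr_suml.
apply: le_trans (ler_norm_sum _ _ _) _; apply: ler_sum => i _.
rewrite -mulrA normrM ler_wpM2l// ger0_norm ?mulr_ge0 ?exprn_ge0 ?expR_ge0//.
rewrite expRN ler_pdivrMr ?expR_gt0// mulrC -ler_pdivrMr ?ltr0n ?fact_gt0//.
case: (nat_of_ord i) => [|j]; first by rewrite expr0 divr1 (le_trans _ (expR_ge1Dx y))// lerDl.
by apply: le_trans (expR_ge1Dxn j y0); rewrite lerDr.
Qed.

(** For [p = 1] the classical function [exp(-1/t)], flat at [0]. The polynomial parameter makes the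
    family closed under differentiation, which maps [p] to [X^2 (p - p')]. *)
Definition flat_exp (p : {poly R}) (t : R) : R :=
  if 0 < t then p.[t^-1] * expR (- t^-1) else 0.

Lemma is_derive_flat_exp (p : {poly R}) (t : R) :
  is_derive t 1 (flat_exp p) (flat_exp ('X^2 * (p - p^`())) t).
Proof.
have [t0|t0|->] := ltgtP t 0.
- have -> : flat_exp ('X^2 * (p - p^`())) t = 0 by rewrite /flat_exp ltNge ltW.
  apply: (@near_eq_is_derive _ _ _ (cst 0)).
  by near=> s; rewrite /flat_exp ltNge ltW//; near: s; exact: lt_nbhsl.
- pose g s := p.[s] * expR (- s).
  have dg (s : R) : is_derive s 1 g (p^`().[s] * expR (- s) - p.[s] * expR (- s)).
    have de : is_derive s 1 (fun s => expR (- s)) (expR (- s) * -1).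
      by apply: is_derive1_comp.
    apply: is_derive_eq; rewrite /GRing.scale/=; ring.
  have tn0 : t != 0 by rewrite gt_eqF.
  have di : is_derive t 1 (fun s : R => s^-1) (- (t ^- 2)).
    have := @is_deriveV R id t 1 1 tn0 (is_derive_id _ _).
    by rewrite /GRing.scale /= mulr1.
  have := @is_derive1_comp R g (fun s => s^-1) t _ _ (dg _) di.
  rewrite {2}/flat_exp t0 hornerM hornerXn hornerD hornerN => h.
  apply: (@near_eq_is_derive _ _ _ (g \o (fun s => s^-1))).
    by near=> s; rewrite /flat_exp ifT//; near: s; exact: lt_nbhsr.
  apply: is_derive_eq; rewrite exprVn; ring.
- have -> : flat_exp ('X^2 * (p - p^`())) 0 = 0 by rewrite /flat_exp ltxx.
  (* The bound for [X^2 p] says that the function is at most [C h^2] for small [h > 0], so the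
     difference quotient at [0] is at most [C h]. *)
  have [C C0 hC] := poly_exp_bound ('X^2 * p).
  have cv : h^-1 *: (flat_exp p (h + 0) - flat_exp p 0) @[h --> 0^'] --> 0.
    apply/cvgrPdist_le => e e0.
    have eC : 0 < e / (C + 1) by rewrite divr_gt0// ltr_wpDl.
    near=> h.
    have hn0 : h != 0 by near: h; exact: nbhs_dnbhs_neq.
    have he : `|h| <= e / (C + 1).
      by near: h; apply: dnbhs0_le.
    rewrite sub0r normrN addr0 {2}/flat_exp ltxx subr0 normrZ /flat_exp.
    case: ifPn => [h0|_]; last by rewrite normr0 mulr0 ltW.
    have := hC h^-1; rewrite invr_ge0 ltW// => /(_ isT).
    rewrite hornerM hornerXn -mulrA normrM => hC'.
    set Q := `|p.[h^-1] * _| in hC' *.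
    rewrite normfV (gtr0_norm h0) ler_pdivrMl//.
    have h2 : 0 < h ^+ 2 by rewrite exprn_gt0.
    rewrite exprVn (gtr0_norm _) ?invr_gt0// ler_pdivrMl// in hC'.
    apply: le_trans hC' _; rewrite expr2 -mulrA ler_pM2l//.
    rewrite (gtr0_norm h0) ler_pdivlMr ?ltr_wpDl// in he.
    by apply: le_trans he; rewrite ler_pM2l// lerDl.
  apply: DeriveDef.
    by apply/cvg_ex; exists 0; under eq_fun do rewrite [_%:A]mulr1.
  rewrite /derive; under eq_fun do rewrite [_%:A]mulr1.
  exact/cvg_lim.
Unshelve. all: by end_near. Qed.

(** The norm of row vectors is the sup norm, so a product over coordinates is positive exactly on
    the open ball of radius [r > 0]. In dimension [0] the empty product is [1]; hence the positivity
    of [n] in [bump0]. *)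
Definition bump n (x0 : 'rV[R]_n) (r : R) (x : 'rV[R]_n) : R :=
  \prod_(i < n) flat_exp 1 (r ^+ 2 - (x ord0 i - x0 ord0 i) ^+ 2).

Lemma flat_exp1_ge0 (t : R) : 0 <= flat_exp 1 t.
Proof. by rewrite /flat_exp; case: ifP => // _; rewrite hornerC mul1r expR_ge0. Qed.

Lemma bump_ge0 n (x0 : 'rV[R]_n) r x : 0 <= bump x0 r x.
Proof. by apply: prodr_ge0 => i _; exact: flat_exp1_ge0. Qed.

Lemma bump_gt0 n (x0 : 'rV[R]_n) r x : `|x - x0| < r -> 0 < bump x0 r x.
Proof.
move=> h; have r0 : 0 < r by rewrite (le_lt_trans _ h).
apply: prodr_gt0 => i _; rewrite /flat_exp hornerC mul1r.
rewrite ifT ?expR_gt0// subr_gt0 -real_normK ?num_real//.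
rewrite ltr_pXn2r// ?nnegrE// ?(ltW r0)//; apply: le_lt_trans h.
have /norm_rV_leP := lexx `|x - x0|; move=> /(_ (normr_ge0 _) i).
by rewrite !mxE.
Qed.

Lemma bump0 n (x0 : 'rV[R]_n) r x : 0 <= r -> r <= `|x - x0| -> (0 < n)%N -> bump x0 r x = 0.
Proof.
move=> r0 h n0.
have [i hi] : exists i, r <= `|x ord0 i - x0 ord0 i|.
  have [xx|/mx_norm_neq0[[k i] hi]] := eqVneq `|x - x0| 0.
    by exists (Ordinal n0); rewrite (le_trans h)// xx.
  exists i; apply: le_trans h _; rewrite [leLHS]hi /= ord1.
  by rewrite !mxE.
rewrite /bump (bigD1 i)//= /flat_exp ifF ?mul0r//.
apply/negbTE; rewrite -leNgt subr_le0 -[leRHS]real_normK ?num_real//.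
by rewrite ler_pXn2r// nnegrE.
Qed.

Lemma smooth_bump n (x0 : 'rV[R]_n) r U : open U -> smooth_on U (bump x0 r).
Proof.
move=> oU; apply: smooth_on_prod => // i _.
apply: (@smooth_on_family R n {poly R} flat_exp (fun p => 'X^2 * (p - p^`())) setT U) => //.
  by move=> p t _; exact: is_derive_flat_exp.
have sc : smooth_on U (fun x : 'rV[R]_n => x ord0 i - x0 ord0 i).
  by apply: smooth_onB => //; [exact: smooth_on_coord|exact: smooth_on_cst].
apply: smooth_onB => //; first exact: smooth_on_cst.
by under eq_fun do rewrite expr2; exact: smooth_onM.
Qed.

End bump.

(** * Test functions, integration by parts and norms of derivatives *)

Section test_functions.
Context {R : realType} {n : nat}.
Implicit Types (u v : 'rV[R]_n -> R) (U : set 'rV[R]_n).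

(** The strict inequality describes an open set, so derivatives inherit the property with the same
    radius. *)
Definition supported_in (x0 : 'rV[R]_n) (r : R) u := forall x, r < `|x - x0| -> u x = 0.

(** Working form of [test_function] (see [test_functionP]): a radius is easier to carry through
    estimates than compactness of a closure. *)
Definition test u := smooth_on setT u /\ exists r : R, supported_in 0 r u.

Lemma open_far (x0 : 'rV[R]_n) (r : R) : open [set x | r < `|x - x0|].
Proof.
rewrite -[X in open X]setCK openC.
have -> : ~` [set x | r < `|x - x0|] = [set x | `|x - x0| <= r].
  by apply/seteqP; split => x /=; rewrite leNgt => /negP.
by apply: compact_closed; [exact: norm_hausdorff|exact: compact_closed_ball_rV].
Qed.

Lemma supported_partial x0 r u i : supported_in x0 r u -> supported_in x0 r (pderiv i u).
Proof.
move=> su x rx; rewrite (@eq_partial R n [set x | r < `|x - x0|] _ (fun=> 0))//.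
- exact: partial_cst.
- exact: open_far.
Qed.

Lemma supported_mull x0 r u v : supported_in x0 r v -> supported_in x0 r (fun x => u x * v x).
Proof. by move=> sv x /sv ->; rewrite mulr0. Qed.

Lemma supported_cc x0 r u : continuous u -> supported_in x0 r u -> cc u.
Proof.
move=> cu su; split => //; exists (r + 1 + `|x0|) => x hx; apply: su.
have := ler_distD x0 x 0; rewrite !subr0 => h.
rewrite -(ltrD2r `|x0|); apply: lt_le_trans h; apply: lt_le_trans hx.
by rewrite ltrD2r ltrDl.
Qed.

Lemma supported_test x0 r u : smooth_on setT u -> supported_in x0 r u -> test u.
Proof.
move=> su ssu; split => //; have [_ [s hs]] := supported_cc (smooth_continuous su) ssu.
by exists s => x; rewrite subr0 => /ltW; exact: hs.
Qed.

Lemma test_cc u : test u -> cc u.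
Proof. by move=> [su [r hr]]; exact: supported_cc (smooth_continuous su) hr. Qed.

Lemma test_functionP u : test_function u <-> test u.
Proof.
split=> -[su h]; split => //.
  have [M [_ hM]] := compact_bounded h.
  exists (M + 1) => x; rewrite subr0 => Mx; apply: contrapT => /eqP ux.
  have := hM (M + 1); rewrite ltrDl ltr01 => /(_ isT x) F.
  have : `|x| <= M + 1 by apply: F; exact: subset_closure.
  by rewrite leNgt Mx.
case: h => r hr; apply: (@subclosed_compact _ _ [set x | `|x - 0| <= r]).
- exact: closed_closure.
- exact: compact_closed_ball_rV.
- have := compact_closed (@norm_hausdorff _ _) (@compact_closed_ball_rV R n 0 r).
  move=> /closure_id ->; apply: closure_subset => x /= ux.
  by rewrite leNgt; apply/negP => /hr /eqP; apply/negP.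
Qed.

Lemma test_partial u i : test u -> test (pderiv i u).
Proof.
move=> [su [r hr]]; split; first exact: smooth_on_partial.
by exists r; exact: supported_partial.
Qed.

Lemma test_mull u v : smooth_on setT u -> test v -> test (fun x => u x * v x).
Proof.
move=> su [sv [r hr]]; split; first by apply: smooth_onM => //; exact: openT.
by exists r; exact: supported_mull.
Qed.

Lemma testZ (a : R) v : test v -> test (fun x => a * v x).
Proof. by apply: test_mull; apply: smooth_on_cst; exact: openT. Qed.

Lemma test0 : test (fun=> 0).
Proof. by split; [apply: smooth_on_cst; exact: openT|exists 0]. Qed.

Lemma testD u v : test u -> test v -> test (fun x => u x + v x).
Proof.
move=> tu tv; have [_ [r hr]] := ccD (test_cc tu) (test_cc tv).
split; first by case: tu tv => su _ [sv _]; apply: smooth_onD => //; exact: openT.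
by exists r => x; rewrite subr0 => /ltW /hr.
Qed.

Lemma testB u v : test u -> test v -> test (fun x => u x - v x).
Proof.
move=> tu tv; apply: testD => //; under eq_fun do rewrite -mulN1r; exact: testZ.
Qed.

Lemma test_sum I (s : seq I) (P : pred I) (F : I -> 'rV[R]_n -> R) :
  (forall j, P j -> test (F j)) -> test (fun x => \sum_(j <- s | P j) F j x).
Proof.
move=> h; elim: s => [|j s IH]; first by under eq_fun do rewrite big_nil; exact: test0.
case Pj: (P j); under eq_fun do rewrite big_cons Pj; last exact: IH.
by apply: testD => //; exact: h.
Qed.

(** Difference quotients have integral [0] by translation invariance, and they converge to the
    derivative under a common majorant. *)
Lemma integral_partial u i : test u -> integral_rV (pderiv i u) = 0.
Proof.
move=> tu; have [su [r hr]] := tu.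
have cpu := test_cc (test_partial i tu).
have [C C0 hC] := cc_bounded cpu.
pose h m : R := m.+1%:R^-1.
pose e : 'rV[R]_n := delta_mx ord0 i.
have ne : `|e| <= 1.
  by apply/norm_rV_leP => // k; rewrite mxE; case: eqP => //= _; case: eqP => //=; rewrite ?normr1 ?normr0.
have h0 m : 0 < h m by rewrite invr_gt0.
have h1 m : h m <= 1 by rewrite invf_le1// ler1n.
pose g m (x : 'rV[R]_n) := (h m)^-1 * (u (x + h m *: e) - u x).
(* A continuous tent which is at least [C] where [|x| <= |r| + 2]. Beyond that the quotients vanish,
   because the steps [h m] are at most [1]. *)
pose dom (x : 'rV[R]_n) := C * Num.max (`|r| + 3 - `|x|) 0.
have cdom : cc dom.
  apply: ccZ; split; last first.
    by exists (`|r| + 3) => x hx; rewrite max_r// subr_le0.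
  have c1 : continuous (fun s : R => Num.max (`|r| + 3 - s) 0); last first.
    exact: (continuous_compose (@norm_continuous _ _) c1).
  have c0 : continuous (fun s : R => `|r| + 3 - s).
    by move=> s; apply: cvgB; [exact: cvg_cst|exact: cvg_id].
  have cm : continuous (fun s : R => Num.max s 0).
    by move=> s; apply: continuous_max => //; exact: cvg_cst.
  exact: continuous_compose c0 cm.
have ush m : cc (fun x => u (x + h m *: e)).
  under eq_fun do rewrite -[X in X + _]mulmx1.
  by apply: cc_affine (test_cc tu) _; exact: unitmx1.
have cg m : cc (g m) by apply: ccZ; apply: ccB => //; exact: test_cc.
have g0 m : integral_rV (g m) = 0.
  rewrite integral_rVZ; last by apply: ccB => //; exact: test_cc.
  rewrite integral_rVB//; last exact: test_cc.
  have := @integral_rV_affine R n 1%:M (h m *: e) u (@affine_change_scalar R n 1 ltr01).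
  rewrite det1 mul1r ltr01 => /(_ isT (test_cc tu)) <-.
  by under [X in _ * (_ - integral_rV X)]eq_fun do rewrite mulmx1; rewrite subrr mulr0.
have gE m x : exists2 s, 0 <= s <= h m & g m x = pderiv i u (s *: e + x).
  have [|s hs E] := @mvt_line R n u x i (h m) (h0 m).
    by move=> s _; exact: (smooth_on_diff su).
  exists s => //; rewrite /g [x + _]addrC E mulrC mulfK//.
  by rewrite gt_eqF.
have gd m x : `|g m x| <= dom x.
  have [xr|xr] := leP `|x| (`|r| + 2).
    have [s _ ->] := gE m x; apply: le_trans (hC _) _.
    by rewrite /dom ler_peMr// le_max; apply/orP; left; move: xr; lra.
  have dom0 : 0 <= dom x by rewrite mulr_ge0// le_max lexx orbT.
  have hr0 y : `|r| < `|y| -> u y = 0.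
    by move=> ry; apply: hr; rewrite subr0; apply: le_lt_trans ry; exact: ler_norm.
  rewrite /g !hr0 ?subrr ?mulr0 ?normr0//; first by move: xr; lra.
  have := ler_distD x (x + h m *: e) 0.
  have : `|x| <= `|x + h m *: e| + `|h m *: e|.
    by rewrite -{1}(addrK (h m *: e) x); exact: ler_normB.
  have : `|h m *: e| <= 1.
    by rewrite normrZ gtr0_norm// mulr_ile1// ltW.
  by move: xr; lra.
have hcv : h m @[m --> \oo] --> (0 : R) by exact: cvg_harmonic.
have gc x : g m x @[m --> \oo] --> pderiv i u x.
  apply/cvgrPdist_le => ep ep0.
  have cp := smooth_continuous (smooth_on_partial i su).
  have /cvgrPdist_le /(_ ep ep0) /nbhs_ballP[d /= d0 hd] := cp x.
  have /cvgrPdist_lt /(_ d d0) := hcv; apply: filterS => m /=.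
  rewrite sub0r normrN (gtr0_norm (h0 m)) => hm.
  have [s /andP[s0 sh] ->] := gE m x; apply: hd.
  rewrite -ball_normE /ball_ /= opprD addrCA subrr addr0 normrN normrZ ger0_norm//.
  apply: le_lt_trans hm; apply: le_trans sh; by rewrite ler_piMr.
have mm (f : 'rV[R]_n -> R) : cc f -> measurable_fun [set: tup R n] (EFin \o (f \o X)).
  by move=> [cf _]; apply/measurable_EFinP; exact: continuous_measurable_rV.
have := @dominated_convergence _ _ R (dx n) setT measurableT
  (fun m => EFin \o (g m \o X)) (EFin \o (pderiv i u \o X)) (EFin \o (dom \o X))
  (fun m => mm _ (cg m)) (mm _ cpu) _ (cc_integrable cdom) _.
case.
- by apply/aeW => t _ /=; apply: cvg_EFin; [exact: nearW|exact: gc].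
- by apply/aeW => t m _ /=; rewrite lee_fin.
move=> _ _ cv.
have ee : [sequence (\int[dx n]_x (EFin \o (g m \o X)) x)%E]_m = cst 0%E.
  by apply/funext => m; rewrite -[RHS]/(0%:E) -(g0 m) integral_rVE.
have {}cv : (cst 0%E : nat -> \bar R) @ \oo --> (\int[dx n]_x (EFin \o (pderiv i u \o X)) x)%E.
  by rewrite -ee.
have E := cvg_unique (@ereal_hausdorff R) cv (cvg_cst _).
by apply: EFin_inj; rewrite integral_rVE// -[RHS](E _ _).
Qed.

Lemma integral_by_parts u v i : smooth_on setT u -> test v ->
  integral_rV (fun x => u x * pderiv i v x) = - integral_rV (fun x => pderiv i u x * v x).
Proof.
move=> su tv; have := integral_partial i (test_mull su tv).
have -> : pderiv i (fun x => u x * v x) = fun x => u x * pderiv i v x + pderiv i u x * v x.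
  apply/funext => x; rewrite partialM; [|exact: smooth_on_diff su I|exact: smooth_on_diff tv.1 I].
  by congr (_ + _); exact: mulrC.
rewrite integral_rVD; first by move/eqP; rewrite addr_eq0 => /eqP.
- by apply: test_cc; apply: test_mull => //; exact: test_partial.
- by apply: test_cc; apply: test_mull => //; exact: smooth_on_partial.
Qed.

(** The squared norm of the tensor of derivatives of order [m]: a mixed derivative is counted once
    for each order in which it can be taken. With these multiplicities the comparison with the
    polyharmonic energy is an identity. *)
Fixpoint Dsq m u (x : 'rV[R]_n) : R :=
  if m is m'.+1 then \sum_i Dsq m' (pderiv i u) x else u x ^+ 2.

(** Orders strictly below [m]: the lower order terms that accompany [Dsq m]. *)
Definition jet m u x : R := \sum_(a < m) Dsq a u x.

Lemma Dsq_ge0 m u x : 0 <= Dsq m u x.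
Proof.
by elim: m u => [|m IH] u /=; [exact: sqr_ge0|apply: sumr_ge0 => i _].
Qed.

Lemma jet_ge0 m u x : 0 <= jet m u x.
Proof. by apply: sumr_ge0 => a _; exact: Dsq_ge0. Qed.

Lemma jetS m u x : jet m.+1 u x = jet m u x + Dsq m u x.
Proof. by rewrite /jet big_ord_recr. Qed.

Lemma le_jet a m u x : (a <= m)%N -> jet a u x <= jet m u x.
Proof.
move=> /subnK <-; elim: (m - a)%N => [|k IH]//.
by rewrite addSn jetS; apply: le_trans IH _; rewrite lerDl Dsq_ge0.
Qed.

Lemma Dsq_partials u s x : foldr pderiv u s x ^+ 2 <= Dsq (size s) u x.
Proof.
elim/last_ind: s u => [|s i IH] u //=.
rewrite foldr_rcons size_rcons /=; apply: le_trans (IH _) _.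
rewrite (bigD1 i)//= lerDl; apply: sumr_ge0 => j _; exact: Dsq_ge0.
Qed.

Lemma partials_jet u s m x : (size s < m)%N -> foldr pderiv u s x ^+ 2 <= jet m u x.
Proof.
move=> sm; apply: le_trans (Dsq_partials _ _ _) _; rewrite /jet.
by rewrite (bigD1 (Ordinal sm))//= lerDl sumr_ge0// => a _; exact: Dsq_ge0.
Qed.

Lemma smooth_Dsq m U u : open U -> smooth_on U u -> smooth_on U (Dsq m u).
Proof.
move=> oU; elim: m u => [|m IH] u su /=.
  by under eq_fun do rewrite expr2; exact: smooth_onM.
by apply: smooth_on_sum => // i _; apply: IH; exact: smooth_on_partial.
Qed.

Lemma supported_Dsq m x0 r u : supported_in x0 r u -> supported_in x0 r (Dsq m u).
Proof.
elim: m u => [|m IH] u su x rx /=; first by rewrite su// expr0n.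
by rewrite big1// => i _; apply: IH rx; exact: supported_partial.
Qed.

Lemma test_Dsq m u : test u -> test (Dsq m u).
Proof.
by move=> [su [r hr]]; split; [apply: smooth_Dsq => //; exact: openT|exists r; exact: supported_Dsq].
Qed.

Lemma test_jet m u : test u -> test (jet m u).
Proof. by move=> tu; apply: test_sum => a _; exact: test_Dsq. Qed.

Lemma smooth_jet m U u : open U -> smooth_on U u -> smooth_on U (jet m u).
Proof. by move=> oU su; apply: smooth_on_sum => // a _; exact: smooth_Dsq. Qed.

Lemma eq_Dsq U m u v x : open U -> U x -> (forall y, U y -> u y = v y) ->
  Dsq m u x = Dsq m v x.
Proof.
move=> oU Ux; elim: m u v => [|m IH] u v uv /=; first by rewrite uv.
by apply: eq_bigr => i _; apply: IH => y Uy; exact: eq_partial oU Uy _.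
Qed.

Definition lap0 u : 'rV[R]_n -> R := fun x => - \sum_i pderiv i (pderiv i u) x.

Lemma laplacian_id : laplacian (fun=> 1%:M) = lap0.
Proof.
apply/funext => u; apply/funext => x; rewrite /laplacian /divergence /volume_density /lap0.
rewrite det1 sqrtr1 invr1 mul1r; congr (- _); apply: eq_bigr => i _.
rewrite pderivE; congr pderiv; apply/funext => y; rewrite mul1r /gradient pderivE invmx1 (bigD1 i)//=.
by rewrite mxE eqxx mul1r big1 ?addr0// => j ji; rewrite mxE eq_sym (negbTE ji) mul0r.
Qed.

Lemma gradient_sqnorm_id u x : gradient_sqnorm (fun=> 1%:M) u x = Dsq 1 u x.
Proof.
rewrite /gradient_sqnorm /=; apply: eq_bigr => i _; rewrite (bigD1 i)//=.
rewrite big1 ?addr0 => [|j ji]; last by rewrite mxE eq_sym (negbTE ji) !mul0r.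
suff -> : gradient (fun=> 1%:M) u i x = pderiv i u x by rewrite mxE eqxx mul1r expr2.
rewrite /gradient pderivE invmx1 (bigD1 i)//= mxE eqxx mul1r big1 ?addr0// => j ji.
by rewrite mxE eq_sym (negbTE ji) mul0r.
Qed.

Lemma half_laplacian_sqSS (lap gradsq : ('rV[R]_n -> R) -> 'rV[R]_n -> R) m u :
  half_laplacian_sq lap gradsq m.+2 u = half_laplacian_sq lap gradsq m (lap u).
Proof.
rewrite /half_laplacian_sq (_ : m.+2./2 = m./2.+1)// iterSr.
by rewrite (_ : odd m.+2 = odd m) //= negbK.
Qed.

Lemma test_lap0 u : test u -> test (lap0 u).
Proof.
move=> tu; rewrite /lap0; under eq_fun do rewrite -mulN1r; apply: testZ.
by apply: test_sum => i _; do 2 apply: test_partial.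
Qed.

Lemma partialC_fun u i j : smooth_on setT u -> pderiv i (pderiv j u) = pderiv j (pderiv i u).
Proof. by move=> su; apply/funext => x; exact: (@partialC R n setT u i j x openT su I). Qed.

Lemma partial_lap0 u i : smooth_on setT u -> pderiv i (lap0 u) = lap0 (pderiv i u).
Proof.
move=> su; apply/funext => x; rewrite /lap0.
have s2 j : smooth_on setT (pderiv j (pderiv j u)) by do 2 apply: smooth_on_partial.
under [X in pderiv i X]eq_fun do rewrite -mulN1r.
rewrite partialZ; last by apply: differentiable_bigsum => j _; exact: smooth_on_diff (s2 j) I.
rewrite mulN1r partial_sum; last by move=> j _; exact: smooth_on_diff (s2 j) I.
have E j : pderiv i (pderiv j (pderiv j u)) x = pderiv j (pderiv j (pderiv i u)) x.
  exact: (etrans (congr1 (@^~ x) (partialC_fun i j (smooth_on_partial j su)))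
    (congr1 (fun f => pderiv j f x) (partialC_fun i j su))).
by apply: (congr1 (fun z => - z)); apply: eq_bigr => j _; exact: E.
Qed.

(** For [m = 0], two integrations by parts turn each product of a second derivative in direction [i]
    and one in direction [j] into the square of the mixed derivative. Higher orders follow because
    [lap0] commutes with partial derivatives. *)
Lemma integral_Dsq_lap0 m u : test u ->
  integral_rV (Dsq m (lap0 u)) = integral_rV (Dsq m.+2 u).
Proof.
elim: m u => [|m IH] u tu; last first.
  rewrite /= !integral_rV_sum; last 2 first.
  - by move=> i _; apply: test_cc; apply: test_sum => j _; apply: test_sum => k _; apply: test_Dsq; do 3 apply: test_partial.
  - by move=> i _; apply: test_cc; apply: test_Dsq; apply: test_partial; exact: test_lap0.
  apply: eq_bigr => i _; rewrite partial_lap0; last by case: tu.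
  by rewrite IH//; exact: test_partial.
have t2 i j : test (pderiv i (pderiv j u)) by do 2 apply: test_partial.
rewrite /=.
transitivity (integral_rV (fun x => \sum_i \sum_j pderiv i (pderiv i u) x * pderiv j (pderiv j u) x)).
  by congr integral_rV; apply/funext => x; rewrite /lap0 sqrrN expr2 big_distrlr.
have tt v w : test v -> test w -> test (fun x => v x * w x).
  by move=> [sv _] tw; exact: test_mull.
rewrite [LHS]integral_rV_sum => [|i _]; last first.
  by apply: test_cc; apply: test_sum => j _; exact: tt.
rewrite [RHS]integral_rV_sum => [|i _]; last first.
  by apply: test_cc; apply: test_sum => j _; exact: (@test_Dsq 0).
apply: eq_bigr => i _; rewrite [LHS]integral_rV_sum => [|j _]; last first.
  by apply: test_cc; exact: tt.
rewrite [RHS]integral_rV_sum => [|j _]; last first.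
  by apply: test_cc; exact: (@test_Dsq 0).
apply: eq_bigr => j _.
transitivity (integral_rV (fun x => pderiv j (pderiv j u) x * pderiv i (pderiv i u) x)).
  by apply: (congr1 (@integral_rV R n)); apply/funext => x; exact: mulrC.
rewrite (@integral_by_parts (pderiv j (pderiv j u)) (pderiv i u) i);
  [|by case: (t2 j j)|exact: test_partial].
transitivity (- integral_rV (fun x => pderiv i u x * pderiv j (pderiv j (pderiv i u)) x)).
  apply: (congr1 (fun z => - z)); apply: (congr1 (@integral_rV R n)); apply/funext => x.
  rewrite [LHS]mulrC; apply: (congr1 (fun z => _ * z)).
  exact: (etrans (congr1 (@^~ x) (partialC_fun i j (smooth_on_partial j tu.1)))
    (congr1 (fun f => pderiv j f x) (partialC_fun i j tu.1))).
rewrite (@integral_by_parts (pderiv i u) (pderiv j (pderiv i u)) j);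
  [|by case: (test_partial i tu)|exact: t2].
by rewrite opprK; apply: (congr1 (@integral_rV R n)); apply/funext => x; rewrite expr2.
Qed.

(** The link between the energy in the definition of [K0] and the quantity that the Sobolev
    inequality controls; the induction removes one Laplacian, hence two orders, at a time. *)
Lemma integral_half_laplacian_sq m u : test u ->
  integral_rV (euclidean_half_laplacian_sq m u) = integral_rV (Dsq m u).
Proof.
rewrite /euclidean_half_laplacian_sq laplacian_id.
elim/ltn_ind: m u => -[|[|m]] IH u tu //.
  by apply: (congr1 (@integral_rV R n)); apply/funext => x; exact: gradient_sqnorm_id.
rewrite half_laplacian_sqSS IH//; last exact: test_lap0.
exact: integral_Dsq_lap0.
Qed.

End test_functions.

(** * The Gagliardo-Nirenberg-Sobolev inequality *)

Section bounded_bounded_support.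
Context {R : realType}.

Definition bb n (F : tup R n -> R) := [/\ measurable_fun setT F, (forall t, 0 <= F t) &
  exists C r : R, (forall t, F t <= C) /\ (forall t, r < `|X t| -> F t = 0)].

Definition itup n (F : tup R n -> R) : R := \int[@dx R n]_t F t.

Lemma bb_integrable n (F : tup R n -> R) : bb F -> (@dx R n).-integrable setT (EFin \o F).
Proof.
move=> [mF F0 [C [r [FC Fr]]]].
pose D := [set t : tup R n | `|X t| <= r].
have mD : measurable D by exact: measurable_closed_ball_rV.
have -> : EFin \o F = (EFin \o F) \_ D.
  apply/funext => t; rewrite patchE /=; case: ifPn => //; rewrite notin_setE /D/=.
  by move=> /negP; rewrite -ltNge => /Fr ->.
apply/(integrable_mkcond _ mD); apply: measurable_bounded_integrable => //.
- exact: lebesgue_tuple_closed_ball.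
- exact: measurable_funS mF.
- exists C; split; first exact: num_real.
  by move=> M CM x _ /=; rewrite ger0_norm// (le_trans (FC x))// ltW.
Qed.

Lemma itupE n (F : tup R n -> R) : bb F -> ((itup F)%:E = \int[@dx R n]_t (F t)%:E)%E.
Proof.
by move=> bF; rewrite fineK//; exact: (integrable_fin_num measurableT (bb_integrable bF)).
Qed.

Lemma itup_ge0 n (F : tup R n -> R) : bb F -> 0 <= itup F.
Proof. by move=> [_ F0 _]; apply: Rintegral_ge0. Qed.

Lemma le_itup n (F G : tup R n -> R) : bb F -> bb G -> (forall t, F t <= G t) -> itup F <= itup G.
Proof. by move=> bF bG FG; apply: le_Rintegral => //; exact: bb_integrable. Qed.

Lemma bbM n (F G : tup R n -> R) : bb F -> bb G -> bb (fun t => F t * G t).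
Proof.
move=> [mF F0 [C [r [FC Fr]]]] [mG G0 [C' [r' [GC Gr]]]]; split.
- exact: measurable_funM.
- by move=> t; exact: mulr_ge0.
- exists (C * C'), r; split; first by move=> t; apply: ler_pM.
  by move=> t /Fr ->; rewrite mul0r.
Qed.

Lemma bbZ n (a : R) (F : tup R n -> R) : 0 <= a -> bb F -> bb (fun t => a * F t).
Proof.
move=> a0 [mF F0 [C [r [FC Fr]]]]; split.
- exact: measurable_funM.
- by move=> t; exact: mulr_ge0.
- exists (a * C), r; split; first by move=> t; apply: ler_wpM2l.
  by move=> t /Fr ->; rewrite mulr0.
Qed.

Lemma bb_powR n (F : tup R n -> R) (q : R) : 0 < q -> bb F -> bb (fun t => F t `^ q).
Proof.
move=> q0 [mF F0 [C [r [FC Fr]]]]; split.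
- exact: (measurableT_comp (measurable_powR q) mF).
- by move=> t; exact: powR_ge0.
- exists (C `^ q), r; split; last by move=> t /Fr ->; rewrite powR0// gt_eqF.
  move=> t; apply: ge0_ler_powR => //; rewrite ?nnegrE//; first exact: ltW.
  exact: le_trans (FC t).
Qed.

Lemma itup_hoelder n (F G : tup R n -> R) (p q : R) : bb F -> bb G -> 0 < p -> 0 < q ->
  p^-1 + q^-1 = 1 ->
  itup (fun t => F t * G t) <=
  itup (fun t => F t `^ p) `^ p^-1 * itup (fun t => G t `^ q) `^ q^-1.
Proof.
move=> bF bG p0 q0 pq; have [mF F0 _] := bF; have [mG G0 _] := bG.
have := @hoelder _ _ R (@dx R n) F G p q mF mG p0 q0 pq.
rewrite Lnorm1 unlock /=.
under eq_integral do rewrite ger0_norm ?mulr_ge0//.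
rewrite -(itupE (bbM bF bG)).
under [X in (_ <= X `^ _ * _)%E]eq_integral do rewrite ger0_norm//.
under [X in (_ <= _ * X `^ _)%E]eq_integral do rewrite ger0_norm//.
by rewrite -(itupE (bb_powR p0 bF)) -(itupE (bb_powR q0 bG)) lee_fin.
Qed.

Lemma measurable_cons_slice n (s : measurableTypeR R) :
  measurable_fun [set: tup R n] (fun t => tuple_cons (s, t)).
Proof. by apply: measurable_cons => //; exact: measurable_id. Qed.

Lemma X_cons_far n (s : measurableTypeR R) (t : tup R n) (r : R) :
  r < `|X t| -> r < `|X (tuple_cons (s, t))|.
Proof.
move=> h; have [r0|r0] := leP 0 r; last by rewrite (lt_le_trans r0).
rewrite ltNge; apply: contraTN h => /norm_rV_leP h; rewrite -leNgt.
apply/norm_rV_leP => // i; have := h r0 (lift ord0 i).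
by rewrite !mxE tnthS.
Qed.

Lemma X_cons_far0 n (s : measurableTypeR R) (t : tup R n) (r : R) :
  r < `|s : R| -> r < `|X (tuple_cons (s, t))|.
Proof.
move=> h; have [r0|r0] := leP 0 r; last by rewrite (lt_le_trans r0).
rewrite ltNge; apply: contraTN h => /norm_rV_leP h; rewrite -leNgt.
by have := h r0 ord0; rewrite !mxE tnth0.
Qed.

Lemma bb_slice n (F : tup R n.+1 -> R) (s : measurableTypeR R) :
  bb F -> bb (fun t => F (tuple_cons (s, t))).
Proof.
move=> [mF F0 [C [r [FC Fr]]]]; split=> //.
- exact: (measurableT_comp mF (measurable_cons_slice s)).
- by exists C, r; split => // t h; apply: Fr; exact: X_cons_far.
Qed.

Lemma lebesgue_segment_lty (r : R) :
  (@lebesgue_measure R (`[(- r)%R, r]%classic : set R) < +oo)%E.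
Proof. by rewrite lebesgue_measure_itv /=; case: ifP => // _; rewrite -?EFinD ltry. Qed.

Lemma bb_line n (F : tup R n.+1 -> R) (t : tup R n) : bb F ->
  (@lebesgue_measure R).-integrable setT (fun s : measurableTypeR R => (F (tuple_cons (s, t)))%:E).
Proof.
move=> [mF F0 [C [r [FC Fr]]]].
have mf : measurable_fun setT (fun s : measurableTypeR R => F (tuple_cons (s, t))).
  apply: (measurableT_comp mF); apply: measurable_cons => //; exact: measurable_id.
pose D : set (measurableTypeR R) := `[- r, r]%classic.
have mD : measurable D by exact: measurable_itv.
have -> : (fun s : measurableTypeR R => (F (tuple_cons (s, t)))%:E) =
    (fun s : measurableTypeR R => (F (tuple_cons (s, t)))%:E) \_ D.
  apply/funext => s; rewrite patchE; case: ifPn => //; rewrite notin_setE /D/= in_itv/= -ler_norml.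
  by move=> /negP; rewrite -ltNge => h; rewrite Fr//; exact: X_cons_far0.
apply/(integrable_mkcond _ mD); apply: measurable_bounded_integrable => //.
- exact: lebesgue_segment_lty.
- exact: measurable_funS mf.
- exists C; split; first exact: num_real.
  by move=> M CM x _ /=; rewrite ger0_norm// (le_trans (FC _))// ltW.
Qed.

Definition line_integral n (F : tup R n.+1 -> R) (t : tup R n) : R :=
  \int[@lebesgue_measure R]_s F (tuple_cons (s, t)).

Lemma line_integralE n (F : tup R n.+1 -> R) (t : tup R n) : bb F ->
  ((line_integral F t)%:E = \int[@lebesgue_measure R]_s (F (tuple_cons (s, t)))%:E)%E.
Proof.
by move=> bF; rewrite fineK//; exact: (integrable_fin_num measurableT (bb_line t bF)).
Qed.

Lemma bb_line_integral n (F : tup R n.+1 -> R) : bb F -> bb (line_integral F).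
Proof.
move=> bF; have [mF F0 [C [r [FC Fr]]]] := bF; split.
- apply/measurable_EFinP.
  have := @measurable_fun_fubini_tonelli_G _ _ _ _ R (@lebesgue_measure R)
    (fun z : measurableTypeR R * tup R n => (F (tuple_cons z))%:E).
  rewrite /fubini_G => h.
  have m1 : measurable_fun setT (fun z : measurableTypeR R * tup R n => (F (tuple_cons z))%:E).
    by apply/measurable_EFinP; apply: (measurableT_comp mF); exact: measurable_tuple_cons.
  have {h} := h m1 (fun z => ltac:(by rewrite lee_fin)).
  by apply: eq_measurable_fun => t _ /=; rewrite line_integralE.
- by move=> t; apply: Rintegral_ge0.
- exists (C * fine (@lebesgue_measure R `[- r, r]%classic)), r; split=> t; last first.
    move=> rt; rewrite /line_integral (@eq_Rintegral _ _ _ _ _ (fun=> 0)).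
      by rewrite Rintegral_cst// mul0r.
    by move=> s _; apply: Fr; exact: X_cons_far.
  rewrite -Rintegral_cst; last exact: measurable_itv.
  rewrite /line_integral Rintegral_mkcond [leRHS]Rintegral_mkcond /=.
  have mD : measurable (`[- r, r]%classic : set (measurableTypeR R)) by exact: measurable_itv.
  apply: le_Rintegral => //.
  + rewrite patch_setT; exact: bb_line.
  + rewrite -restrict_EFin; apply/(integrable_mkcond _ mD).
    apply: measurable_bounded_integrable => //.
    * exact: lebesgue_segment_lty.
    * exact: bounded_cst.
  + move=> s _; rewrite patch_setT patchE; case: ifPn => //; rewrite notin_setE /= in_itv/= -ler_norml.
    by move=> /negP; rewrite -ltNge => h; rewrite Fr//; exact: X_cons_far0.
Qed.

Lemma itup_line n (F : tup R n.+1 -> R) : bb F -> itup (line_integral F) = itup F.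
Proof.
move=> bF; have [mF F0 _] := bF; apply: EFin_inj; rewrite !itupE//; last exact: bb_line_integral.
rewrite ge0_integral_tupleS//; last exact/measurable_EFinP.
by apply: eq_integral => t _; rewrite line_integralE.
Qed.

(* Tonelli in the other order: integrating over the hyperplanes first. *)
Lemma itup_slice_le n (F G : tup R n.+1 -> R) (c : R) : bb F -> bb G -> 0 <= c ->
  (forall s : measurableTypeR R,
    itup (fun t => F (tuple_cons (s, t))) <= c * itup (fun t => G (tuple_cons (s, t)))) ->
  itup F <= c * itup G.
Proof.
move=> bF bG c0 h.
have swap (H : tup R n.+1 -> R) : bb H -> ((itup H)%:E =
    \int[@lebesgue_measure R]_s (itup (fun t => H (tuple_cons (s, t))))%:E)%E /\
    measurable_fun setT (fun s : measurableTypeR R => (itup (fun t => H (tuple_cons (s, t))))%:E).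
  move=> bH; have [mH H0 _] := bH.
  have m1 : measurable_fun setT (fun z : measurableTypeR R * tup R n => (H (tuple_cons z))%:E).
    by apply/measurable_EFinP; apply: (measurableT_comp mH); exact: measurable_tuple_cons.
  have p1 z : (0 <= (H (tuple_cons z))%:E)%E by rewrite lee_fin.
  have e s : (itup (fun t => H (tuple_cons (s, t))))%:E = (\int[@dx R n]_t (H (tuple_cons (s, t)))%:E)%E.
    by rewrite itupE//; exact: bb_slice.
  split; last first.
    have := @measurable_fun_fubini_tonelli_F _ _ _ _ R (@dx R n) _ m1 p1.
    by apply: eq_measurable_fun => s _; rewrite e.
  rewrite itupE// ge0_integral_tupleS//; last exact/measurable_EFinP.
  rewrite -(@fubini_tonelli _ _ _ _ R (@lebesgue_measure R) (@dx R n) _ m1 p1).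
  by apply: eq_integral => s _; rewrite e.
rewrite -lee_fin EFinM (swap F bF).1 (swap G bG).1 -ge0_integralZl_EFin//; last 2 first.
- by move=> s _; rewrite lee_fin; apply: itup_ge0; exact: bb_slice.
- exact: (swap G bG).2.
apply: ge0_le_integral => //.
- by move=> s _; rewrite lee_fin; apply: itup_ge0; exact: bb_slice.
- exact: (swap F bF).2.
- by apply: measurable_funeM; exact: (swap G bG).2.
- by move=> s _; rewrite -EFinM lee_fin.
Qed.

Definition upd n (t : tup R n) (i : 'I_n) (s : measurableTypeR R) : tup R n :=
  [tuple if j == i then s else tnth t j | j < n].

Lemma upd_cons0 n (t : tup R n) s0 s : upd (tuple_cons (s0, t)) ord0 s = tuple_cons (s, t).
Proof.
apply/eq_from_tnth => j; rewrite tnth_mktuple.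
by case: (unliftP ord0 j) => [k ->|->] /=; rewrite ?tnthS ?tnth0.
Qed.

Lemma upd_consS n (t : tup R n) s0 (i : 'I_n) s :
  upd (tuple_cons (s0, t)) (lift ord0 i) s = tuple_cons (s0, upd t i s).
Proof.
apply/eq_from_tnth => j; rewrite tnth_mktuple.
by case: (unliftP ord0 j) => [k ->|->] /=; rewrite ?tnthS ?tnth0 ?tnth_mktuple// (inj_eq lift_inj).
Qed.

(** The only trace of derivatives in Gagliardo's induction: for a test function the hypothesis comes
    from the fundamental theorem of calculus on each coordinate line. *)
Definition lines_dominate n (h f : tup R n -> R) :=
  forall i t, f t <= \int[@lebesgue_measure R]_s h (upd t i s).

(** The Sobolev conjugate of [1] in dimension [n.+1]. At [n = 0] the quotient is [0] by convention,
    so dimension one is treated apart. *)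
Definition gn_exponent n : R := n.+1%:R / n%:R.

Lemma gn_exponent_gt0 n : 0 < gn_exponent n.+1.
Proof. by rewrite divr_gt0. Qed.

Lemma gn_exponentE n : gn_exponent n.+1 = n.+1%:R^-1 + 1.
Proof.
by rewrite /gn_exponent -[n.+2%:R]natr1 mulrDl divff ?pnatr_eq0// mul1r addrC.
Qed.

(** The exponent is [1 + 1/(n+1)]. The fractional power of [f] is replaced by that of [w], Hoelder's
    inequality with exponents [n+1] and [(n+1)/n] separates the two factors, and the hypothesis on
    [f] turns the second one into [itup h]. *)
Lemma gagliardo_step n (f h w : tup R n.+1 -> R) : bb f -> bb h -> bb w ->
  (n = 0%N \/ itup (fun t => f t `^ gn_exponent n) <= itup h `^ gn_exponent n) ->
  lines_dominate h f -> (forall t, f t <= w t) ->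
  itup (fun t => f t `^ gn_exponent n.+1) <= itup w `^ (n.+1%:R^-1) * itup h.
Proof.
move=> bf bh bw IH hf fw; have [mf f0 _] := bf; have [mw w0 _] := bw; have [mh h0 _] := bh.
have hh0 := itup_ge0 bh; have ww0 := itup_ge0 bw.
have g0 := gn_exponent_gt0 n; have gE := gn_exponentE n.
have n0 : 0 < n.+1%:R^-1 :> R by rewrite invr_gt0.
have step1 : itup (fun t => f t `^ gn_exponent n.+1) <= itup (fun t => (w t `^ n.+1%:R^-1) * f t).
  apply: le_itup; first exact: bb_powR.
    by apply: bbM => //; exact: bb_powR.
  move=> t; rewrite gE powRD; last by apply/implyP; rewrite gt_eqF// -gE.
  rewrite powRr1// ler_wpM2r//; apply: ge0_ler_powR; rewrite ?nnegrE ?(ltW n0)//.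
apply: le_trans step1 _.
(* In dimension one the only line is the whole space, so [f] is bounded pointwise by [itup h]. *)
case: n => [|n] in f h w bf bh bw IH hf fw mf f0 mw w0 mh h0 hh0 ww0 g0 n0 gE *.
  rewrite invr1 powRr1//.
  have hE : forall t, f t <= itup h.
    move=> t; apply: le_trans (hf ord0 t) _; rewrite -(itup_line bh) /itup /=.
    rewrite -lee_fin -/(itup _) itupE; last exact: bb_line_integral.
    rewrite integral_dirac//; last by apply/measurable_EFinP; case: (bb_line_integral bh).
    rewrite diracT mul1e lee_fin /line_integral le_eqVlt; apply/orP; left; apply/eqP.
    apply: eq_Rintegral => s _; congr h; apply/eq_from_tnth => j.
    by rewrite tnth_mktuple !ord1 eqxx tnth0.
  apply: (@le_trans _ _ (itup (fun t => itup h * w t))).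
    apply: le_itup; [|exact: bbZ|].
      by under eq_fun do rewrite powRr1//; exact: bbM.
    by move=> t; rewrite powRr1// mulrC ler_wpM2r.
  by rewrite {1}/itup RintegralZl// 1?mulrC//; exact: bb_integrable.
case: IH => // IH.
have q0 : 0 < gn_exponent n.+1 by rewrite divr_gt0.
have pq : n.+2%:R^-1^-1^-1 + (gn_exponent n.+1)^-1 = 1.
  rewrite invrK /gn_exponent invf_div -[X in X + _]mul1r -mulrDl -natr1 addrC.
  by rewrite [_ + 1]addrC addrC natr1 addrC divff// ?pnatr_eq0.
have ninv : 0 < n.+2%:R^-1^-1 :> R by rewrite !invr_gt0.
have H := itup_hoelder (bb_powR n0 bw) bf ninv q0 pq.
apply: le_trans H _; rewrite invrK.
have -> : itup (fun t => w t `^ n.+2%:R^-1 `^ n.+2%:R) = itup w.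
  by congr itup; apply/funext => t; rewrite -powRrM mulVf ?powRr1// pnatr_eq0.
apply: ler_wpM2l; first exact: powR_ge0.
have H := @ge0_ler_powR _ (gn_exponent n.+1)^-1 _ _ _ _ _ IH.
apply: le_trans (H _ _ _) _; rewrite ?nnegrE ?powR_ge0// ?invr_ge0 ?(ltW q0)//.
  by apply: itup_ge0; exact: bb_powR.
by rewrite -powRrM mulfV ?powRr1// gt_eqF.
Qed.

(** On the hyperplane where the first coordinate is [s], [gagliardo_step] applies with [w] the line
    integral of [h] in the first direction. The integral of [w] is [itup h], whatever [s] is, so
    integrating over [s] adds the last exponent. *)
Lemma gagliardo n (f h : tup R n.+2 -> R) : bb f -> bb h -> lines_dominate h f ->
  itup (fun t => f t `^ gn_exponent n.+1) <= itup h `^ gn_exponent n.+1.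
Proof.
have step m (f' h' : tup R m.+2 -> R) : bb f' -> bb h' -> lines_dominate h' f' ->
  (forall s : measurableTypeR R, m = 0%N \/ itup (fun t => f' (tuple_cons (s, t)) `^ gn_exponent m) <=
    itup (fun t => h' (tuple_cons (s, t))) `^ gn_exponent m) ->
  itup (fun t => f' t `^ gn_exponent m.+1) <= itup h' `^ gn_exponent m.+1.
  move=> bf bh hf IH; have hh0 := itup_ge0 bh.
  have -> : itup h' `^ gn_exponent m.+1 = itup h' `^ m.+1%:R^-1 * itup h'.
    rewrite gn_exponentE powRD ?powRr1//; apply/implyP.
    by rewrite gt_eqF// -gn_exponentE gn_exponent_gt0.
  apply: (itup_slice_le (bb_powR (gn_exponent_gt0 m) bf) bh (powR_ge0 _ _)) => s.
  rewrite -(itup_line bh).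
  apply: gagliardo_step => //; [exact: bb_slice|exact: bb_slice|exact: bb_line_integral| |].
  - move=> i t; have := hf (lift ord0 i) (tuple_cons (s, t)).
    by under eq_Rintegral do rewrite upd_consS.
  - move=> t; have := hf ord0 (tuple_cons (s, t)).
    by under eq_Rintegral do rewrite upd_cons0.
elim: n f h => [|n IH] f h bf bh hf; apply: step => // s; first by left.
right; apply: IH; [exact: bb_slice|exact: bb_slice|].
move=> i t; have := hf (lift ord0 i) (tuple_cons (s, t)).
by under eq_Rintegral do rewrite upd_consS.
Qed.

End bounded_bounded_support.

Section norm_powers.
Context {R : realType}.

Lemma continuous_norm_powR (d : R) : 0 < d -> continuous (fun y : R => `|y| `^ d).
Proof.
move=> d0 y; have [->|y0] := eqVneq y 0.
  rewrite /continuous_at normr0 powR0 ?gt_eqF//; apply/cvgrPdist_le => e e0.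
  have e1 : 0 < e `^ d^-1 by rewrite powR_gt0.
  apply/nbhs_ballP; exists (e `^ d^-1) => //= z; rewrite /ball_ /= !sub0r !normrN => /ltW ze.
  rewrite ger0_norm ?powR_ge0//.
  rewrite -[leRHS](powRr1 (ltW e0)) -(mulVf (lt0r_neq0 d0)) powRrM.
  by apply: ge0_ler_powR; rewrite ?nnegrE ?powR_ge0 ?(ltW d0).
have H : {for `|y|, continuous (fun z : R => z `^ d)}.
  apply: differentiable_continuous; apply/derivable1_diffP.
  by apply: derivable_powR; rewrite in_itv/= andbT normr_gt0.
exact: (continuous_comp (@norm_continuous _ _ y) H).
Qed.

(** With [2 < g] the factor [|y|^(g - 2)] is continuous at [0], so the derivative is continuous, as
    the fundamental theorem of calculus will require. *)
Lemma is_derive_norm_powR (g y : R) : 2 < g ->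
  is_derive y 1 (fun y : R => `|y| `^ g) (g * (y * `|y| `^ (g - 2))).
Proof.
move=> g2; have g0 : 0 < g by lra.
have dp (x : R) : 0 < x -> is_derive x 1 (fun z : R => z `^ g) (g * (x * x `^ (g - 2))).
  move=> x0; have xi : x \in `]0, +oo[%R by rewrite in_itv/= andbT.
  apply: DeriveDef; first exact: derivable_powR.
  rewrite -derive1E powR_derive1//; congr (_ * _).
  rewrite (_ : g - 2 = g - 1 - 1); last by ring.
  by rewrite mulr_powRB1 ?ltW//; lra.
have [y0|y0|->] := ltgtP y 0.
- have := @is_derive1_comp R (fun z : R => z `^ g) (fun z : R => - z) y _ _ (dp (- y) _) _.
  rewrite oppr_gt0 => /(_ _ y0 (is_deriveNid _ _)).
  rewrite ltr0_norm// => h.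
  apply: (@near_eq_is_derive _ _ _ ((fun z : R => z `^ g) \o (fun z : R => - z))).
    by near=> z; rewrite /= ltr0_norm//; near: z; exact: lt_nbhsl.
  by apply: is_derive_eq; ring.
- rewrite gtr0_norm//; apply: (@near_eq_is_derive _ _ _ (fun z : R => z `^ g)); last exact: dp.
  by near=> z; rewrite gtr0_norm//; near: z; exact: lt_nbhsr.
- rewrite mul0r mulr0.
  have cv : (fun h : R => h^-1 *: (`|h + 0| `^ g - `|0 : R| `^ g)) @ (0 : R)^' --> (0 : R).
    apply/cvgrPdist_le => e e0.
    have c := @continuous_norm_powR (g - 1) ltac:(lra) 0.
    move: c; rewrite /continuous_at normr0 powR0; last by rewrite gt_eqF//; lra.
    move=> /cvgrPdist_le /(_ e e0) c.
    near=> h; have hn0 : h != 0 by near: h; exact: nbhs_dnbhs_neq.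
    rewrite addr0 powR0 ?gt_eqF// subr0 sub0r normrN normrZ normfV.
    rewrite (ger0_norm (powR_ge0 _ _)) ler_pdivrMl ?normr_gt0//.
    rewrite -(mulr_powRB1 (normr_ge0 h) g0) ler_pM2l ?normr_gt0//.
    have : `|0 - `|h| `^ (g - 1)| <= e by near: h; apply: nbhs_dnbhs.
    by rewrite sub0r normrN ger0_norm ?powR_ge0.
  apply: DeriveDef.
    by apply/cvg_ex; exists 0; under eq_fun do rewrite [_%:A]mulr1.
  rewrite /derive; under eq_fun do rewrite [_%:A]mulr1.
  exact/cvg_lim.
Unshelve. all: by end_near. Qed.

(** The sum is at most [#|I|] times its largest term, whose power is one of the summands on the
    right. *)
Lemma powR_sum_le (I : finType) (a : I -> R) (q : R) : 0 < q -> (forall i, 0 <= a i) ->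
  (\sum_i a i) `^ q <= #|I|%:R `^ q * \sum_i a i `^ q.
Proof.
move=> q0 a0; have [i0 _|I0] := pickP (fun _ : I => true); last first.
  by rewrite [in leLHS]big_pred0 ?powR0 ?gt_eqF ?mulr_ge0 ?powR_ge0// sumr_ge0// => i _; exact: powR_ge0.
pose j := [arg max_(j > i0) a j]%O.
have hj i : a i <= a j by rewrite /j; case: arg_maxP => // k _ h; exact: h.
apply: (@le_trans _ _ ((#|I|%:R * a j) `^ q)).
  apply: ge0_ler_powR; rewrite ?nnegrE ?sumr_ge0 ?mulr_ge0 ?(ltW q0)//.
  apply: le_trans (ler_sum _ (fun i _ => hj i)) _.
  by rewrite mulr_natl sumr_const lexx.
rewrite powRM// ler_wpM2l ?powR_ge0// (bigD1 j)//= lerDl sumr_ge0// => i _.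
exact: powR_ge0.
Qed.

End norm_powers.

Section powers_of_compactly_supported.
Context {R : realType} {n : nat}.

Lemma bb_cc (f : 'rV[R]_n -> R) : cc f -> (forall x, 0 <= f x) -> bb (f \o X).
Proof.
move=> cf f0; have [C _ hC] := cc_bounded cf; case: cf => cf [r hr]; split.
- exact: continuous_measurable_rV.
- by move=> t; exact: f0.
- exists C, r; split; first by move=> t; exact: le_trans (ler_norm _) (hC _).
  by move=> t /ltW /hr.
Qed.

Lemma cc_norm_powR (f : 'rV[R]_n -> R) (d : R) : 0 < d -> cc f -> cc (fun x => `|f x| `^ d).
Proof.
move=> d0 cf; apply: (@cc_comp _ _ (fun y : R => `|y| `^ d)) => //.
  exact: continuous_norm_powR.
by rewrite normr0 powR0// gt_eqF.
Qed.

Lemma cc_norm (f : 'rV[R]_n -> R) : cc f -> cc (fun x => `|f x|).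
Proof.
by move=> cf; apply: (@cc_comp _ _ (fun y : R => `|y|)) => //; [exact: norm_continuous|exact: normr0].
Qed.

End powers_of_compactly_supported.

(** * The Sobolev inequality for test functions *)

Section sobolev_inequality.
Context {R : realType} {n : nat}.
Local Notation n2 := n.+2.
Implicit Types v : 'rV[R]_n2 -> R.

(* The fundamental theorem of calculus along coordinate lines. *)
Lemma lines_dominate_test v (g : R) : 2 < g -> test v ->
  lines_dominate
    ((fun x => g * (`|v x| `^ (g - 1) * \sum_i `|pderiv i v x|)) \o @rV_of_tuple R n2)
    ((fun x => `|v x| `^ g) \o @rV_of_tuple R n2).
Proof.
move=> g2 tv i t; have [sv _] := tv; have cv := smooth_continuous sv.
pose x : 'rV[R]_n2 := X t; pose e : 'rV[R]_n2 := delta_mx ord0 i.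
pose y := x - x ord0 i *: e.
pose h x' := g * (`|v x'| `^ (g - 1) * \sum_i `|pderiv i v x'|).
have LE (s : R) : X (upd t i s) = s *: e + y.
  apply/rowP => j; rewrite !mxE tnth_mktuple eqxx /=; case: eqP => [->|ji].
    by rewrite !mulr1 subrr addr0.
  by rewrite !mulr0 add0r subr0.
have Lx : x = x ord0 i *: e + y by rewrite /y addrC subrK.
have cL : continuous (fun s : R => s *: e + y).
  by move=> s; apply: cvgD; [apply: cvgZl; exact: cvg_id|exact: cvg_cst].
have cch : cc h.
  apply: ccZ; apply: cc_mulr; first by apply: cc_norm_powR; [lra|exact: test_cc].
  have : cc (fun x => \sum_i `|pderiv i v x|).
    by apply: cc_sum => j _; apply: cc_norm; apply: test_cc; exact: test_partial.
  by case.
have h0 z : 0 <= h z by rewrite mulr_ge0 ?mulr_ge0 ?powR_ge0 ?sumr_ge0//; lra.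
have [chc [r hr]] := cch.
have ch : continuous (fun s : R => h (s *: e + y)) by exact: continuous_compose cL chc.
have ns s : `|s| <= `|s *: e + y|.
  have /norm_rV_leP := lexx `|s *: e + y|; move=> /(_ (normr_ge0 _) i).
  by rewrite -LE mxE tnth_mktuple eqxx.
have hint : (@lebesgue_measure R).-integrable setT (fun s : R => (h (s *: e + y))%:E).
  have -> : (fun s : R => (h (s *: e + y))%:E) = (EFin \o (fun s => h (s *: e + y))) \_ `[- r, r].
    apply/funext => s; rewrite patchE; case: ifPn => //; rewrite notin_setE /= in_itv/= -ler_norml.
    move=> /negP; rewrite -ltNge => rs; rewrite hr//; exact: le_trans (ltW rs) (ns s).
  have mD : measurable (`[- r, r]%classic : set (measurableTypeR R)) by exact: measurable_itv.
  apply/(integrable_mkcond _ mD).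
  apply: continuous_compact_integrable; first exact: segment_compact.
  exact: continuous_subspaceT.
rewrite -lee_fin /= -/x.
have -> : ((\int[@lebesgue_measure R]_s h (X (upd t i s)))%:E =
    \int[@lebesgue_measure R]_s (h (s *: e + y))%:E)%E.
  under eq_Rintegral do rewrite LE.
  by rewrite fineK//; exact: (integrable_fin_num measurableT hint).
have [_ [r' hr']] := test_cc tv.
(* [a] lies to the left of [b] and far enough for [v] to vanish there, so the integral of the
   derivative from [a] to [b] is [G b] itself. *)
pose b := x ord0 i; pose a := - (`|r'| + 1 + `|b|).
have ab : a < b.
  rewrite /a ltrNl; apply: le_lt_trans (ler_norm _) _; rewrite normrN.
  by rewrite ltrDr; exact: ltr_wpDl.
pose G s := `|v (s *: e + y)| `^ g.
pose G' s := g * (v (s *: e + y) * `|v (s *: e + y)| `^ (g - 2)) * pderiv i v (s *: e + y).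
have dG (s : R) : is_derive s 1 G (G' s).
  have dl := @is_derive_line R n2 v y i s (smooth_on_diff sv I).
  exact: (@is_derive1_comp R (fun z => `|z| `^ g) (fun s => v (s *: e + y)) s _ _ (is_derive_norm_powR _ g2) dl).
have cG s : {for s, continuous G}.
  by apply: differentiable_continuous; apply/derivable1_diffP; have [] := dG s.
have cG' : continuous G'.
  have c1 : continuous (fun s : R => v (s *: e + y)) by exact: continuous_compose cL cv.
  have c2 : continuous (fun s : R => pderiv i v (s *: e + y)).
    exact: (continuous_compose cL (smooth_continuous (smooth_on_partial i sv))).
  have c3 : continuous (fun s : R => `|v (s *: e + y)| `^ (g - 2)).
    have g20 : 0 < g - 2 by lra.
    exact: (continuous_compose c1 (continuous_norm_powR g20)).
  move=> s; apply: cvgM; last exact: c2.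
  by apply: cvgM; [exact: cvg_cst|apply: cvgM; [exact: c1|exact: c3]].
have ftc : (\int[@lebesgue_measure R]_(s in `[a, b]) (G' s)%:E = (G b)%:E - (G a)%:E)%E.
  apply: continuous_FTC2 => //.
  - exact: continuous_subspaceT.
  - split; [by move=> s _; have [] := dG s|apply: cvg_at_right_filter; exact: cG|
      apply: cvg_at_left_filter; exact: cG].
  - by move=> s _; rewrite derive1E; exact: (@derive_val _ _ _ _ _ _ _ (dG s)).
have Ga : G a = 0.
  rewrite /G hr' ?normr0 ?powR0 ?gt_eqF//; first by lra.
  apply: le_trans (ns a); rewrite /a normrN ger0_norm ?addr_ge0//.
  by apply: le_trans (ler_norm r') _; rewrite -addrA lerDl addr_ge0.
move: ftc; rewrite Ga sube0 => ftc.
rewrite [in leLHS]Lx -/b -/(G b) -ftc.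
have G'h s : G' s <= h (s *: e + y).
  apply: le_trans (ler_norm _) _; rewrite /G' /h !normrM (ger0_norm (powR_ge0 _ _)).
  rewrite gtr0_norm; last by lra.
  rewrite -mulrA ler_pM2l; last by lra.
  rewrite -(@mulr_powRB1 _ _ (g - 1) (normr_ge0 _)); last by lra.
  rewrite (_ : g - 1 - 1 = g - 2); last by ring.
  rewrite ler_wpM2l ?mulr_ge0 ?powR_ge0//.
  by rewrite (bigD1 i)//= lerDl sumr_ge0.
apply: (@le_trans _ _ (\int[@lebesgue_measure R]_(s in `[a, b]) (h (s *: e + y))%:E)%E).
  have iG' : (@lebesgue_measure R).-integrable `[a, b] (EFin \o G').
    by apply: continuous_compact_integrable; [exact: segment_compact|exact: continuous_subspaceT].
  apply: le_integral => //; first exact: integrableS hint.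
  by move=> s _; rewrite lee_fin.
apply: ge0_subset_integral => //.
- by case/integrableP: hint.
- by move=> s _; rewrite lee_fin.
Qed.

Local Notation N := (n2%:R : R).

(** In dimension [M], with [g = p(M-1)/(M-p)] and [q = Mp/(M-p)]: [g] times Gagliardo's exponent is
    [q], [g - 1] times the Hoelder conjugate of [p] is again [q], and the last identity says which
    power of the [L^q] integral survives cancellation. *)
Lemma gns_exponents (M p : R) : 2 <= p -> p < M ->
  [/\ p * (M - 1) / (M - p) * (M / (M - 1)) = M * p / (M - p),
    (p * (M - 1) / (M - p) - 1) * (p / (p - 1)) = M * p / (M - p) &
    (M / (M - 1))^-1 = (p / (p - 1))^-1 + (M * p / (M - p))^-1].
Proof.
move=> p2 pM; have ? : M - p != 0 by rewrite gt_eqF//; lra.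
have ? : M - 1 != 0 by rewrite gt_eqF//; lra.
have ? : p - 1 != 0 by rewrite gt_eqF//; lra.
have ? : p != 0 by rewrite gt_eqF//; lra.
have ? : M != 0 by rewrite gt_eqF//; lra.
by split; field; do ?[apply/andP; split].
Qed.

(** Gagliardo's inequality for [|v|^g], followed by Hoelder for the product of [|v|^(g-1)] and the
    gradient. The value of [g] makes the same integral [A] of [|v|^q] appear on both sides, and a
    power of it cancels. The condition [2 <= p] yields [2 < g]. *)
Lemma gns (p q : R) v : 2 <= p -> p < N -> test v -> q = N * p / (N - p) ->
  integral_rV (fun x => `|v x| `^ q) `^ q^-1 <=
  p * (N - 1) / (N - p) *
    integral_rV (fun x => (\sum_i `|pderiv i v x|) `^ p) `^ p^-1.
Proof.
move=> p2 pN tv qE; set g := p * (N - 1) / (N - p).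
have N1 : N - 1 = n.+1%:R by rewrite -natr1 addrK.
have N10 : 0 < N - 1 by rewrite N1.
have Np : 0 < N - p by rewrite subr_gt0.
have N0 : 0 < N by [].
have p0 : 0 < p by lra.
have [e1 e2 e3] := gns_exponents p2 pN.
have g2 : 2 < g by rewrite /g ltr_pdivlMr//; nra.
have q0 : 0 < q by rewrite qE divr_gt0// mulr_gt0.
have gnE : gn_exponent n.+1 = N / (N - 1) by rewrite N1.
have gn0 := @gn_exponent_gt0 R n.
have cv := test_cc tv.
pose G x := \sum_i `|pderiv i v x|.
have ccG : cc G by apply: cc_sum => j _; apply: cc_norm; apply: test_cc; exact: test_partial.
have G0 x : 0 <= G x by apply: sumr_ge0.
have bG : bb (G \o @rV_of_tuple R n2) by exact: bb_cc.
have bv d : 0 < d -> bb ((fun x => `|v x| `^ d) \o @rV_of_tuple R n2).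
  by move=> d0; apply: bb_cc => [|x]; [exact: cc_norm_powR|exact: powR_ge0].
have g10 : 0 < g - 1 by lra.
have bvG : bb ((fun x => `|v x| `^ (g - 1) * G x) \o @rV_of_tuple R n2).
  by apply: (bbM (bv _ g10) bG).
have g0 : 0 <= g by lra.
have := gagliardo (bv g ltac:(lra)) (bbZ g0 bvG) (lines_dominate_test g2 tv).
have -> : itup (fun t => ((fun x => `|v x| `^ g) \o @rV_of_tuple R n2) t `^ gn_exponent n.+1) =
    integral_rV (fun x => `|v x| `^ q).
  congr itup; apply/funext => t /=; rewrite -powRrM; congr (_ `^ _).
  by rewrite gnE /g qE.
set A := integral_rV _; set B := integral_rV _.
have A0 : 0 <= A by apply: integral_rV_ge0 => x; exact: powR_ge0.
have B0 : 0 <= B by apply: integral_rV_ge0 => x; exact: powR_ge0.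
have p1 : 0 < p / (p - 1) by rewrite divr_gt0//; lra.
have hld : itup ((fun x => `|v x| `^ (g - 1) * G x) \o @rV_of_tuple R n2) <=
    A `^ (p / (p - 1))^-1 * B `^ p^-1.
  have pq : (p / (p - 1))^-1 + p^-1 = 1 by field; rewrite !gt_eqF//; lra.
  have H := itup_hoelder (bv _ g10) bG p1 p0 pq.
  have eA : itup (fun t => ((fun x => `|v x| `^ (g - 1)) \o @rV_of_tuple R n2) t `^ (p / (p - 1))) = A.
    apply: (congr1 (@itup R n2)); apply/funext => t /=.
    by rewrite -powRrM /g e2 qE.
  by rewrite eA in H; exact: H.
rewrite /= => gag.
have {}gag : A <= (g * (A `^ (p / (p - 1))^-1 * B `^ p^-1)) `^ gn_exponent n.+1.
  apply: le_trans gag _; apply: ge0_ler_powR; rewrite ?nnegrE ?(ltW gn0)//.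
  - by apply: itup_ge0; exact: bbZ.
  - by apply: mulr_ge0 => //; apply: mulr_ge0; exact: powR_ge0.
  rewrite {1}/itup RintegralZl//; last exact: bb_integrable.
  by rewrite ler_wpM2l.
have [A00|An0] := eqVneq A 0.
  have qn0 : q^-1 != 0 by rewrite invr_eq0 gt_eqF.
  by rewrite A00 (powR0 qn0); apply: mulr_ge0 => //; exact: powR_ge0.
have Ap : 0 < A by rewrite lt0r An0.
have {}gag : A `^ (gn_exponent n.+1)^-1 <= g * (A `^ (p / (p - 1))^-1 * B `^ p^-1).
  have gi : 0 <= (gn_exponent n.+1 : R)^-1 by rewrite invr_ge0 ltW.
  have := ge0_ler_powR gi _ _ gag; rewrite !nnegrE powR_ge0 A0 => /(_ isT isT).
  by rewrite -powRrM mulfV ?gt_eqF// powRr1//; apply: mulr_ge0 => //; apply: mulr_ge0; exact: powR_ge0.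
have e : (gn_exponent n.+1)^-1 = (p / (p - 1))^-1 + q^-1.
  by rewrite gnE qE.
move: gag; rewrite e powRD; last by rewrite An0 implybT.
by rewrite mulrCA ler_pM2l// powR_gt0.
Qed.

(** Raising the order by one replaces the critical exponent by its Sobolev conjugate; the remaining
    bounds are the hypotheses of [gns]. *)
Lemma critical_exponentS k : (2 * k.+1 < n2)%N ->
  critical_exponent R n2 k.+1 = N * critical_exponent R n2 k / (N - critical_exponent R n2 k) /\
  [/\ 2 <= critical_exponent R n2 k, critical_exponent R n2 k < N &
    0 < critical_exponent R n2 k.+1].
Proof.
move=> h; rewrite /critical_exponent !natrM -[k.+1%:R]natr1.
have hk : 2 * (k%:R + 1) < N.
  have : (2 * k.+1)%:R < N :> R by rewrite ltr_nat.
  by rewrite natrM -[k.+1%:R]natr1.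
have k0 : 0 <= k%:R :> R by [].
move: (k%:R : R) hk k0 => K hk k0; move: (n2%:R : R) hk => M hk.
have d1 : 0 < M - 2 * K by lra.
have d2 : 0 < M - 2 * (K + 1) by lra.
have M0 : 0 < M by lra.
split; first by field; rewrite !gt_eqF//; nra.
split.
- by rewrite ler_pdivlMr//; lra.
- by rewrite ltr_pdivrMr//; nra.
- by rewrite divr_gt0//; lra.
Qed.

(** Order [0] has exponent [2] and is an equality. The step applies [gns] at the exponent of order
    [k], then the induction hypothesis to each first derivative. *)
Lemma sobolev_test k : (2 * k < n2)%N -> exists2 C : R, 0 <= C & forall v, test v ->
  integral_rV (fun x => `|v x| `^ critical_exponent R n2 k) `^ (2 / critical_exponent R n2 k)
   <= C * integral_rV (Dsq k v).
Proof.
elim: k => [|k IH] hk.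
  exists 1 => // v tv; rewrite mul1r.
  have -> : critical_exponent R n2 0 = 2.
    by rewrite /critical_exponent muln0 subr0 natrM mulfK// pnatr_eq0.
  rewrite divff// powRr1; last by apply: integral_rV_ge0 => x; exact: powR_ge0.
  rewrite le_eqVlt; apply/orP; left; apply/eqP; congr integral_rV; apply/funext => x.
  by rewrite powR_mulrn// real_normK// num_real.
have [|C C0 hC] := IH; first by apply: leq_ltn_trans hk; rewrite leq_mul2l leqnSn orbT.
have [qE [p2 pN q0]] := critical_exponentS hk.
set p := critical_exponent R n2 k in hC p2 pN qE *.
set q := critical_exponent R n2 k.+1 in qE q0 *.
pose g := p * (N - 1) / (N - p).
exists (g ^+ 2 * (N ^+ 2 * (N `^ (2 / p) * C))).
  apply: mulr_ge0; first exact: sqr_ge0.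
  by apply: mulr_ge0; [exact: sqr_ge0|rewrite mulr_ge0 ?powR_ge0].
move=> v tv; have p0 : 0 < p by lra.
have p20 : 0 < 2 / p by rewrite divr_gt0.
have td i := test_partial i tv.
pose a i := integral_rV (fun x => `|pderiv i v x| `^ p).
have a0 i : 0 <= a i by apply: integral_rV_ge0 => x; exact: powR_ge0.
set A := integral_rV _; have A0 : 0 <= A by apply: integral_rV_ge0 => x; exact: powR_ge0.
pose B := integral_rV (fun x => (\sum_i `|pderiv i v x|) `^ p).
have B0 : 0 <= B by apply: integral_rV_ge0 => x; exact: powR_ge0.
have h1 : A `^ q^-1 <= g * B `^ p^-1 by apply: gns.
have hB : B <= N `^ p * \sum_i a i.
  rewrite /a -integral_rV_sum => [|i _]; last by apply: cc_norm_powR => //; exact: test_cc.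
  rewrite -integral_rVZ; last first.
    by apply: cc_sum => i _; apply: cc_norm_powR => //; exact: test_cc.
  apply: le_integral_rV.
  - have cs : cc (fun x => \sum_i `|pderiv i v x|) by apply: cc_sum => i _; apply: cc_norm; exact: test_cc.
    have := cc_norm_powR p0 cs.
    by under eq_fun do rewrite (ger0_norm (sumr_ge0 _ (fun i _ => normr_ge0 _))).
  - by apply: ccZ; apply: cc_sum => i _; apply: cc_norm_powR => //; exact: test_cc.
  - move=> x; have := @powR_sum_le R 'I_n2 (fun i => `|pderiv i v x|) p p0 (fun i => normr_ge0 _).
    by rewrite card_ord.
have sq (c d : R) : 0 <= c -> c `^ (2 * d) = (c `^ d) ^+ 2.
  by move=> c0; rewrite mulrC powRrM powR_mulrn// powR_ge0.
rewrite sq// -mulrA.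
apply: (@le_trans _ _ ((g * B `^ p^-1) ^+ 2)).
  rewrite ler_pXn2r// nnegrE ?powR_ge0//; exact: le_trans (powR_ge0 _ _) h1.
rewrite exprMn ler_wpM2l ?sqr_ge0// -sq//.
apply: (@le_trans _ _ ((N `^ p * \sum_i a i) `^ (2 / p))).
  have r0 : 0 <= N `^ p * \sum_i a i.
    by apply: mulr_ge0; [exact: powR_ge0|apply: sumr_ge0 => i _; exact: a0].
  by apply: ge0_ler_powR; rewrite ?nnegrE// ltW.
rewrite powRM; last 2 first.
- exact: powR_ge0.
- by apply: sumr_ge0 => i _; exact: a0.
have -> : (N `^ p) `^ (2 / p) = N ^+ 2.
  by rewrite -powRrM mulrC divfK ?gt_eqF// powR_mulrn.
rewrite -mulrA ler_wpM2l ?sqr_ge0//.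
have := @powR_sum_le R 'I_n2 a (2 / p) p20 a0; rewrite card_ord => /le_trans; apply.
rewrite -mulrA ler_wpM2l ?powR_ge0//= integral_rV_sum => [|i _]; last by apply: test_cc; exact: test_Dsq.
by rewrite mulr_sumr; apply: ler_sum => i _; exact: hC.
Qed.

End sobolev_inequality.

(** * The Euclidean constant *)

Section limits_in_Lp.
Context {R : realType} d (T : measurableType d) (mu : {measure set T -> \bar R}).
Variable p : R.
Hypothesis p1 : 1 <= p.

Lemma LnormE (f : T -> R) :
  ('N[mu]_p%:E[EFin \o f] = (\int[mu]_t (`|f t| `^ p)%:E) `^ p^-1)%E.
Proof. by rewrite unlock /=; congr (_ `^ _)%E; apply: eq_integral => t _; rewrite poweR_EFin. Qed.

Lemma Lnorm_le_near (f_ : nat -> T -> R) (f : T -> R) :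
  (\int[mu]_t (`|f_ i t - f t| `^ p)%:E)%E @[i --> \oo] --> 0%E ->
  forall e : R, 0 < e -> \forall i \near \oo, ('N[mu]_p%:E[EFin \o (fun t => f_ i t - f t)%R] <= e%:E)%E.
Proof.
move=> h e e0; have p0 : 0 < p := lt_le_trans ltr01 p1.
have ep : (0%E < (e `^ p)%:E :> \bar R)%E by rewrite lte_fin powR_gt0.
have : \forall i \near \oo, (\int[mu]_t (`|f_ i t - f t| `^ p)%:E < (e `^ p)%:E)%E.
  exact: h (open_ereal_lt' ep).
apply: filterS => i hi; rewrite LnormE.
have -> : e%:E = ((e `^ p)%:E `^ p^-1)%E.
  by rewrite poweR_EFin -powRrM mulfV ?gt_eqF// powRr1// ltW.
apply: gt0_ler_poweR; rewrite ?invr_ge0 ?(ltW p0)// ?in_itv/= ?andbT ?leey ?andbT.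
- by apply: integral_ge0 => t _; rewrite lee_fin powR_ge0.
- by rewrite lee_fin powR_ge0.
- exact: ltW.
Qed.

(** By Minkowski, since [f] is [f_ i] minus a difference of small norm; the norm of [f] is not
    assumed finite. *)
Lemma Lnorm_cvg_le (f_ : nat -> T -> R) (f : T -> R) (c : nat -> R) (l : R) :
  (forall i, measurable_fun setT (f_ i)) -> measurable_fun setT f ->
  (\int[mu]_t (`|f_ i t - f t| `^ p)%:E)%E @[i --> \oo] --> 0%E ->
  (forall i, ('N[mu]_p%:E[EFin \o f_ i] <= (c i)%:E)%E) -> c @ \oo --> l ->
  ('N[mu]_p%:E[EFin \o f] <= l%:E)%E.
Proof.
move=> mf_ mf h hc cl; apply/lee_addgt0Pr => e e0.
have e2 : 0 < e / 2 by rewrite divr_gt0.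
have [i [h1 h2]] : exists i, ('N[mu]_p%:E[EFin \o (fun t => f_ i t - f t)%R] <= (e / 2)%:E)%E /\ c i < l + e / 2.
  apply: (@filter_ex _ (nbhs \oo)); apply: filterI; first exact: Lnorm_le_near.
  by apply: (cvgr_lt _ cl); rewrite ltrDl.
have mN : measurable_fun setT (fun t => - (f_ i t - f t)).
  by apply: measurableT_comp => //; exact: measurable_funB.
have := minkowski_EFin mu (mf_ i) mN p1.
have -> : EFin \o (f_ i \+ (fun t => - (f_ i t - f t))) = EFin \o f.
  by apply/funext => t /=; congr EFin; ring.
have -> : EFin \o (fun t => - (f_ i t - f t)) = (\- (EFin \o (fun t => f_ i t - f t)%R))%E by [].
rewrite oppe_Lnorm => /le_trans; apply.
apply: (@le_trans _ _ ((c i)%:E + (e / 2)%:E)%E); first exact: leeD.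
by rewrite -!EFinD lee_fin; lra.
Qed.

End limits_in_Lp.

Section cauchy_energies.
Context {R : realType}.

(** Takes the place of the triangle inequality for energies: it passes termwise to sums of squares
    and to integrals, and its loss on the first term is arbitrarily small. *)
Lemma sqD_le (e a b : R) : 0 < e -> (a + b) ^+ 2 <= (1 + e) * a ^+ 2 + (1 + e^-1) * b ^+ 2.
Proof.
move=> e0; rewrite -subr_ge0.
have -> : (1 + e) * a ^+ 2 + (1 + e^-1) * b ^+ 2 - (a + b) ^+ 2 = e^-1 * (e * a - b) ^+ 2.
  by field; rewrite gt_eqF.
by rewrite mulr_ge0 ?sqr_ge0// invr_ge0 ltW.
Qed.

(** [q i] stands for a squared seminorm and [d i j] for the squared seminorm of a difference. Only
    an inequality of the type of [sqD_le] is assumed, so the Euclidean and the Riemannian energies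
    are both covered. *)
Lemma cauchy_energies_cvg (q : nat -> R) (d : nat -> nat -> R) :
  (forall i, 0 <= q i) -> (forall i j, 0 <= d i j) ->
  (forall i j (e : R), 0 < e -> q i <= (1 + e) * q j + (1 + e^-1) * d i j) ->
  (forall e, 0 < e -> exists N, forall i j, (N <= i)%N -> (N <= j)%N -> d i j < e) -> cvgn q.
Proof.
move=> q0 d0 h hd; have [N hN] := hd 1 ltr01.
pose B := 2 * q N + 2 + 1.
have B0 : 0 < B by have := q0 N; rewrite /B; lra.
have qB i : (N <= i)%N -> q i <= B.
  by move=> Ni; have := h i N 1 ltr01; have := hN i N Ni (leqnn _); rewrite /B invr1; lra.
apply: cauchy_cvg; apply: cauchy_exP => e e0.
(* With this slack the excess [s * q j] is at most [e / 2]; [c] then makes the contribution of [d]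
   less than [e / 2]. *)
pose s := e / (2 * B).
have s0 : 0 < s by rewrite divr_gt0// mulr_gt0.
pose c := e / 2 / (1 + s^-1).
have c0 : 0 < 1 + s^-1 by rewrite addr_gt0// invr_gt0.
have cc0 : 0 < c by rewrite !divr_gt0.
have [N' hN'] := hd c cc0.
have close i j : (N <= i)%N -> (N <= j)%N -> (N' <= i)%N -> (N' <= j)%N -> q i < q j + e.
  move=> Ni Nj Ni' Nj'; apply: le_lt_trans (h i j s s0) _.
  have h1 : s * q j <= e / 2.
    apply: (@le_trans _ _ (s * B)); first by rewrite ler_pM2l// qB.
    by rewrite le_eqVlt; apply/orP; left; apply/eqP; rewrite /s; field; rewrite gt_eqF.
  have h2 : (1 + s^-1) * d i j < e / 2.
    have -> : e / 2 = (1 + s^-1) * c by rewrite [RHS]mulrC /c divfK// gt_eqF.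
    by rewrite ltr_pM2l//; exact: hN'.
  lra.
exists (q (maxn N N')).
change (\forall i \near \oo, ball (q (maxn N N')) e (q i)).
near=> i; rewrite /ball/= ltr_distlC.
have Ni : (N <= i)%N by near: i; exact: nbhs_infty_ge.
have Ni' : (N' <= i)%N by near: i; exact: nbhs_infty_ge.
have h1 := @close i (maxn N N') Ni (leq_maxl _ _) Ni' (leq_maxr _ _).
have h2 := @close (maxn N N') i (leq_maxl _ _) Ni (leq_maxr _ _) Ni'.
by apply/andP; split; lra.
Unshelve. all: by end_near. Qed.

End cauchy_energies.

Section positive_integrals.
Context {R : realType}.

(** The indicator of the box is written as a product so that induction on the dimension can split
    off one factor. *)
Lemma integral_box n (y : 'I_n -> R) (r : R) : 0 <= r ->
  (\int[@dx R n]_t (\prod_i (`|tnth t i - y i| <= r)%R%:R)%:E = ((2 * r) ^+ n)%:E)%E.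
Proof.
move=> r0; elim: n y => [|n IH] y.
  under eq_integral do rewrite big_ord0.
  by rewrite (integral_cst _ measurableT) /= diracT mul1e expr0.
have m1 (m : nat) (i : 'I_m) (z : R) : measurable_fun setT (fun t : tup R m => (`|tnth t i - z| <= r)%R%:R : R).
  have -> : (fun t : tup R m => (`|tnth t i - z| <= r)%R%:R : R) =
    (\1_[set s : R | `|s - z| <= r] : R -> R) \o (fun t : tup R m => tnth t i).
    by apply/funext => t /=; rewrite indicE; congr (_%:R); congr nat_of_bool; apply/idP/idP; rewrite inE.
  apply: measurableT_comp; last exact: measurable_tnth.
  apply: measurable_indic; rewrite (_ : mkset _ = `[z - r, z + r]%classic); first exact: measurable_itv.
  by apply/seteqP; split => s /=; rewrite in_itv/= ler_distl.
rewrite ge0_integral_tupleS; last 2 first.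
- by apply/measurable_EFinP; apply: measurable_prod => i _; exact: m1.
- by move=> t; rewrite lee_fin prodr_ge0.
pose I0 : set R := `[y ord0 - r, y ord0 + r]%classic.
have mI0 : measurable (I0 : set (measurableTypeR R)) by exact: measurable_itv.
have I0E : (\int[@lebesgue_measure R]_s (\1_I0 s)%:E = (2 * r)%:E)%E.
  rewrite integral_indic// setIT [LHS]lebesgue_measure_itv/= lte_fin; case: ifPn; rewrite -?leNgt => h.
    by rewrite -EFinB; congr EFin; ring.
  by rewrite (_ : r = 0) ?mulr0//; lra.
pose P (t : tup R n) : R := \prod_i (`|tnth t i - y (lift ord0 i)| <= r)%R%:R.
have inner (t : tup R n) : (\int[@lebesgue_measure R]_s
    (\prod_i (`|tnth (tuple_cons (s, t)) i - y i| <= r)%R%:R)%:E = (P t)%:E * (2 * r)%:E)%E.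
  rewrite -I0E -ge0_integralZl_EFin//; last 2 first.
  - by apply/measurable_EFinP; exact: measurable_indic.
  - exact: prodr_ge0.
  apply: eq_integral => s _; rewrite -EFinM big_ord_recl tnth0 mulrC; congr (_ * _)%:E.
    by apply: eq_bigr => i _; rewrite tnthS.
  rewrite indicE; congr (_%:R); congr nat_of_bool; rewrite mem_setE /I0 /= in_itv/=.
  by rewrite -ler_distl.
under eq_integral do rewrite inner.
rewrite ge0_integralZr//; last 3 first.
- apply/measurable_EFinP; apply: measurable_prod => i _.
  exact: m1.
- by move=> t _; rewrite lee_fin prodr_ge0.
- by rewrite lee_fin mulr_ge0.
by rewrite IH -EFinM exprSr.
Qed.

Lemma integral_rV_gt0 n (f : 'rV[R]_n -> R) x0 : cc f -> (forall x, 0 <= f x) -> 0 < f x0 ->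
  0 < integral_rV f.
Proof.
move=> cf f0 fx0; have [cf' _] := cf.
have : \forall x \near x0, f x0 / 2 < f x.
  by apply: (@cvgr_gt _ _ _ _ _ _ (cf' x0)); rewrite ltr_pdivrMr// ltr_pMr// ltr1n.
move=> /nbhs_ballP [r /= r0 hr].
have s0 : 0 < r / 2 by rewrite divr_gt0.
rewrite -lte_fin integral_rVE//.
apply: (@lt_le_trans _ _ ((f x0 / 2)%:E * ((2 * (r / 2)) ^+ n)%:E)%E).
  by rewrite -EFinM lte_fin mulr_gt0 ?divr_gt0// exprn_gt0// mulr_gt0.
rewrite -(@integral_box n (fun i => x0 ord0 i) _ (ltW s0)) -ge0_integralZl_EFin//; last 3 first.
- by move=> t _; rewrite lee_fin prodr_ge0.
- apply/measurable_EFinP; apply: measurable_prod => i _.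
  rewrite (_ : (fun t => _) = (\1_(`[x0 ord0 i - r / 2, x0 ord0 i + r / 2]%classic : set R) : R -> R) \o (fun t : tup R n => tnth t i)).
    by apply: measurableT_comp; [apply: measurable_indic; exact: measurable_itv|exact: measurable_tnth].
  by apply/funext => s /=; rewrite indicE mem_setE /= in_itv/= -ler_distl.
- by rewrite divr_ge0// ltW.
apply: ge0_le_integral => //.
- by move=> t _; rewrite -EFinM lee_fin mulr_ge0 ?prodr_ge0 ?divr_ge0// ltW.
- apply: measurable_funeM; apply/measurable_EFinP; apply: measurable_prod => i _.
  rewrite (_ : (fun t => _) = (\1_(`[x0 ord0 i - r / 2, x0 ord0 i + r / 2]%classic : set R) : R -> R) \o (fun t : tup R n => tnth t i)).
    by apply: measurableT_comp; [apply: measurable_indic; exact: measurable_itv|exact: measurable_tnth].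
  by apply/funext => s /=; rewrite indicE mem_setE /= in_itv/= -ler_distl.
- by apply/measurable_EFinP; exact: continuous_measurable_rV.
move=> t _; rewrite -EFinM lee_fin.
have [h|] := boolP [forall i, `|tnth t i - x0 ord0 i| <= r / 2].
  rewrite big1 ?mulr1; last by move=> i _; rewrite (forallP h i).
  apply: ltW; apply: hr; apply/ball_rVP => // i.
  rewrite distrC mxE; apply: le_lt_trans (forallP h i) _.
  by rewrite ltr_pdivrMr// ltr_pMr// ltr1n.
rewrite negb_forall => /existsP[i /negbTE hi].
by rewrite (bigD1 i)//= hi mul0r mulr0.
Qed.

End positive_integrals.

(** * Elements of the completion and the constant [K0] *)

Section homogeneous_sobolev_space.
Context {R : realType}.

Lemma DsqD_le n U m (u v : 'rV[R]_n -> R) x (e : R) : open U -> U x -> 0 < e ->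
  smooth_on U u -> smooth_on U v ->
  Dsq m (fun y => u y + v y) x <= (1 + e) * Dsq m u x + (1 + e^-1) * Dsq m v x.
Proof.
move=> oU Ux e0; elim: m u v => [|m IH] u v su sv /=; first exact: sqD_le.
rewrite !mulr_sumr -big_split/=; apply: ler_sum => i _.
rewrite (@eq_Dsq R n U m _ (fun y => pderiv i u y + pderiv i v y))//; last first.
  by move=> y Uy; rewrite partialD//; exact: smooth_on_diff Uy.
by apply: IH; exact: smooth_on_partial.
Qed.

Lemma DsqN n U m (u : 'rV[R]_n -> R) x : open U -> U x -> smooth_on U u ->
  Dsq m (fun y => - u y) x = Dsq m u x.
Proof.
move=> oU Ux; elim: m u => [|m IH] u su /=; first by rewrite sqrrN.
apply: eq_bigr => i _; rewrite -(IH (pderiv i u)); last exact: smooth_on_partial.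
apply: (@eq_Dsq R n U) => // y Uy.
rewrite -[RHS]mulN1r -(partialZ _ _ (smooth_on_diff su Uy)).
by apply: (@eq_partial R n U) => // z _; rewrite mulN1r.
Qed.

Lemma euclidean_energyE n k (u : 'rV[R]_n -> R) : test u ->
  euclidean_energy k u = integral_rV (Dsq k u).
Proof. exact: integral_half_laplacian_sq. Qed.

(** The polar form of the energy at [u], integrated by parts [k] times: the [f] constructed is the
    [k]-th iterate of the positive Laplacian on [u]. It exhibits the form as continuous in [v] for
    [L^p] norms. *)
Lemma energy_polar n k (u : 'rV[R]_n -> R) : test u ->
  exists2 f, test f & forall v, test v ->
    integral_rV (Dsq k u) + integral_rV (Dsq k v) - integral_rV (Dsq k (fun x => u x - v x)) =
    2 * integral_rV (fun x => f x * v x).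
Proof.
elim: k u => [|k IH] u tu.
  exists u => // v tv; rewrite /= -integral_rVD; last 2 first.
  - exact: test_cc (test_Dsq 0 tu).
  - exact: test_cc (test_Dsq 0 tv).
  rewrite -integral_rVB; last 2 first.
  - exact: test_cc (testD (test_Dsq 0 tu) (test_Dsq 0 tv)).
  - exact: test_cc (test_Dsq 0 (testB tu tv)).
  rewrite -integral_rVZ; last by apply: test_cc; apply: test_mull => //; case: tu.
  by apply: (congr1 (@integral_rV R n)); apply/funext => x; ring.
have tp i := test_partial i tu.
pose f i := projT1 (cid2 (IH _ (tp i))).
have tf i : test (f i) by rewrite /f; case: cid2.
have hf i v : test v -> integral_rV (Dsq k (pderiv i u)) + integral_rV (Dsq k v)
    - integral_rV (Dsq k (fun x => pderiv i u x - v x)) = 2 * integral_rV (fun x => f i x * v x).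
  by rewrite /f; case: cid2 => g /= tg; exact.
have sf i : smooth_on setT (f i) by case: (tf i).
have tpf i : test (pderiv i (f i)) := test_partial i (tf i).
have spf i : smooth_on setT (pderiv i (f i)) by case: (tpf i).
exists (fun x => - \sum_i pderiv i (f i) x).
  have -> : (fun x => - \sum_i pderiv i (f i) x) = (fun x => -1 * \sum_i pderiv i (f i) x).
    by apply/funext => x; rewrite mulN1r.
  by apply: testZ; apply: test_sum.
move=> v tv; have sv : smooth_on setT v by case: tv.
have su : smooth_on setT u by case: tu.
have tD w : test w -> integral_rV (Dsq k.+1 w) = \sum_i integral_rV (Dsq k (pderiv i w)).
  move=> tw; rewrite /= integral_rV_sum// => i _.
  by apply: test_cc; apply: test_Dsq; exact: test_partial.
rewrite !tD//; last exact: testB.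
rewrite -big_split -sumrB/=.
have -> : integral_rV (fun x => (- \sum_i pderiv i (f i) x) * v x) =
    \sum_i integral_rV (fun x => f i x * pderiv i v x).
  rewrite (_ : (fun x => (- \sum_i pderiv i (f i) x) * v x) =
    (fun x => \sum_i (-1 * (pderiv i (f i) x * v x)))); last first.
    by apply/funext => x; rewrite mulNr mulr_suml -mulr_sumr mulN1r.
  rewrite integral_rV_sum; last first.
    by move=> i _; apply: ccZ; apply: test_cc; exact: test_mull.
  apply: eq_bigr => i _; rewrite integral_by_parts// integral_rVZ ?mulN1r//.
  by apply: test_cc; exact: test_mull.
rewrite mulr_sumr; apply: eq_bigr => i _.
rewrite -hf; last exact: test_partial.
congr (_ + _ - integral_rV _); apply/funext => x; apply: (@eq_Dsq R n setT) => //; first exact: openT.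
move=> y _; rewrite partialD; [|exact: smooth_on_diff su _|]; last first.
  by apply: (@smooth_on_diff R n setT) => //; apply: smooth_onN => //; exact: openT.
apply: (congr1 (fun z => pderiv i u y + z)).
have -> : (fun y => - v y) = (fun y => -1 * v y) by apply/funext => z; rewrite mulN1r.
by rewrite partialZ ?mulN1r//; exact: smooth_on_diff sv _.
Qed.

Lemma sobolev_test_dim n k : (0 < k)%N -> (2 * k < n)%N -> exists2 C : R, 0 <= C & forall v : 'rV[R]_n -> R,
  test v ->
  integral_rV (fun x => `|v x| `^ critical_exponent R n k) `^ (2 / critical_exponent R n k)
   <= C * integral_rV (Dsq k v).
Proof.
case: n => [|[|n]]; first by rewrite ltn0.
  by case: k => // k _; rewrite mulnS.
by move=> _; exact: sobolev_test.
Qed.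

Lemma critical_exponent_gt2 n k : (0 < k)%N -> (2 * k < n)%N -> 2 < critical_exponent R n k.
Proof.
move=> k0 kn; rewrite /critical_exponent !natrM.
have : (2 * k)%:R < n%:R :> R by rewrite ltr_nat.
have : 0 < k%:R :> R by rewrite ltr0n.
rewrite natrM; move: (k%:R : R) (n%:R : R) => K N K0 h.
by rewrite ltr_pdivlMr; lra.
Qed.

Section best_constant.
Variables n k : nat.
Hypotheses (k0 : (0 < k)%N) (kn : (2 * k < n)%N).
Local Notation p := (critical_exponent R n k).
Implicit Types (u : @homogeneous_sobolev R n k) (v : 'rV[R]_n -> R).

(** [hs_energy] is a [limn], meaningful only once the Cauchy condition is known to force
    convergence. *)
Lemma hs_energy_cvg u : (fun i => integral_rV (Dsq k (hs_seq u i))) @ \oo --> hs_energy u.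
Proof.
have tu i : test (hs_seq u i) by apply/test_functionP; exact: hs_test.
have -> : hs_energy u = limn (fun i => integral_rV (Dsq k (hs_seq u i))).
  by congr (limn _); apply/funext => i; rewrite euclidean_energyE.
pose d i j := integral_rV (Dsq k (fun x => hs_seq u i x - hs_seq u j x)).
apply: (@cauchy_energies_cvg R _ d).
- by move=> i; apply: integral_rV_ge0 => x; exact: Dsq_ge0.
- by move=> i j; apply: integral_rV_ge0 => x; exact: Dsq_ge0.
- move=> i j e e0; rewrite /d.
  have c1 := test_cc (test_Dsq k (tu j)).
  have c2 := test_cc (test_Dsq k (testB (tu i) (tu j))).
  rewrite -!integral_rVZ// -integral_rVD; [|exact: ccZ|exact: ccZ].
  apply: le_integral_rV; [exact: test_cc (test_Dsq k (tu i))|by apply: ccD; exact: ccZ|move=> x].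
  have sj : smooth_on setT (hs_seq u j) by case: (tu j).
  have sij : smooth_on setT (fun y => hs_seq u i y - hs_seq u j y) by case: (testB (tu i) (tu j)).
  have := @DsqD_le n setT k _ _ x e openT I e0 sj sij.
  by under [X in Dsq k X x <= _]eq_fun do rewrite addrC subrK.
- move=> e /(hs_cauchy u)[N hN]; exists N => i j Ni Nj.
  by rewrite /d -euclidean_energyE; [exact: hN|exact: testB].
Qed.

Lemma measurable_test v : test v -> measurable_fun setT (v \o @rV_of_tuple R n).
Proof. by move=> tv; apply: continuous_measurable_rV; case: (test_cc tv). Qed.

Lemma test_Lnorm v : test v ->
  ('N[@dx R n]_p%:E[EFin \o (v \o @rV_of_tuple R n)] =
   (integral_rV (fun x => `|v x| `^ p) `^ p^-1)%:E)%E.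
Proof.
move=> tv; have p2 := critical_exponent_gt2 k0 kn.
rewrite LnormE -poweR_EFin integral_rVE//.
by apply: cc_norm_powR; [lra|exact: test_cc].
Qed.

(** The upper bound passes to the limit. Positivity is duality: if the represented function were
    [0], the [hs_seq u j] would tend to [0] in [L^p], and [energy_polar] at a late index [N] would
    bound their energies by the energy of the difference with index [N], which is small, plus a
    pairing with a fixed [f], which tends to [0]. *)
Lemma hs_bound (A : R) : (forall v, test v ->
    integral_rV (fun x => `|v x| `^ p) `^ (2 / p) <= A * integral_rV (Dsq k v)) ->
  forall u, hs_energy u != 0 ->
    0 < (\int[@dx R n]_t `|u (X t)| `^ p) `^ (2 / p) <= A * hs_energy u.
Proof.
move=> hA u u0; have p2 := critical_exponent_gt2 k0 kn.
have p1 : 1 <= p by lra.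
have p0 : 0 < p by lra.
have tu i : test (hs_seq u i) by apply/test_functionP; exact: hs_test.
have mu i := measurable_test (tu i).
have cE := @hs_energy_cvg u; have hc := @hs_cvg _ _ _ u; have mU := @hs_measurable _ _ _ u.
pose E i := integral_rV (Dsq k (hs_seq u i)).
pose a i := integral_rV (fun x => `|hs_seq u i x| `^ p).
have a0 i : 0 <= a i by apply: integral_rV_ge0 => x; exact: powR_ge0.
have sq (c d : R) : 0 <= c -> c `^ (2 * d) = (c `^ d) ^+ 2.
  by move=> c0; rewrite mulrC powRrM powR_mulrn// powR_ge0.
have aA i : (a i `^ p^-1) ^+ 2 <= A * E i by rewrite -sq//; exact: hA.
have AE0 i : 0 <= A * E i by apply: le_trans (aA i); exact: sqr_ge0.
have cAE : (fun i => A * E i) @ \oo --> A * hs_energy u by apply: cvgMr.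
have AE : 0 <= A * hs_energy u.
  rewrite -(cvg_lim _ cAE)//; apply: limr_ge; first by apply/cvg_ex; eexists; exact: cAE.
  by apply: nearW => i; exact: AE0.
have csq : (fun i => Num.sqrt (A * E i)) @ \oo --> Num.sqrt (A * hs_energy u).
  by apply: (continuous_cvg _ _ cAE); exact: sqrt_continuous.
have Na i : ('N[@dx R n]_p%:E[EFin \o (hs_seq u i \o @rV_of_tuple R n)] <= (Num.sqrt (A * E i))%:E)%E.
  rewrite test_Lnorm// lee_fin -(@ger0_norm _ (_ `^ _)) ?powR_ge0// -sqrtr_sqr.
  by apply: ler_wsqrtr; exact: aA.
have Nu := Lnorm_cvg_le p1 mu mU hc Na csq.
pose r := fine ('N[@dx R n]_p%:E[EFin \o (u \o @rV_of_tuple R n)]).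
have r0 : 0 <= r by apply: fine_ge0; exact: Lnorm_ge0.
have rE : ('N[@dx R n]_p%:E[EFin \o (u \o @rV_of_tuple R n)] = r%:E)%E.
  rewrite /r fineK// ge0_fin_numE ?Lnorm_ge0//; apply: le_lt_trans Nu _; exact: ltry.
have rle : r <= Num.sqrt (A * hs_energy u) by rewrite -lee_fin -rE.
have Iu : (\int[@dx R n]_t `|u (X t)| `^ p) = r `^ p.
  have e := powR_Lnorm (@dx R n) (EFin \o (u \o @rV_of_tuple R n)) (lt0r_neq0 p0).
  rewrite rE poweR_EFin in e.
  by rewrite /Rintegral (_ : (\int[@dx R n]_t _)%E = (r `^ p)%:E)// e.
rewrite Iu -powRrM mulrC divfK ?gt_eqF// powR_mulrn//.
apply/andP; split; last first.
  by rewrite -[leRHS]sqr_sqrtr// ler_pXn2r// nnegrE ?sqrtr_ge0.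
rewrite lt0r sqr_ge0 andbT sqrf_eq0; apply: contra u0 => /eqP rr.
have small e : 0 < e -> \forall i \near \oo, a i <= e `^ p.
  move=> e0; have := Lnorm_le_near p1 hc e0; apply: filterS => i hi.
  have := minkowski_EFin (@dx R n) (f := u \o @rV_of_tuple R n)
     (g := fun t => hs_seq u i (X t) - u (X t)) mU (measurable_funB (mu i) mU) p1.
  rewrite rE rr add0e.
  rewrite (_ : EFin \o (_ \+ _) = EFin \o (hs_seq u i \o @rV_of_tuple R n)); last first.
    by apply/funext => t /=; congr EFin; ring.
  move=> /le_trans /(_ hi); rewrite test_Lnorm// lee_fin => h.
  have := @ge0_ler_powR _ p (ltW p0) _ _ _ _ h.
  rewrite !nnegrE powR_ge0 (ltW e0) => /(_ isT isT).
  by rewrite -powRrM mulVf ?gt_eqF// powRr1//; exact: (a0 i).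
have E0 i : 0 <= E i by apply: integral_rV_ge0 => x; exact: Dsq_ge0.
have hE0 : 0 <= hs_energy u.
  rewrite -(cvg_lim _ cE)//; apply: limr_ge; first by apply/cvg_ex; eexists; exact: cE.
  by apply: nearW => i; exact: E0.
rewrite eq_le hE0 andbT; apply/ler_addgt0Pr => e e0; rewrite add0r.
have e2 : 0 < e / 2 by rewrite divr_gt0.
have [N hN] := hs_cauchy u e2.
have [f tf hf] := energy_polar k (tu N).
pose q := p / (p - 1).
have q0 : 0 < q by rewrite divr_gt0//; lra.
have pq : q^-1 + p^-1 = 1 by rewrite /q; field; rewrite !gt_eqF//; lra.
have p1' : p - 1 != 0 by rewrite gt_eqF//; lra.
pose F := integral_rV (fun x => `|f x| `^ q) `^ q^-1.
have F0 : 0 <= F by exact: powR_ge0.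
have pair j : integral_rV (fun x => f x * hs_seq u j x) <= F * a j `^ p^-1.
  have bf : bb ((fun x => `|f x|) \o @rV_of_tuple R n).
    by apply: bb_cc => // ; apply: cc_norm; exact: test_cc.
  have bu : bb ((fun x => `|hs_seq u j x|) \o @rV_of_tuple R n).
    by apply: bb_cc => // ; apply: cc_norm; exact: test_cc.
  have := itup_hoelder bf bu q0 p0 pq; apply: le_trans.
  have sf : smooth_on setT f by case: tf.
  apply: (@le_trans _ _ (integral_rV (fun x => `|f x| * `|hs_seq u j x|))) => //.
  apply: le_integral_rV.
  - by apply: test_cc; exact: test_mull.
  - by apply: cc_mulr; [apply: cc_norm; exact: test_cc|case: (cc_norm (test_cc (tu j)))].
  - by move=> x; rewrite -normrM; exact: ler_norm.
(* Makes twice the pairing at most [e / 2]; the energy of the difference takes the other half. *)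
pose s := e / (4 * (F + 1)).
have F1 : 0 < F + 1 by lra.
have s0 : 0 < s by rewrite divr_gt0// mulr_gt0.
have lim_le : hs_energy u <= e / 2 + 2 * (F * s) - E N.
  rewrite -(cvg_lim _ cE)//; apply: limr_le; first by apply/cvg_ex; eexists; exact: cE.
  have h1 := small s s0; have h2 := nbhs_infty_ge N.
  move: h1 h2; apply: filterS2 => j aj Nj.
  have h1 := hN N j (leqnn _) Nj; rewrite euclidean_energyE in h1; last exact: testB.
  have h2 := hf _ (tu j); have h3 := pair j.
  have h4 : F * a j `^ p^-1 <= F * s.
    apply: ler_wpM2l => //.
    have p00 : 0 <= p^-1 by rewrite invr_ge0 ltW.
    have := @ge0_ler_powR _ p^-1 p00 _ _ _ _ aj; rewrite !nnegrE a0 powR_ge0 => /(_ isT isT).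
    by rewrite -powRrM mulfV ?gt_eqF// powRr1// ltW.
  move: h1 h2 h3 h4; rewrite -/(E N) -/(E j).
  have arith (a1 a2 a3 a4 a5 a6 : R) : a3 < e / 2 -> a1 + a2 - a3 = 2 * a4 -> a4 <= a5 ->
    a5 <= a6 -> a2 <= e / 2 + 2 * a6 - a1 by move=> *; lra.
  exact: arith.
have Fs : F * s <= e / 4.
  apply: (@le_trans _ _ ((F + 1) * s)); first by rewrite ler_pM2r// lerDl.
  rewrite le_eqVlt; apply/orP; left; apply/eqP; rewrite /s.
  by move: F1; clear; move: (F + 1) => G G0; field; rewrite gt_eqF.
have arith (a1 a2 a3 : R) : a1 <= e / 2 + 2 * a2 - a3 -> a2 <= e / 4 -> 0 <= a3 -> a1 <= e.
  by move=> *; lra.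
exact: (arith _ _ _ lim_le Fs (E0 N)).
Qed.

Definition hs_of_test v (tv : test v) : @homogeneous_sobolev R n k.
Proof.
refine (@HomogeneousSobolev R n k v (fun=> v) _ _ _ _).
- by move=> i; apply/test_functionP.
- move=> e e0; exists 0%N => i j _ _.
  under eq_fun do rewrite subrr.
  rewrite euclidean_energyE; last exact: test0.
  have -> : Dsq k (fun=> 0 : R) = (fun=> 0) :> ('rV[R]_n -> R).
    apply/funext => x.
    by apply: (@supported_Dsq R n k x (-1)) => //; rewrite subrr normr0 oppr_lt0.
  by rewrite integral_rV0.
- exact: measurable_test.
- rewrite (_ : (fun _ : nat => _) = fun=> 0%E); first exact: cvg_cst.
  apply/funext => i; apply: integral0_eq => t _.
  rewrite subrr normr0 powR0// gt_eqF//; have := critical_exponent_gt2 k0 kn; lra.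
Defined.

Lemma hs_energy_test v (tv : test v) : hs_energy (hs_of_test tv) = integral_rV (Dsq k v).
Proof. by rewrite /hs_energy /hs_of_test /= euclidean_energyE// lim_cst. Qed.

Lemma exists_test : exists2 v : 'rV[R]_n -> R, test v & 0 < integral_rV (fun x => `|v x| `^ p).
Proof.
have p2 := critical_exponent_gt2 k0 kn.
have n0 : (0 < n)%N by exact: leq_ltn_trans kn.
have tb : test (bump (0 : 'rV[R]_n) 1).
  apply: (@supported_test R n 0 1); first by apply: smooth_bump; exact: openT.
  by move=> x /ltW h; exact: bump0.
exists (bump 0 1) => //; apply: (@integral_rV_gt0 R n _ 0).
- by apply: cc_norm_powR; [lra|exact: test_cc].
- by move=> x; exact: powR_ge0.
- rewrite powR_gt0// normr_gt0 gt_eqF// bump_gt0// subrr normr0.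
  exact: ltr01.
Qed.

Lemma Dsq_integral_ge0 v : 0 <= integral_rV (Dsq k v : 'rV[R]_n -> R).
Proof. by apply: integral_rV_ge0 => x; exact: Dsq_ge0. Qed.

Let quotients := [set sobolev_quotient u | u in [set u : @homogeneous_sobolev R n k | hs_energy u != 0]].

Let quotients_nonempty : quotients !=set0.
Proof.
have [v tv v0] := exists_test; have [C C0 hC] := sobolev_test_dim k0 kn.
exists (sobolev_quotient (hs_of_test tv)), (hs_of_test tv) => //=.
rewrite hs_energy_test; apply/eqP => e0.
have := hC v tv; rewrite e0 mulr0; apply/negP; rewrite -ltNge; exact: powR_gt0.
Qed.

Let quotients_ge (A : R) : 0 < A -> (forall v, test v ->
    integral_rV (fun x => `|v x| `^ p) `^ (2 / p) <= A * integral_rV (Dsq k v)) ->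
  lbound quotients A^-1.
Proof.
move=> A0 hA _ [u /= u0 <-]; have /andP[i0 ile] := hs_bound hA u0.
by rewrite /sobolev_quotient ler_pdivlMr// ler_pdivrMl.
Qed.

Lemma K0_gt0 : 0 < K0 (R := R) n k.
Proof.
have [C C0 hC] := sobolev_test_dim k0 kn.
(* Only [0 <= C] is known, and the constant is about to be inverted. *)
have C1 : 0 < C + 1 by lra.
rewrite /K0 invr_gt0; apply: (@lt_le_trans _ _ (C + 1)^-1); first by rewrite invr_gt0.
apply: lb_le_inf => //; apply: quotients_ge => // v tv.
apply: le_trans (hC v tv) _; apply: ler_wpM2r; first exact: Dsq_integral_ge0.
lra.
Qed.

Lemma sobolev_K0 v : test v ->
  integral_rV (fun x => `|v x| `^ p) `^ (2 / p) <= K0 (R := R) n k * integral_rV (Dsq k v).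
Proof.
move=> tv; have [C C0 hC] := sobolev_test_dim k0 kn.
(* Functions of zero energy do not enter the infimum; for them the Sobolev inequality already gives
   a zero left-hand side. *)
have [e0|e0] := eqVneq (integral_rV (Dsq k v)) 0.
  by apply: le_trans (hC v tv) _; rewrite e0 !mulr0.
have eh : hs_energy (hs_of_test tv) != 0 by rewrite hs_energy_test.
have /andP[i0 _] := hs_bound hC eh.
have K00 := K0_gt0; have I0 : 0 < inf quotients by rewrite -invr_gt0.
have C1 : 0 < C + 1 by lra.
have hlb : has_lbound quotients.
  exists (C + 1)^-1; apply: quotients_ge => // w tw.
  apply: le_trans (hC w tw) _; apply: ler_wpM2r; first exact: Dsq_integral_ge0.
  lra.
have q : quotients (sobolev_quotient (hs_of_test tv)) by exists (hs_of_test tv).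
have := ge_inf hlb q; rewrite /sobolev_quotient hs_energy_test.
rewrite (ler_pdivlMr _ _ i0) => h; rewrite /K0 -/quotients [leRHS]mulrC.
by rewrite ler_pdivlMr// mulrC.
Qed.

Lemma K0_le (A : R) : (forall v, test v ->
    integral_rV (fun x => `|v x| `^ p) `^ (2 / p) <= A * integral_rV (Dsq k v)) ->
  K0 n k <= A.
Proof.
move=> hA; have [v tv v0] := exists_test.
(* A bump has a positive norm and a nonnegative energy, which excludes [A <= 0]. *)
have A0 : 0 < A.
  rewrite ltNge; apply/negP => A0.
  have := hA v tv; apply/negP; rewrite -ltNge.
  apply: (@le_lt_trans _ _ 0); last exact: powR_gt0.
  by rewrite mulr_le0_ge0// Dsq_integral_ge0.
have I0 : A^-1 <= inf quotients by apply: lb_le_inf => //; exact: quotients_ge.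
rewrite /K0 -[leRHS]invrK lef_pV2// posrE ?invr_gt0//.
by apply: lt_le_trans I0; rewrite invr_gt0.
Qed.

End best_constant.
End homogeneous_sobolev_space.

(** * Constant metrics *)

Section positive_definite.
Context {R : realType}.

Definition posdef n (G : 'M[R]_n) :=
  G^T = G /\ forall v : 'rV[R]_n, v != 0 -> 0 < (v *m G *m v^T) ord0 ord0.

(* The triangular shape of [M] is what makes [affine_change] elementary. *)
Lemma cholesky n (G : 'M[R]_n) : posdef G ->
  exists M : 'M[R]_n, [/\ 0 < \det M, affine_change M & M *m G *m M^T = 1%:M].
Proof.
elim: n G => [|n IH] G [GT Gpos].
  by exists 1%:M; split; [rewrite det1|exact: affine_change0|apply/matrixP; case].
pose G' : 'M[R]_(1 + n) := G.
pose a : R := ulsubmx G' ord0 ord0.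
pose b : 'rV[R]_n := ursubmx G'.
pose D : 'M[R]_n := drsubmx G'.
have GE : G' = block_mx a%:M b b^T D.
  rewrite -[LHS]submxK -mx11_scalar; congr block_mx.
  by rewrite /b trmx_ursub /G' GT.
have DT : D^T = D by rewrite /D trmx_drsub /G' GT.
have {}Gpos (v : 'rV[R]_(1 + n)) : v != 0 -> 0 < (v *m G' *m v^T) ord0 ord0 by exact: Gpos.
have a0 : 0 < a.
  have := Gpos (row_mx 1 0 : 'rV[R]_(1 + n)).
  have -> : (row_mx 1 0 : 'rV[R]_(1 + n)) != 0.
    apply/eqP => /matrixP/(_ ord0 (lshift _ ord0)); rewrite row_mxEl !mxE/=.
    by move/eqP; rewrite oner_eq0.
  move=> /(_ isT); rewrite GE tr_row_mx mul_row_block mul_row_col.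
  by rewrite !mul0mx !addr0 trmx0 mulmx0 addr0 mul1mx trmx1 mulmx1 mxE eqxx.
have an0 : a != 0 by rewrite gt_eqF.
(* The Schur complement of the corner entry. *)
pose S := D - a^-1 *: (b^T *m b).
have [M' [M'0 M'c M'S]] : exists M : 'M[R]_n, [/\ 0 < \det M, affine_change M & M *m S *m M^T = 1%:M].
  apply: IH; split.
    by rewrite /S raddfB/= DT linearZ/= trmx_mul trmxK.
  move=> w w0.
  (* The first block of this vector times [G'] vanishes, so the form of [G'] takes there the value
     of the form of [S] at [w]. *)
  have := Gpos (row_mx (- (a^-1 *: (w *m b^T))) w : 'rV[R]_(1 + n)).
  have -> : (row_mx (- (a^-1 *: (w *m b^T))) w : 'rV[R]_(1 + n)) != 0.
    by apply: contra w0 => /eqP; rewrite -row_mx0 => /eq_row_mx[_ ->].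
  move=> /(_ isT); rewrite GE tr_row_mx mul_row_block mul_row_col.
  rewrite mul_mx_scalar scalerN scalerA mulfV// scale1r addNr mul0mx add0r.
  rewrite mulNmx -scalemxAl -[w *m b^T *m b]mulmxA /S mulmxBr -scalemxAr.
  by rewrite [- _ + _]addrC.
pose s := (Num.sqrt a)^-1.
have s0 : 0 < s by rewrite invr_gt0 sqrtr_gt0.
have ssa : s * a * s = 1.
  rewrite /s -{2}[a]sqr_sqrtr ?ltW// expr2 mulrA mulVf ?mul1r ?mulfV// gt_eqF// sqrtr_gt0//.
(* The solution of [c a + M' b^T = 0], which kills the off-diagonal block. *)
pose c : 'cV[R]_n := - (a^-1 *: (M' *m b^T)).
have ca : c *m a%:M + M' *m b^T = 0.
  by rewrite mul_mx_scalar /c scalerN scalerA mulfV// scale1r addNr.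
exists (block_mx s%:M 0 c M' : 'M[R]_(1 + n)); split.
- by rewrite (@det_lblock _ 1 n) det_scalar expr1 mulr_gt0.
- exact: affine_change_block (ltW M'0) M'c.
pose M0 : 'M[R]_(1 + n) := block_mx s%:M 0 c M'.
change (M0 *m G' *m M0^T = 1%:M); rewrite /M0 GE tr_block_mx !mulmx_block !mul0mx !addr0 ca mul0mx !add0r.
rewrite trmx0 !tr_scalar_mx mulmx0 addr0.
rewrite (_ : s%:M *m a%:M *m s%:M = 1%:M); last by rewrite -!scalar_mxM ssa.
rewrite (_ : s%:M *m a%:M *m c^T + s%:M *m b *m M'^T = 0); last first.
  rewrite -!mulmxA -mulmxDr -[_ + _]trmxK raddfD/= !trmx_mul !trmxK tr_scalar_mx.
  by rewrite ca trmx0 mulmx0.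
rewrite (_ : (c *m b + M' *m D) *m M'^T = 1%:M).
  by rewrite mulmx0 mul0mx add0r [RHS](@scalar_mx_block _ 1 n).
rewrite -M'S /S mulmxBr -scalemxAr /c mulNmx -scalemxAl mulmxA addrC.
by [].
Qed.

Lemma posdef_det n (G : 'M[R]_n) : posdef G -> 0 < \det G.
Proof.
move=> /cholesky[M [M0 _ /(congr1 determinant)]]; rewrite !det_mulmx det_tr det1 => h.
have : 0 < \det M * \det G * \det M by rewrite h.
by rewrite pmulr_lgt0// pmulr_rgt0.
Qed.

Lemma posdef_unit n (G : 'M[R]_n) : posdef G -> G \in unitmx.
Proof. by move=> /posdef_det h; rewrite unitmxE unitfE gt_eqF. Qed.

End positive_definite.

(** * Gradient products and pullback by affine isometries *)

Section metrics.
Context {R : realType} {n : nat}.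
Implicit Types (u v : 'rV[R]_n -> R) (U : set 'rV[R]_n) (G : 'rV[R]_n -> 'M[R]_n).

(** Written with differentials, hence with the inverse matrix. It equals the product of gradient
    vectors by symmetry of the metric ([gradient_sqnormE]) and transforms simply under changes of
    coordinates. *)
Definition gradient_product G u v (x : 'rV[R]_n) : R :=
  \sum_i \sum_j invmx (G x) i j * pderiv i u x * pderiv j v x.

Lemma gradient_sqnormE G u x : posdef (G x) ->
  gradient_sqnorm G u x = gradient_product G u u x.
Proof.
move=> pG; have uG := posdef_unit pG; have [GT _] := pG.
pose D : 'rV[R]_n := \row_j pderiv j u x.
have gE i : gradient G u i x = (invmx (G x) *m D^T) i ord0.
  by rewrite mxE /gradient; apply: eq_bigr => j _; rewrite !mxE pderivE.
rewrite /gradient_sqnorm.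
transitivity (((invmx (G x) *m D^T)^T *m G x *m (invmx (G x) *m D^T)) ord0 ord0).
  rewrite mxE; under [RHS]eq_bigr do rewrite mxE mulr_suml.
  rewrite [RHS]exchange_big; apply: eq_bigr => i _; apply: eq_bigr => j _.
  by rewrite !gE [in RHS]mxE; congr (_ * _); exact: mulrC.
rewrite trmx_mul trmxK trmx_inv GT mulmxKV// mulmxA mxE.
under eq_bigr do rewrite mxE mulr_suml.
rewrite exchange_big; apply: eq_bigr => i _; apply: eq_bigr => j _.
by rewrite !mxE [pderiv i u x * _]mulrC.
Qed.

Section affine_pullback.
Variables (N : 'M[R]_n) (w : 'rV[R]_n).
Local Notation L x := (x *m N + w).

Lemma affine_coord a x : L x ord0 a = \sum_i x ord0 i * N i a + w ord0 a.
Proof. by rewrite !mxE. Qed.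

Lemma smooth_affine a U : open U -> smooth_on U (fun x => L x ord0 a).
Proof.
move=> oU; rewrite (_ : (fun x : 'rV[R]_n => L x ord0 a) = (fun x => \sum_i x ord0 i * N i a + w ord0 a)).
  apply: smooth_onD => //; last exact: smooth_on_cst.
  apply: smooth_on_sum => // i _; apply: smooth_onM => //; first exact: smooth_on_coord.
  exact: smooth_on_cst.
by apply/funext => x; exact: affine_coord.
Qed.

Lemma pderiv_affine_coord i a x : pderiv i (fun y => L y ord0 a) x = N i a.
Proof.
rewrite (_ : (fun y : 'rV[R]_n => L y ord0 a) = (fun x => \sum_i N i a * x ord0 i + w ord0 a)); last first.
  by apply/funext => z; rewrite affine_coord; under eq_bigr do rewrite mulrC.
have sc j : differentiable (fun y : 'rV[R]_n => y ord0 j) x.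
  by apply: (@smooth_on_diff R n setT) => //; apply: smooth_on_coord; exact: openT.
have sz j : differentiable (fun y : 'rV[R]_n => N j a * y ord0 j) x.
  by apply: differentiableM => //; exact: differentiable_cst.
rewrite partialD; [|exact: differentiable_bigsum|exact: differentiable_cst].
rewrite partial_cst addr0 partial_sum// (bigD1 i)//= big1 => [|j ji].
  by rewrite partialZ// partial_coord eqxx mulr1 addr0.
by rewrite partialZ// partial_coord (negbTE ji) mulr0.
Qed.

Lemma pderiv_affine i phi x : smooth_on setT phi ->
  pderiv i (fun y => phi (L y)) x = \sum_a N i a * pderiv a phi (L x).
Proof.
move=> sphi; have [] := @partial_comp R n n (fun y => L y) phi x i.
- by move=> a; apply: (@smooth_on_diff R n setT) => //; apply: smooth_affine; exact: openT.
- exact: smooth_on_diff sphi I.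
- by move=> _ ->; apply: eq_bigr => a _; rewrite pderiv_affine_coord.
Qed.

Lemma smooth_pullback phi : smooth_on setT phi -> smooth_on setT (fun x => phi (L x)).
Proof.
move=> sphi; apply: (@smooth_on_comp R n n setT setT (fun x => L x)) => //; first exact: openT.
by move=> a; apply: smooth_affine; exact: openT.
Qed.

Variable G0 : 'M[R]_n.
Hypothesis pG0 : posdef G0.
Hypothesis NG0 : N *m N^T = G0.

(** Equivalent to [N N^T = G0]; it says that [x |-> x N + w] carries the metric [G0] to the
    Euclidean one. *)
Let NN a b : \sum_i \sum_j invmx G0 i j * N i a * N j b = (a == b)%:R.
Proof.
have uG := posdef_unit pG0.
have uN : N \in unitmx by move: uG; rewrite -NG0 unitmx_mul => /andP[].
have e : N^T *m invmx G0 *m N = 1%:M.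
  have h : N *m (N^T *m invmx G0 *m N) = N by rewrite !mulmxA NG0 mulmxV// mul1mx.
  by rewrite -[LHS](mulKmx uN) h mulVmx.
transitivity ((N^T *m invmx G0 *m N) a b); last by rewrite e mxE.
rewrite mxE; under [RHS]eq_bigr do rewrite mxE mulr_suml.
rewrite exchange_big; apply: eq_bigr => j _; apply: eq_bigr => i _.
by rewrite !mxE [_ * invmx _ _ _]mulrC.
Qed.

Lemma constant_laplacianE u x : smooth_on setT u ->
  laplacian (fun=> G0) u x = - \sum_i \sum_j invmx G0 i j * pderiv i (pderiv j u) x.
Proof.
move=> su; rewrite /laplacian /divergence; apply: (congr1 (fun z => - z)).
rewrite mulr_sumr; apply: eq_bigr => i _; rewrite pderivE.
rewrite /volume_density.
have s0 : Num.sqrt (\det G0) != 0 by rewrite gt_eqF// sqrtr_gt0 posdef_det.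
have dd j : differentiable (fun y => invmx G0 i j * pderiv j u y) x.
  apply: differentiableM; first exact: differentiable_cst.
  exact: (smooth_on_diff (smooth_on_partial j su) I).
have -> : (fun y => Num.sqrt (\det G0) * gradient (fun=> G0) u i y) =
    (fun y => Num.sqrt (\det G0) * \sum_j (invmx G0 i j * pderiv j u y)).
  by apply/funext => y; rewrite /gradient pderivE.
rewrite partialZ; last exact: differentiable_bigsum.
rewrite mulKf// partial_sum//; apply: eq_bigr => j _; rewrite partialZ//.
exact: (smooth_on_diff (smooth_on_partial j su) I).
Qed.

Lemma laplacian_pullback phi : smooth_on setT phi ->
  laplacian (fun=> G0) (fun x => phi (L x)) = (fun x => lap0 phi (L x)).
Proof.
move=> sphi; apply/funext => x; rewrite constant_laplacianE; last exact: smooth_pullback.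
rewrite /lap0; apply: (congr1 (fun z => - z)).
have pp i j : pderiv i (pderiv j (fun x => phi (L x))) x =
    \sum_a \sum_b N j a * N i b * pderiv b (pderiv a phi) (L x).
  have -> : pderiv j (fun x => phi (L x)) = (fun x => \sum_a N j a * pderiv a phi (L x)).
    by apply/funext => y; exact: pderiv_affine.
  have sa a : smooth_on setT (fun y => pderiv a phi (L y)).
    by apply: smooth_pullback; exact: smooth_on_partial.
  rewrite partial_sum; last first.
    move=> a _; apply: differentiableM; first exact: differentiable_cst.
    exact: smooth_on_diff (sa a) I.
  apply: eq_bigr => a _; rewrite partialZ; last exact: smooth_on_diff (sa a) I.
  rewrite pderiv_affine; last exact: smooth_on_partial.
  by rewrite mulr_sumr; apply: eq_bigr => b _; rewrite mulrA.
transitivity (\sum_a \sum_b (\sum_i \sum_j invmx G0 i j * N i b * N j a) * pderiv b (pderiv a phi) (L x)).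
  under eq_bigr do under eq_bigr do rewrite pp mulr_sumr.
  under eq_bigr do under eq_bigr do under eq_bigr do rewrite mulr_sumr.
  under eq_bigr do rewrite exchange_big.
  rewrite exchange_big; apply: eq_bigr => a _.
  under eq_bigr do rewrite exchange_big.
  rewrite exchange_big; apply: eq_bigr => b _.
  rewrite mulr_suml; apply: eq_bigr => i _; rewrite mulr_suml; apply: eq_bigr => j _.
  by rewrite !mulrA; congr (_ * _); rewrite -!mulrA; congr (_ * _); exact: mulrC.
apply: eq_bigr => a _; rewrite (bigD1 a)//= NN eqxx mul1r big1 ?addr0// => b ba.
by rewrite NN (negbTE ba) mul0r.
Qed.

Lemma gradient_sqnorm_pullback phi x : smooth_on setT phi ->
  gradient_sqnorm (fun=> G0) (fun x => phi (L x)) x = Dsq 1 phi (L x).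
Proof.
move=> sphi; rewrite gradient_sqnormE// /gradient_product.
transitivity (\sum_a \sum_b (\sum_i \sum_j invmx G0 i j * N i a * N j b) *
    (pderiv a phi (L x) * pderiv b phi (L x))).
  under eq_bigr do under eq_bigr do rewrite !pderiv_affine// -mulrA big_distrlr/= mulr_sumr.
  under eq_bigr do under eq_bigr do under eq_bigr do rewrite mulr_sumr.
  under eq_bigr do rewrite exchange_big.
  rewrite exchange_big; apply: eq_bigr => a _.
  under eq_bigr do rewrite exchange_big.
  rewrite exchange_big; apply: eq_bigr => b _.
  rewrite mulr_suml; apply: eq_bigr => i _; rewrite mulr_suml; apply: eq_bigr => j _.
  ring.
apply: eq_bigr => a _; rewrite (bigD1 a)//= NN eqxx mul1r big1 ?addr0 ?expr2// => b ba.
by rewrite NN eq_sym (negbTE ba) mul0r.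
Qed.

Lemma smooth_lap0 u : smooth_on setT u -> smooth_on setT (lap0 u).
Proof.
move=> su; apply: smooth_onN; first exact: openT.
apply: smooth_on_sum => [|i _]; first exact: openT.
by do 2 apply: smooth_on_partial.
Qed.

Lemma half_laplacian_pullback m phi x : smooth_on setT phi ->
  half_laplacian_sq (laplacian (fun=> G0)) (gradient_sqnorm (fun=> G0)) m (fun x => phi (L x)) x
  = euclidean_half_laplacian_sq m phi (L x).
Proof.
rewrite /euclidean_half_laplacian_sq.
move: m {-2}m (leqnn m) phi => m' m.
elim: m' m => [|m' IH]; first by move=> m; rewrite leqn0 => /eqP ->.
case=> [_ //|[|m]] hm phi sphi.
  by rewrite /half_laplacian_sq /= gradient_sqnorm_pullback// gradient_sqnorm_id.
rewrite !half_laplacian_sqSS laplacian_pullback// (IH m (ltnW hm))//; last exact: smooth_lap0.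
by rewrite laplacian_id.
Qed.

End affine_pullback.
End metrics.

Section sums_of_squares.
Context {R : realType}.

Lemma sqr_sum_le (I : Type) (s : seq I) (y : I -> R) :
  (\sum_(i <- s) y i) ^+ 2 <= (size s)%:R * \sum_(i <- s) y i ^+ 2.
Proof.
have e : \sum_(i <- s) \sum_(j <- s) ((y i ^+ 2 + y j ^+ 2) / 2) = (size s)%:R * \sum_(i <- s) y i ^+ 2.
  under eq_bigr do rewrite -mulr_suml big_split/= big_const_seq count_predT iter_addr_0.
  rewrite -mulr_suml big_split/= big_const_seq count_predT iter_addr_0 -sumrMnl.
  have half (a : R) : (a + a) / 2 = a by lra.
  by rewrite half mulr_natl sumrMnl.
rewrite -e expr2 big_distrlr /=; apply: ler_sum => i _; apply: ler_sum => j _.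
by rewrite ler_pdivlMr//; have := sqr_ge0 (y i - y j); nra.
Qed.

Context {n : nat}.

Lemma Dsq_sum_le U m (I : Type) (s : seq I) (f : I -> 'rV[R]_n -> R) x : open U -> U x ->
  (forall i, smooth_on U (f i)) ->
  Dsq m (fun y => \sum_(i <- s) f i y) x <= (size s)%:R * \sum_(i <- s) Dsq m (f i) x.
Proof.
move=> oU Ux; elim: m f => [|m IH] f sf /=; first exact: sqr_sum_le.
rewrite exchange_big mulr_sumr; apply: ler_sum => j _.
rewrite (@eq_Dsq R n U m _ (fun y => \sum_(i <- s) pderiv j (f i) y))//; last first.
  by move=> y Uy; rewrite partial_sum// => i _; exact: smooth_on_diff (sf i) Uy.
by apply: IH => i; exact: smooth_on_partial.
Qed.

Lemma DsqZ U m (a : R) f (x : 'rV[R]_n) : open U -> U x -> smooth_on U f ->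
  Dsq m (fun y => a * f y) x = a ^+ 2 * Dsq m f x.
Proof.
move=> oU Ux; elim: m f => [|m IH] f sf /=; first by rewrite exprMn.
rewrite mulr_sumr; apply: eq_bigr => j _; rewrite -IH; last exact: smooth_on_partial.
by apply: (@eq_Dsq R n U) => // y Uy; rewrite partialZ//; exact: smooth_on_diff sf Uy.
Qed.

(** By the chain rule and Cauchy-Schwarz, one derivative at a time. A crude bound, for coercivity
    and lower order terms, where the size of the constant is irrelevant. *)
Lemma Dsq_pullback_le (N : 'M[R]_n) (w : 'rV[R]_n) m : exists2 C, 0 <= C &
  forall phi x, smooth_on setT phi ->
    Dsq m (fun y => phi (y *m N + w)) x <= C * Dsq m phi (x *m N + w).
Proof.
elim: m => [|m [C C0 IH]]; first by exists 1 => // phi x _ /=; rewrite mul1r.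
pose B := \sum_i \sum_a (N i a) ^+ 2.
have B0 : 0 <= B by apply: sumr_ge0 => i _; apply: sumr_ge0 => a _; exact: sqr_ge0.
exists (C * (n%:R * B)); first by rewrite mulr_ge0// mulr_ge0.
move=> phi x sphi.
apply: (@le_trans _ _ (\sum_i C * (n%:R * \sum_a N i a ^+ 2) * Dsq m.+1 phi (x *m N + w))); last first.
  by rewrite -mulr_suml -!mulr_sumr.
rewrite [Dsq m.+1 _ x]/=; apply: ler_sum => i _.
pose psi z := \sum_a N i a * pderiv a phi z.
have sN a : smooth_on setT (fun z => N i a * pderiv a phi z).
  by apply: smooth_onZ; [exact: openT|exact: smooth_on_partial].
have spsi : smooth_on setT psi by apply: smooth_on_sum => //; exact: openT.
have -> : pderiv i (fun y => phi (y *m N + w)) = (fun y => psi (y *m N + w)).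
  by apply/funext => y; rewrite pderiv_affine.
apply: le_trans (IH psi x spsi) _; rewrite -!mulrA ler_wpM2l//.
apply: le_trans (Dsq_sum_le m (index_enum 'I_n) openT I sN) _.
rewrite -sum1_size big_const_ord iter_addn_0 mul1n ler_wpM2l// mulr_suml; apply: ler_sum => a _.
rewrite (DsqZ _ _ openT I); last exact: smooth_on_partial.
apply: ler_wpM2l; first exact: sqr_ge0.
rewrite /= [leRHS](bigD1 a)//= lerDl sumr_ge0// => b _.
exact: Dsq_ge0.
Qed.

End sums_of_squares.

Section constant_metric.
Context {R : realType} {n : nat}.
Implicit Types (u v : 'rV[R]_n -> R).

Definition metric_square (G : 'rV[R]_n -> 'M[R]_n) m u : 'rV[R]_n -> R :=
  half_laplacian_sq (laplacian G) (gradient_sqnorm G) m u.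

Lemma test_euclidean m u : test u -> test (euclidean_half_laplacian_sq m u).
Proof.
move: m {-2}m (leqnn m) u => m' m.
elim: m' m => [|m' IH]; first by move=> m; rewrite leqn0 => /eqP -> u /(test_Dsq 0).
case=> [_ u /(test_Dsq 0) //|[|m]] hm u tu.
  rewrite (_ : euclidean_half_laplacian_sq 1 u = Dsq 1 u); first exact: test_Dsq.
  by apply/funext => x; exact: gradient_sqnorm_id.
rewrite /euclidean_half_laplacian_sq half_laplacian_sqSS laplacian_id.
have := IH m (ltnW hm) _ (test_lap0 tu).
by rewrite /euclidean_half_laplacian_sq laplacian_id.
Qed.

Lemma test_pullback (M : 'M[R]_n) w u : M \in unitmx -> test u ->
  test (fun x => u (x *m M + w)).
Proof.
move=> uM tu; have [su _] := tu; split; first exact: smooth_pullback.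
have [_ [r hr]] := cc_affine w (test_cc tu) uM.
by exists r => x; rewrite subr0 => /ltW; exact: hr.
Qed.

Variables (k : nat).
Hypotheses (k0 : (0 < k)%N) (kn : (2 * k < n)%N).
Local Notation p := (critical_exponent R n k).

Variable G0 : 'M[R]_n.
Hypothesis pG0 : posdef G0.

(* A linear change of variables turns [G0] into the Euclidean metric. *)
Lemma constant_metric : exists M N : 'M[R]_n,
  [/\ M \in unitmx, N \in unitmx, N *m M = 1%:M, N *m N^T = G0 & forall f, cc f ->
     integral_rV (fun x => f (x *m N + 0)) * Num.sqrt (\det G0) = integral_rV f].
Proof.
have [M [M0 cM MG]] := cholesky pG0.
have uM : M \in unitmx by rewrite unitmxE unitfE gt_eqF.
have uN : invmx M \in unitmx by rewrite unitmx_inv.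
have dM : \det M != 0 by rewrite gt_eqF.
exists M, (invmx M); split => //; first exact: mulVmx.
  rewrite trmx_inv -[RHS](mulKmx uM) -[M *m G0](@mulmxK _ _ _ M^T) ?unitmx_tr//.
  by rewrite MG mul1mx.
have -> : Num.sqrt (\det G0) = (\det M)^-1.
  have := congr1 determinant MG; rewrite !det_mulmx det_tr det1 => h.
  have -> : \det G0 = (\det M)^-1 ^+ 2.
    apply: (mulfI dM); apply: (mulIf dM); rewrite h expr2.
    by rewrite mulrA mulfV// mul1r mulVf.
  by rewrite sqrtr_sqr ger0_norm// invr_ge0 ltW.
move=> f cf; apply: (mulIf dM); rewrite divfK// mulrC.
have := integral_rV_affine 0 cM M0 (cc_affine 0 cf uN) => <-.
by congr (_ * integral_rV _); apply/funext => x; rewrite !addr0 -mulmxA mulmxV// mulmx1.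
Qed.

Lemma metric_square_pullback m v : test v -> forall M N : 'M[R]_n, M \in unitmx -> N *m M = 1%:M ->
  N *m N^T = G0 -> let phi x := v (x *m M + 0) in
  [/\ test phi, v = (fun x => phi (x *m N + 0)) &
    metric_square (fun=> G0) m v = (fun x => euclidean_half_laplacian_sq m phi (x *m N + 0))].
Proof.
move=> tv M N uM NM NG phi.
have tphi : test phi by exact: test_pullback.
have vE : v = (fun x => phi (x *m N + 0)).
  by apply/funext => x; rewrite /phi !addr0 -mulmxA NM mulmx1.
split => //; rewrite vE; apply/funext => x; apply: half_laplacian_pullback => //.
by case: tphi.
Qed.

Lemma test_metric_square m v : test v -> test (metric_square (fun=> G0) m v).
Proof.
move=> tv; have [M [N [uM uN NM NG _]]] := constant_metric.
have [tphi _ ->] := metric_square_pullback m tv uM NM NG.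
by apply: test_pullback => //; exact: test_euclidean.
Qed.

(** Through the linear isometry of [constant_metric] the energy becomes the Euclidean one, whose
    integral equals that of [Dsq]; returning costs a constant. *)
Lemma coercive_constant_metric m : exists2 C, 0 <= C & forall v, test v ->
  integral_rV (Dsq m v) <= C * (integral_rV (metric_square (fun=> G0) m v) * Num.sqrt (\det G0)).
Proof.
have [M [N [uM uN NM NG hI]]] := constant_metric.
have [C C0 hC] := Dsq_pullback_le N 0 m.
have s0 : 0 < Num.sqrt (\det G0) by rewrite sqrtr_gt0 posdef_det.
exists (C / Num.sqrt (\det G0)); first by rewrite divr_ge0// ltW.
move=> v tv; have [tphi vE ->] := metric_square_pullback m tv uM NM NG.
set phi := (fun x => v (x *m M + 0)) in tphi vE *.
rewrite hI; last by apply: test_cc; exact: test_euclidean.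
rewrite integral_half_laplacian_sq// mulrAC ler_pdivlMr// [in leLHS]vE.
rewrite -(hI _ (test_cc (test_Dsq m tphi))) mulrA ler_pM2r// -integral_rVZ; last first.
  by apply: cc_affine => //; apply: test_cc; exact: test_Dsq.
apply: le_integral_rV.
- exact: (test_cc (test_Dsq m (test_pullback 0 uN tphi))).
- by apply: ccZ; apply: cc_affine => //; apply: test_cc; exact: test_Dsq.
- by move=> x; apply: hC; case: tphi.
Qed.

(** Both integrals carry the density of [G0], so each is exactly the Euclidean one of the pulled
    back function and the constant does not change. *)
Lemma sobolev_constant_metric v : test v ->
  (integral_rV (fun x => `|v x| `^ p) * Num.sqrt (\det G0)) `^ (2 / p) <=
  K0 (R := R) n k * (integral_rV (metric_square (fun=> G0) k v) * Num.sqrt (\det G0)).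
Proof.
move=> tv; have [M [N [uM uN NM NG hI]]] := constant_metric.
have [tphi vE ->] := metric_square_pullback k tv uM NM NG.
set phi := (fun x => v (x *m M + 0)) in tphi vE *.
rewrite hI; last by apply: test_cc; exact: test_euclidean.
rewrite integral_half_laplacian_sq// [in leLHS]vE.
have p2 := critical_exponent_gt2 (R := R) k0 kn.
rewrite (hI (fun x => `|phi x| `^ p)); last first.
  by apply: cc_norm_powR; [lra|exact: test_cc].
exact: sobolev_K0.
Qed.

End constant_metric.

(** * Differential operators with smooth coefficients *)

Section smooth_functions_of_matrices.
Context {R : realType} {n : nat} (U : set 'rV[R]_n).
Hypothesis oU : open U.

Lemma smooth_on_powR (g : 'rV[R]_n -> R) (e : R) : smooth_on U g -> (forall x, U x -> 0 < g x) ->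
  smooth_on U (fun x => g x `^ e).
Proof.
move=> sg g0.
have := @smooth_on_family R n (R * R)%type (fun a t => a.1 * t `^ a.2)
  (fun a => (a.1 * a.2, a.2 - 1)) [set t | 0 < t] U g (1, e) oU _ sg g0.
rewrite /=; under eq_fun do rewrite mul1r; apply => -[a b] t /= t0.
have h : is_derive t 1 (a *: (fun t => t `^ b)) (a *: (b * t `^ (b - 1))).
  by apply: is_deriveZ; exact: is_derive1_powR.
by rewrite -mulrA; exact: h.
Qed.

Lemma smooth_on_inv (g : 'rV[R]_n -> R) : smooth_on U g -> (forall x, U x -> 0 < g x) ->
  smooth_on U (fun x => (g x)^-1).
Proof.
move=> sg g0; apply: (eq_smooth_on oU _ (smooth_on_powR (-1) sg g0)) => x Ux.
by rewrite powR_inv1// ltW// g0.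
Qed.

Lemma smooth_on_sqrt (g : 'rV[R]_n -> R) : smooth_on U g -> (forall x, U x -> 0 < g x) ->
  smooth_on U (fun x => Num.sqrt (g x)).
Proof.
move=> sg g0; apply: (eq_smooth_on oU _ (smooth_on_powR 2^-1 sg g0)) => x Ux.
by rewrite powR12_sqrt// ltW// g0.
Qed.

Lemma smooth_on_det m (A : 'rV[R]_n -> 'M[R]_m) : (forall i j, smooth_on U (fun x => A x i j)) ->
  smooth_on U (fun x => \det (A x)).
Proof.
move=> sA; apply: smooth_on_sum => // s _; apply: smooth_onZ => //.
by apply: smooth_on_prod.
Qed.

End smooth_functions_of_matrices.

Section smooth_metric.
Context {R : realType} {n : nat} (U : set 'rV[R]_n) (G : 'rV[R]_n -> 'M[R]_n).
Hypothesis oU : open U.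
Hypothesis sG : forall i j, smooth_on U (fun x => G x i j).
Hypothesis pG : forall x, U x -> posdef (G x).
Local Notation rho := (volume_density G).

Lemma volume_density_gt0 x : U x -> 0 < rho x.
Proof. by move=> Ux; rewrite /volume_density sqrtr_gt0; apply: posdef_det; exact: pG. Qed.

Lemma smooth_volume_density : smooth_on U rho.
Proof.
apply: smooth_on_sqrt => //; first exact: smooth_on_det.
by move=> x Ux; apply: posdef_det; exact: pG.
Qed.

Lemma smooth_invmx i j : smooth_on U (fun x => invmx (G x) i j).
Proof.
apply: (@eq_smooth_on _ _ _ (fun x => (\det (G x))^-1 * cofactor (G x) j i)) => //.
  by move=> x Ux; rewrite /invmx posdef_unit ?mxE//; exact: pG.
apply: smooth_onM => //.
  apply: smooth_on_inv => //; first exact: smooth_on_det.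
  by move=> x Ux; apply: posdef_det; exact: pG.
apply: smooth_onZ => //; apply: smooth_on_det => // a b.
rewrite (_ : (fun x => _) = (fun x => G x (lift j a) (lift i b))) //.
by apply/funext => x; rewrite !mxE.
Qed.

(** First order coefficients of the Laplacian once the divergence is expanded. *)
Definition drift j x := (rho x)^-1 * \sum_i pderiv i (fun y => rho y * invmx (G y) i j) x.

Lemma smooth_drift j : smooth_on U (drift j).
Proof.
apply: smooth_onM => //.
  apply: smooth_on_inv => //; [exact: smooth_volume_density|exact: volume_density_gt0].
apply: smooth_on_sum => // i _; apply: smooth_on_partial; apply: smooth_onM => //.
  exact: smooth_volume_density.
exact: smooth_invmx.
Qed.

Lemma laplacianE u x : smooth_on U u -> U x -> laplacian G u x =
  - (\sum_i \sum_j invmx (G x) i j * pderiv i (pderiv j u) x + \sum_j drift j x * pderiv j u x).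
Proof.
move=> su Ux; rewrite /laplacian /divergence; apply: (congr1 (fun z => - z)).
have r0 : rho x != 0 by rewrite gt_eqF// volume_density_gt0.
have sc i j : smooth_on U (fun y => rho y * invmx (G y) i j).
  by apply: smooth_onM => //; [exact: smooth_volume_density|exact: smooth_invmx].
have e i : partial i (fun y => rho y * gradient G u i y) x =
    \sum_j (rho x * invmx (G x) i j * pderiv i (pderiv j u) x +
      pderiv j u x * pderiv i (fun y => rho y * invmx (G y) i j) x).
  rewrite pderivE (_ : (fun y => _) = (fun y => \sum_j (rho y * invmx (G y) i j) * pderiv j u y)).
    rewrite partial_sum => [|j _]; last first.
      apply: differentiableM; first exact: smooth_on_diff (sc i j) Ux.
      exact: smooth_on_diff (smooth_on_partial j su) Ux.
    apply: eq_bigr => j _; rewrite partialM//; first exact: smooth_on_diff (sc i j) Ux.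
    exact: smooth_on_diff (smooth_on_partial j su) Ux.
  by apply/funext => y; rewrite /gradient mulr_sumr pderivE; apply: eq_bigr => j _; rewrite mulrA.
under eq_bigr do rewrite e big_split/=.
rewrite big_split/= mulrDr; congr (_ + _).
  rewrite mulr_sumr; apply: eq_bigr => i _; rewrite mulr_sumr; apply: eq_bigr => j _.
  by rewrite -mulrA mulKf.
rewrite exchange_big mulr_sumr; apply: eq_bigr => j _; rewrite /drift -mulrA.
by rewrite -mulr_sumr [pderiv j u x * _]mulrC.
Qed.

Lemma smooth_laplacian u : smooth_on U u -> smooth_on U (laplacian G u).
Proof.
move=> su; apply: (@eq_smooth_on _ _ _ (fun x =>
  - (\sum_i \sum_j invmx (G x) i j * pderiv i (pderiv j u) x + \sum_j drift j x * pderiv j u x))) => //.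
  by move=> x Ux; rewrite laplacianE.
apply: smooth_onN => //; apply: smooth_onD => //.
  apply: smooth_on_sum => // i _; apply: smooth_on_sum => // j _.
  apply: smooth_onM => //; first exact: smooth_invmx.
  by do 2 apply: smooth_on_partial.
apply: smooth_on_sum => // j _; apply: smooth_onM => //; first exact: smooth_drift.
exact: smooth_on_partial.
Qed.

Lemma smooth_iter_laplacian j u : smooth_on U u -> smooth_on U (iter j (laplacian G) u).
Proof. by move=> su; elim: j => //= j IH; exact: smooth_laplacian. Qed.

End smooth_metric.

(** * Linear differential operators and their size near a point *)

Section differential_operators.
Context {R : realType} {n : nat} (U : set 'rV[R]_n) (x0 : 'rV[R]_n).
Hypothesis oU : open U.
Hypothesis Ux0 : U x0.
Local Notation F := ('rV[R]_n -> R).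
Implicit Types (T : F -> F) (f u : F).

Definition op (L : seq (F * seq 'I_n)) u (x : 'rV[R]_n) : R :=
  \sum_(c <- L) c.1 x * foldr pderiv u c.2 x.

(** [P] restricts each term of the list, a coefficient with a word of derivatives, so that one set
    of closure lemmas serves both the order bound and the vanishing condition. Agreement with [T] is
    required for smooth [u] and inside [U] only. *)
Definition op_class (P : F * seq 'I_n -> Prop) T := exists2 L,
  forall c, c \in L -> smooth_on U c.1 /\ P c &
  forall u, smooth_on U u -> forall x, U x -> T u x = op L u x.

Definition is_op m := op_class (fun c => size c.2 <= m)%N.

(** With [b] false only orders below [m] are allowed; [b] true adds order exactly [m] with a
    coefficient vanishing at [x0]. *)
Definition op_vanish (b : bool) m (c : F * seq 'I_n) :=
  (size c.2 < m)%N \/ [/\ b, size c.2 = m & c.1 x0 = 0].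

(** What remains of an operator of order [m] after subtraction of the one with coefficients frozen
    at [x0]. *)
Definition small_op m := op_class (op_vanish true m).

Lemma op_class_eq P T T' : (forall u x, smooth_on U u -> U x -> T' u x = T u x) ->
  op_class P T -> op_class P T'.
Proof. by move=> e [L hL h]; exists L => // u su x Ux; rewrite e// h. Qed.

Lemma op_classW (P P' : F * seq 'I_n -> Prop) T : (forall c, P c -> P' c) ->
  op_class P T -> op_class P' T.
Proof. by move=> e [L hL h]; exists L => // c /hL[? ?]; split => //; exact: e. Qed.

Lemma op_class0 P : op_class P (fun _ _ => 0).
Proof. by exists [::] => // u _ x _; rewrite /op big_nil. Qed.

Lemma op_classD P T T' : op_class P T -> op_class P T' ->
  op_class P (fun u x => T u x + T' u x).
Proof.
move=> [L hL h] [L' hL' h']; exists (L ++ L').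
  by move=> c; rewrite mem_cat => /orP[/hL|/hL'].
by move=> u su x Ux; rewrite /op big_cat/= h// h'.
Qed.

Lemma op_class_sum P (I : Type) (s : seq I) (T : I -> F -> F) : (forall i, op_class P (T i)) ->
  op_class P (fun u x => \sum_(i <- s) T i u x).
Proof.
move=> h; elim: s => [|i s IH].
  by apply: op_class_eq (op_class0 P) => u x _ _; rewrite big_nil.
by apply: op_class_eq (op_classD (h i) IH) => u x _ _; rewrite big_cons.
Qed.

Lemma op_classM (P P' : F * seq 'I_n -> Prop) f T : smooth_on U f ->
  (forall c, P c -> P' ((fun x => f x * c.1 x), c.2)) ->
  op_class P T -> op_class P' (fun u x => f x * T u x).
Proof.
move=> sf hP [L hL h]; exists [seq ((fun x => f x * c.1 x), c.2) | c <- L].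
  by move=> _ /mapP[c /hL[sc Pc] ->]; split; [exact: smooth_onM|exact: hP].
move=> u su x Ux; rewrite h// /op big_map mulr_sumr.
by apply: eq_bigr => c _; rewrite mulrA.
Qed.

Lemma op_class_partial (P P' : F * seq 'I_n -> Prop) i T :
  (forall c, P c -> P' (c.1, i :: c.2) /\ P' (pderiv i c.1, c.2)) ->
  op_class P T -> op_class P' (fun u => pderiv i (T u)).
Proof.
move=> hP [L hL h].
exists ([seq (c.1, i :: c.2) | c <- L] ++ [seq (pderiv i c.1, c.2) | c <- L]).
  move=> c; rewrite mem_cat => /orP[] /mapP[d /hL[sd Pd] ->] /=.
    by split => //; exact: (hP _ Pd).1.
  by split; [exact: smooth_on_partial|exact: (hP _ Pd).2].
move=> u su x Ux.
rewrite (@eq_partial R n U _ (op L u))//; last by move=> y Uy; rewrite h.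
rewrite /op big_cat !big_map/=.
have sd s : smooth_on U (foldr pderiv u s) by exact: smooth_on_partials.
elim: L hL {h} => [|c L IH] hL.
  rewrite !big_nil addr0 (_ : (fun _ => _) = (fun=> 0)); first exact: partial_cst.
  by apply/funext => y; rewrite big_nil.
have [sc _] := hL c (mem_head _ _).
have dc : differentiable c.1 x := smooth_on_diff sc Ux.
have du : differentiable (foldr pderiv u c.2) x := smooth_on_diff (sd _) Ux.
rewrite !big_cons (_ : (fun _ => _) =
  (fun y => c.1 y * foldr pderiv u c.2 y + \sum_(d <- L) d.1 y * foldr pderiv u d.2 y)); last first.
  by apply/funext => y; rewrite big_cons.
have hL' d : d \in L -> smooth_on U d.1 /\ P d by move=> dL; apply: hL; rewrite inE dL orbT.
rewrite partialD; [|exact: differentiableM|].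
  rewrite IH// partialM// [foldr _ _ _ x * _]mulrC.
  by rewrite addrACA.
have : smooth_on U (fun y => \sum_(d <- L) d.1 y * foldr pderiv u d.2 y).
  elim: L hL' {hL IH} => [|d L IH] hL.
    by apply: (eq_smooth_on oU _ (smooth_on_cst 0 oU)) => y _; rewrite big_nil.
  have [sd' _] := hL d (mem_head _ _).
  have {}IH : smooth_on U (fun y => \sum_(d <- L) d.1 y * foldr pderiv u d.2 y).
    by apply: IH => e eL; apply: hL; rewrite inE eL orbT.
  apply: (eq_smooth_on oU _ (smooth_onD oU (smooth_onM oU sd' (sd d.2)) IH)).
  by move=> y _; rewrite big_cons.
by move=> s; exact: smooth_on_diff s Ux.
Qed.

Lemma is_op_id : is_op 0 id.
Proof.
exists [:: (fun=> 1, [::])]; last by move=> u _ x _; rewrite /op big_seq1 mul1r.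
by move=> c; rewrite inE => /eqP ->; split => //; exact: smooth_on_cst.
Qed.

Lemma is_opW m m' T : (m <= m')%N -> is_op m T -> is_op m' T.
Proof. by move=> mm; apply: op_classW => c /leq_trans; exact. Qed.

Lemma is_op_partial m i T : is_op m T -> is_op m.+1 (fun u => pderiv i (T u)).
Proof. by apply: op_class_partial => c /= h; split => //; exact: leqW. Qed.

Lemma is_opM m f T : smooth_on U f -> is_op m T -> is_op m (fun u x => f x * T u x).
Proof. by move=> sf; exact: op_classM. Qed.

(** When the derivative hits a coefficient, its vanishing at [x0] is lost, but the term then has
    order at most [m] and counts as lower order. *)
Lemma small_op_partial m i T : small_op m T -> small_op m.+1 (fun u => pderiv i (T u)).
Proof.
apply: op_class_partial => c /= [h|[_ h c0]]; split.
- by left.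
- by left; exact: leqW.
- by right; split => //=; rewrite h.
- by left; rewrite /= h.
Qed.

Lemma small_opM m f T : smooth_on U f -> small_op m T -> small_op m (fun u x => f x * T u x).
Proof.
move=> sf; apply: op_classM => // c [h|[_ h c0]]; first by left.
by right; split => //=; rewrite c0 mulr0.
Qed.

Lemma small_op_vanish m f T : smooth_on U f -> f x0 = 0 -> is_op m T ->
  small_op m (fun u x => f x * T u x).
Proof.
move=> sf f0; apply: op_classM => // c /=; rewrite leq_eqVlt => /orP[/eqP h|h]; last by left.
by right; split => //=; rewrite f0 mul0r.
Qed.

Lemma is_op_small m T : is_op m T -> small_op m.+1 T.
Proof. by apply: op_classW => c h; left. Qed.

Lemma coef_near (f : F) (e : R) : smooth_on U f -> 0 < e ->
  \forall x \near x0, `|f x - f x0| < e.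
Proof.
move=> sf e0; have := smooth_on_cont sf Ux0; move/cvgrPdist_lt => /(_ e e0).
by apply: filterS => x; rewrite distrC.
Qed.

Lemma coef_bounded (f : F) : smooth_on U f -> \forall x \near x0, f x ^+ 2 <= (`|f x0| + 1) ^+ 2.
Proof.
move=> sf; apply: filterS (coef_near sf ltr01) => x hx.
rewrite -[leLHS]real_normK ?num_real// ler_pXn2r// ?nnegrE ?addr_ge0//.
by rewrite -[f x](subrK (f x0)) (le_trans (ler_normD _ _))// addrC lerD2l ltW.
Qed.

Lemma op_vanish_near b m T (e : R) : op_class (op_vanish b m) T -> 0 < e -> exists2 C, 0 <= C &
  \forall x \near x0, forall u, smooth_on U u ->
    T u x ^+ 2 <= b%:R * e * Dsq m u x + C * jet m u x.
Proof.
move=> [L hL h] e0.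
have arith1 (a s c1 j C b' d' D : R) : a <= c1 * j -> s <= b' * (d' / 2) * D + C * j ->
  0 <= b' * d' * D -> a + s <= b' * d' * D + (c1 + C) * j by move=> *; lra.
have arith2 (a s d' D Cj : R) : a <= d' / 2 * D -> s <= d' / 2 * D + Cj -> a + s <= d' * D + Cj.
  by move=> *; lra.
have [C C0 hC] : exists2 C, 0 <= C & \forall x \near x0, forall u, smooth_on U u ->
    \sum_(c <- L) (c.1 x * foldr pderiv u c.2 x) ^+ 2 <=
    b%:R * (e / ((size L).+1)%:R) * Dsq m u x + C * jet m u x.
  (* Compensates the number of terms lost in [sqr_sum_le]; the successor covers the empty list. *)
  have : 0 < e / ((size L).+1)%:R by rewrite divr_gt0.
  move: (e / _) => d; elim: L hL {h} d => [|c L IH] hL d d0.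
    exists 0 => //; apply: (@filterE _ (nbhs x0) (nbhs_filter x0)) => x u _.
    by rewrite big_nil mul0r addr0 mulr_ge0 ?Dsq_ge0// mulr_ge0// ltW.
  have d2 : 0 < d / 2 by rewrite divr_gt0.
  have [c' cL|C C0 hC] := IH _ (d / 2) d2; first by apply: hL; rewrite inE cL orbT.
  have [sc [hc|[b1 hc c0]]] := hL c (mem_head _ _).
    exists ((`|c.1 x0| + 1) ^+ 2 + C); first by rewrite addr_ge0// sqr_ge0.
    apply: filterS2 (coef_bounded sc) hC => x cx hx u su; rewrite big_cons.
    have h1 : (c.1 x * foldr pderiv u c.2 x) ^+ 2 <= (`|c.1 x0| + 1) ^+ 2 * jet m u x.
      rewrite exprMn; apply: ler_pM; rewrite ?sqr_ge0//; exact: partials_jet.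
    have h2 := hx u su; have h3 := Dsq_ge0 m u x.
    have h4 : 0 <= b%:R * d * Dsq m u x by rewrite !mulr_ge0// ltW.
    exact: (arith1 _ _ _ _ _ _ _ _ h1 h2 h4).
  have sd : 0 < Num.sqrt (d / 2) by rewrite sqrtr_gt0.
  exists C => //; apply: filterS2 (coef_near sc sd) hC => x cx hx u su; rewrite big_cons.
  have h1 : (c.1 x * foldr pderiv u c.2 x) ^+ 2 <= d / 2 * Dsq m u x.
    rewrite exprMn; apply: ler_pM; rewrite ?sqr_ge0//; last by rewrite -hc; exact: Dsq_partials.
    move: cx; rewrite c0 subr0 => /ltW cx.
    by rewrite -[leLHS]real_normK ?num_real// -[leRHS]sqr_sqrtr ?(ltW d2)// ler_pXn2r// nnegrE ltW.
  have h2 := hx u su.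
  move: h2; rewrite b1 !mul1r => h2; exact: (arith2 _ _ _ _ _ h1 h2).
have sL : 0 < ((size L).+1)%:R :> R by [].
exists ((size L).+1%:R * C); first by rewrite mulr_ge0.
have nU : \forall x \near x0, U x by exact: open_near oU Ux0 _.
apply: filterS2 nU hC => x Ux hx u su; rewrite h// /op.
apply: le_trans (sqr_sum_le _ _) _.
apply: (@le_trans _ _ ((size L).+1%:R * (b%:R * (e / (size L).+1%:R) * Dsq m u x + C * jet m u x))).
  apply: ler_pM => //; last exact: hx.
  - by apply: sumr_ge0 => c _; exact: sqr_ge0.
  - by rewrite ler_nat.
rewrite mulrDr [in leLHS]mulrA mulrCA [_ * (e / _)]mulrC divfK ?gt_eqF//.
by rewrite mulrA.
Qed.

Lemma small_op_near m T (e : R) : small_op m T -> 0 < e -> exists2 C, 0 <= C &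
  \forall x \near x0, forall u, smooth_on U u -> T u x ^+ 2 <= e * Dsq m u x + C * jet m u x.
Proof.
move=> sT e0; have [C C0 h] := op_vanish_near sT e0.
by exists C => //; apply: filterS h => x h u su; rewrite -[e]mul1r; exact: h.
Qed.

Lemma is_op_near m T : is_op m T -> exists2 C, 0 <= C &
  \forall x \near x0, forall u, smooth_on U u -> T u x ^+ 2 <= C * jet m.+1 u x.
Proof.
move=> iT; have hT : op_class (op_vanish false m.+1) T by apply: op_classW iT => c h; left.
have [C C0 h] := op_vanish_near hT ltr01.
exists C => //; apply: filterS h => x h u su.
by apply: le_trans (h u su) _; rewrite !mul0r add0r.
Qed.

End differential_operators.

(** * Leibniz' rule and cut-off functions *)

Section leibniz.
Context {R : realType} {n : nat} (U : set 'rV[R]_n).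
Hypothesis oU : open U.
Implicit Types (eta u : 'rV[R]_n -> R).

(** The terms of Leibniz' rule in which at least one derivative falls on the first factor; the
    component for the second factor is therefore strictly shorter than [s]. *)
Fixpoint proper_splits (s : seq 'I_n) : seq (seq 'I_n * seq 'I_n) :=
  if s is i :: s' then ([:: i], s') ::
    [seq (i :: c.1, c.2) | c <- proper_splits s'] ++ [seq (c.1, i :: c.2) | c <- proper_splits s']
  else [::].

Lemma proper_splits_size s c : c \in proper_splits s ->
  (size c.1 <= size s)%N /\ (size c.2 < size s)%N.
Proof.
elim: s c => [|i s IH] c //=; rewrite inE mem_cat => /orP[/eqP -> //|/orP[]] /mapP[d /IH[h1 h2] ->] /=.
  by split => //; exact: ltnW.
by split => //; exact: leqW.
Qed.

Lemma partials_leibniz s eta u x : smooth_on U eta -> smooth_on U u -> U x ->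
  foldr pderiv (fun y => eta y * u y) s x = eta x * foldr pderiv u s x +
    \sum_(c <- proper_splits s) foldr pderiv eta c.1 x * foldr pderiv u c.2 x.
Proof.
move=> se su; elim: s x => [|i s IH] x Ux /=; first by rewrite big_nil addr0.
rewrite (eq_partial i oU Ux IH).
have de t : smooth_on U (foldr pderiv eta t) by exact: smooth_on_partials.
have du t : smooth_on U (foldr pderiv u t) by exact: smooth_on_partials.
have dd c : differentiable (fun y => foldr pderiv eta c.1 y * foldr pderiv u c.2 y) x.
  by apply: smooth_on_diff (smooth_onM oU (de c.1) (du c.2)) Ux.
rewrite partialD; last 2 first.
- by apply: smooth_on_diff (smooth_onM oU se (du s)) Ux.
- exact: differentiable_bigsum.
rewrite partial_sum// partialM; last 2 first.
- exact: smooth_on_diff se Ux.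
- exact: smooth_on_diff (du s) Ux.
rewrite big_cons big_cat !big_map/= -addrA; congr (_ + _).
rewrite [foldr _ _ _ x * _]mulrC; congr (_ + _); rewrite addrC -big_split/=.
apply: eq_bigr => c _; rewrite partialM; last 2 first.
- exact: smooth_on_diff (de _) Ux.
- exact: smooth_on_diff (du _) Ux.
by congr (_ + _); exact: mulrC.
Qed.

(** In the commutator some derivative falls on [eta], so at most [m - 1] fall on [u]: this is why
    [jet m u], without [Dsq m u], suffices. *)
Lemma commutator_le s m : (size s <= m)%N -> exists2 C, 0 <= C & forall eta u x,
  smooth_on U eta -> smooth_on U u -> U x ->
  (foldr pderiv (fun y => eta y * u y) s x - eta x * foldr pderiv u s x) ^+ 2 <=
  C * (jet m.+1 eta x * jet m u x).
Proof.
move=> sm; exists ((size (proper_splits s))%:R * (size (proper_splits s))%:R); first by rewrite mulr_ge0.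
move=> eta u x se su Ux; rewrite partials_leibniz// addrC addKr.
apply: le_trans (sqr_sum_le _ _) _; rewrite -mulrA; apply: ler_wpM2l => //.
have h c : c \in proper_splits s -> (foldr pderiv eta c.1 x * foldr pderiv u c.2 x) ^+ 2 <=
    jet m.+1 eta x * jet m u x.
  move=> /proper_splits_size[h1 h2]; rewrite exprMn; apply: ler_pM; rewrite ?sqr_ge0//.
    by apply: partials_jet; rewrite ltnS; exact: leq_trans sm.
  by apply: partials_jet; exact: leq_trans sm.
elim: (proper_splits s) h => [|c L IH] h; first by rewrite big_nil mul0r.
rewrite big_cons -natr1 mulrDl mul1r addrC; apply: lerD; last by apply: h; exact: mem_head.
by apply: IH => d dL; apply: h; rewrite inE dL orbT.
Qed.

Lemma jet_partial m i u x : jet m (pderiv i u) x <= jet m.+1 u x.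
Proof.
rewrite /jet big_ord_recl; apply: ler_wpDl; first exact: Dsq_ge0.
by apply: ler_sum => a _ /=; rewrite (bigD1 i)//= lerDl sumr_ge0// => j _; exact: Dsq_ge0.
Qed.

Lemma DsqM_le m : exists2 C, 0 <= C & forall eta u x,
  smooth_on U eta -> smooth_on U u -> U x ->
  Dsq m (fun y => eta y * u y) x <= C * (jet m.+1 eta x * jet m.+1 u x).
Proof.
elim: m => [|m [C C0 IH]].
  by exists 1 => // eta u x se su Ux; rewrite mul1r /jet !big_ord1 /= exprMn.
exists (n%:R * (4 * C)); first by rewrite mulr_ge0// mulr_ge0.
move=> eta u x se su Ux /=.
have h i : Dsq m (pderiv i (fun y => eta y * u y)) x <= 4 * C * (jet m.+2 eta x * jet m.+2 u x).
  have sp w : smooth_on U w -> smooth_on U (pderiv i w) by exact: smooth_on_partial.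
  rewrite (@eq_Dsq R n U m _ (fun y => eta y * pderiv i u y + pderiv i eta y * u y))//; last first.
    move=> y Uy; rewrite partialM; [by rewrite [u y * _]mulrC| |].
      exact: smooth_on_diff se Uy.
    exact: smooth_on_diff su Uy.
  have s1 := smooth_onM oU se (sp _ su); have s2 := smooth_onM oU (sp _ se) su.
  apply: le_trans (DsqD_le m oU Ux ltr01 s1 s2) _.
  have h1 := IH _ _ x se (sp _ su) Ux; have h2 := IH _ _ x (sp _ se) su Ux.
  have j1 : jet m.+1 eta x * jet m.+1 (pderiv i u) x <= jet m.+2 eta x * jet m.+2 u x.
    by apply: ler_pM; rewrite ?jet_ge0//; [exact: le_jet|exact: jet_partial].
  have j2 : jet m.+1 (pderiv i eta) x * jet m.+1 u x <= jet m.+2 eta x * jet m.+2 u x.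
    by apply: ler_pM; rewrite ?jet_ge0//; [exact: jet_partial|exact: le_jet].
  have := ler_wpM2l C0 j1; have := ler_wpM2l C0 j2.
  move: h1 h2; move: (Dsq m _ x) (Dsq m _ x) (C * _) (C * _) => a b c d h1 h2 h3 h4.
  rewrite invr1 -[4 * C * _]mulrA; move: h3 h4; move: (C * _) => e h3 h4; lra.
apply: le_trans (ler_sum _ (fun i _ => h i)) _.
by rewrite sumr_const card_ord -[leRHS]mulrA [leRHS]mulr_natl.
Qed.

Lemma jetM_le m : exists2 C, 0 <= C & forall eta u x,
  smooth_on U eta -> smooth_on U u -> U x ->
  jet m (fun y => eta y * u y) x <= C * (jet m eta x * jet m u x).
Proof.
elim: m => [|m [C C0 IH]].
  by exists 0 => // eta u x _ _ _; rewrite mul0r /jet big_ord0.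
have [C' C'0 hD] := DsqM_le m.
exists (C + C'); first by rewrite addr_ge0.
move=> eta u x se su Ux; rewrite jetS mulrDl; apply: lerD; last exact: hD.
apply: le_trans (IH _ _ _ se su Ux) _; rewrite ler_wpM2l//.
by apply: ler_pM; rewrite ?jet_ge0//; exact: le_jet.
Qed.

(** Induction from the identity expressing [eta] times a derivative of [u] as the derivative of
    [eta u] minus a derivative of [eta] times [u]. It recovers the top derivatives of [u] from those
    of the cut-off function, up to lower order. *)
Lemma Dsq_cutoff m : exists2 C, 0 <= C & forall eta u x,
  smooth_on U eta -> smooth_on U u -> U x ->
  eta x ^+ 2 * Dsq m u x <= C * (Dsq m (fun y => eta y * u y) x + jet m.+1 eta x * jet m u x).
Proof.
elim: m => [|m [C C0 IH]].
  by exists 1 => // eta u x se su Ux; rewrite mul1r /= exprMn lerDl mulr_ge0// jet_ge0.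
have [C' C'0 hD] := DsqM_le m.
exists (C * (2 + n%:R * (2 * C' + 1))).
  by rewrite mulr_ge0// addr_ge0// mulr_ge0// addr_ge0// mulr_ge0.
move=> eta u x se su Ux /=.
set J := jet m.+2 eta x * jet m.+1 u x.
have J0 : 0 <= J by rewrite mulr_ge0 ?jet_ge0.
have h i : eta x ^+ 2 * Dsq m (pderiv i u) x <=
    C * (2 * Dsq m (pderiv i (fun y => eta y * u y)) x + (2 * C' + 1) * J).
  have sp w : smooth_on U w -> smooth_on U (pderiv i w) by exact: smooth_on_partial.
  apply: le_trans (IH _ _ _ se (sp _ su) Ux) _; apply: ler_wpM2l => //.
  have s1 : smooth_on U (pderiv i (fun y => eta y * u y)).
    by apply: smooth_on_partial; exact: smooth_onM.
  have s2 := smooth_onN oU (smooth_onM oU (sp _ se) su).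
  have := DsqD_le m oU Ux ltr01 s1 s2; rewrite (DsqN m oU Ux (smooth_onM oU (sp _ se) su)).
  rewrite (@eq_Dsq R n U m _ (fun y => eta y * pderiv i u y) _ oU Ux); last first.
    move=> y Uy; rewrite partialM; [by rewrite [pderiv i eta y * _]mulrC addrK| |].
      exact: smooth_on_diff se Uy.
    exact: smooth_on_diff su Uy.
  have h2 := hD _ _ x (sp _ se) su Ux.
  have j1 : jet m.+1 eta x * jet m (pderiv i u) x <= J.
    by apply: ler_pM; rewrite ?jet_ge0//; [exact: le_jet|exact: jet_partial].
  have j2 : jet m.+1 (pderiv i eta) x * jet m.+1 u x <= J.
    by apply: ler_pM; rewrite ?jet_ge0//; exact: jet_partial.
  have arith (a b c d e : R) : a <= (1 + 1) * b + (1 + 1^-1) * c -> c <= e -> d <= J ->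
    e <= C' * J -> a + d <= 2 * b + (2 * C' + 1) * J by rewrite invr1 => *; lra.
  by move=> h3; apply: arith h3 h2 j1 _; exact: ler_wpM2l.
rewrite mulr_sumr; apply: le_trans (ler_sum _ (fun i _ => h i)) _.
rewrite -mulr_sumr -mulrA ler_wpM2l// big_split/= -mulr_sumr sumr_const card_ord -[(_ * J) *+ n]mulr_natl.
set D := \sum_i _; have D0 : 0 <= D by apply: sumr_ge0 => i _; exact: Dsq_ge0.
have n0 : 0 <= n%:R * (2 * C' + 1) :> R by rewrite mulr_ge0// addr_ge0// mulr_ge0.
have arith (a : R) : 0 <= a * D -> 2 * D + a * J <= (2 + a) * (D + J) by move=> *; lra.
by rewrite mulrA; apply: arith; exact: mulr_ge0.
Qed.

End leibniz.

Section quadratic_forms.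
Context {R : realType} {n : nat}.

Definition metric_form (A : 'M[R]_n) (a b : 'I_n -> R) : R :=
  \sum_i \sum_j invmx A i j * a i * b j.

Lemma metric_form_ge0 (A : 'M[R]_n) a : posdef A -> 0 <= metric_form A a a.
Proof.
move=> pA; have uA := posdef_unit pA; have [AT Apos] := pA.
pose v : 'rV[R]_n := \row_i a i; pose w := v *m invmx A.
have -> : metric_form A a a = (w *m A *m w^T) ord0 ord0.
  rewrite /w mulmxKV// trmx_mul trmx_inv AT mulmxA mxE /metric_form exchange_big.
  apply: eq_bigr => j _; rewrite !mxE mulr_suml; apply: eq_bigr => i _.
  by rewrite !mxE [a i * _]mulrC.
have [->|w0] := eqVneq w 0; first by rewrite !mul0mx mxE.
exact: ltW (Apos _ w0).
Qed.

Lemma metric_formD_le (A : 'M[R]_n) a b (e : R) : posdef A -> 0 < e ->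
  metric_form A (fun i => a i + b i) (fun i => a i + b i) <=
  (1 + e) * metric_form A a a + (1 + e^-1) * metric_form A b b.
Proof.
move=> pA e0; rewrite -subr_ge0.
have -> : (1 + e) * metric_form A a a + (1 + e^-1) * metric_form A b b -
    metric_form A (fun i => a i + b i) (fun i => a i + b i) =
    e^-1 * metric_form A (fun i => e * a i - b i) (fun i => e * a i - b i).
  rewrite /metric_form !mulr_sumr -big_split -sumrB/=; apply: eq_bigr => i _.
  rewrite !mulr_sumr -big_split -sumrB/=; apply: eq_bigr => j _.
  by field; rewrite gt_eqF.
by rewrite mulr_ge0 ?metric_form_ge0// invr_ge0 ltW.
Qed.

Lemma metric_formZ (A : 'M[R]_n) a (c : R) :
  metric_form A (fun i => c * a i) (fun i => c * a i) = c ^+ 2 * metric_form A a a.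
Proof.
rewrite /metric_form mulr_sumr; apply: eq_bigr => i _; rewrite mulr_sumr.
by apply: eq_bigr => j _; ring.
Qed.

Lemma metric_form_bound (A : 'M[R]_n) a :
  metric_form A a a <= (\sum_i \sum_j (invmx A i j ^+ 2 + 1)) * \sum_i a i ^+ 2.
Proof.
rewrite mulr_suml; apply: ler_sum => i _; rewrite mulr_suml; apply: ler_sum => j _.
have h l : a l ^+ 2 <= \sum_i a i ^+ 2.
  by rewrite (bigD1 l)//= lerDl sumr_ge0// => m _; exact: sqr_ge0.
have h1 := h i; have h2 := h j; move: h1 h2.
move: (\sum_i _) (invmx _ _ _) (a i) (a j) => S P x y h1 h2.
have S0 : 0 <= S by apply: le_trans h1; exact: sqr_ge0.
have xy : `|x * y| <= S.
  have := sqr_ge0 (`|x| - `|y|); rewrite normrM -(real_normK (num_real x)) in h1 *.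
  rewrite -(real_normK (num_real y)) in h2; move: `|x| `|y| h1 h2 => z w *; nra.
have P1 : `|P| <= P ^+ 2 + 1.
  by rewrite -(real_normK (num_real P)); have := sqr_ge0 (`|P| - 1); have := normr_ge0 P; move: `|P| => z *; nra.
apply: le_trans (ler_norm _) _; rewrite -mulrA normrM.
exact: ler_pM.
Qed.

End quadratic_forms.

Section partial_derivatives.
Context {R : realType} {n : nat} (U : set 'rV[R]_n).
Hypothesis oU : open U.
Implicit Types (f g : 'rV[R]_n -> R).

Lemma partialB f g i x : smooth_on U f -> smooth_on U g -> U x ->
  pderiv i (fun y => f y - g y) x = pderiv i f x - pderiv i g x.
Proof.
move=> sf sg Ux; rewrite -[- pderiv i g x]mulN1r -(partialZ _ _ (smooth_on_diff sg Ux)).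
rewrite -partialD; last 2 first.
- exact: smooth_on_diff sf Ux.
- by apply: differentiableM; [exact: differentiable_cst|exact: smooth_on_diff sg Ux].
by apply: (eq_partial _ oU Ux) => z _; rewrite mulN1r.
Qed.

Lemma partials_add s f g x : smooth_on U f -> smooth_on U g -> U x ->
  foldr pderiv (fun y => f y + g y) s x = foldr pderiv f s x + foldr pderiv g s x.
Proof.
move=> sf sg; elim: s x => [//|i s IH] x Ux /=.
rewrite (eq_partial i oU Ux IH) partialD//.
  exact: (smooth_on_diff (smooth_on_partials s sf) Ux).
exact: (smooth_on_diff (smooth_on_partials s sg) Ux).
Qed.

End partial_derivatives.

(** * Comparison with the metric frozen at [x0] *)

Section local_estimates.
Context {R : realType} {n : nat} (U : set 'rV[R]_n) (x0 : 'rV[R]_n).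
Hypothesis oU : open U.
Hypothesis Ux0 : U x0.
Local Notation F := ('rV[R]_n -> R).
Local Notation is_op := (is_op U).
Local Notation small_op := (small_op U x0).
Implicit Types (T : F -> F) (u v eta : F) (G : 'rV[R]_n -> 'M[R]_n).

Definition smooth_metric G :=
  (forall i j, smooth_on U (fun x => G x i j)) /\ forall x, U x -> posdef (G x).

Lemma op_smooth P T u : op_class U P T -> smooth_on U u -> smooth_on U (T u).
Proof.
move=> [L hL h] su; apply: (@eq_smooth_on _ _ _ (op L u)) => //; first by move=> x Ux; rewrite h.
elim: L hL {h} => [|d L IH] hL.
  by apply: (eq_smooth_on oU _ (smooth_on_cst 0 oU)) => y _; rewrite /op big_nil.
have [sd _] := hL d (mem_head _ _).
have {}IH : smooth_on U (op L u) by apply: IH => e eL; apply: hL; rewrite inE eL orbT.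
apply: (eq_smooth_on oU _ (smooth_onD oU (smooth_onM oU sd (smooth_on_partials d.2 su)) IH)).
by move=> y _; rewrite /op big_cons.
Qed.

Lemma is_opN m T : is_op m T -> is_op m (fun u x => - T u x).
Proof.
move=> iT; apply: (op_class_eq _ (is_opM oU (smooth_on_cst (-1) oU) iT)) => u x _ _.
by rewrite mulN1r.
Qed.

Lemma small_opN m T : small_op m T -> small_op m (fun u x => - T u x).
Proof.
move=> iT; apply: (op_class_eq _ (small_opM oU (smooth_on_cst (-1) oU) iT)) => u x _ _.
by rewrite mulN1r.
Qed.

Lemma is_op_laplacian m G T : smooth_metric G -> is_op m T ->
  is_op m.+2 (fun u => laplacian G (T u)).
Proof.
move=> [sG pG] iT.
apply: (op_class_eq (T := fun u x => - (\sum_i \sum_j invmx (G x) i j * pderiv i (pderiv j (T u)) x +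
  \sum_j drift G j x * pderiv j (T u) x))).
  by move=> u x su Ux; rewrite (laplacianE oU sG pG)//; exact: op_smooth iT su.
apply: is_opN; apply: op_classD.
  apply: op_class_sum => i; apply: op_class_sum => j.
  apply: is_opM => //; first exact: smooth_invmx.
  by do 2 apply: is_op_partial => //.
apply: op_class_sum => j; apply: is_opM => //; first exact: smooth_drift.
by apply: (@is_opW _ _ _ m.+1) => //; exact: is_op_partial.
Qed.

Lemma is_op_iter_laplacian j G : smooth_metric G -> is_op j.*2 (iter j (laplacian G)).
Proof.
move=> sG; elim: j => [|j IH]; first exact: is_op_id.
exact: is_op_laplacian sG IH.
Qed.

Lemma constant_smooth_metric G : smooth_metric G -> smooth_metric (fun=> G x0).
Proof. by move=> [sG pG]; split => [i j|x _]; [exact: smooth_on_cst|exact: pG]. Qed.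

Lemma small_op_laplacian m G T T0 : smooth_metric G -> is_op m T -> is_op m T0 ->
  small_op m (fun u x => T u x - T0 u x) ->
  small_op m.+2 (fun u x => laplacian G (T u) x - laplacian (fun=> G x0) (T0 u) x).
Proof.
move=> sG iT iT0 sT; have [sG1 pG1] := sG; have [sG2 pG2] := constant_smooth_metric sG.
pose D u := fun x => T u x - T0 u x.
apply: (op_class_eq (T := fun u x => - (\sum_i \sum_j (invmx (G x) i j * pderiv i (pderiv j (D u)) x +
      (invmx (G x) i j - invmx (G x0) i j) * pderiv i (pderiv j (T0 u)) x) +
    \sum_j (drift G j x * pderiv j (T u) x + - (drift (fun=> G x0) j x * pderiv j (T0 u) x))))).
  move=> u x su Ux; have s1 := op_smooth iT su; have s2 := op_smooth iT0 su.
  rewrite (laplacianE oU sG1 pG1 s1 Ux) (laplacianE oU sG2 pG2 s2 Ux).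
  rewrite opprK addrC -opprB; apply: (congr1 (fun z => - z)).
  rewrite opprD addrACA; congr (_ + _); last by rewrite -sumrN -big_split.
  rewrite -sumrN -big_split/=; apply: eq_bigr => i _; rewrite -sumrN -big_split/=; apply: eq_bigr => j _.
  have -> : pderiv i (pderiv j (D u)) x = pderiv i (pderiv j (T u)) x - pderiv i (pderiv j (T0 u)) x.
    rewrite -(partialB oU)//; [|exact: smooth_on_partial|exact: smooth_on_partial].
    by apply: (eq_partial _ oU Ux) => y Uy; rewrite (partialB oU).
  by ring.
apply: small_opN; apply: op_classD.
  apply: op_class_sum => i; apply: op_class_sum => j; apply: op_classD.
    apply: small_opM => //; first exact: smooth_invmx.
    by do 2 apply: small_op_partial => //.
  apply: small_op_vanish => //; last by do 2 apply: is_op_partial => //.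
    by apply: smooth_onB => //; [exact: smooth_invmx|exact: smooth_on_cst].
  by rewrite subrr.
apply: op_class_sum => j; apply: op_classD.
  apply: is_op_small; apply: is_opM => //; first exact: smooth_drift.
  exact: is_op_partial.
apply: is_op_small; apply: is_opN; apply: is_opM => //; first exact: smooth_drift.
exact: is_op_partial.
Qed.

Lemma small_op_iter_laplacian j G : smooth_metric G ->
  small_op j.*2 (fun u x => iter j (laplacian G) u x - iter j (laplacian (fun=> G x0)) u x).
Proof.
move=> sG; elim: j => [|j IH].
  by apply: op_class_eq (op_class0 _ _) => u x _ _; rewrite subrr.
apply: small_op_laplacian => //; apply: is_op_iter_laplacian => //.
exact: constant_smooth_metric.
Qed.

Lemma near_bound_sum (I : Type) (s : seq I) (Z : Type) (P : Z -> Prop)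
    (f : I -> Z -> 'rV[R]_n -> R) (B : Z -> 'rV[R]_n -> R) :
  (forall i, exists2 C, 0 <= C & \forall x \near x0, forall z, P z -> f i z x <= C * B z x) ->
  exists2 C, 0 <= C & \forall x \near x0, forall z, P z -> \sum_(i <- s) f i z x <= C * B z x.
Proof.
move=> h; elim: s => [|i s [C C0 IH]].
  exists 0 => //; apply: (@filterE _ (nbhs x0) (nbhs_filter x0)) => x z _.
  by rewrite big_nil mul0r.
have [C' C'0 hi] := h i; exists (C' + C); first exact: addr_ge0.
by apply: filterS2 hi IH => x h1 h2 z Pz; rewrite big_cons mulrDl lerD// ?h1 ?h2.
Qed.

(** For expressions quadratic in the derivatives of [u]. The neighbourhood and [C] may depend on
    [e], not on [u]. *)
Definition near_small m (f : F -> F) := forall e : R, 0 < e -> exists2 C, 0 <= C &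
  \forall x \near x0, forall u, smooth_on U u -> `|f u x| <= e * Dsq m u x + C * jet m u x.

Lemma near_small_eq m f g : (forall u x, smooth_on U u -> U x -> g u x = f u x) ->
  near_small m f -> near_small m g.
Proof.
move=> e hf d d0; have [C C0 h] := hf d d0; exists C => //.
have nU : \forall x \near x0, U x by exact: open_near oU Ux0 _.
by apply: filterS2 nU h => x Ux h u su; rewrite e//; exact: h.
Qed.

Lemma near_smallD m f g : near_small m f -> near_small m g ->
  near_small m (fun u x => f u x + g u x).
Proof.
move=> hf hg e e0; have e2 : 0 < e / 2 by rewrite divr_gt0.
have [C C0 h1] := hf _ e2; have [C' C'0 h2] := hg _ e2.
exists (C + C'); first exact: addr_ge0.
apply: filterS2 h1 h2 => x h1 h2 u su; have {}h1 := h1 u su; have {}h2 := h2 u su.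
apply: le_trans (ler_normD _ _) _; move: h1 h2.
by move: (`|f u x|) (`|g u x|) (Dsq _ _ _) (jet _ _ _) => *; lra.
Qed.

Lemma near_small_sum m (I : Type) (s : seq I) (f : I -> F -> F) : (forall i, near_small m (f i)) ->
  near_small m (fun u x => \sum_(i <- s) f i u x).
Proof.
move=> h; elim: s => [|i s IH].
  move=> e e0; exists 0 => //; apply: (@filterE _ (nbhs x0) (nbhs_filter x0)) => x u su.
  by rewrite big_nil normr0 mul0r addr0 mulr_ge0 ?Dsq_ge0// ltW.
by apply: near_small_eq (near_smallD (h i) IH) => u x _ _; rewrite big_cons.
Qed.

Lemma near_small_prod m T T' : small_op m T -> is_op m T' ->
  near_small m (fun u x => T u x * T' u x).
Proof.
move=> sT iT e e0; have [K K0 hK] := is_op_near oU Ux0 iT.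
(* Weight in [|ab| <= a^2/(2d) + d b^2/2]: it absorbs the bound [K] of the second factor, and
   precision [e d] for the first one leaves [e/2] after division by [2d]. *)
pose d := e / (K + 1); have K1 : 0 < K + 1 by lra.
have d0 : 0 < d by rewrite divr_gt0.
have ed0 : 0 < e * d by rewrite mulr_gt0.
have [C C0 hC] := small_op_near oU Ux0 sT ed0.
exists (C / d + e); first by apply: addr_ge0; [apply: divr_ge0 => //; exact: ltW|exact: ltW].
apply: filterS2 hK hC => x hK hC u su; have := hK u su; have := hC u su; rewrite jetS.
have := Dsq_ge0 m u x; have := jet_ge0 m u x.
move: (T u x) (T' u x) (Dsq m u x) (jet m u x) => a b D j j0 D0 h1 h2.
have h3 : `|a * b| <= a ^+ 2 / (2 * d) + d / 2 * b ^+ 2.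
  rewrite normrM -(real_normK (num_real a)) -(real_normK (num_real b)).
  rewrite -subr_ge0.
  have -> : `|a| ^+ 2 / (2 * d) + d / 2 * `|b| ^+ 2 - `|a| * `|b| = (`|a| - d * `|b|) ^+ 2 / (2 * d).
    by field; rewrite gt_eqF.
  by rewrite divr_ge0 ?sqr_ge0// mulr_ge0// ltW.
apply: le_trans h3 _.
have h4 : a ^+ 2 / (2 * d) <= e / 2 * D + C / d / 2 * j.
  have d20 : 0 < 2 * d by rewrite mulr_gt0.
  rewrite (ler_pdivrMr _ _ d20); apply: le_trans h1 _.
  have ident (d' : R) : d' != 0 -> e * d' * D + C * j = (e / 2 * D + C / d' / 2 * j) * (2 * d').
    by move=> d'0; field.
  by rewrite (ident d) ?gt_eqF.
have dK : d * K <= e.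
  have dK1 : d * (K + 1) = e by rewrite /d divfK ?gt_eqF.
  by rewrite -[leRHS]dK1 mulrDr mulr1 lerDl ltW.
have h5 : d / 2 * b ^+ 2 <= e / 2 * (j + D).
  apply: (@le_trans _ _ (d / 2 * (K * (j + D)))); first by rewrite ler_wpM2l// divr_ge0// ltW.
  rewrite mulrA ler_wpM2r ?addr_ge0//; lra.
have h6 : 0 <= C / d * j by rewrite !mulr_ge0// invr_ge0 ltW.
have h7 : 0 <= e * j by rewrite mulr_ge0// ltW.
move: h4 h5 h6; rewrite mulrDl; move: (a ^+ 2 / _) (d / 2 * _) (C / d) => A B E h4 h5 h6.
nra.
Qed.

Lemma near_small_quad m (f : F) (c : R) W W0 V V0 : smooth_on U f -> f x0 = c ->
  is_op m W -> is_op m W0 -> is_op m V -> is_op m V0 ->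
  small_op m (fun u x => W u x - W0 u x) -> small_op m (fun u x => V u x - V0 u x) ->
  near_small m (fun u x => f x * W u x * V u x - c * W0 u x * V0 u x).
Proof.
move=> sf fc iW iW0 iV iV0 sW sV.
have s1 : small_op m (fun u x => (f x - c) * W0 u x).
  apply: small_op_vanish => //; last by rewrite fc subrr.
  by apply: smooth_onB => //; exact: smooth_on_cst.
have h1 := near_small_prod s1 iV0.
have h2 := near_small_prod (small_opM oU sf sW) iV.
have h3 := near_small_prod sV (is_opM oU sf iW0).
apply: near_small_eq (near_smallD (near_smallD h1 h2) h3) => u x _ _; ring.
Qed.

Lemma metric_squareE G m u x : smooth_metric G -> smooth_on U u -> U x ->
  metric_square G m u x = let w := iter m./2 (laplacian G) u in
    if odd m then metric_form (G x) (fun i => pderiv i w x) (fun i => pderiv i w x) else w x ^+ 2.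
Proof.
move=> [sG pG] su Ux; rewrite /metric_square /half_laplacian_sq/=; case: ifP => // _.
by rewrite gradient_sqnormE//; exact: pG.
Qed.

(** For even [m] the integrand is the density times a square; for odd [m] it is a sum over entries
    of the inverse metric. Either way [near_small_quad] applies term by term. *)
Lemma local_comparison G m : smooth_metric G -> near_small m (fun u x =>
  metric_square G m u x * volume_density G x - metric_square (fun=> G x0) m u x * volume_density G x0).
Proof.
move=> sG; have sG0 := constant_smooth_metric sG; have [sG1 pG1] := sG.
have srho := smooth_volume_density oU sG1 pG1.
have iT := is_op_iter_laplacian m./2 sG; have iT0 := is_op_iter_laplacian m./2 sG0.
have sT := small_op_iter_laplacian m./2 sG.
have m2 := odd_double_half m.
case om : (odd m) m2 => /= m2; last first.
  rewrite add0n in m2; rewrite m2 in iT iT0 sT.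
  apply: near_small_eq (near_small_quad srho erefl iT iT0 iT iT0 sT sT) => u x su Ux.
  rewrite !metric_squareE// om /= !expr2.
  by congr (_ - _); rewrite mulrC mulrA.
rewrite add1n in m2.
have iP a := is_op_partial oU a iT; have iP0 a := is_op_partial oU a iT0.
have sP a : small_op m (fun u x => pderiv a (iter m./2 (laplacian G) u) x -
    pderiv a (iter m./2 (laplacian (fun=> G x0)) u) x).
  rewrite -[X in small_op X]m2.
  apply: (op_class_eq _ (small_op_partial oU a sT)) => u x su Ux.
  have s1 := op_smooth iT su; have s2 := op_smooth iT0 su.
  by rewrite (partialB oU a s1 s2 Ux).
rewrite m2 in iP iP0.
have sf a b : smooth_on U (fun x => volume_density G x * invmx (G x) a b).
  by apply: smooth_onM => //; exact: smooth_invmx.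
have h a b := near_small_quad (sf a b) erefl (iP a) (iP0 a) (iP b) (iP0 b) (sP a) (sP b).
apply: near_small_eq (near_small_sum (index_enum 'I_n) (fun a =>
  near_small_sum (index_enum 'I_n) (h a))) => u x su Ux.
rewrite !metric_squareE// om /= /metric_form !mulr_suml -sumrB.
apply: eq_bigr => a _; rewrite !mulr_suml -sumrB; apply: eq_bigr => b _.
by congr (_ - _); rewrite mulrC !mulrA.
Qed.

Lemma op_commutator m T : is_op m T -> exists2 C, 0 <= C & \forall x \near x0, forall z : F * F,
  smooth_on U z.1 /\ smooth_on U z.2 ->
  (T (fun y => z.1 y * z.2 y) x - z.1 x * T z.2 x) ^+ 2 <= C * (jet m.+1 z.1 x * jet m z.2 x).
Proof.
move=> [L hL h].
pose f (c : F * seq 'I_n) (z : F * F) x :=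
  (c.1 x * (foldr pderiv (fun y => z.1 y * z.2 y) c.2 x - z.1 x * foldr pderiv z.2 c.2 x)) ^+ 2.
have [C C0 hC] : exists2 C, 0 <= C & \forall x \near x0, forall z : F * F,
    smooth_on U z.1 /\ smooth_on U z.2 -> \sum_(c <- L) f c z x <= C * (jet m.+1 z.1 x * jet m z.2 x).
  elim: L hL {h} => [|c L IH] hL.
    exists 0 => //; apply: (@filterE _ (nbhs x0) (nbhs_filter x0)) => x z _.
    by rewrite big_nil mul0r.
  have [sc mc] := hL c (mem_head _ _).
  have [d dL|C C0 hC] := IH; first by apply: hL; rewrite inE dL orbT.
  have [K K0 hK] := commutator_le oU mc.
  have nU : \forall x \near x0, U x by exact: open_near oU Ux0 _.
  exists ((`|c.1 x0| + 1) ^+ 2 * K + C); first by rewrite addr_ge0// mulr_ge0// sqr_ge0.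
  have cc := coef_bounded Ux0 sc.
  move: cc hC nU; apply: filterS3 => x cx hC Ux z sz; rewrite big_cons mulrDl.
  apply: lerD; last exact: hC.
  have [s1 s2] := sz; have := hK z.1 z.2 x s1 s2 Ux.
  move=> hz; rewrite /f exprMn -[_ ^+ 2 * K * _]mulrA.
  exact: ler_pM (sqr_ge0 _) (sqr_ge0 _) cx hz.
exists ((size L)%:R * C); first by rewrite mulr_ge0.
have nU : \forall x \near x0, U x by exact: open_near oU Ux0 _.
apply: filterS2 nU hC => x Ux hC z [s1 s2].
have s12 := smooth_onM oU s1 s2.
rewrite !h// /op mulr_sumr -sumrB.
apply: le_trans (sqr_sum_le _ _) _; rewrite -mulrA; apply: ler_wpM2l => //.
apply: le_trans (hC z (conj s1 s2)); rewrite le_eqVlt; apply/orP; left; apply/eqP.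
by apply: eq_bigr => c _; rewrite /f; congr (_ ^+ 2); ring.
Qed.

Lemma metric_form_near G : smooth_metric G -> exists2 C, 0 <= C &
  \forall x \near x0, forall a : 'I_n -> R, metric_form (G x) a a <= C * \sum_i a i ^+ 2.
Proof.
move=> [sG pG]; pose f x := \sum_i \sum_j (invmx (G x) i j ^+ 2 + 1).
have sf : smooth_on U f.
  apply: smooth_on_sum => // i _; apply: smooth_on_sum => // j _.
  apply: smooth_onD => //; last exact: smooth_on_cst.
  under eq_fun do rewrite expr2.
  by apply: smooth_onM => //; exact: smooth_invmx.
exists (`|f x0| + 1); first exact: addr_ge0.
apply: filterS (coef_near Ux0 sf ltr01) => x hx a.
apply: le_trans (metric_form_bound _ _) _; apply: ler_wpM2r.
  by apply: sumr_ge0 => i _; exact: sqr_ge0.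
rewrite -/(f x); apply: le_trans (ler_norm _) _.
by rewrite -[f x](subrK (f x0)) (le_trans (ler_normD _ _))// addrC lerD2l ltW.
Qed.

Lemma metric_square_near G m : smooth_metric G -> exists2 C, 0 <= C &
  \forall x \near x0, forall u, smooth_on U u -> metric_square G m u x <= C * jet m.+1 u x.
Proof.
move=> sG; have nU : \forall x \near x0, U x by exact: open_near oU Ux0 _.
have iT := is_op_iter_laplacian m./2 sG; have m2 := odd_double_half m.
case om : (odd m) m2 => /= m2; last first.
  rewrite add0n in m2; rewrite m2 in iT; have [C C0 hC] := is_op_near oU Ux0 iT.
  by exists C => //; apply: filterS2 nU hC => x Ux hC u su; rewrite metric_squareE// om; exact: hC.
rewrite add1n in m2.
have [C C0 hC] := metric_form_near sG.
have iP a := is_op_near oU Ux0 (is_op_partial oU a iT); rewrite m2 in iP.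
have [C' C'0 hC'] := near_bound_sum (index_enum 'I_n) iP.
exists (C * C'); first exact: mulr_ge0.
move: nU hC hC'; apply: filterS3 => x Ux hC hC' u su; rewrite metric_squareE// om /=.
by apply: le_trans (hC _) _; rewrite -mulrA ler_wpM2l// hC'.
Qed.

(** The operator applied to a product is [z.1] times its value on [z.2] plus a commutator of lower
    order in [z.2]; [sqD_le], or its analogue for the metric form, separates the two with a loss
    [1 + e]. The functions form a pair so that [near_bound_sum] can range over both at once. *)
Lemma metric_square_cutoff G m (e : R) : smooth_metric G -> 0 < e -> exists2 C, 0 <= C &
  \forall x \near x0, forall z : F * F, smooth_on U z.1 /\ smooth_on U z.2 ->
  metric_square G m (fun y => z.1 y * z.2 y) x <=
    (1 + e) * (z.1 x ^+ 2 * metric_square G m z.2 x) + C * (jet m.+1 z.1 x * jet m z.2 x).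
Proof.
move=> sG e0; have nU : \forall x \near x0, U x by exact: open_near oU Ux0 _.
have iT := is_op_iter_laplacian m./2 sG; have m2 := odd_double_half m.
have ei : 0 <= 1 + e^-1 by rewrite addr_ge0// invr_ge0 ltW.
case om : (odd m) m2 => /= m2; last first.
  rewrite add0n in m2; rewrite m2 in iT; have [C C0 hC] := op_commutator iT.
  exists ((1 + e^-1) * C); first exact: mulr_ge0.
  apply: filterS2 nU hC => x Ux hC z sz; have [s1 s2] := sz.
  have s12 := smooth_onM oU s1 s2.
  rewrite !metric_squareE// om /= -exprMn -mulrA.
  rewrite -[iter _ _ _ x](subrK (z.1 x * iter m./2 (laplacian G) z.2 x)) addrC.
  apply: le_trans (sqD_le _ _ e0) _; rewrite lerD2l ler_wpM2l//.
  exact: hC.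
rewrite add1n in m2.
have [C C0 hC] := metric_form_near sG.
have iP a := op_commutator (is_op_partial oU a iT); rewrite m2 in iP.
have [C' C'0 hC'] := near_bound_sum (index_enum 'I_n) iP.
exists ((1 + e^-1) * (C * C')); first by rewrite !mulr_ge0.
move: nU hC hC'; apply: filterS3 => x Ux hC hC' z sz; have [s1 s2] := sz.
have s12 := smooth_onM oU s1 s2.
rewrite !metric_squareE// om /= -metric_formZ.
set w := iter _ _ z.2; set w' := iter _ _ _.
pose a i := z.1 x * pderiv i w x; pose b i := pderiv i w' x - a i.
have -> : metric_form (G x) (fun i => pderiv i w' x) (fun i => pderiv i w' x) =
    metric_form (G x) (fun i => a i + b i) (fun i => a i + b i).
  by congr metric_form; apply/funext => i; rewrite /b addrC subrK.
have pGx : posdef (G x) by case: sG => _; exact.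
apply: le_trans (metric_formD_le _ _ pGx e0) _; rewrite lerD2l -!mulrA ler_wpM2l//.
by apply: le_trans (hC _) _; rewrite ler_wpM2l//; exact: hC'.
Qed.

Lemma metric_square_ge0 G m u x : smooth_metric G -> smooth_on U u -> U x ->
  0 <= metric_square G m u x.
Proof.
move=> sG su Ux; rewrite metric_squareE//=; case: ifP => _; last exact: sqr_ge0.
by apply: metric_form_ge0; case: sG => _; exact.
Qed.

Lemma smooth_metric_square G m u : smooth_metric G -> smooth_on U u ->
  smooth_on U (metric_square G m u).
Proof.
move=> sG su; have [sG1 pG1] := sG.
have sT : smooth_on U (iter m./2 (laplacian G) u) by exact: smooth_iter_laplacian.
apply: (@eq_smooth_on _ _ _ (fun x => let w := iter m./2 (laplacian G) u in
  if odd m then metric_form (G x) (fun i => pderiv i w x) (fun i => pderiv i w x) else w x ^+ 2)) => //.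
  by move=> x Ux; rewrite metric_squareE.
rewrite /=; case: (odd m); last by under eq_fun do rewrite expr2; exact: smooth_onM.
apply: smooth_on_sum => // i _; apply: smooth_on_sum => // j _.
apply: smooth_onM => //; last exact: smooth_on_partial.
by apply: smooth_onM => //; [exact: smooth_invmx|exact: smooth_on_partial].
Qed.

Lemma op_additive P T u v x : op_class U P T -> smooth_on U u -> smooth_on U v -> U x ->
  T (fun y => u y + v y) x = T u x + T v x.
Proof.
move=> [L _ h] su sv Ux; rewrite !h//; last exact: smooth_onD.
rewrite /op -big_split/=; apply: eq_bigr => c _.
by rewrite (partials_add oU)// mulrDr.
Qed.

Lemma metric_squareD_le G m u v x (e : R) : smooth_metric G -> smooth_on U u -> smooth_on U v ->
  U x -> 0 < e ->
  metric_square G m (fun y => u y + v y) x <=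
    (1 + e) * metric_square G m u x + (1 + e^-1) * metric_square G m v x.
Proof.
move=> sG su sv Ux e0; have [sG1 pG1] := sG.
have iT := is_op_iter_laplacian m./2 sG.
rewrite !metric_squareE//=; last exact: smooth_onD.
case: ifP => om; last by rewrite (op_additive iT)//; exact: sqD_le.
have iP a := is_op_partial oU a iT.
set w := iter _ _ u; set w' := iter _ _ v; set w'' := iter _ _ _.
have -> : metric_form (G x) (fun i => pderiv i w'' x) (fun i => pderiv i w'' x) =
    metric_form (G x) (fun i => pderiv i w x + pderiv i w' x) (fun i => pderiv i w x + pderiv i w' x).
  by congr metric_form; apply/funext => i; rewrite /w'' (op_additive (iP i)).
by apply: metric_formD_le => //; exact: pG1.
Qed.

End local_estimates.

(** * Local estimates *)

Section locality.
Context {R : realType} {n : nat}.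
Implicit Types (f u v : 'rV[R]_n -> R) (U W K : set 'rV[R]_n) (G : 'rV[R]_n -> 'M[R]_n).

Lemma test_compact U K f : open U -> compact K -> K `<=` U -> smooth_on U f ->
  (forall x, ~ K x -> f x = 0) -> test f.
Proof.
move=> oU cK KU sf f0; have clK : closed K by apply: compact_closed => //; exact: norm_hausdorff.
have oK : open (~` K) by exact: closed_openC.
split.
  apply: (@smooth_onS _ _ (U `|` ~` K)); first by move=> x _; have [/KU|] := pselect (K x); [left|right].
  apply: smooth_on_setU => //.
  by apply: (eq_smooth_on oK _ (smooth_on_cst 0 oK)) => x /f0.
have [M [_ hM]] := compact_bounded cK.
exists (M + 1) => x; rewrite subr0 => hx; apply: f0 => Kx.
have M1 : M < M + 1 by rewrite ltrDl.
by have := hM _ M1 x Kx; rewrite /= leNgt hx.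
Qed.

Lemma eq_laplacian G W u v x : open W -> W x -> (forall y, W y -> u y = v y) ->
  laplacian G u x = laplacian G v x.
Proof.
move=> oW Wx uv; rewrite /laplacian /divergence; apply: (congr1 (fun z => - (_ * z))).
apply: eq_bigr => i _; rewrite pderivE; apply: (eq_partial i oW Wx) => y Wy.
rewrite /gradient pderivE; congr (_ * _); apply: eq_bigr => j _.
by rewrite (eq_partial j oW Wy uv).
Qed.

Lemma eq_gradient_sqnorm G W u v x : open W -> W x -> (forall y, W y -> u y = v y) ->
  gradient_sqnorm G u x = gradient_sqnorm G v x.
Proof.
move=> oW Wx uv; have e i : gradient G u i x = gradient G v i x.
  rewrite /gradient pderivE; apply: eq_bigr => j _.
  by rewrite (eq_partial j oW Wx uv).
by apply: eq_bigr => i _; apply: eq_bigr => j _; rewrite !e.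
Qed.

Lemma eq_metric_square G W m u v x : open W -> W x -> (forall y, W y -> u y = v y) ->
  metric_square G m u x = metric_square G m v x.
Proof.
move=> oW Wx uv; have e j y : W y -> iter j (laplacian G) u y = iter j (laplacian G) v y.
  by elim: j y => [|j IH] y Wy /=; [exact: uv|exact: (eq_laplacian _ oW Wy IH)].
rewrite /metric_square /half_laplacian_sq; case: (odd m); last by rewrite e.
by apply: (eq_gradient_sqnorm _ oW Wx) => y; exact: e.
Qed.

Lemma metric_square0 G m x : metric_square G m (fun=> 0) x = 0.
Proof.
have l0 : laplacian G (fun=> 0) = fun=> 0.
  apply/funext => y; rewrite /laplacian /divergence big1 ?mulr0 ?oppr0// => i _.
  rewrite pderivE (_ : (fun _ => _) = fun=> 0) ?partial_cst//; apply/funext => z.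
  by rewrite /gradient big1 ?mulr0// => j _; rewrite pderivE partial_cst mulr0.
have il j : iter j (laplacian G) (fun=> 0) = (fun=> 0).
  by elim: j => [//|j IH]; rewrite iterS IH l0.
rewrite /metric_square /half_laplacian_sq il; case: (odd m); last by rewrite expr0n.
rewrite /gradient_sqnorm big1// => i _; rewrite big1// => j _.
by rewrite /gradient big1 ?mulr0 ?mul0r// => a _; rewrite pderivE partial_cst mulr0.
Qed.

Lemma supported_metric_square G m x0 r u : supported_in x0 r u ->
  supported_in x0 r (metric_square G m u).
Proof.
move=> su x hx; rewrite -(metric_square0 G m x).
by apply: (@eq_metric_square G [set y | r < `|y - x0|] m u (fun=> 0) x (@open_far R n x0 r) hx) => y; exact: su.
Qed.

Definition closed_rball (x0 : 'rV[R]_n) (r : R) := [set x : 'rV[R]_n | `|x - x0| <= r].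

Lemma test_supported U x0 r f : open U -> closed_rball x0 r `<=` U -> smooth_on U f ->
  supported_in x0 r f -> test f.
Proof.
move=> oU bU sf f0; apply: (@test_compact U (closed_rball x0 r) f oU (@compact_closed_ball_rV R n x0 r) bU sf) => x /negP.
by rewrite -ltNge; exact: f0.
Qed.

Lemma near_closed_rball x0 (P : 'rV[R]_n -> Prop) : (\forall x \near x0, P x) ->
  exists2 r : R, 0 < r & forall x, closed_rball x0 r x -> P x.
Proof.
move=> /nbhs_normP[r /= r0 h]; exists (r / 2); first by rewrite divr_gt0.
move=> x hx; apply: h; rewrite /ball_/= distrC; apply: le_lt_trans hx _.
by rewrite ltr_pdivrMr// ltr_pMr// ltr1n.
Qed.

Lemma supportedW x0 r r' u : r <= r' -> supported_in x0 r u -> supported_in x0 r' u.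
Proof. by move=> rr h x hx; apply: h; exact: le_lt_trans hx. Qed.

Lemma supported_mulr x0 r u v : supported_in x0 r u -> supported_in x0 r (fun x => u x * v x).
Proof. by move=> h x hx; rewrite h// mul0r. Qed.

Lemma supported_jet m x0 r u : supported_in x0 r u -> supported_in x0 r (jet m u).
Proof. by move=> h x hx; rewrite /jet big1// => a _; exact: supported_Dsq hx. Qed.

Hypothesis n0 : (0 < n)%N.

Lemma supported_bump (x0 : 'rV[R]_n) (r : R) : 0 <= r -> supported_in x0 r (bump x0 r).
Proof. by move=> r0 x hx; apply: (bump0 r0 _ n0); exact: ltW. Qed.

(** The larger bump has a positive minimum on the ball of radius [r], and [f] vanishes outside. It
    allows derivatives of cut-offs to be traded for the square of one slightly wider cut-off. *)
Lemma bump_dominates x0 r s f : r < s -> test f -> supported_in x0 r f ->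
  exists2 C, 0 <= C & forall x, f x <= C * bump x0 s x ^+ 2.
Proof.
move=> rs tf sf; have [B B0 hB] := cc_bounded (test_cc tf).
have [c c0 hc] : exists2 c, 0 < c & forall x, closed_rball x0 r x -> c <= bump x0 s x ^+ 2.
  have [[y hy]|ne] := pselect (closed_rball x0 r !=set0); last first.
    by exists 1 => // x hx; exfalso; apply: ne; exists x.
  have cb : continuous (fun x => bump x0 s x ^+ 2).
    have cb0 : continuous (bump x0 s : 'rV[R]_n -> R).
      by apply: smooth_continuous; apply: smooth_bump; exact: openT.
    by under eq_fun do rewrite expr2; exact: continuousM_rV.
  have [z zK hz] := @EVT_min_rV R n _ (closed_rball x0 r) (ex_intro _ y hy)
    (@compact_closed_ball_rV R n x0 r) (continuous_subspaceT cb).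
  exists (bump x0 s z ^+ 2); last by move=> x hx; apply: hz; rewrite inE.
  rewrite exprn_gt0// bump_gt0//; apply: le_lt_trans rs; move: zK; rewrite inE; exact.
exists (B / c); first by rewrite divr_ge0// ltW.
move=> x; have [hx|hx] := leP `|x - x0| r; last first.
  by rewrite sf// mulr_ge0 ?sqr_ge0// divr_ge0// ltW.
apply: (@le_trans _ _ B); first exact: le_trans (ler_norm _) (hB x).
rewrite -[leLHS](@divfK _ c) ?gt_eqF//; apply: ler_wpM2l; last exact: hc.
by rewrite divr_ge0// ltW.
Qed.

End locality.

(** * Coercivity with variable coefficients and interior elliptic estimates *)

Section interior_estimates.
Context {R : realType} {n : nat} (U : set 'rV[R]_n) (x0 : 'rV[R]_n).
Hypothesis oU : open U.
Hypothesis Ux0 : U x0.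
Hypothesis n0 : (0 < n)%N.
Variable G : 'rV[R]_n -> 'M[R]_n.
Hypothesis sG : smooth_metric U G.
Local Notation rho := (volume_density G).
Local Notation q := (metric_square G).
Implicit Types (u v eta : 'rV[R]_n -> R).

Let pG0 : posdef (G x0). Proof. by case: sG => _; exact. Qed.
Let srho : smooth_on U rho. Proof. by case: sG => *; exact: smooth_volume_density. Qed.
Let rho_gt0 x : U x -> 0 < rho x. Proof. by case: sG => *; exact: (@volume_density_gt0 R n U). Qed.

Lemma smooth_onX2 f : smooth_on U f -> smooth_on U (fun x => f x ^+ 2).
Proof. by move=> sf; under eq_fun do rewrite expr2; exact: smooth_onM. Qed.

Lemma test_q m r v : closed_rball x0 r `<=` U -> test v -> supported_in x0 r v ->
  test (fun x => q m v x * rho x).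
Proof.
move=> bU tv sv; apply: (test_supported oU bU).
  apply: smooth_onM => //; apply: smooth_metric_square => //.
  by apply: smooth_onS (proj1 tv).
by apply: supported_mulr; exact: supported_metric_square.
Qed.

Lemma test_cutoff r eta f : closed_rball x0 r `<=` U -> smooth_on setT eta -> supported_in x0 r eta ->
  smooth_on U f -> test (fun x => eta x * f x).
Proof.
move=> bU se ss sf; apply: (test_supported oU bU); last exact: supported_mulr.
by apply: smooth_onM => //; apply: smooth_onS se.
Qed.

Lemma test_cutoff2 r eta f : closed_rball x0 r `<=` U -> smooth_on setT eta -> supported_in x0 r eta ->
  smooth_on U f -> test (fun x => eta x ^+ 2 * f x).
Proof.
move=> bU se ss sf; apply: (test_supported oU bU).
  apply: smooth_onM => //; apply: smooth_onX2; exact: smooth_onS se.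
by apply: supported_mulr => x /ss ->; rewrite expr0n.
Qed.

(* Freeze the coefficients at [x0]. *)
Lemma coercive_near m (d : R) : 0 < d -> exists2 r0, 0 < r0 & exists2 C, 0 <= C &
  closed_rball x0 r0 `<=` U /\ forall v, test v -> supported_in x0 r0 v ->
   `|integral_rV (fun x => q m v x * rho x) -
      integral_rV (metric_square (fun=> G x0) m v) * rho x0| <=
    d * integral_rV (Dsq m v) + C * integral_rV (jet m v).
Proof.
move=> d0; have [C C0 hC] := local_comparison oU Ux0 m sG d0.
have nU : \forall x \near x0, U x by exact: open_near oU Ux0 _.
have [r0 r00 hr] := near_closed_rball (filterI nU hC).
exists r0 => //; exists C => //; have bU : closed_rball x0 r0 `<=` U by move=> x /hr[].
split=> // v tv sv; have sUv : smooth_on U v by apply: smooth_onS (proj1 tv).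
have cc1 := test_cc (test_q m bU tv sv).
have cc2 : cc (fun x => rho x0 * metric_square (fun=> G x0) m v x).
  by apply: ccZ; apply: test_cc; exact: test_metric_square.
have ccD' := test_cc (test_Dsq m tv); have ccJ := test_cc (test_jet m tv).
have cc3 : cc (fun x => d * Dsq m v x + C * jet m v x) by apply: ccD; exact: ccZ.
have -> : integral_rV (metric_square (fun=> G x0) m v) * rho x0 =
    integral_rV (fun x => rho x0 * metric_square (fun=> G x0) m v x).
  by rewrite integral_rVZ 1?mulrC//; apply: test_cc; exact: test_metric_square.
rewrite -integral_rVB// -!integral_rVZ// -integral_rVD; [|exact: ccZ|exact: ccZ].
have h x : `|q m v x * rho x - rho x0 * metric_square (fun=> G x0) m v x| <= d * Dsq m v x + C * jet m v x.
  have [hx|hx] := leP `|x - x0| r0; first by rewrite [rho x0 * _]mulrC; apply: (hr x hx).2.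
  rewrite (supported_metric_square _ _ sv hx) (supported_metric_square _ _ sv hx).
  rewrite mul0r mulr0 subrr normr0 addr_ge0// mulr_ge0 ?Dsq_ge0 ?jet_ge0//; exact: ltW.
rewrite ler_norml; apply/andP; split.
  rewrite -integral_rVN//; apply: le_integral_rV; [exact: ccN|exact: ccB|].
  by move=> x; have := h x; rewrite ler_norml => /andP[].
apply: le_integral_rV => //; first exact: ccB.
by move=> x; have := h x; rewrite ler_norml => /andP[].
Qed.

Lemma rho_bound : exists2 r0, 0 < r0 & exists2 B, 0 <= B & closed_rball x0 r0 `<=` U /\
  forall x, closed_rball x0 r0 x -> rho x <= B.
Proof.
have nU : \forall x \near x0, U x by exact: open_near oU Ux0 _.
have [r0 r00 hr] := near_closed_rball (filterI nU (coef_near Ux0 srho ltr01)).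
exists r0 => //; exists (`|rho x0| + 1); first exact: addr_ge0.
split=> [x /hr[]//|x /hr[_ hx]]; apply: le_trans (ler_norm _) _.
by rewrite -[rho x](subrK (rho x0)) (le_trans (ler_normD _ _))// addrC lerD2l ltW.
Qed.

Lemma Dsq_energy m : exists2 r0, 0 < r0 & exists2 C, 0 <= C &
  closed_rball x0 r0 `<=` U /\ forall v, test v -> supported_in x0 r0 v ->
  integral_rV (Dsq m v) <= C * (integral_rV (fun x => q m v x * rho x) + integral_rV (jet m v)).
Proof.
have [C1 C10 h1] := coercive_constant_metric pG0 m.
(* Chosen so that [C1] times the freezing error is at most half of the integral of [Dsq m v]. *)
have d0 : 0 < (2 * (C1 + 1))^-1 by rewrite invr_gt0 mulr_gt0// ltr_wpDl.
have [r0 r00 [C C0 [bU hC]]] := coercive_near m d0.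
exists r0 => //; exists (2 * C1 * (1 + C)).
  by rewrite mulr_ge0 ?addr_ge0// mulr_ge0.
split=> // v tv sv; have := h1 v tv; have := hC v tv sv; rewrite -/(rho x0).
have I0 : 0 <= integral_rV (fun x => q m v x * rho x).
  apply: integral_rV_ge0 => x; have [hx|hx] := leP `|x - x0| r0; last first.
    by rewrite (supported_metric_square _ _ sv hx) mul0r.
  have Ux := bU _ hx; apply: mulr_ge0; last exact: ltW (rho_gt0 Ux).
  by apply: (@metric_square_ge0 _ _ U) => //; apply: smooth_onS (proj1 tv).
have J0 : 0 <= integral_rV (jet m v) by apply: integral_rV_ge0 => x; exact: jet_ge0.
have D0 : 0 <= integral_rV (Dsq m v) by apply: integral_rV_ge0 => x; exact: Dsq_ge0.
move: I0 J0 D0; move: (integral_rV (jet m v)) (integral_rV (Dsq m v)) (integral_rV _ * _) (integral_rV _).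
move=> J D Q0 Q Q_ge J_ge D_ge; rewrite ler_norml => /andP[h2 _] h3.
have h4 : Q0 <= Q + (2 * (C1 + 1))^-1 * D + C * J by lra.
have h5 : C1 * ((2 * (C1 + 1))^-1 * D) <= D / 2.
  move: d0 h2 h4; set t := _^-1 => t0 _ _.
  have ht : t * (2 * (C1 + 1)) = 1 by rewrite mulVf// gt_eqF// mulr_gt0//; lra.
  have -> : C1 * (t * D) = t * (2 * (C1 + 1)) * D / 2 - t * D by field.
  by rewrite ht mul1r lerBlDr lerDl mulr_ge0// ltW.
have h6 := ler_wpM2l C10 h4.
have h7 : 0 <= C1 * (C * Q) by rewrite !mulr_ge0.
have h8 : 0 <= C1 * J by rewrite mulr_ge0.
nra.
Qed.

(** Integrated form of the product estimates. The lower order terms carry a bump of radius [s > r],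
    whose square dominates all derivatives of [eta] that occur. *)
Lemma cutoff_integrals m (e : R) : 0 < e -> exists2 r0, 0 < r0 & closed_rball x0 r0 `<=` U /\
  forall r s eta, 0 < s -> r < s -> s <= r0 -> test eta -> supported_in x0 r eta ->
  exists2 C, 0 <= C & forall u, smooth_on U u ->
    let S := integral_rV (fun x => bump x0 s x ^+ 2 * jet m u x) in
    integral_rV (fun x => q m (fun y => eta y * u y) x * rho x) <=
      (1 + e) * integral_rV (fun x => eta x ^+ 2 * (q m u x * rho x)) + C * S /\
    integral_rV (jet m (fun y => eta y * u y)) <= C * S.
Proof.
move=> e0; have [C3 C30 hcut] := metric_square_cutoff oU Ux0 m sG e0.
have [r3 r30 hr3] := near_closed_rball hcut.
have [r4 r40 [B B0 [b4U hB]]] := rho_bound.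
have [C5 C50 h5] := jetM_le oU m.
exists (Num.min r3 r4); first by rewrite lt_min r30.
have ball_le (s s' : R) : s <= s' -> closed_rball x0 s `<=` closed_rball x0 s'.
  by move=> ss x /= h; exact: le_trans ss.
split; first by apply: subset_trans b4U; apply: ball_le; rewrite ge_min lexx orbT.
move=> r s eta s_gt rs; rewrite le_min => /andP[sr3 sr4] te sup.
have [sT _] := te; have se : smooth_on U eta by apply: smooth_onS sT.
have [K K0 hK] := bump_dominates rs (test_jet m.+1 te) (supported_jet _ sup).
exists (C3 * K * B + C5 * K); first by rewrite addr_ge0 ?mulr_ge0.
move=> u su S; pose v x := eta x * u x.
have bUs : closed_rball x0 s `<=` U by apply: subset_trans b4U; exact: ball_le.
have bUr : closed_rball x0 r `<=` U by apply: subset_trans bUs; exact: ball_le (ltW rs).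
have supb : supported_in x0 s (bump x0 s) by exact: supported_bump (ltW s_gt).
have ccb f : smooth_on U f -> cc (fun x => bump x0 s x ^+ 2 * f x).
  move=> sf; apply: test_cc; apply: (test_cutoff2 bUs _ supb sf).
  by apply: smooth_bump; exact: openT.
have cce f : smooth_on U f -> cc (fun x => eta x ^+ 2 * f x).
  by move=> sf; apply: test_cc; exact: (test_cutoff2 bUr sT sup sf).
have tv : test v := test_cutoff bUr sT sup su.
have sv : supported_in x0 r v by exact: supported_mulr.
have sq : smooth_on U (fun x => q m u x * rho x).
  by apply: smooth_onM => //; exact: smooth_metric_square.
have sj : smooth_on U (jet m u) by exact: smooth_jet.
have sj0 x : 0 <= bump x0 s x ^+ 2 * jet m u x by rewrite mulr_ge0 ?sqr_ge0 ?jet_ge0.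
have S0 : 0 <= S by exact: integral_rV_ge0.
have far x : ~ closed_rball x0 r x -> r < `|x - x0| by move=> /negP; rewrite -ltNge.
split.
  apply: (@le_trans _ _ ((1 + e) * integral_rV (fun x => eta x ^+ 2 * (q m u x * rho x)) +
      C3 * K * B * S)); last first.
    by rewrite lerD2l ler_wpM2r// lerDl mulr_ge0.
  have c1 := ccZ (1 + e) (cce _ sq); have c2 := ccZ (C3 * K * B) (ccb _ sj).
  rewrite -[(1 + e) * _]integral_rVZ; last exact: cce.
  rewrite -[C3 * K * B * _]integral_rVZ; last exact: ccb.
  rewrite -integral_rVD//.
  apply: le_integral_rV; [exact: test_cc (test_q m bUr tv sv)|exact: ccD|move=> x].
  have R0 : 0 <= C3 * K * B * (bump x0 s x ^+ 2 * jet m u x).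
    by apply: mulr_ge0 => //; rewrite !mulr_ge0.
  have [hx|/far hx] := pselect (closed_rball x0 r x); last first.
    rewrite (sup _ hx) expr0n mul0r mulr0 add0r.
    by rewrite (supported_metric_square _ _ sv) ?mul0r.
  have Ux := bUr _ hx; have rho0 : 0 <= rho x := ltW (rho_gt0 Ux).
  have hx4 : closed_rball x0 r4 x by apply: ball_le hx; exact: le_trans (ltW rs) sr4.
  have hx3 : closed_rball x0 r3 x by apply: ball_le hx; exact: le_trans (ltW rs) sr3.
  have := hr3 x hx3 (eta, u) (conj se su) => /= hq.
  apply: le_trans (ler_wpM2r rho0 hq) _; rewrite mulrDl; apply: lerD.
    by rewrite -!mulrA.
  have rB : rho x <= B by exact: hB.
  have j0 := jet_ge0 m u x.
  rewrite -[C3 * K * B]mulrA -[C3 * _ * _]mulrA -[C3 * (K * B) * _]mulrA; apply: ler_wpM2l => //.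
  apply: (@le_trans _ _ (K * bump x0 s x ^+ 2 * jet m u x * B)).
    apply: ler_pM => //; first by rewrite mulr_ge0 ?jet_ge0.
    by apply: ler_wpM2r.
  by rewrite le_eqVlt; apply/orP; left; apply/eqP; ring.
apply: (@le_trans _ _ (C5 * K * S)); last by rewrite ler_wpM2r// lerDr !mulr_ge0.
rewrite -integral_rVZ; last exact: ccb.
apply: le_integral_rV; [exact: test_cc (test_jet m tv)|by apply: ccZ; exact: ccb|move=> x].
have [hx|/far hx] := pselect (closed_rball x0 r x); last first.
  rewrite (supported_jet _ sv hx).
  by apply: mulr_ge0 => //; exact: mulr_ge0.
apply: le_trans (h5 eta u x se su (bUr _ hx)) _; rewrite -mulrA; apply: ler_wpM2l => //.
rewrite mulrA; apply: ler_wpM2r; first exact: jet_ge0.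
by apply: le_trans (hK x); exact: le_jet.
Qed.

(** Induction on the order, giving up some radius each time. The top derivatives on the ball of
    radius [r] are those of a cut-off function, to which [Dsq_energy] applies; the price is a lower
    jet on a ball of intermediate radius, covered by the induction hypothesis. Only finitely many
    orders share one [r0], hence the bound [M]. *)
Lemma interior_estimate M : exists2 r0, 0 < r0 & closed_rball x0 r0 `<=` U /\
  forall m, (m <= M)%N -> forall r r', 0 < r -> r < r' -> r' <= r0 -> exists2 C, 0 <= C &
  forall u, smooth_on U u -> integral_rV (fun x => bump x0 r x ^+ 2 * jet m u x) <=
    C * \sum_(a < m) integral_rV (fun x => bump x0 r' x ^+ 2 * (q a u x * rho x)).
Proof.
have nU : \forall x \near x0, U x by exact: open_near oU Ux0 _.
elim: M => [|M [r1 r10 [b1U IH]]].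
  have [r0 r00 hr] := near_closed_rball nU; exists r0 => //; split=> // m.
  rewrite leqn0 => /eqP -> r r' _ _ _; exists 0 => // u su.
  rewrite mul0r (_ : (fun _ => _) = fun=> 0) ?integral_rV0//.
  by apply/funext => x; rewrite /jet big_ord0 mulr0.
have [r2 r20 [C2 C20 [b2U hD]]] := Dsq_energy M.
have [r3 r30 [b3U hcut]] := cutoff_integrals M ltr01.
pose r0 := Num.min r1 (Num.min r2 r3).
have r00 : 0 < r0 by rewrite !lt_min r10 r20 r30.
have [l1 l2 l3] : [/\ r0 <= r1, r0 <= r2 & r0 <= r3].
  by rewrite /r0; split; rewrite !ge_min lexx ?orbT.
have ball_le (s s' : R) : s <= s' -> closed_rball x0 s `<=` closed_rball x0 s'.
  by move=> ss x /= h; exact: le_trans ss.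
exists r0 => //; split; first by apply: subset_trans b1U; exact: ball_le.
move=> m; rewrite leq_eqVlt ltnS => /orP[/eqP -> {m}|mM]; last first.
  by move=> r r' r_gt rr r'0; apply: IH => //; exact: le_trans l1.
(* Intermediate radius: the cut-off lives on [r], its commutators on [s], and the induction
   hypothesis goes from [s] to [r']. *)
move=> r r' r_gt rr r'r0; pose s := (r + r') / 2.
have rs : r < s by rewrite /s ltr_pdivlMr//; lra.
have sr : s < r' by rewrite /s ltr_pdivrMr//; lra.
have s_gt : 0 < s by exact: lt_trans rs.
have rr0 : r <= r0 by lra.
have sr0 : s <= r0 by lra.
have r'_gt : 0 < r' by lra.
have bU r'' : r'' <= r0 -> closed_rball x0 r'' `<=` U.
  by move=> h; apply: subset_trans b1U; apply: ball_le; exact: le_trans l1.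
have sb r'' V : open V -> smooth_on V (bump x0 r'') by exact: smooth_bump.
have sbT r'' : smooth_on setT (bump x0 r'') by apply: sb; exact: openT.
have tb r'' : 0 < r'' -> test (bump x0 r'').
  by move=> h; apply: supported_test (supported_bump n0 (ltW h)); exact: sbT.
have supb r'' : 0 < r'' -> supported_in x0 r'' (bump x0 r'') by move=> /ltW; exact: supported_bump.
have [K K0 hK] := bump_dominates rs (test_jet M.+1 (tb r r_gt)) (supported_jet _ (supb r r_gt)).
have [K' K'0 hK'] := bump_dominates rr (test_jet 1 (tb r r_gt)) (supported_jet _ (supb r r_gt)).
have [C4 C40 h4] := Dsq_cutoff oU M.
have [C3 C30 h3] := hcut r s _ s_gt rs (le_trans sr0 l3) (tb r r_gt) (supb r r_gt).
have [C6 C60 h6] := IH M (leqnn M) s r' s_gt sr (le_trans r'r0 l1).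
(* Collects all coefficients of [S]: [K] from the lower jet, [C4 * K] from undoing the cut-off, and
   [C4 * C2 * C3] twice, for the energy and for the jet of the cut-off function. The factor [2] in
   the next line is [1 + e] at [e = 1]. *)
pose D1 := K + C4 * (C2 * (C3 + C3) + K).
exists (C4 * C2 * 2 * K' + D1 * C6).
  by apply: addr_ge0; apply: mulr_ge0 => //; rewrite ?mulr_ge0// addr_ge0// mulr_ge0// addr_ge0//
    mulr_ge0// addr_ge0.
move=> u su; set b := bump x0 r; set bs := bump x0 s; set b' := bump x0 r'.
pose v x := b x * u x.
have bUr := bU _ rr0; have bUs := bU _ sr0; have bUr' := bU _ r'r0.
have ccb t f : 0 < t -> t <= r0 -> smooth_on U f -> cc (fun x => bump x0 t x ^+ 2 * f x).
  by move=> t0 tr sf; apply: test_cc; apply: (test_cutoff2 (bU t tr)) => //; exact: supb.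
have tv : test v := test_cutoff bUr (sbT r) (supb r r_gt) su.
have sv : supported_in x0 r v by apply: supported_mulr; exact: supb.
have sq a : smooth_on U (fun x => q a u x * rho x).
  by apply: smooth_onM => //; exact: smooth_metric_square.
have q0 a x : U x -> 0 <= q a u x by move=> Ux; exact: (metric_square_ge0 a sG su Ux).
have rho0 x : U x -> 0 <= rho x by move=> Ux; exact: ltW (rho_gt0 Ux).
have sj a : smooth_on U (jet a u) by exact: smooth_jet.
have sD a : smooth_on U (Dsq a u) by exact: smooth_Dsq.
have sbU t : smooth_on U (bump x0 t) by exact: sb.
pose E a := integral_rV (fun x => b' x ^+ 2 * (q a u x * rho x)).
pose P := integral_rV (fun x => b x ^+ 2 * (q M u x * rho x)).
pose S := integral_rV (fun x => bs x ^+ 2 * jet M u x).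
have b0 x : ~ closed_rball x0 r x -> b x = 0 by move=> /negP; rewrite -ltNge => /supb; exact.
have hS : S <= C6 * \sum_(a < M) E a by exact: h6.
have E0 a : 0 <= E a.
  apply: integral_rV_ge0 => x; have [hx|hx] := leP `|x - x0| r'; last first.
    by rewrite /b' (supb r' r'_gt _ hx) expr0n mul0r.
  by rewrite mulr_ge0 ?sqr_ge0// mulr_ge0 ?q0 ?rho0//; exact: bUr'.
have S0 : 0 <= S by apply: integral_rV_ge0 => x; rewrite mulr_ge0 ?sqr_ge0 ?jet_ge0.
have sj0 x : 0 <= bs x ^+ 2 * jet M u x by rewrite mulr_ge0 ?sqr_ge0 ?jet_ge0.
have bK x : jet M.+1 b x <= K * bs x ^+ 2 by exact: hK.
have bbK x : b x ^+ 2 <= K * bs x ^+ 2.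
  by apply: le_trans (bK x); have := @le_jet R n 1 M.+1 b x isT; rewrite {1}/jet big_ord1.
have hP : P <= K' * E M.
  rewrite -integral_rVZ; last exact: ccb.
  apply: le_integral_rV; [exact: ccb|by apply: ccZ; exact: ccb|move=> x].
  have [hx|hx] := pselect (closed_rball x0 r x); last first.
    rewrite b0// expr0n mul0r; apply: mulr_ge0 => //.
    have [hx'|hx'] := leP `|x - x0| r'; last by rewrite /b' (supb r' r'_gt _ hx') expr0n mul0r.
    by rewrite mulr_ge0 ?sqr_ge0// mulr_ge0 ?q0 ?rho0//; exact: bUr'.
  have Ux := bUr _ hx; rewrite [leRHS]mulrA; apply: ler_wpM2r; first by rewrite mulr_ge0 ?q0 ?rho0.
  by have := hK' x; rewrite /jet big_ord1.
have hA : integral_rV (fun x => b x ^+ 2 * jet M u x) <= K * S.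
  rewrite -integral_rVZ; last exact: ccb.
  apply: le_integral_rV; [exact: ccb|by apply: ccZ; exact: ccb|move=> x].
  by rewrite mulrA; apply: ler_wpM2r; first exact: jet_ge0.
have hB1 : integral_rV (fun x => b x ^+ 2 * Dsq M u x) <= C4 * (integral_rV (Dsq M v) + K * S).
  rewrite -integral_rVZ; last exact: ccb.
  have cS : cc (fun x => K * (bs x ^+ 2 * jet M u x)) by apply: ccZ; exact: ccb.
  have cD := test_cc (test_Dsq M tv).
  rewrite -integral_rVD// -integral_rVZ; last exact: ccD.
  apply: le_integral_rV; [exact: ccb|by apply: ccZ; exact: ccD|move=> x].
  have [hx|hx] := pselect (closed_rball x0 r x); last first.
    rewrite b0// expr0n mul0r mulr_ge0// addr_ge0 ?Dsq_ge0// mulr_ge0// mulr_ge0 ?sqr_ge0 ?jet_ge0//.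
  apply: le_trans (h4 b u x (sbU r) su (bUr _ hx)) _; apply: ler_wpM2l => //.
  by rewrite lerD2l mulrA; apply: ler_wpM2r; first exact: jet_ge0.
have hC1 : integral_rV (Dsq M v) <= C2 * (integral_rV (fun x => q M v x * rho x) + integral_rV (jet M v)).
  by apply: hD => //; apply: supportedW sv; exact: le_trans rr0 l2.
have [hD1 hE1] := h3 u su.
have -> : integral_rV (fun x => b x ^+ 2 * jet M.+1 u x) =
    integral_rV (fun x => b x ^+ 2 * jet M u x) + integral_rV (fun x => b x ^+ 2 * Dsq M u x).
  rewrite -integral_rVD; [|exact: ccb|exact: ccb].
  by congr integral_rV; apply/funext => x; rewrite jetS mulrDr.
rewrite big_ord_recr /= -/(E M).
have -> : \sum_(i < M) integral_rV (fun x => b' x ^+ 2 * (q i u x * rho x)) = \sum_(i < M) E i by [].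
have SE0 : 0 <= \sum_(i < M) E i by apply: sumr_ge0.
have D10 : 0 <= D1.
  by rewrite /D1 addr_ge0// mulr_ge0// addr_ge0// mulr_ge0// addr_ge0.
apply: (@le_trans _ _ (C4 * C2 * 2 * P + D1 * S)).
  have t1 := ler_wpM2l C20 (lerD hD1 hE1).
  have t2 := le_trans hC1 t1; have t3 := le_trans hB1 (ler_wpM2l C40 (lerD t2 (lexx (K * S)))).
  apply: le_trans (lerD hA t3) _; rewrite le_eqVlt; apply/orP; left; apply/eqP.
  by rewrite /D1 -/P -/S; ring.
have t1 : D1 * S <= D1 * C6 * \sum_(i < M) E i by rewrite -mulrA ler_wpM2l.
have t2 : C4 * C2 * 2 * P <= C4 * C2 * 2 * K' * E M by rewrite -[leRHS]mulrA ler_wpM2l// !mulr_ge0.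
apply: le_trans (lerD t2 t1) _.
have t3 : 0 <= C4 * C2 * 2 * K' * \sum_(i < M) E i by apply: mulr_ge0 => //; rewrite !mulr_ge0.
have t4 : 0 <= D1 * C6 * E M by rewrite !mulr_ge0.
have arith (a1 a2 x y : R) : 0 <= a1 * x -> 0 <= a2 * y -> a1 * y + a2 * x <= (a1 + a2) * (x + y).
  by move=> h1 h2; rewrite -subr_ge0 (_ : _ - _ = a1 * x + a2 * y) ?addr_ge0//; ring.
exact: arith.
Qed.

End interior_estimates.

(** * The local inequality with almost sharp constant *)

Section local_sobolev_inequality.
Context {R : realType} {n : nat} (U : set 'rV[R]_n) (x0 : 'rV[R]_n).
Hypothesis oU : open U.
Hypothesis Ux0 : U x0.
Variable G : 'rV[R]_n -> 'M[R]_n.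
Hypothesis sG : smooth_metric U G.
Variable k : nat.
Hypotheses (k0 : (0 < k)%N) (kn : (2 * k < n)%N).
Local Notation rho := (volume_density G).
Local Notation q := (metric_square G).
Local Notation p := (critical_exponent R n k).
Local Notation K := (K0 (R := R) n k).
Implicit Types (u v eta : 'rV[R]_n -> R).

Let n0 : (0 < n)%N. Proof. exact: leq_ltn_trans kn. Qed.
Let pG0 : posdef (G x0). Proof. by case: sG => _; exact. Qed.
Let srho : smooth_on U rho. Proof. by case: sG => *; exact: smooth_volume_density. Qed.
Let rho_gt0 x : U x -> 0 < rho x. Proof. by case: sG => *; exact: (@volume_density_gt0 R n U). Qed.

Lemma test_p_rho r v : closed_rball x0 r `<=` U -> test v -> supported_in x0 r v ->
  cc (fun x => `|v x| `^ p * rho x).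
Proof.
move=> bU tv sv; have p2 := critical_exponent_gt2 (R := R) k0 kn.
have cv : cc (fun x => `|v x| `^ p) by apply: cc_norm_powR; [lra|exact: test_cc].
have [cf [r' hr']] := cv; split; last by exists r' => x /hr' ->; rewrite mul0r.
move=> x; have [hx|hx] := leP `|x - x0| r.
  exact: continuousM (cf x) (smooth_on_cont srho (bU _ hx)).
have z y : r < `|y - x0| -> `|v y| `^ p * rho y = 0.
  by move=> hy; rewrite sv// normr0 powR0 ?mul0r// gt_eqF//; lra.
rewrite /continuous_at (z _ hx); apply/(@cvgrPdist_le _ _ _ (nbhs x)) => e' e'0.
have := open_near (@open_far R n x0 r) hx z; apply: filterS => y ->.
by rewrite subrr normr0 ltW.
Qed.

Lemma local_sobolev (e : R) : 0 < e -> exists2 r0, 0 < r0 & exists2 C, 0 <= C &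
  closed_rball x0 r0 `<=` U /\ forall v, test v -> supported_in x0 r0 v ->
  integral_rV (fun x => `|v x| `^ p * rho x) `^ (2 / p) <=
  (K + e) * integral_rV (fun x => q k v x * rho x) + C * integral_rV (jet k v).
Proof.
move=> e0; have p2 := critical_exponent_gt2 (R := R) k0 kn; have Kp := K0_gt0 (R := R) k0 kn.
(* Freezing costs a factor [1 + d] twice, for the density and for the energy; as [d <= 1], the
   square exceeds [1] by at most [3 d]. *)
pose d := Num.min 1 (e / (3 * K)).
have d0 : 0 < d by rewrite lt_min ltr01 divr_gt0// mulr_gt0.
have dK : (1 + d) ^+ 2 * K <= K + e.
  have d1 : d <= 1 by rewrite ge_min lexx.
  have d2 : d * (3 * K) <= e.
    have : d <= e / (3 * K) by rewrite ge_min lexx orbT.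
    by rewrite ler_pdivlMr// mulr_gt0.
  have d3 : d ^+ 2 <= d by rewrite expr2 ler_piMr// ltW.
  have := ler_wpM2r (ltW Kp) d3; move: (d) d2 => t; lra.
have d1 : 0 < 1 + d by lra.
have [C1 C10 hC1] := coercive_constant_metric pG0 k.
have C1p : 0 < C1 + 1 by lra.
have dd0 : 0 < d / ((1 + d) * (C1 + 1)) by rewrite divr_gt0// mulr_gt0.
have [r1 r10 [C C0 [b1U hC]]] := coercive_near oU Ux0 sG k dd0.
have rx0 := rho_gt0 Ux0.
have [r2 r20 hr2] : exists2 r2, 0 < r2 & forall x, closed_rball x0 r2 x -> rho x <= (1 + d) * rho x0.
  apply: near_closed_rball; apply: filterS (coef_near Ux0 srho (mulr_gt0 d0 rx0)) => x hx.
  rewrite mulrDl mul1r -lerBlDl ltW//; exact: le_lt_trans (ler_norm _) hx.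
exists (Num.min r1 r2); first by rewrite lt_min r10.
exists ((K + e) * C); first by rewrite mulr_ge0// addr_ge0// ltW.
have ball_le (s s' : R) : s <= s' -> closed_rball x0 s `<=` closed_rball x0 s'.
  by move=> ss x /= h; exact: le_trans ss.
have m1 : Num.min r1 r2 <= r1 by rewrite ge_min lexx.
have m2 : Num.min r1 r2 <= r2 by rewrite ge_min lexx orbT.
have bU : closed_rball x0 (Num.min r1 r2) `<=` U by apply: subset_trans b1U; exact: ball_le.
split=> // v tv sv.
have cv : cc (fun x => `|v x| `^ p) by apply: cc_norm_powR; [lra|exact: test_cc].
pose Q0 := integral_rV (metric_square (fun=> G x0) k v) * rho x0.
pose Q := integral_rV (fun x => q k v x * rho x).
pose J := integral_rV (jet k v); pose D := integral_rV (Dsq k v).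
have J0 : 0 <= J by apply: integral_rV_ge0 => x; exact: jet_ge0.
have D0 : 0 <= D by apply: integral_rV_ge0 => x; exact: Dsq_ge0.
have hD : D <= C1 * Q0 by exact: hC1.
have := hC v tv (supportedW m1 sv); rewrite ler_norml -/Q -/Q0 -/J -/D => /andP[h2 _].
have Q00 : 0 <= Q0.
  apply: mulr_ge0; last exact: ltW.
  apply: integral_rV_ge0 => x.
  apply: (@metric_square_ge0 R n setT (fun=> G x0)) => //; last by case: tv.
  by split => // i j; apply: smooth_on_cst; exact: openT.
have hQ0 : Q0 <= (1 + d) * (Q + C * J).
  have h3 : d / ((1 + d) * (C1 + 1)) * D <= d / (1 + d) * Q0.
    apply: (@le_trans _ _ (d / ((1 + d) * (C1 + 1)) * ((C1 + 1) * Q0))).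
      rewrite ler_pM2l//; apply: le_trans hD _; rewrite mulrDl mul1r lerDl//.
    have ident (t a b c : R) : a != 0 -> b != 0 -> t / (a * b) * (b * c) = t / a * c.
      by move=> a0 b0; field; rewrite a0 b0.
    by rewrite ident// gt_eqF.
  have h4 : Q0 - d / (1 + d) * Q0 <= Q + C * J by lra.
  have h5 : Q0 = (1 + d) * (Q0 - d / (1 + d) * Q0).
    have : 1 + d != 0 by rewrite gt_eqF.
    by move: (d) => t t0; field.
  by rewrite h5 ler_pM2l.
apply: (@le_trans _ _ ((1 + d) * (K * Q0))); last first.
  apply: (@le_trans _ _ ((1 + d) ^+ 2 * K * (Q + C * J))).
    have h6 := ler_wpM2l (ltW d1) (ler_wpM2l (ltW Kp) hQ0).
    apply: le_trans h6 _; rewrite le_eqVlt; apply/orP; left; apply/eqP.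
    by move: (Q + C * J) (d) (K) => y t z; ring.
  have QJ : 0 <= Q + C * J by rewrite -(pmulr_rge0 _ d1); exact: le_trans hQ0.
  by rewrite -[(K + e) * C * _]mulrA -mulrDr; exact: ler_wpM2r.
have step : integral_rV (fun x => `|v x| `^ p * rho x) <=
    (1 + d) * (integral_rV (fun x => `|v x| `^ p) * rho x0).
  rewrite [_ * rho x0]mulrC mulrA -integral_rVZ//.
  apply: le_integral_rV; [exact: test_p_rho bU tv sv|exact: ccZ|move=> x].
  have [hx|hx] := leP `|x - x0| (Num.min r1 r2); last first.
    by rewrite sv// normr0 powR0 ?mul0r ?mulr0// gt_eqF//; lra.
  rewrite mulrC; apply: ler_wpM2r; first exact: powR_ge0.
  by apply: hr2; exact: ball_le m2 _ hx.
have p20 : 0 <= 2 / p by rewrite divr_ge0//; lra.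
have I0 : 0 <= integral_rV (fun x => `|v x| `^ p) * rho x0.
  by apply: mulr_ge0; [apply: integral_rV_ge0 => x; exact: powR_ge0|exact: ltW].
have B0 : 0 <= (1 + d) * (integral_rV (fun x => `|v x| `^ p) * rho x0) by exact: mulr_ge0 (ltW d1) I0.
have A0 : 0 <= integral_rV (fun x => `|v x| `^ p * rho x).
  apply: integral_rV_ge0 => x; have [hx|hx] := leP `|x - x0| (Num.min r1 r2).
    by rewrite mulr_ge0 ?powR_ge0// ltW// rho_gt0//; exact: bU.
  by rewrite sv// normr0 powR0 ?mul0r// gt_eqF//; lra.
apply: le_trans (ge0_ler_powR p20 _ _ step) _; rewrite ?nnegrE//.
rewrite powRM ?(ltW d1)//; apply: ler_pM; rewrite ?powR_ge0//.
  (* The exponent [2 / p] is at most [1] and the base at least [1]. *)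
  rewrite -[leRHS]powRr1 ?(ltW d1)//; apply: ler_powR; first by lra.
  by rewrite ler_pdivrMr; lra.
exact: sobolev_constant_metric.
Qed.

Lemma local_inequality (e : R) : 0 < e -> exists2 r0, 0 < r0 & closed_rball x0 r0 `<=` U /\
  forall r eta, r < r0 -> test eta -> supported_in x0 r eta -> exists2 C, 0 <= C &
  forall u, smooth_on U u ->
    integral_rV (fun x => `|eta x * u x| `^ p * rho x) `^ (2 / p) <=
    (K + e) * integral_rV (fun x => eta x ^+ 2 * (q k u x * rho x)) +
    C * \sum_(a < k) integral_rV (fun x => bump x0 r0 x ^+ 2 * (q a u x * rho x)).
Proof.
move=> e0; have Kp := K0_gt0 (R := R) k0 kn.
have e2 : 0 < e / 2 by rewrite divr_gt0.
(* Solves [(K + e/2)(1 + d) = K + e]: half of [e] pays for freezing the metric, the rest for the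
   cut-off. *)
pose d := e / 2 / (K + e / 2).
have Ke : 0 < K + e / 2 by rewrite addr_gt0.
have d0 : 0 < d by rewrite divr_gt0.
have dE : (K + e / 2) * (1 + d) = K + e.
  have : d * (K + e / 2) = e / 2 by rewrite divfK// gt_eqF.
  by move: (d) => t; lra.
have [r1 r10 [C1 C10 [b1U h1]]] := local_sobolev e2.
have [r2 r20 [b2U h2]] := cutoff_integrals oU Ux0 n0 sG k d0.
have [r3 r30 [b3U h3]] := interior_estimate oU Ux0 n0 sG k.
pose r0 := Num.min r1 (Num.min r2 r3).
have r00 : 0 < r0 by rewrite !lt_min r10 r20.
have [l1 l2 l3] : [/\ r0 <= r1, r0 <= r2 & r0 <= r3].
  by rewrite /r0; split; rewrite !ge_min lexx ?orbT.
exists r0 => //; split; first by move=> x /= h; apply: b1U; exact: le_trans l1.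
move=> r0' eta r0'0 te sup'.
(* The given radius may be nonpositive; enlarging it keeps it below [r0]. *)
pose r := Num.max r0' (r0 / 2).
have r0r : 0 < r by rewrite lt_max divr_gt0 ?orbT.
have rr0 : r < r0 by rewrite gt_max r0'0 ltr_pdivrMr// ltr_pMr// ltr1n.
have sup : supported_in x0 r eta by apply: supportedW sup'; rewrite le_max lexx.
pose s := (r + r0) / 2.
have rs : r < s by rewrite /s ltr_pdivlMr//; lra.
have sr : s < r0 by rewrite /s ltr_pdivrMr//; lra.
have s0 : 0 < s by exact: lt_trans rs.
have [C2 C20 hC2] := h2 r s eta s0 rs (le_trans (ltW sr) l2) te sup.
have [C3 C30 hC3] := h3 k (leqnn k) s r0 s0 sr l3.
exists (((K + e / 2) * C2 + C1 * C2) * C3).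
  by rewrite mulr_ge0// addr_ge0// mulr_ge0// ltW.
move=> u su; have [hq hj] := hC2 u su; have hS := hC3 u su.
have bUr : closed_rball x0 r `<=` U by move=> x /= h; apply: b1U; apply: le_trans h (le_trans (ltW rr0) l1).
have tv : test (fun x => eta x * u x) := test_cutoff oU bUr (proj1 te) sup su.
have sv : supported_in x0 r1 (fun x => eta x * u x).
  by apply: supportedW (le_trans (ltW rr0) l1) _; exact: supported_mulr.
apply: le_trans (h1 _ tv sv) _.
have hq' := ler_wpM2l (ltW Ke) hq; have hj' := ler_wpM2l C10 hj.
apply: le_trans (lerD hq' hj') _; rewrite mulrDr mulrA dE -addrA lerD2l.
rewrite !mulrA -mulrDl -[_ * C3 * _]mulrA; apply: ler_wpM2l => //.
by rewrite addr_ge0// mulr_ge0// ltW.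
Qed.

End local_sobolev_inequality.

(** * Concentration *)

Section concentration.
Context {R : realType} {n : nat} (U : set 'rV[R]_n) (x0 : 'rV[R]_n).
Hypothesis oU : open U.
Hypothesis Ux0 : U x0.
Variable G : 'rV[R]_n -> 'M[R]_n.
Hypothesis sG : smooth_metric U G.
Variable k : nat.
Hypotheses (k0 : (0 < k)%N) (kn : (2 * k < n)%N).
Local Notation rho := (volume_density G).
Local Notation q := (metric_square G).
Local Notation p := (critical_exponent R n k).
Implicit Types (u v phi : 'rV[R]_n -> R).

Let pG0 : posdef (G x0). Proof. by case: sG => _; exact. Qed.
Let srho : smooth_on U rho. Proof. by case: sG => *; exact: smooth_volume_density. Qed.
Let rho_gt0 x : U x -> 0 < rho x. Proof. by case: sG => *; exact: (@volume_density_gt0 R n U). Qed.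

Lemma Dsq_dilation m phi (l : R) x : smooth_on setT phi ->
  Dsq m (fun y => phi (l *: y)) x = l ^+ (2 * m) * Dsq m phi (l *: x).
Proof.
elim: m phi x => [|m IH] phi x sphi /=; first by rewrite muln0 expr0 mul1r.
rewrite mulr_sumr; apply: eq_bigr => i _.
have sp := smooth_on_partial i sphi.
have -> : pderiv i (fun y => phi (l *: y)) = (fun y => (fun z => l * pderiv i phi z) (l *: y)).
  apply/funext => y.
  have := @pderiv_affine R n (l%:M) 0 i phi y sphi.
  under eq_fun do rewrite addr0 mul_mx_scalar.
  move=> ->; rewrite (bigD1 i)//= big1 ?addr0 => [|j ji].
    by rewrite mxE eqxx mul_mx_scalar.
  by rewrite mxE eq_sym (negbTE ji) mul0r.
have sz : smooth_on setT (fun z => l * pderiv i phi z) by apply: smooth_onZ => //; exact: openT.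
rewrite (IH (fun z => l * pderiv i phi z))// (@DsqZ R n setT) //; last exact: openT.
by rewrite mulrA -exprD mulnS addnC.
Qed.

Lemma test_dilation phi (l : R) : l != 0 -> test phi -> test (fun y => phi (l *: y)).
Proof.
move=> l0 tphi.
have ul : (l%:M : 'M[R]_n) \in unitmx by rewrite unitmxE det_scalar unitrX// unitfE.
have := test_pullback 0 ul tphi.
by under eq_fun do rewrite addr0 mul_mx_scalar.
Qed.

Lemma integral_dilation f (l : R) : 0 < l -> cc f ->
  integral_rV (fun y : 'rV[R]_n => f (l^-1 *: y)) = l ^+ n * integral_rV f.
Proof.
move=> l0 cf; have li : l^-1 != 0 by rewrite invr_eq0 gt_eqF.
have ul : (l^-1%:M : 'M[R]_n) \in unitmx by rewrite unitmxE det_scalar unitrX// unitfE.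
have cF : cc (fun y : 'rV[R]_n => f (l^-1 *: y)).
  by have := cc_affine 0 cf ul; under eq_fun do rewrite addr0 mul_mx_scalar.
have dl : 0 < \det (l%:M : 'M[R]_n) by rewrite det_scalar exprn_gt0.
have := integral_rV_affine 0 (@affine_change_scalar R n l l0) dl cF.
rewrite det_scalar => <-; congr (_ * integral_rV _); apply/funext => y.
by rewrite addr0 mul_mx_scalar scalerA mulVf ?scale1r// gt_eqF.
Qed.

Lemma concentrating_family phi : test phi -> exists2 C, 0 <= C & forall r, 0 < r ->
  exists2 l0, 0 < l0 & forall l, 0 < l -> l <= l0 -> exists v, [/\ test v, supported_in x0 r v &
    exists2 L, 0 < L &
    [/\ (integral_rV (fun x => `|v x| `^ p) * rho x0) `^ (2 / p) =
        L * integral_rV (fun x => `|phi x| `^ p) `^ (2 / p),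
       integral_rV (metric_square (fun=> G x0) k v) * rho x0 = L * integral_rV (Dsq k phi),
       integral_rV (Dsq k v) <= L * C & integral_rV (jet k v) <= L * (l ^+ 2 * C)]].
Proof.
move=> tphi; have [sphi [r' hr']] := tphi.
have p2 := critical_exponent_gt2 (R := R) k0 kn.
have [M [N [uM uN NM NG hI]]] := constant_metric pG0.
have [CM CM0 hCM] := mulmx_bound M.
have rx0 : 0 < rho x0 := rho_gt0 Ux0.
pose cD m := projT1 (cid2 (Dsq_pullback_le N (- (x0 *m N)) m)).
have cD0 m : 0 <= cD m by rewrite /cD; case: cid2.
have hcD m psi x : smooth_on setT psi ->
    Dsq m (fun y => psi (y *m N + - (x0 *m N))) x <= cD m * Dsq m psi (x *m N + - (x0 *m N)).
  by rewrite /cD; case: cid2 => c /= _; exact.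
pose I m := integral_rV (Dsq m phi).
have I0 m : 0 <= I m by apply: integral_rV_ge0 => x; exact: Dsq_ge0.
pose C := \sum_(m < k.+1) cD m / rho x0 * I m.
have t0 m : 0 <= cD m / rho x0 * I m by rewrite mulr_ge0// divr_ge0// ltW.
exists C; first exact: sumr_ge0.
(* On the support of [v], [|x - x0|] is at most [CM * r' * l <= B * l]; hence the condition
   [l <= r / B]. *)
move=> r r_gt; pose B := `|r'| * (CM + 1) + 1.
have B0 : 0 < B by rewrite ltr_wpDl// mulr_ge0// addr_ge0.
exists (Num.min 1 (r / B)); first by rewrite lt_min ltr01 divr_gt0.
move=> l l_gt; rewrite le_min => /andP[l1 lB].
have li : l^-1 != 0 by rewrite invr_eq0 gt_eqF.
pose psi y := phi (l^-1 *: y).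
have tpsi : test psi by exact: test_dilation.
have [spsi _] := tpsi.
pose v x := psi (x *m N + - (x0 *m N)).
have tv : test v by exact: test_pullback.
exists v; split => //.
  move=> x hx; rewrite /v /psi; apply: hr'; rewrite subr0 normrZ.
  rewrite ger0_norm ?invr_ge0 ?(ltW l_gt)// mulrC ltr_pdivlMr// -mulmxBl.
  rewrite ltNge; apply/negP => h.
  have := hCM ((x - x0) *m N); rewrite -mulmxA NM mulmx1 => h'.
  have : r < r.
    apply: lt_le_trans hx _; apply: le_trans h' _.
    apply: (@le_trans _ _ (CM * (r' * l))); first exact: ler_wpM2l.
    apply: (@le_trans _ _ (B * l)); last by rewrite mulrC -ler_pdivlMr.
    rewrite mulrA ler_pM2r//; apply: le_trans (ler_wpM2l CM0 (ler_norm r')) _.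
    by rewrite /B mulrDr mulr1 mulrC -addrA lerDl addr_ge0.
  by rewrite ltxx.
exists (l ^+ (n - 2 * k)); first exact: exprn_gt0.
have shift f : cc f -> integral_rV (fun x => f (x *m N + - (x0 *m N))) * rho x0 = integral_rV f.
  move=> cf; pose F y := f (y + - (x0 *m N)).
  have cF : cc F.
    have := cc_affine (- (x0 *m N)) cf (unitmx1 R n).
    by under eq_fun do rewrite mulmx1.
  have d1 : 0 < \det (1%:M : 'M[R]_n) by rewrite det1.
  have := integral_rV_affine (- (x0 *m N)) (@affine_change_scalar R n 1 ltr01) d1 cf.
  rewrite det1 mul1r; under eq_fun do rewrite mulmx1.
  move=> <-; rewrite -(hI F cF).
  by congr (integral_rV _ * _); apply/funext => x; rewrite /F addr0.
have lpsi m : (m <= k)%N -> integral_rV (Dsq m psi) = l ^+ (n - 2 * k) * l ^+ (2 * (k - m)) * I m.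
  move=> mk; have -> : Dsq m psi = (fun y => l^-1 ^+ (2 * m) * Dsq m phi (l^-1 *: y)).
    by apply/funext => y; exact: Dsq_dilation.
  rewrite integral_rVZ; last by apply: test_cc; apply: test_dilation => //; exact: test_Dsq.
  rewrite integral_dilation//; last by apply: test_cc; exact: test_Dsq.
  rewrite mulrA; congr (_ * _); rewrite -exprD.
  have e : (n = 2 * m + (n - 2 * k + 2 * (k - m)))%N.
    by rewrite mulnBr addnC -addnA subnK ?leq_mul2l ?mk ?orbT// subnK// ltnW.
  rewrite [in LHS]e exprD mulrA -exprMn mulVf ?expr1n ?mul1r//.
  by rewrite gt_eqF.
have lv m : (m <= k)%N -> integral_rV (Dsq m v) <=
    l ^+ (n - 2 * k) * l ^+ (2 * (k - m)) * (cD m / rho x0 * I m).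
  move=> mk; have cp := test_cc (test_Dsq m tpsi).
  apply: (@le_trans _ _ (cD m / rho x0 * integral_rV (Dsq m psi))); last first.
    by rewrite lpsi// le_eqVlt; apply/orP; left; apply/eqP; ring.
  rewrite -(shift _ cp) [X in _ * X]mulrC mulrA divfK ?gt_eqF//.
  have cs : cc (fun x => Dsq m psi (x *m N + - (x0 *m N))) by exact: cc_affine.
  rewrite -integral_rVZ//.
  apply: le_integral_rV; [exact: test_cc (test_Dsq m tv)|exact: ccZ|move=> x].
  exact: hcD.
have L0 : 0 < l ^+ (n - 2 * k) by exact: exprn_gt0.
have tC m : (m <= k)%N -> cD m / rho x0 * I m <= C.
  move=> mk; have mk' : (m < k.+1)%N by [].
  by rewrite /C (bigD1 (Ordinal mk'))//= lerDl sumr_ge0.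
split.
- have cv : cc (fun x => `|phi x| `^ p) by apply: cc_norm_powR; [lra|exact: test_cc].
  have cpsi : cc (fun x => `|psi x| `^ p) by apply: cc_norm_powR; [lra|exact: test_cc].
  rewrite (shift _ cpsi) (integral_dilation l_gt cv) powRM; last 2 first.
  + by rewrite exprn_ge0// ltW.
  + by apply: integral_rV_ge0 => x; exact: powR_ge0.
  congr (_ * _); rewrite -!powR_mulrn ?(ltW l_gt)// -powRrM; congr (_ `^ _).
  have nn : (n%:R : R) != 0 by rewrite pnatr_eq0 -lt0n; exact: leq_ltn_trans kn.
  rewrite natrB ?(ltnW kn)// /critical_exponent natrM.
  have nk : n%:R - (2 * k)%:R != 0 :> R by rewrite subr_eq0 eqr_nat gt_eqF.
  by move: (n%:R : R) ((2 * k)%:R : R) nn nk => a b a0 ab; field; rewrite a0 ab.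
- have -> : metric_square (fun=> G x0) k v =
      (fun x => euclidean_half_laplacian_sq k psi (x *m N + - (x0 *m N))).
    by apply/funext => x; exact: half_laplacian_pullback.
  rewrite shift; last by apply: test_cc; exact: test_euclidean.
  by rewrite integral_half_laplacian_sq// lpsi// subnn muln0 expr0 mulr1.
- apply: le_trans (lv k (leqnn k)) _; rewrite subnn muln0 expr0 mulr1 ler_pM2l//.
  exact: tC.
rewrite /jet integral_rV_sum; last by move=> m _; exact: test_cc (test_Dsq m tv).
apply: (@le_trans _ _ (\sum_(m < k) l ^+ (n - 2 * k) * (l ^+ 2 * (cD m / rho x0 * I m)))).
  apply: ler_sum => m _; apply: le_trans (lv m (ltnW (ltn_ord m))) _.
  rewrite -[leLHS]mulrA ler_pM2l//; apply: ler_wpM2r => //.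
  (* Each missing order of derivation gains two powers of [l <= 1], and at least one order is
     missing. *)
  have m2 : (2 <= 2 * (k - m))%N by rewrite leq_pmulr// subn_gt0.
  exact: (ler_wiXn2l (ltW l_gt) l1 m2).
rewrite -mulr_sumr ler_pM2l// -mulr_sumr ler_wpM2l ?exprn_ge0 ?(ltW l_gt)//.
by rewrite /C big_ord_recr /= lerDl.
Qed.

(** [d] measures how far metric and density are from their values at [x0]. For fixed [d] the
    inequality for the concentrating functions is divided by [L] and [l] tends to [0], which removes
    the lower order terms; then [d] tends to [0]. *)
Lemma concentration (A B : R) r1 : 0 < r1 -> closed_rball x0 r1 `<=` U ->
  (forall v, test v -> supported_in x0 r1 v ->
    integral_rV (fun x => `|v x| `^ p * rho x) `^ (2 / p) <=
    A * integral_rV (fun x => q k v x * rho x) +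
    B * \sum_(a < k) integral_rV (fun x => q a v x * rho x)) ->
  K0 n k <= A.
Proof.
move=> r10 b1U hAB; have p2 := critical_exponent_gt2 (R := R) k0 kn.
have p_gt0 : 0 < p by lra.
have pn0 : p != 0 by rewrite gt_eqF.
have p20 : 0 <= 2 / p by rewrite divr_ge0// ltW.
have p21 : 2 / p <= 1 by rewrite ler_pdivrMr// mul1r ltW.
apply: K0_le => // phi tphi; have [C C0 fam] := concentrating_family tphi.
pose P := integral_rV (fun x => `|phi x| `^ p) `^ (2 / p).
pose D := integral_rV (Dsq k phi).
have P0 : 0 <= P by exact: powR_ge0.
have D0 : 0 <= D by apply: integral_rV_ge0 => x; exact: Dsq_ge0.
have rx0 : 0 < rho x0 := rho_gt0 Ux0.
have key d : 0 < d -> P <= (1 + d) * (A * D + `|A| * (d * C)).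
  move=> d0; have d1 : 0 < 1 + d by lra.
  have [r2 r20 [C2 C20 [b2U h2]]] := coercive_near oU Ux0 sG k d0.
  have hq a : exists2 c, 0 <= c & \forall x \near x0, forall u, smooth_on U u ->
      q a u x <= c * jet a.+1 u x by exact: (metric_square_near oU Ux0 a sG).
  have [C3 C30 h3] : exists2 c, 0 <= c & \forall x \near x0, forall u, smooth_on U u ->
      \sum_(a < k) q a u x <= c * jet k u x.
    apply: near_bound_sum => a; have [c c0 hc] := hq a; exists c => //.
    apply: filterS hc => x hc u su; apply: le_trans (hc u su) _; apply: ler_wpM2l => //.
    exact: le_jet.
  have [r3 r30 hr3] := near_closed_rball h3.
  have [r4 r40 [Br Br0 [b4U h4]]] := rho_bound oU Ux0 sG.
  have [r5 r50 hr5] : exists2 r5, 0 < r5 & forall x, closed_rball x0 r5 x -> rho x0 <= (1 + d) * rho x.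
    apply: near_closed_rball.
    have e0 : 0 < d / (1 + d) * rho x0 by rewrite mulr_gt0// divr_gt0.
    apply: filterS (coef_near Ux0 srho e0) => x hx.
    have : rho x0 - rho x < d / (1 + d) * rho x0.
      by apply: le_lt_trans hx; rewrite distrC; exact: ler_norm.
    rewrite mulrAC ltr_pdivlMr// => h; lra.
  pose r := Num.min r1 (Num.min r2 (Num.min r3 (Num.min r4 r5))).
  have r_gt : 0 < r by rewrite !lt_min r10 r20 r30 r40 r50.
  have [l1 l2 l3 l4 l5] : [/\ r <= r1, r <= r2, r <= r3, r <= r4 & r <= r5].
    by rewrite /r; split; rewrite !ge_min lexx ?orbT.
  have [l0 l00 hl] := fam r r_gt.
  have ball_le (s s' : R) : s <= s' -> closed_rball x0 s `<=` closed_rball x0 s'.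
    by move=> ss x /= h; exact: le_trans ss.
  pose c4 := `|A| * C2 + `|B| * (C3 * Br).
  have c40 : 0 <= c4 by rewrite addr_ge0// mulr_ge0// mulr_ge0.
  have small l : 0 < l -> l <= l0 ->
      P <= (1 + d) * (A * D + `|A| * (d * C) + c4 * (l ^+ 2 * C)).
    move=> l_gt ll0; have [v [tv sv [L L0 [e1 e2 e3 e4]]]] := hl l l_gt ll0.
    have bU : closed_rball x0 r `<=` U by apply: subset_trans b1U; exact: ball_le.
    have sUv : smooth_on U v by apply: smooth_onS (proj1 tv).
    have main := hAB v tv (supportedW l1 sv).
    have := h2 v tv (supportedW l2 sv); rewrite e2 => hQ.
    set Q := integral_rV (fun x => q k v x * rho x) in main hQ.
    set J := integral_rV (jet k v) in hQ e4.
    have hQ' : `|Q - L * D| <= L * (d * C) + C2 * (L * (l ^+ 2 * C)).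
      apply: le_trans hQ _; apply: lerD; last exact: ler_wpM2l.
      by rewrite mulrCA; apply: ler_wpM2l => //; exact: ltW.
    have q0 a x : 0 <= q a v x * rho x.
      have [hx|hx] := leP `|x - x0| r; last by rewrite (supported_metric_square _ _ sv hx) mul0r.
      have Ux := bU _ hx; apply: mulr_ge0; last exact: ltW (rho_gt0 Ux).
      exact: (metric_square_ge0 a sG sUv Ux).
    have hS : \sum_(a < k) integral_rV (fun x => q a v x * rho x) <= C3 * Br * (L * (l ^+ 2 * C)).
      have cq a := test_cc (test_q oU sG a bU tv sv).
      rewrite -integral_rV_sum => [|a _]; last exact: cq.
      apply: le_trans (ler_wpM2l (mulr_ge0 C30 Br0) e4).
      rewrite -integral_rVZ; last exact: test_cc (test_jet k tv).
      apply: le_integral_rV; [by apply: cc_sum => a _; exact: cq|by apply: ccZ; exact: test_cc (test_jet k tv)|].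
      move=> x; have [hx|hx] := leP `|x - x0| r; last first.
        rewrite big1 => [|a _]; last by rewrite (supported_metric_square _ _ sv hx) mul0r.
        by rewrite mulr_ge0 ?jet_ge0// mulr_ge0.
      have Ux := bU _ hx; rewrite -mulr_suml [C3 * Br * _]mulrAC; apply: ler_pM.
      - by apply: sumr_ge0 => a _; exact: (metric_square_ge0 a sG sUv Ux).
      - exact: ltW (rho_gt0 Ux).
      - by apply: hr3 => //; exact: ball_le l3 _ hx.
      - by apply: h4; exact: ball_le l4 _ hx.
    have S0 : 0 <= \sum_(a < k) integral_rV (fun x => q a v x * rho x).
      by apply: sumr_ge0 => a _; apply: integral_rV_ge0 => x; exact: q0.
    have main2 : integral_rV (fun x => `|v x| `^ p * rho x) `^ (2 / p) <=
        L * (A * D + `|A| * (d * C) + c4 * (l ^+ 2 * C)).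
      apply: le_trans main _.
      (* The sign of [A] is unknown, so a two-sided estimate of [Q] is needed. *)
      have hA : A * Q <= A * (L * D) + `|A| * (L * (d * C) + C2 * (L * (l ^+ 2 * C))).
        rewrite -lerBlDl -mulrBr; apply: le_trans (ler_norm _) _; rewrite normrM.
        exact: ler_wpM2l.
      have hB : B * \sum_(a < k) integral_rV (fun x => q a v x * rho x) <=
          `|B| * (C3 * Br * (L * (l ^+ 2 * C))).
        apply: (@le_trans _ _ (`|B| * \sum_(a < k) integral_rV (fun x => q a v x * rho x))).
          by apply: ler_wpM2r => //; exact: ler_norm.
        exact: ler_wpM2l.
      apply: le_trans (lerD hA hB) _; rewrite le_eqVlt; apply/orP; left; apply/eqP.
      by rewrite /c4; ring.
    have step : L * P <= (1 + d) * integral_rV (fun x => `|v x| `^ p * rho x) `^ (2 / p).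
      have cv : cc (fun x => `|v x| `^ p) by apply: cc_norm_powR => //; exact: test_cc.
      have I0 : 0 <= integral_rV (fun x => `|v x| `^ p * rho x).
        apply: integral_rV_ge0 => x; have [hx|hx] := leP `|x - x0| r.
          by rewrite mulr_ge0 ?powR_ge0// ltW// rho_gt0//; exact: bU.
        by rewrite sv// normr0 powR0 ?mul0r.
      have I1 : 0 <= integral_rV (fun x => `|v x| `^ p) * rho x0.
        by apply: mulr_ge0; [apply: integral_rV_ge0 => x; exact: powR_ge0|exact: ltW].
      have cmp : integral_rV (fun x => `|v x| `^ p) * rho x0 <=
          (1 + d) * integral_rV (fun x => `|v x| `^ p * rho x).
        rewrite mulrC -integral_rVZ// -integral_rVZ; last exact: (test_p_rho oU sG k0 kn bU tv sv).
        apply: le_integral_rV; [exact: ccZ|by apply: ccZ; exact: (test_p_rho oU sG k0 kn bU tv sv)|move=> x].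
        have [hx|hx] := leP `|x - x0| r; last first.
          by rewrite sv// normr0 powR0 ?mul0r ?mulr0.
        rewrite mulrC [leRHS]mulrCA; apply: ler_wpM2l; first exact: powR_ge0.
        by apply: hr5; exact: ball_le l5 _ hx.
      rewrite -e1; have B1 := mulr_ge0 (ltW d1) I0.
      apply: le_trans (ge0_ler_powR p20 _ _ cmp) _; rewrite ?nnegrE//.
      rewrite powRM ?(ltW d1)//; apply: ler_wpM2r; first exact: powR_ge0.
      rewrite -[leRHS]powRr1 ?(ltW d1)//; apply: ler_powR => //.
      by rewrite lerDl ltW.
    have := le_trans step (ler_wpM2l (ltW d1) main2).
    by rewrite [X in _ <= X]mulrCA ler_pM2l.
  apply/ler_addgt0Pr => e e0.
  pose c5 := (1 + d) * (c4 * C) + 1.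
  have c50 : 0 < c5 by rewrite ltr_wpDl// mulr_ge0 ?(ltW d1)// mulr_ge0.
  pose l := Num.min l0 (Num.min 1 (e / c5)).
  have l_gt : 0 < l by rewrite !lt_min l00 ltr01 divr_gt0.
  have ll0 : l <= l0 by rewrite ge_min lexx.
  have l_1 : l <= 1 by rewrite !ge_min lexx orbT.
  have l_e : l <= e / c5 by rewrite !ge_min lexx !orbT.
  apply: le_trans (small l l_gt ll0) _; rewrite mulrDr lerD2l.
  apply: (@le_trans _ _ (l * c5)); last by rewrite -ler_pdivlMr.
  have ll : l ^+ 2 <= l by rewrite expr2 ler_piMr// ltW.
  have h0 : 0 <= (1 + d) * (c4 * C) by rewrite mulr_ge0 ?(ltW d1)// mulr_ge0.
  have := ler_wpM2r h0 ll; rewrite /c5; move: (l) l_gt => t t_gt; lra.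
apply/ler_addgt0Pr => e e0; rewrite -/P -/D.
pose c6 := `|A * D| + 2 * (`|A| * C) + 1.
have c60 : 0 < c6 by rewrite ltr_wpDl// addr_ge0// mulr_ge0// mulr_ge0.
pose d := Num.min 1 (e / c6).
have d0 : 0 < d by rewrite !lt_min ltr01 divr_gt0.
have d1 : d <= 1 by rewrite !ge_min lexx.
have de : d <= e / c6 by rewrite !ge_min lexx !orbT.
apply: le_trans (key d d0) _.
have h1 : d * c6 <= e by rewrite -ler_pdivlMr.
have AC : 0 <= `|A| * C by rewrite mulr_ge0.
have h2 : d * (A * D) <= d * `|A * D| by rewrite ler_pM2l//; exact: ler_norm.
have h3 : d ^+ 2 * (`|A| * C) <= d * (`|A| * C).
  by apply: ler_wpM2r => //; rewrite expr2 ler_piMr// ltW.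
move: h1 h2 h3 AC; rewrite /c6; move: `|A * D| => z; move: `|A| (d) d0 => y t t0; move: (D) => w; lra.
Qed.

End concentration.

(** * Charts and the Riemannian volume *)

Section weighted_pushforward.
Import HBNNSimple.
Context {R : realType} d (T : measurableType d) d' (T' : measurableType d').
Context (m : {measure set T -> \bar R}) (nu : {measure set T' -> \bar R}).
Context (D : set T') (E : set T) (h : T -> T') (w : T -> R).
Hypothesis mD : measurable D.
Hypothesis mE : measurable E.
Hypothesis mh : measurable_fun E h.
Hypothesis mw : measurable_fun E w.
Hypothesis w0 : forall t, E t -> 0 <= w t.
Hypothesis nuE : forall A, measurable A ->
  nu (A `&` D) = (\int[m]_(t in E `&` h @^-1` A) (w t)%:E)%E.
Local Open Scope ereal_scope.

Let weighted_indic A : measurable A ->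
  \int[nu]_(x in D) (\1_A x)%:E = \int[m]_(t in E) ((\1_A (h t))%:E * (w t)%:E).
Proof.
move=> mA; rewrite integral_indic// nuE// integral_mkcondr.
apply: eq_integral => t _; rewrite patchE indicE.
have -> : (t \in h @^-1` A) = (h t \in A) by apply/idP/idP; rewrite !inE.
by case: ifPn => _; rewrite ?mul1e ?mul0e.
Qed.

Let measurable_indic_comp A : measurable A ->
  measurable_fun E (fun t => (\1_A (h t) : R)).
Proof.
by move=> mA; apply: (measurable_comp measurableT).
Qed.

Let weighted_nnsfun (f : {nnsfun T' >-> R}) :
  \int[nu]_(x in D) (f x)%:E = \int[m]_(t in E) ((f (h t))%:E * (w t)%:E).
Proof.
have fr0 r t : (0 <= r * \1_(f @^-1` [set r]) t)%R.
  by have := nnfun_muleindic_ge0 f r t; rewrite -EFinM lee_fin.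
under [LHS]eq_integral do rewrite fimfunE -fsumEFin//.
rewrite [LHS]ge0_integral_fsum//; last 2 first.
- by move=> r; apply/measurable_EFinP/measurable_funTS; exact/measurableT_comp.
- by move=> r x _; rewrite lee_fin.
under [RHS]eq_integral => t tE.
  rewrite fimfunE -fsumEFin// ge0_mule_fsuml; last by move=> r; rewrite lee_fin.
  over.
rewrite [RHS]ge0_integral_fsum//; last 2 first.
- move=> r; under eq_fun do rewrite -EFinM; apply/measurable_EFinP.
  apply: measurable_funM => //; apply: measurable_funM => //.
  exact: measurable_indic_comp.
- by move=> r x Ex; rewrite mule_ge0// lee_fin ?w0.
apply: eq_fsbigr => r rf.
rewrite integralZl_indic_nnsfun// weighted_indic//.
have r0 : (0 <= r)%R by move: rf; rewrite inE => -[x _ <-].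
rewrite -ge0_integralZl//; last 2 first.
- under eq_fun do rewrite -EFinM; apply/measurable_EFinP.
  by apply: measurable_funM => //; exact: measurable_indic_comp.
- by move=> t Et; rewrite mule_ge0// lee_fin ?w0.
by apply: eq_integral => t _; rewrite EFinM muleA.
Qed.

(** [nuE] gives the formula for indicators; simple functions and monotone convergence extend it. *)
Lemma ge0_integral_weighted (f : T' -> \bar R) :
  measurable_fun setT f -> (forall x, 0 <= f x) ->
  \int[nu]_(x in D) f x = \int[m]_(t in E) (f (h t) * (w t)%:E).
Proof.
move=> mf f0.
pose f_ := nnsfun_approx measurableT mf.
transitivity (lim (\int[nu]_(x in D) (f_ n x)%:E @[n --> \oo])).
  rewrite -monotone_convergence//=.
  - apply: eq_integral => ? /[!inE] xD; apply/esym/cvg_lim => //=.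
    exact: cvg_nnsfun_approx.
  - by move=> n; exact/measurable_EFinP/measurable_funTS.
  - by move=> n ? _; rewrite lee_fin.
  - by move=> ? _ ? ? mn; rewrite lee_fin; exact/lefP/nd_nnsfun_approx.
transitivity (lim (\int[m]_(t in E) ((f_ n (h t))%:E * (w t)%:E) @[n --> \oo])).
  by apply: congr_lim; apply/funext => n /=; exact: weighted_nnsfun.
rewrite -monotone_convergence//=.
- apply: eq_integral => t /[!inE] Et; apply/cvg_lim => //=.
  apply: cvgeZr => //; exact: cvg_nnsfun_approx.
- move=> n; under eq_fun do rewrite -EFinM; apply/measurable_EFinP.
  by apply: measurable_funM => //; apply: (measurable_comp measurableT).
- by move=> n t Et; rewrite mule_ge0// lee_fin ?w0.
- move=> t Et a b ab; apply: lee_wpmul2r; first by rewrite lee_fin w0.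
  by rewrite lee_fin; exact/lefP/nd_nnsfun_approx.
Qed.

Lemma integral_weighted (f : T' -> \bar R) : measurable_fun setT f ->
  \int[nu]_(x in D) f x = \int[m]_(t in E) (f (h t) * (w t)%:E).
Proof.
move=> mf; rewrite integralE [RHS]integralE.
rewrite !ge0_integral_weighted//; last 2 first.
- exact: measurable_funeneg.
- exact: measurable_funepos.
congr (_ - _); apply: eq_integral => t /[!inE] Et; apply/esym.
  by rewrite !funeposE -[X in maxe _ X](mul0e (w t)%:E) maxe_pMl// lee_fin w0.
by rewrite !funenegE -mulNe -[X in maxe _ X](mul0e (w t)%:E) maxe_pMl// lee_fin w0.
Qed.

End weighted_pushforward.

Lemma open_nearW (T : topologicalType) (U : set T) (x : T) (P Q : T -> Prop) :
  open U -> U x -> (\forall y \near x, P y) -> (forall y, U y -> P y -> Q y) ->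
  \forall y \near x, Q y.
Proof.
move=> oU Ux nP PQ; apply: filterS2 nP; last first.
  by apply: open_nbhs_nbhs; split; [exact: oU|exact: Ux].
by move=> y Py Uy; exact: PQ.
Qed.

Section charts.
Context {R : realType} {n : nat} (M : riemannian_manifold R n).
Implicit Types (i j : chart_index M) (p : M) (x : 'rV[R]_n).

Definition chart_im i : set 'rV[R]_n := chart i @` chart_dom i.

Lemma chart_imP i x : chart_im i x ->
  chart_dom i (chart_inv i x) /\ chart i (chart_inv i x) = x.
Proof. by move=> [p Dp <-]; rewrite chartK. Qed.

Lemma chart_im_chart i p : chart_dom i p -> chart_im i (chart i p).
Proof. by move=> Dp; exists p. Qed.

Lemma open_chart_im i : open (chart_im i). Proof. exact: chart_cod_open. Qed.

Lemma smooth_metric_chart i : smooth_metric (chart_im i) (metric i).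
Proof.
split; first exact: metric_smooth.
by move=> x ix; split; [exact: Defs.metric_sym|exact: metric_posdef].
Qed.

Lemma continuous_chart_inv i x : chart_im i x -> {for x, continuous (chart_inv i)}.
Proof.
move=> ix; have := @chart_inv_continuous R n M i.
rewrite continuous_open_subspace; last exact: chart_cod_open.
by apply; rewrite inE.
Qed.

Lemma continuous_chart i p : chart_dom i p -> {for p, continuous (chart i)}.
Proof.
move=> ip; have := @chart_continuous R n M i.
rewrite continuous_open_subspace; last exact: chart_dom_open.
by apply; rewrite inE.
Qed.

Lemma open_chart_image i (W : set M) : open W -> W `<=` chart_dom i ->
  open (chart i @` W).
Proof.
move=> oW WD; rewrite openE => _ [p Wp <-]; rewrite /interior.
have ip : chart_im i (chart i p) by apply: chart_im_chart; exact: WD.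
have : \forall y \near chart i p, W (chart_inv i y).
  by apply: (continuous_chart_inv ip); rewrite chartK; [exact: open_nbhs_nbhs|exact: WD].
move=> nW; apply: (@open_nearW _ (chart_im i) (chart i p) (W \o chart_inv i) _ (@open_chart_im i) ip nW) => y iy Wy.
by exists (chart_inv i y) => //; case: (chart_imP iy).
Qed.

Lemma measurable_open_borel (W : set M) : open W -> measurable (W : set (borel M)).
Proof. by move=> oW; exact: sub_sigma_algebra. Qed.

Lemma continuous_measurable_borel (f : M -> R) : continuous f ->
  measurable_fun [set: borel M] f.
Proof.
move=> cf; apply: (measurability _ (RGenOInfty.measurableE R)) => /= _ [_ [a ->] <-].
rewrite setTI; apply: measurable_open_borel.
by apply: open_comp => // x _; exact: cf.
Qed.

Lemma measurable_chart_inv i :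
  measurable_fun (X @^-1` chart_im i) (chart_inv i \o X : tup R n -> borel M).
Proof.
move=> mi; apply: (@measurability _ _ _ (borel M) _ _ (@open M)) => //= _ [W oW <-].
apply: (@measurable_preimage_rV R n (chart_im i `&` (chart_inv i) @^-1` W)).
rewrite openE => x [ix Wx]; rewrite /interior.
have : \forall y \near x, W (chart_inv i y).
  by apply: (continuous_chart_inv ix); exact: open_nbhs_nbhs.
by move=> nW; exact: (@open_nearW _ (chart_im i) x (W \o chart_inv i) _ (@open_chart_im i) ix nW).
Qed.

Lemma measurable_on_rV (U : set 'rV[R]_n) (f : 'rV[R]_n -> R) : open U ->
  (forall x, U x -> {for x, continuous f}) ->
  measurable_fun (X @^-1` U) (f \o X).
Proof.
move=> oU cf mU; apply: (measurability _ (RGenOInfty.measurableE R)) => //= _ [_ [a ->] <-].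
apply: (@measurable_preimage_rV R n (U `&` f @^-1` `]a, +oo[)).
rewrite openE => x [ix Wx]; rewrite /interior.
have : \forall y \near x, `]a, +oo[%classic (f y).
  by apply: (cf _ ix); apply: open_nbhs_nbhs; split => //; exact: interval_open.
by move=> nW; exact: (open_nearW oU ix nW).
Qed.

Section volume.
Context (mu : {measure set (borel M) -> \bar R}).
Hypothesis mu_volume : is_riemannian_volume mu.
Local Notation rho i := (volume_density (metric i)).

Lemma volume_density_chart_gt0 i x : chart_im i x -> 0 < rho i x.
Proof.
by move=> ix; apply: (@volume_density_gt0 _ _ _ _ (proj2 (smooth_metric_chart i))).
Qed.

(** [mu_volume] concerns measurable subsets of [chart_dom i]; intersecting with the domain yields
    the hypothesis of [integral_weighted]. *)
Lemma integral_chart i (f : borel M -> \bar R) : measurable_fun setT f ->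
  (\int[mu]_(p in chart_dom i) f p =
   \int[@dx R n]_(t in X @^-1` chart_im i)
     (f (chart_inv i (X t)) * (rho i (X t))%:E))%E.
Proof.
have [sG pG] := smooth_metric_chart i.
move=> mf; apply: (@integral_weighted R _ _ _ _ (@dx R n) mu (chart_dom i) (X @^-1` chart_im i) (chart_inv i \o X) (rho i \o X)) => //.
- by apply: measurable_open_borel; exact: chart_dom_open.
- by apply: measurable_preimage_rV; exact: open_chart_im.
- exact: measurable_chart_inv.
- apply: measurable_on_rV; first exact: open_chart_im.
  move=> x ix; apply: (@smooth_on_cont _ _ _ _ _ _ ix).
  by apply: smooth_volume_density => //; exact: open_chart_im.
- by move=> t it; apply/ltW/volume_density_chart_gt0.
- move=> A mA; rewrite (mu_volume (i := i)); last 2 first.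
  + by apply: measurableI => //; apply: measurable_open_borel; exact: chart_dom_open.
  + exact: subIsetr.
  congr (integral _ _ _); apply/seteqP; split => [t|t] /=.
    by move=> [p [Ap ip] <-]; split; [exact: chart_im_chart|rewrite /= chartK].
  by move=> [/chart_imP[ip ipE] Ap]; exists (chart_inv i (X t)).
Qed.

End volume.
End charts.

(** Covectors transform by [J] and inverse metrics contragrediently. Invertibility of [J] and [B]
    follows from that of [A]. *)
Lemma metric_form_congr (R : realType) n (A B J : 'M[R]_n) (a b : 'I_n -> R) :
  A = J *m B *m J^T -> A \in unitmx ->
  metric_form A (fun i => \sum_c J i c * a c) (fun i => \sum_c J i c * b c) =
  metric_form B a b.
Proof.
have mfE (C : 'M[R]_n) (x y : 'I_n -> R) :
    metric_form C x y = ((\row_i x i) *m invmx C *m (\row_i y i)^T) ord0 ord0.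
  rewrite /metric_form mxE exchange_big/=; apply: eq_bigr => j _.
  rewrite mxE big_distrl/=; apply: eq_bigr => i _.
  by rewrite !mxE; ring.
have rowJ (x : 'I_n -> R) : \row_i (\sum_c J i c * x c) = (\row_c x c) *m J^T.
  by apply/rowP => i; rewrite !mxE; apply: eq_bigr => c _; rewrite !mxE mulrC.
move=> AE uA; rewrite !mfE !rowJ.
have uJ : J \in unitmx.
  by move: uA; rewrite AE -mulmxA unitmx_mul => /andP[].
have uB : B \in unitmx.
  by move: uA; rewrite AE !unitmx_mul => /andP[/andP[]].
have -> : invmx A = invmx J^T *m (invmx B *m invmx J).
  rewrite -[RHS](mulKmx uA); rewrite {3}AE -!mulmxA.
  by rewrite (mulmxA J^T) mulmxV ?unitmx_tr// mul1mx (mulmxA B) mulmxV// mul1mx mulmxV// mulmx1.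
rewrite trmx_mul trmxK -!mulmxA (mulmxA J^T) mulmxV ?unitmx_tr// mul1mx.
by rewrite (mulmxA (invmx J)) mulVmx// mul1mx.
Qed.

Lemma gradient_product_comp (R : realType) n (G H : 'rV[R]_n -> 'M[R]_n)
    (f : 'rV[R]_n -> 'rV[R]_n) (u v : 'rV[R]_n -> R) (x : 'rV[R]_n) :
  (forall a, differentiable (fun y => f y ord0 a) x) ->
  differentiable u (f x) -> differentiable v (f x) ->
  posdef (G x) -> G x = 'J f x *m H (f x) *m ('J f x)^T ->
  gradient_product G (u \o f) (v \o f) x = gradient_product H u v (f x).
Proof.
move=> df du dv pG GE.
have JE i c : 'J f x i c = pderiv i (fun y => f y ord0 c) x.
  rewrite mxE (proj2 (diff_components df)) -pderivE /partial deriveE//.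
have Ji w i : differentiable w (f x) ->
    pderiv i (w \o f) x = \sum_c 'J f x i c * pderiv c w (f x).
  move=> dw; rewrite (proj2 (partial_comp i df dw)).
  by apply: eq_bigr => c _; rewrite JE.
transitivity (metric_form (H (f x)) (fun i => pderiv i u (f x)) (fun i => pderiv i v (f x))) => //.
rewrite -(metric_form_congr _ _ GE) ?posdef_unit//.
by apply: eq_bigr => i _; apply: eq_bigr => j _; rewrite !Ji.
Qed.

Lemma gradient_product_support (R : realType) n (G : 'rV[R]_n -> 'M[R]_n)
    (K : set 'rV[R]_n) (u v : 'rV[R]_n -> R) (x : 'rV[R]_n) :
  compact K -> (forall y, ~ K y -> v y = 0) -> ~ K x ->
  gradient_product G u v x = 0.
Proof.
move=> cK v0 Kx; rewrite /gradient_product big1// => i _; rewrite big1// => j _.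
have oK : open (~` K).
  by rewrite openC; apply: compact_closed => //; exact: norm_hausdorff.
by rewrite (@eq_partial _ _ (~` K) v (fun=> 0))// partial_cst mulr0.
Qed.

(** * Green's formula in coordinates *)

Section weak_laplacian.
Context {R : realType} {n : nat} (U : set 'rV[R]_n) (G : 'rV[R]_n -> 'M[R]_n).
Hypothesis oU : open U.
Hypothesis sG : smooth_metric U G.
Local Notation rho := (volume_density G).

(** With the density included, the Riemannian divergence becomes a Euclidean one. *)
Let flux (u : 'rV[R]_n -> R) i y := rho y * gradient G u i y.

Let smooth_flux u i : smooth_on U u -> smooth_on U (flux u i).
Proof.
case: (sG) => sG1 pG su; apply: smooth_onM => //.
  exact: smooth_volume_density.
apply: smooth_on_sum => // j _.
apply: smooth_onM => //; first exact: smooth_invmx.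
by rewrite pderivE; exact: smooth_on_partial.
Qed.

(** The Euclidean divergence of [phi] times the flux of [u] integrates to [0]; expanding it by the
    product rule gives the two sides, the minus sign being that of [laplacian]. *)
Lemma weak_laplacian (K : set 'rV[R]_n) (u phi : 'rV[R]_n -> R) :
  compact K -> K `<=` U -> smooth_on U u -> test phi ->
  (forall x, ~ K x -> phi x = 0) ->
  integral_rV (fun x => gradient_product G u phi x * rho x) =
  integral_rV (fun x => phi x * laplacian G u x * rho x).
Proof.
case: (sG) => sG1 pG cK KU su tphi phi0.
have sphi V : smooth_on V phi by apply: smooth_onS (proj1 tphi).
have oK : open (~` K).
  by rewrite openC; apply: compact_closed => //; exact: norm_hausdorff.
have tF i : test (fun x => flux u i x * phi x).
  apply: (@test_compact _ _ U K) => //; first by apply: smooth_onM => //; exact: smooth_flux.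
  by move=> x /phi0 ->; rewrite mulr0.
have F0 i : integral_rV (fun x => pderiv i (fun y => flux u i y * phi y) x) = 0.
  under eq_fun do rewrite -[pderiv _ _ _]mul1r.
  rewrite (@integral_by_parts R n (fun=> 1) _ i (@smooth_on_cst _ _ _ 1 openT) (tF i)).
  apply/eqP; rewrite oppr_eq0; apply/eqP.
  by under eq_fun do rewrite partial_cst mul0r; rewrite integral_rV0.
have tL : test (fun x => phi x * laplacian G u x * rho x).
  apply: (@test_compact _ _ U K) => //; last by move=> x /phi0 ->; rewrite !mul0r.
  apply: smooth_onM => //; last exact: smooth_volume_density.
  by apply: smooth_onM => //; exact: smooth_laplacian.
apply/eqP; rewrite -subr_eq0; apply/eqP.
transitivity (\sum_i integral_rV (fun x => pderiv i (fun y => flux u i y * phi y) x));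
  last by rewrite big1.
have tG : test (fun x => gradient_product G u phi x * rho x).
  apply: (@test_compact _ _ U K) => //.
    apply: smooth_onM => //; last exact: smooth_volume_density.
    apply: smooth_on_sum => // i _; apply: smooth_on_sum => // j _.
    apply: smooth_onM => //; last exact: smooth_on_partial.
    by apply: smooth_onM => //; [exact: smooth_invmx|exact: smooth_on_partial].
  by move=> x Kx; rewrite (gradient_product_support _ _ cK)// mul0r.
rewrite -integral_rVB; [|exact: test_cc|exact: test_cc].
rewrite -integral_rV_sum; last by move=> i _; apply: test_cc; exact: test_partial.
congr integral_rV; apply/funext => x.
have [Kx|Kx] := pselect (K x); last first.
  rewrite phi0// !mul0r subr0 (gradient_product_support _ _ cK)// mul0r big1// => i _.
  rewrite (@eq_partial _ _ (~` K) _ (fun=> 0))// ?partial_cst//.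
  by move=> y /phi0 ->; rewrite mulr0.
have Ux := KU _ Kx.
have fE i : pderiv i (fun y => flux u i y * phi y) x =
    pderiv i (flux u i) x * phi x + flux u i x * pderiv i phi x.
  have df := smooth_on_diff (smooth_flux i su) Ux.
  by have dphi := smooth_on_diff (sphi U) Ux; rewrite partialM//= addrC [_ * phi x]mulrC.
under [RHS]eq_bigr do rewrite fE.
rewrite big_split/= [RHS]addrC; congr +%R.
  rewrite /gradient_product exchange_big/= mulr_suml; apply: eq_bigr => i _.
  rewrite /flux /gradient mulrAC mulr_sumr !mulr_suml; apply: eq_bigr => j _.
  have -> : invmx (G x) j i = invmx (G x) i j.
    by rewrite -[in LHS](proj1 (pG _ Ux)) -trmx_inv mxE.
  by rewrite pderivE; ring.
rewrite -mulr_suml /laplacian /divergence mulrN mulNr opprK pderivE.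
have r0 : volume_density G x != 0 by rewrite gt_eqF// (volume_density_gt0 pG).
by rewrite -mulrA [_^-1 * _ * _]mulrAC mulVf// mul1r mulrC.
Qed.

End weak_laplacian.

Section chart_transfer.
Context {R : realType} {n : nat} (M : riemannian_manifold R n).
Implicit Types (i j : chart_index M) (p : M) (x : 'rV[R]_n).
Implicit Types (u : M -> R) (phi : 'rV[R]_n -> R).

(** Extension by zero from a chart to [M]; [chart_rep] goes the other way. Both produce smooth
    functions only under a support condition. *)
Definition chart_ext i phi : M -> R := fun p =>
  if p \in chart_dom i then phi (chart i p) else 0.

Definition chart_rep i u : 'rV[R]_n -> R := fun x =>
  if x \in chart_im i then u (chart_inv i x) else 0.

Lemma chart_extE i phi p : chart_dom i p -> chart_ext i phi p = phi (chart i p).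
Proof. by move=> ip; rewrite /chart_ext mem_set. Qed.

Lemma chart_ext_inv i phi x : chart_im i x -> chart_ext i phi (chart_inv i x) = phi x.
Proof. by move=> /chart_imP[ip ipE]; rewrite chart_extE// ipE. Qed.

Lemma chart_ext0 i phi p : ~ chart_dom i p -> chart_ext i phi p = 0.
Proof. by move=> ip; rewrite /chart_ext memNset. Qed.

Lemma chart_repE i u x : chart_im i x -> chart_rep i u x = u (chart_inv i x).
Proof. by move=> ix; rewrite /chart_rep mem_set. Qed.

Lemma chart_rep0 i u x : ~ chart_im i x -> chart_rep i u x = 0.
Proof. by move=> ix; rewrite /chart_rep memNset. Qed.

Lemma smooth_chart_rep i u : smooth u -> smooth_on (chart_im i) (chart_rep i u).
Proof.
move=> su; apply: eq_smooth_on (su i); first exact: open_chart_im.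
by move=> x ix; rewrite chart_repE.
Qed.

Lemma continuous_smooth u : smooth u -> continuous u.
Proof.
move=> su p; have [i ip] := chart_dom_cover p.
have cu : {for p, continuous ((u \o chart_inv i) \o chart i)}.
  apply: continuous_comp; first exact: continuous_chart.
  by apply: smooth_on_cont (su i) _; exact: chart_im_chart.
have E : {near p, (u \o chart_inv i) \o chart i =1 u}.
  by apply: open_near (chart_dom_open i) ip _ => q iq /=; rewrite chartK.
rewrite /prop_for /continuous_at /= chartK// in cu.
exact: cvg_trans (near_eq_cvg E) cu.
Qed.

Lemma compact_chart_inv i (K : set 'rV[R]_n) : compact K -> K `<=` chart_im i ->
  compact (chart_inv i @` K).
Proof.
move=> cK Ki; apply: continuous_compact => //; apply: continuous_in_subspaceT => x /[!inE] Kx.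
by apply: continuous_chart_inv; exact: Ki.
Qed.

Lemma compact_chart i (K : set M) : compact K -> K `<=` chart_dom i ->
  compact (chart i @` K).
Proof.
move=> cK Ki; apply: continuous_compact => //; apply: continuous_in_subspaceT => x /[!inE] Kx.
by apply: continuous_chart; exact: Ki.
Qed.

(** In another chart [j] two open sets cover the image: on the overlap with chart [i] the extension
    is [phi] after a transition map, and off the image of [K] it is [0]. The image of [K] is closed
    because [M] is Hausdorff. *)
Lemma smooth_chart_ext i (K : set 'rV[R]_n) phi : compact K -> K `<=` chart_im i ->
  test phi -> (forall x, ~ K x -> phi x = 0) -> smooth (chart_ext i phi).
Proof.
move=> cK Ki tphi phi0 j.
have oC : open (chart_dom j `&` ~` (chart_inv i @` K)).
  apply: openI; first exact: chart_dom_open.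
  rewrite openC; apply: compact_closed; first exact: manifold_hausdorff.
  exact: compact_chart_inv.
have oV := openI (chart_dom_open j) (chart_dom_open i).
apply: (@smooth_onS _ _ (chart j @` (chart_dom j `&` chart_dom i) `|`
  chart j @` (chart_dom j `&` ~` (chart_inv i @` K)))).
  move=> _ [p jp <-]; have [ip|ip] := pselect (chart_dom i p); first by left; exists p.
  right; exists p => //; split=> //= -[x Kx xp]; apply: ip; rewrite -xp.
  by case: (chart_imP (Ki _ Kx)).
apply: smooth_on_setU.
  apply: (@eq_smooth_on _ _ _ (fun y => phi (chart i (chart_inv j y)))).
  - by apply: open_chart_image => // p [].
  - by move=> _ [p [jp ip] <-] /=; rewrite chartK// chart_extE.
  apply: (@smooth_on_comp _ _ _ _ setT) => //.
  - by apply: open_chart_image => // p [].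
  - by move=> a; exact: transition_smooth.
  - by case: tphi.
apply: (@eq_smooth_on _ _ _ (fun=> 0)).
- by apply: open_chart_image => // p [].
- move=> _ [p [jp ip] <-] /=; rewrite chartK//.
  have [ipi|ipi] := pselect (chart_dom i p); last by rewrite chart_ext0.
  rewrite chart_extE// phi0// => Kp; apply: ip; exists (chart i p) => //.
  by rewrite chartK.
- by apply: smooth_on_cst; apply: open_chart_image => // p [].
Qed.

Lemma test_chart_rep i u (K : set 'rV[R]_n) : compact K -> K `<=` chart_im i ->
  smooth_on (chart_im i) (u \o chart_inv i) ->
  (forall x, chart_im i x -> ~ K x -> u (chart_inv i x) = 0) -> test (chart_rep i u).
Proof.
move=> cK Ki su u0; apply: (@test_compact _ _ (chart_im i) K) => //.
- exact: open_chart_im.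
- by apply: eq_smooth_on su => [|x ix]; [exact: open_chart_im|rewrite chart_repE].
- move=> x Kx; have [ix|ix] := pselect (chart_im i x); last by rewrite chart_rep0.
  by rewrite chart_repE// u0.
Qed.

Section volume.
Context (mu : {measure set (borel M) -> \bar R}).
Hypothesis mu_volume : is_riemannian_volume mu.
Local Notation rho i := (volume_density (metric i)).

Lemma integral_chartE i u phi : measurable_fun [set: borel M] u ->
  (forall p, ~ chart_dom i p -> u p = 0) ->
  (forall x, chart_im i x -> phi x = u (chart_inv i x) * rho i x) ->
  (forall x, ~ chart_im i x -> phi x = 0) ->
  (\int[mu]_p (u p)%:E = \int[@dx R n]_t (phi (X t))%:E)%E.
Proof.
move=> mu_ u0 phiE phi0.
have mD : measurable (chart_dom i : set (borel M)).
  by apply: measurable_open_borel; exact: chart_dom_open.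
have mI : measurable (X @^-1` chart_im i : set (tup R n)).
  by apply: measurable_preimage_rV; exact: open_chart_im.
transitivity (\int[mu]_(p in (chart_dom i : set (borel M))) (u p)%:E)%E.
  rewrite [RHS]integral_mkcond; apply: eq_integral => p _; rewrite patchE.
  by case: ifPn => //; rewrite notin_setE => /u0 ->.
rewrite (integral_chart mu_volume); last exact/measurable_EFinP.
rewrite integral_mkcond; apply: eq_integral => t _; rewrite patchE.
case: ifPn; first by rewrite inE/= => ix; rewrite phiE// EFinM.
by rewrite notin_setE/= => /phi0 ->.
Qed.

Lemma integral_chart_rV i u phi : measurable_fun [set: borel M] u ->
  (forall p, ~ chart_dom i p -> u p = 0) ->
  (forall x, chart_im i x -> phi x = u (chart_inv i x) * rho i x) ->
  (forall x, ~ chart_im i x -> phi x = 0) ->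
  \int[mu]_p u p = integral_rV phi.
Proof.
by move=> m1 u0 pE p0; rewrite /integral_rV /Rintegral (integral_chartE m1 u0 pE p0).
Qed.

End volume.
End chart_transfer.

(** * Chart independence of the Laplacian *)

Lemma integral_rV_eq0 (R : realType) n (f : 'rV[R]_n -> R) : cc f ->
  (forall x, 0 <= f x) -> integral_rV f = 0 -> forall x, f x = 0.
Proof.
move=> cf f0 If x; apply/eqP; rewrite eq_le f0 andbT leNgt; apply/negP => fx.
by have := integral_rV_gt0 cf f0 fx; rewrite If ltxx.
Qed.

Section invariance.
Context {R : realType} {n : nat} (n_gt0 : (0 < n)%N) (M : riemannian_manifold R n).
Context (mu : {measure set (borel M) -> \bar R}).
Hypothesis mu_volume : is_riemannian_volume mu.
Implicit Types (i j : chart_index M) (p : M) (x : 'rV[R]_n).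
Implicit Types (u : M -> R) (phi : 'rV[R]_n -> R).
Local Notation rho i := (volume_density (metric i)).

Definition overlap i j : set 'rV[R]_n := chart i @` (chart_dom i `&` chart_dom j).

Definition transition i j : 'rV[R]_n -> 'rV[R]_n := fun x => chart j (chart_inv i x).

Lemma overlapP i j x : overlap i j x <-> chart_im i x /\ chart_dom j (chart_inv i x).
Proof.
split; first by move=> [p [ip jp] <-]; rewrite chartK//; split=> //; exact: chart_im_chart.
by move=> [/chart_imP[ip ipE] jp]; exists (chart_inv i x).
Qed.

Lemma open_overlap i j : open (overlap i j).
Proof.
apply: open_chart_image; last by move=> p [].
by apply: openI; exact: chart_dom_open.
Qed.

Lemma overlap_im i j : overlap i j `<=` chart_im i.
Proof. by move=> x /overlapP[]. Qed.

Lemma transition_im i j x : overlap i j x -> chart_im j (transition i j x).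
Proof. by move=> /overlapP[_ jp]; exact: chart_im_chart. Qed.

Lemma chart_inv_transition i j x : overlap i j x ->
  chart_inv j (transition i j x) = chart_inv i x.
Proof. by move=> /overlapP[_ jp]; rewrite /transition chartK. Qed.

Lemma differentiable_transition i j x (a : 'I_n) : overlap i j x ->
  differentiable (fun y => transition i j y ord0 a) x.
Proof.
by move=> ox; apply: (@smooth_on_diff _ _ (overlap i j)) => //; exact: transition_smooth.
Qed.

Lemma gradient_product_overlap i j u v x : overlap i j x ->
  differentiable (u \o chart_inv j) (transition i j x) ->
  differentiable (v \o chart_inv j) (transition i j x) ->
  gradient_product (metric i) (u \o chart_inv i) (v \o chart_inv i) x =
  gradient_product (metric j) (u \o chart_inv j) (v \o chart_inv j) (transition i j x).
Proof.
move=> ox du dv.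
have E w y : overlap i j y -> (w \o chart_inv i) y = ((w \o chart_inv j) \o transition i j) y :> R.
  by move=> oy /=; rewrite chart_inv_transition.
rewrite -(@gradient_product_comp _ _ (metric i) (metric j) (transition i j)) //.
- apply: eq_bigr => a _; apply: eq_bigr => b _.
  rewrite (@eq_partial _ _ _ _ _ a x (@open_overlap i j) ox (E u)).
  by rewrite (@eq_partial _ _ _ _ _ b x (@open_overlap i j) ox (E v)).
- by move=> a; exact: differentiable_transition.
- by apply: (proj2 (smooth_metric_chart i)); exact: overlap_im ox.
- exact: (metric_transition ox).
Qed.

(* Both sides satisfy the same weak formulation; their difference [psi] is tested
   against a bump times [psi]. *)
Lemma laplacian_overlap i j u x : smooth u -> overlap i j x ->
  laplacian (metric i) (u \o chart_inv i) x =
  laplacian (metric j) (u \o chart_inv j) (transition i j x).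
Proof.
move=> su x0V.
have [sGi pGi] := smooth_metric_chart i; have [sGj pGj] := smooth_metric_chart j.
have oi := @open_chart_im _ _ M i; have oj := @open_chart_im _ _ M j.
have oV := @open_overlap i j.
pose Lj y := laplacian (metric j) (u \o chart_inv j) (transition i j y).
have sLj : smooth_on (overlap i j) Lj.
  apply: (@smooth_on_comp _ _ _ _ (chart_im j)) => //.
  - by move=> a; exact: transition_smooth.
  - exact: transition_im.
  - by apply: smooth_laplacian => //; exact: su.
have sLi : smooth_on (overlap i j) (laplacian (metric i) (u \o chart_inv i)).
  by apply: (smooth_onS (@overlap_im i j)); apply: smooth_laplacian => //; exact: su.
pose psi y := laplacian (metric i) (u \o chart_inv i) y - Lj y.
have spsi : smooth_on (overlap i j) psi by apply: smooth_onB.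
have [r r0 rV] := @near_closed_rball R n x _ (open_nbhs_nbhs (conj oV x0V)).
pose K := closed_rball x r; have cK : compact K := @compact_closed_ball_rV R n x r.
have sb : supported_in x r (bump x r) by apply: supported_bump => //; exact: ltW.
have bK y : ~ K y -> bump x r y = 0.
  by move=> /negP; rewrite -ltNge => /sb.
have smb : smooth_on (overlap i j) (bump x r) := smooth_bump x r oV.
pose phi y := bump x r y * psi y.
have phi0 y : ~ K y -> phi y = 0 by move=> Ky; rewrite /phi bK// mul0r.
have sphi : smooth_on (overlap i j) phi by apply: smooth_onM.
have tphi : test phi by exact: (test_compact oV cK).
have Ki : K `<=` chart_im i by move=> y /rV; exact: overlap_im.
have srhoi : smooth_on (chart_im i) (rho i) by exact: smooth_volume_density.
pose f := chart_ext i phi.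
have sf : smooth f by exact: (smooth_chart_ext cK Ki tphi phi0).
pose K' := chart j @` (chart_inv i @` K).
have KD : chart_inv i @` K `<=` chart_dom j.
  by move=> _ [y Ky <-]; case/overlapP: (rV _ Ky).
have KDi : chart_inv i @` K `<=` chart_dom i.
  by move=> _ [y Ky <-]; case: (chart_imP (Ki _ Ky)).
have cK' : compact K' by apply: compact_chart => //; exact: compact_chart_inv.
have K'j : K' `<=` chart_im j by move=> _ [p Kp <-]; apply: chart_im_chart; exact: KD.
have f0 p : ~ (chart_inv i @` K) p -> f p = 0.
  move=> Kp; have [ip|ip] := pselect (chart_dom i p); last by rewrite /f chart_ext0.
  rewrite /f chart_extE// phi0// => Kcp; apply: Kp.
  by exists (chart i p) => //; rewrite chartK.
have fj0 y : chart_im j y -> ~ K' y -> f (chart_inv j y) = 0.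
  move=> jy K'y; apply: f0 => Ky; apply: K'y.
  by exists (chart_inv j y) => //; case: (chart_imP jy).
(* The reading in chart [j] of the same function on [M] whose reading in chart [i] is [phi]. *)
pose phij := chart_rep j f.
have phij0 y : ~ K' y -> phij y = 0.
  move=> K'y; have [jy|jy] := pselect (chart_im j y); last by rewrite /phij chart_rep0.
  by rewrite /phij chart_repE// fj0.
have tphij : test phij by apply: (test_chart_rep cK' K'j) => //; exact: sf.
have wi := weak_laplacian oi (smooth_metric_chart i) cK Ki (su i) tphi phi0.
have wj := weak_laplacian oj (smooth_metric_chart j) cK' K'j (su j) tphij phij0.
have sphii : smooth_on (chart_im i) phi by apply: smooth_onS (proj1 tphi).
pose gi := gradient_product (metric i) (u \o chart_inv i) phi.
have gi0 y : ~ K y -> gi y = 0 by move=> Ky; exact: (gradient_product_support _ _ cK).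
have tgi : test gi.
  apply: (test_compact oi cK) => //.
  apply: smooth_on_sum => // a _; apply: smooth_on_sum => // b _.
  apply: smooth_onM => //; last exact: smooth_on_partial.
  apply: smooth_onM => //; first exact: smooth_invmx.
  by apply: smooth_on_partial; exact: su.
have mgi : measurable_fun [set: borel M] (chart_ext i gi).
  by apply: continuous_measurable_borel; apply: continuous_smooth;
    exact: (smooth_chart_ext cK Ki tgi gi0).
pose li y := phi y * Lj y.
have li0 y : ~ K y -> li y = 0 by move=> Ky; rewrite /li phi0// mul0r.
have tli : test li by apply: (test_compact oV cK) => //; apply: smooth_onM.
have mli : measurable_fun [set: borel M] (chart_ext i li).
  by apply: continuous_measurable_borel; apply: continuous_smooth;
    exact: (smooth_chart_ext cK Ki tli li0).
have off (h : 'rV[R]_n -> R) p : (forall y, ~ K y -> h y = 0) -> ~ (chart_inv i @` K) p ->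
    chart_ext i h p = 0.
  move=> h0 Kp; have [ip|ip] := pselect (chart_dom i p); last by rewrite chart_ext0.
  rewrite chart_extE// h0// => Kcp; apply: Kp.
  by exists (chart i p) => //; rewrite chartK.
have dI (h : 'rV[R]_n -> R) : (forall y, ~ K y -> h y = 0) ->
    measurable_fun [set: borel M] (chart_ext i h) ->
    \int[mu]_p chart_ext i h p = integral_rV (fun y => h y * rho i y).
  move=> h0 mh; apply: (integral_chart_rV (i := i) mu_volume mh).
  - by move=> p ip; rewrite chart_ext0.
  - by move=> y iy; rewrite chart_ext_inv.
  - by move=> y iy; rewrite h0 ?mul0r// => /Ki.
have dJ (h g : 'rV[R]_n -> R) : (forall y, ~ K y -> h y = 0) ->
    (forall y, ~ K' y -> g y = 0) ->
    (forall y, overlap i j y -> g (transition i j y) = h y) ->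
    measurable_fun [set: borel M] (chart_ext i h) ->
    \int[mu]_p chart_ext i h p = integral_rV (fun y => g y * rho j y).
  move=> h0 g0 gh mh; apply: (integral_chart_rV (i := j) mu_volume mh).
  - by move=> p jp; apply: off => // /KD.
  - move=> y jy; congr (_ * _).
    have [jyj jyE] := chart_imP jy.
    have [iy|iy] := pselect (chart_dom i (chart_inv j y)).
      rewrite chart_extE// -gh; first by rewrite /transition chartK// jyE.
      by exists (chart_inv j y).
    rewrite chart_ext0// g0// => -[p Kp py]; apply: iy.
    by rewrite -py chartK; [exact: KDi|exact: KD].
  - by move=> y jy; rewrite g0 ?mul0r// => /K'j.
pose gj := gradient_product (metric j) (u \o chart_inv j) phij.
have gj0 y : ~ K' y -> gj y = 0 by move=> Ky; exact: (gradient_product_support _ _ cK').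
have gE y : overlap i j y -> gj (transition i j y) = gi y.
  move=> oy; have ty := transition_im oy.
  transitivity (gradient_product (metric j) (u \o chart_inv j) (f \o chart_inv j) (transition i j y)).
    apply: eq_bigr => a _; apply: eq_bigr => b _; congr (_ * _).
    by apply: (eq_partial _ oj ty) => z jz; rewrite /phij chart_repE.
  rewrite -gradient_product_overlap//; last 2 first.
  - by apply: smooth_on_diff ty; exact: su.
  - by apply: smooth_on_diff ty; exact: sf.
  apply: eq_bigr => a _; apply: eq_bigr => b _; congr (_ * _).
  by apply: (eq_partial _ oi (overlap_im oy)) => z iz; rewrite /f/= chart_ext_inv.
have phijE y : overlap i j y -> phij (transition i j y) = phi y.
  move=> oy; rewrite /phij chart_repE; last exact: transition_im.
  by rewrite chart_inv_transition// /f chart_ext_inv//; exact: overlap_im oy.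
(* The route: Green's formula in chart [i], the gradient product integrated over [M] and read again
   in chart [j], Green's formula there, and back to chart [i] through [M]. *)
have eqI : integral_rV (fun y => phi y * laplacian (metric i) (u \o chart_inv i) y * rho i y) =
    integral_rV (fun y => li y * rho i y).
  apply: (etrans (esym wi)).
  apply: (etrans (esym (dI _ gi0 mgi))).
  apply: (etrans (dJ _ _ gi0 gj0 gE mgi)).
  apply: (etrans wj).
  apply: (etrans _ (dI _ li0 mli)); apply/esym.
  apply: (dJ _ _ li0 _ _ mli) => [y K'y|y oy]; first by rewrite phij0// mul0r.
  by rewrite phijE.
have t1 : test (fun y => phi y * laplacian (metric i) (u \o chart_inv i) y * rho i y).
  apply: (test_compact oV cK rV); last by move=> y Ky; rewrite (phi0 _ Ky) !mul0r.
  apply: (smooth_onM oV (smooth_onM oV sphi sLi)).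
  exact: (smooth_onS (@overlap_im i j) srhoi).
have t2 : test (fun y => li y * rho i y).
  apply: (test_compact oV cK rV); last by move=> y Ky; rewrite (li0 _ Ky) !mul0r.
  apply: (smooth_onM oV (smooth_onM oV sphi sLj)).
  exact: (smooth_onS (@overlap_im i j) srhoi).
(* The difference of the two integrands just compared: nonnegative, continuous and of integral [0],
   hence zero, while the bump and the density are positive at [x]. *)
pose F y := bump x r y * psi y ^+ 2 * rho i y.
have ident (b l m s : R) : b * (l - m) ^+ 2 * s = b * (l - m) * l * s - b * (l - m) * m * s.
  by ring.
have FE : F = (fun y => phi y * laplacian (metric i) (u \o chart_inv i) y * rho i y - li y * rho i y).
  by apply/funext => y; exact: ident.
have ccF : cc F by rewrite FE; exact: ccB (test_cc t1) (test_cc t2).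
have IF0 : integral_rV F = 0.
  rewrite FE; apply: (etrans (integral_rVB (test_cc t1) (test_cc t2))).
  by apply/eqP; rewrite subr_eq0; apply/eqP; exact: eqI.
have F0 y : 0 <= F y by apply: mulr_ge0 (sqrtr_ge0 _); apply: mulr_ge0 (bump_ge0 _ _ _) (sqr_ge0 _).
have Fx := integral_rV_eq0 ccF F0 IF0 x.
have bx : 0 < bump x r x by apply: bump_gt0; rewrite subrr normr0.
have rx : 0 < rho i x by apply: volume_density_chart_gt0; exact: overlap_im x0V.
have arith (b l s : R) : 0 < b -> 0 < s -> b * l ^+ 2 * s = 0 -> l = 0.
  move=> b0 s0 /eqP; rewrite !mulf_eq0 (gt_eqF b0) (gt_eqF s0) /= orbF orbb.
  by move=> /eqP.
by apply/eqP; rewrite -subr_eq0; apply/eqP; exact: (arith _ _ _ bx rx Fx).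
Qed.

Lemma chart_at_dom p : chart_dom (chart_at p) p.
Proof. exact: (projT2 (cid (chart_dom_cover p))). Qed.

Lemma overlap_chart_at i x : chart_im i x -> overlap i (chart_at (chart_inv i x)) x.
Proof. by move=> ix; apply/overlapP; split=> //; exact: chart_at_dom. Qed.

Lemma manifold_laplacian_chart i u x : smooth u -> chart_im i x ->
  manifold_laplacian u (chart_inv i x) = laplacian (metric i) (u \o chart_inv i) x.
Proof. by move=> su ix; exact: (esym (laplacian_overlap su (overlap_chart_at ix))). Qed.

Lemma smooth_manifold_laplacian u : smooth u -> smooth (manifold_laplacian u).
Proof.
move=> su i; have [sG pG] := smooth_metric_chart i.
have oi := @open_chart_im _ _ M i.
apply: (eq_smooth_on oi _ (smooth_laplacian oi sG pG (su i))) => x ix.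
exact: (esym (manifold_laplacian_chart su ix)).
Qed.

(** Since [chart_at] varies with the point without any continuity, smoothness of each iterate comes
    from chart independence and is needed for the next step; both claims are therefore proved
    together. *)
Lemma iter_manifold_laplacian m u : smooth u ->
  smooth (iter m (@manifold_laplacian R n M) u) /\
  forall i x, chart_im i x -> iter m (@manifold_laplacian R n M) u (chart_inv i x) =
    iter m (laplacian (metric i)) (u \o chart_inv i) x.
Proof.
move=> su; elim: m => [//|m [sm IH]]; split; first exact: smooth_manifold_laplacian.
move=> i x ix; apply: (etrans (manifold_laplacian_chart sm ix)).
by apply: (@eq_laplacian R n _ (chart_im i) _ _ x (@open_chart_im _ _ M i) ix) => y iy; exact: IH.
Qed.

Lemma gradient_sqnorm_overlap i j u x : smooth u -> overlap i j x ->
  gradient_sqnorm (metric i) (u \o chart_inv i) x =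
  gradient_sqnorm (metric j) (u \o chart_inv j) (transition i j x).
Proof.
move=> su ox; have jx := transition_im ox.
rewrite !gradient_sqnormE; last 2 first.
- exact: (proj2 (smooth_metric_chart j)).
- by apply: (proj2 (smooth_metric_chart i)); exact: overlap_im ox.
by apply: gradient_product_overlap => //; apply: smooth_on_diff jx; exact: su.
Qed.

(** Frees the energy density from the chosen charts: any chart around the point computes it. *)
Lemma manifold_half_laplacian_chart l u i x : smooth u -> chart_im i x ->
  manifold_half_laplacian_sq l u (chart_inv i x) =
  metric_square (metric i) l (u \o chart_inv i) x.
Proof.
move=> su ix; have [sm mE] := iter_manifold_laplacian l./2 su.
rewrite /manifold_half_laplacian_sq /metric_square /half_laplacian_sq.
case: ifP => _; last by rewrite (mE i x ix).
apply: (etrans (esym (gradient_sqnorm_overlap sm (overlap_chart_at ix)))).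
by apply: (@eq_gradient_sqnorm R n _ (chart_im i) _ _ x (@open_chart_im _ _ M i) ix) => y iy; exact: mE.
Qed.

Lemma smooth_manifold_half_laplacian l u : smooth u ->
  smooth (manifold_half_laplacian_sq l u).
Proof.
move=> su i; have oi := @open_chart_im _ _ M i.
apply: (eq_smooth_on oi _ (smooth_metric_square oi l (smooth_metric_chart i) (su i))) => x ix.
exact: (esym (manifold_half_laplacian_chart l su ix)).
Qed.

Lemma manifold_half_laplacian_ge0 l u p : smooth u -> 0 <= manifold_half_laplacian_sq l u p.
Proof.
move=> su; have [i ip] := chart_dom_cover p; rewrite -(chartK ip).
have ix := chart_im_chart ip; rewrite (manifold_half_laplacian_chart l su ix).
exact: metric_square_ge0 (smooth_metric_chart i) (su i) ix.
Qed.

Lemma smoothD u v : smooth u -> smooth v -> smooth (fun p => u p + v p).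
Proof. by move=> su sv i; apply: smooth_onD; [exact: open_chart_im|exact: su|exact: sv]. Qed.

Lemma manifold_half_laplacianD_le l u v p e : smooth u -> smooth v -> 0 < e ->
  manifold_half_laplacian_sq l (fun q => u q + v q) p <=
  (1 + e) * manifold_half_laplacian_sq l u p + (1 + e^-1) * manifold_half_laplacian_sq l v p.
Proof.
move=> su sv e0; have [i ip] := chart_dom_cover p; rewrite -(chartK ip).
have ix := chart_im_chart ip.
rewrite (manifold_half_laplacian_chart l su ix) (manifold_half_laplacian_chart l sv ix).
rewrite (manifold_half_laplacian_chart l (smoothD su sv) ix).
exact: (metric_squareD_le (@open_chart_im _ _ M i) l (smooth_metric_chart i) (su i) (sv i)).
Qed.

End invariance.

(** * Energies on a compact manifold *)

Section energies.
Context {R : realType} {n : nat} (n_gt0 : (0 < n)%N) (M : riemannian_manifold R n).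
Context (mu : {measure set (borel M) -> \bar R}).
Hypothesis mu_volume : is_riemannian_volume mu.
Hypothesis M_compact : compact [set: M].
Implicit Types (i j : chart_index M) (p q : M) (x : 'rV[R]_n) (u v : M -> R).
Local Notation rho i := (volume_density (metric i)).

(** Normalised to the value [2] at the centre, so that it exceeds [1] on a neighbourhood; a finite
    subcover then makes the sum of squares at least [1]. *)
Definition rV_bump (x0 : 'rV[R]_n) (r : R) : 'rV[R]_n -> R :=
  fun x => 2 / bump x0 r x0 * bump x0 r x.

Definition chart_bump i p (r : R) : M -> R := chart_ext i (rV_bump (chart i p) r).

Lemma rV_bump_center x0 r : 0 < r -> rV_bump x0 r x0 = 2.
Proof.
move=> r0; rewrite /rV_bump divfK// gt_eqF//; apply: bump_gt0.
by rewrite subrr normr0.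
Qed.

Lemma supported_rV_bump x0 r : 0 <= r -> supported_in x0 r (rV_bump x0 r).
Proof. by move=> r0 x /(supported_bump n_gt0 r0) b0; rewrite /rV_bump b0 mulr0. Qed.

Lemma smooth_rV_bump x0 r (U : set 'rV[R]_n) : open U -> smooth_on U (rV_bump x0 r).
Proof.
by move=> oU; apply: smooth_onM => //; [exact: smooth_on_cst|exact: smooth_bump].
Qed.

Lemma test_rV_bump x0 r : 0 <= r -> test (rV_bump x0 r).
Proof.
move=> r0; apply: (@test_supported _ _ setT x0 r) => //; first exact: openT.
- exact: smooth_rV_bump openT.
- exact: supported_rV_bump.
Qed.

Lemma smooth_chart_ext_ball i x0 r phi : closed_rball x0 r `<=` chart_im i ->
  test phi -> supported_in x0 r phi -> smooth (chart_ext i phi).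
Proof.
move=> rU tphi sphi.
apply: (smooth_chart_ext (@compact_closed_ball_rV R n x0 r) rU tphi) => x /negP.
by rewrite -ltNge => /sphi.
Qed.

Lemma smooth_chart_bump i p r : 0 <= r -> closed_rball (chart i p) r `<=` chart_im i ->
  smooth (chart_bump i p r).
Proof.
move=> r0 rU; apply: (smooth_chart_ext_ball rU); first exact: test_rV_bump.
exact: supported_rV_bump.
Qed.

Lemma bump_cover (i_ : M -> chart_index M) (r : M -> R) :
  (forall p, chart_dom (i_ p) p) -> (forall p, 0 < r p) ->
  (forall p, closed_rball (chart (i_ p) p) (r p) `<=` chart_im (i_ p)) ->
  exists s : seq M, forall q, 1 <= \sum_(p <- s) chart_bump (i_ p) p (r p) q ^+ 2.
Proof.
move=> ip r0 rU.
pose W p := [set q | 1 < chart_bump (i_ p) p (r p) q].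
have oW p : open (W p).
  have cb := continuous_smooth (smooth_chart_bump (ltW (r0 p)) (@rU p)).
  by apply: (@open_comp M R (chart_bump (i_ p) p (r p)) [set y | 1 < y]) => [q _|]; [exact: cb|exact: open_gt].
have := M_compact; rewrite compact_cover => /(_ M setT W) [//|p _|s _ sM].
  exists p => //; rewrite /W /= /chart_bump chart_extE// rV_bump_center//.
  by rewrite ltr1n.
exists (finmap.enum_fset s) => q.
have [p ps Wp] := sM q I.
have bp : 1 < chart_bump (i_ p) p (r p) q ^+ 2 by rewrite exprn_egt1.
rewrite (big_rem p)//=; apply: (le_trans (ltW bp)).
by rewrite lerDl sumr_ge0// => ? _; exact: sqr_ge0.
Qed.

(** The constant [1] is dominated by a finite sum of squared bumps, each of which has a finite
    integral computed in its own chart. *)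
Lemma volume_finite : (mu setT < +oo)%E.
Proof.
have hr p : exists2 r : R, 0 < r & closed_rball (chart (chart_at p) p) r `<=` chart_im (chart_at p).
  have [r r0 rU] := @near_closed_rball R n _ _ (open_nbhs_nbhs (conj
    (@open_chart_im _ _ M (chart_at p)) (chart_im_chart (chart_at_dom p)))).
  by exists r.
pose r p := sval (cid2 (hr p)).
have r0 p : 0 < r p by rewrite /r; case: cid2.
have rU p : closed_rball (chart (chart_at p) p) (r p) `<=` chart_im (chart_at p).
  by rewrite /r; case: cid2.
have [s hs] := bump_cover (@chart_at_dom _ _ M) r0 rU.
pose b p := chart_bump (chart_at p) p (r p).
have mb p : measurable_fun [set: borel M] (fun q => b p q ^+ 2).
  apply: measurable_funX; apply: continuous_measurable_borel.
  exact: (continuous_smooth (smooth_chart_bump (ltW (r0 p)) (@rU p))).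
have bfin p : (\int[mu]_q (b p q ^+ 2)%:E < +oo)%E.
  set i := chart_at p; set phi := rV_bump (chart i p) (r p).
  have tphi : test phi by apply: test_rV_bump; exact: ltW.
  have sphi : supported_in (chart i p) (r p) phi by apply: supported_rV_bump; exact: ltW.
  have sr : smooth_on (chart_im i) (rho i).
    have [sG pG] := smooth_metric_chart i.
    by apply: smooth_volume_density => //; exact: open_chart_im.
  have tg : test (fun x => phi x ^+ 2 * rho i x).
    apply: (test_supported (@open_chart_im _ _ M i) (@rU p)).
      apply: (smooth_onM (@open_chart_im _ _ M i)) => //.
      apply: smooth_onX2; [exact: open_chart_im|exact: smooth_onS (proj1 tphi)].
    by move=> x /sphi ->; rewrite expr0n mul0r.
  rewrite (integral_chartE (i := i) mu_volume (mb p) (phi := fun x => phi x ^+ 2 * rho i x)).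
  - by have := integral_rVE (test_cc tg) => <-; exact: ltry.
  - by move=> q iq; rewrite /b /chart_bump chart_ext0// expr0n.
  - by move=> x ix; rewrite /b /chart_bump chart_ext_inv.
  - move=> x ix; rewrite sphi ?expr0n ?mul0r// ltNge; apply/negP => xr.
    by apply: ix; exact: rU.
apply: (@le_lt_trans _ _ (\int[mu]_q (\sum_(p <- s) (b p q ^+ 2)%:E))%E).
  rewrite -[mu setT]mul1e -integral_cst//.
  apply: ge0_le_integral => //.
  - by apply: emeasurable_sum => p; exact/measurable_EFinP.
  - by move=> q _; rewrite sumEFin lee_fin; exact: hs.
rewrite ge0_integral_sum//; last 2 first.
- by move=> p; exact/measurable_EFinP.
- by move=> p q _; rewrite lee_fin sqr_ge0.
by apply: lte_sum_pinfty => p _; exact: bfin.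
Qed.

Lemma integrable_continuous u : continuous u -> mu.-integrable setT (EFin \o u).
Proof.
move=> cu; apply: measurable_bounded_integrable => //.
- exact: volume_finite.
- exact: continuous_measurable_borel.
have : compact (u @` setT) by apply: continuous_compact => //; exact: continuous_subspaceT.
move=> /compact_bounded[C [Cr hC]]; exists C; split=> // y Cy q _.
by apply: hC => //; exists q.
Qed.

Lemma integrable_energy l u : smooth u ->
  mu.-integrable setT (EFin \o manifold_half_laplacian_sq l u).
Proof.
move=> su; apply: integrable_continuous; apply: continuous_smooth.
exact: (smooth_manifold_half_laplacian n_gt0 mu_volume).
Qed.

Lemma energy_ge0 l u : smooth u -> 0 <= energy mu l u.
Proof.
move=> su; apply: Rintegral_ge0 => p _.
exact: (manifold_half_laplacian_ge0 n_gt0 mu_volume).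
Qed.

Lemma energyD_le l u v e : smooth u -> smooth v -> 0 < e ->
  energy mu l (fun p => u p + v p) <= (1 + e) * energy mu l u + (1 + e^-1) * energy mu l v.
Proof.
move=> su sv e0; rewrite /energy -!RintegralZl//; [|exact: integrable_energy..].
have iZ c w : smooth w -> mu.-integrable setT
    (EFin \o (fun p => c * manifold_half_laplacian_sq l w p)).
  by move=> sw; have := integrableZl measurableT c (integrable_energy l sw).
rewrite -RintegralD//; [|exact: iZ..].
apply: le_Rintegral => //.
- by apply: integrable_energy; exact: smoothD.
- exact: (integrableD measurableT (iZ _ _ su) (iZ _ _ sv)).
- by move=> p _; exact: (manifold_half_laplacianD_le n_gt0 mu_volume).
Qed.

Lemma sobolev_sqnorm_ge0 l u : smooth u -> 0 <= sobolev_sqnorm mu l u.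
Proof. by move=> su; apply: sumr_ge0 => a _; exact: energy_ge0. Qed.

Lemma sobolev_sqnormD_le l u v e : smooth u -> smooth v -> 0 < e ->
  sobolev_sqnorm mu l (fun p => u p + v p) <=
  (1 + e) * sobolev_sqnorm mu l u + (1 + e^-1) * sobolev_sqnorm mu l v.
Proof.
move=> su sv e0; rewrite /sobolev_sqnorm !mulr_sumr -big_split/=.
by apply: ler_sum => a _; exact: energyD_le.
Qed.

End energies.

(** * The inequality for smooth functions *)

Lemma minkowski_sum (R : realType) d (T : measurableType d)
    (mu : {measure set T -> \bar R}) (I : Type) (s : seq I) (f : I -> T -> R) (q : R) :
  1 <= q -> (forall i, measurable_fun setT (f i)) ->
  ('N[mu]_q%:E[EFin \o (fun x => \sum_(i <- s) f i x)%R] <=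
   \sum_(i <- s) 'N[mu]_q%:E[EFin \o f i])%E.
Proof.
move=> q1 mf; elim: s => [|i s IH].
  rewrite big_nil LnormE; under eq_integral do rewrite big_nil normr0 powR0 ?gt_eqF ?(lt_le_trans ltr01)//.
  by rewrite integral0 poweR0r// invr_eq0 gt_eqF// (lt_le_trans ltr01).
rewrite big_cons; under eq_fun do rewrite big_cons.
apply: (le_trans (minkowski_EFin _ (mf i) _ q1)); first exact: measurable_sum.
by rewrite leeD2l.
Qed.

Section main_inequality.
Context {R : realType} {n : nat} (M : riemannian_manifold R n).
Context (mu : {measure set (borel M) -> \bar R}).
Hypothesis mu_volume : is_riemannian_volume mu.
Hypothesis M_compact : compact [set: M].
Context (k : nat) (k_gt0 : (0 < k)%N) (lt_2k_n : (2 * k < n)%N).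
Implicit Types (p q : M) (x : 'rV[R]_n) (u v : M -> R).

Let n_gt0 : (0 < n)%N := leq_ltn_trans (leq0n _) lt_2k_n.
Let P : R := critical_exponent R n k.

Let P_gt2 : 2 < P. Proof. exact: critical_exponent_gt2. Qed.

Let P_gt0 : 0 < P. Proof. by rewrite (lt_trans _ P_gt2). Qed.

Lemma continuous_mul u v : continuous u -> continuous v -> continuous (fun p => u p * v p).
Proof. by move=> cu cv p; apply: continuousM; [exact: cu|exact: cv]. Qed.

Lemma continuous_sq_mul u v : continuous u -> continuous v ->
  continuous (fun p => u p ^+ 2 * v p).
Proof. by move=> cu cv; apply: continuous_mul => //; exact: continuous_mul. Qed.

Lemma continuous_powR_norm u (r : R) : 0 < r -> continuous u ->
  continuous (fun p => `|u p| `^ r).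
Proof.
move=> r0 cu p; apply: (@continuous_comp _ _ _ u (fun y => `|y| `^ r)); first exact: cu.
exact: continuous_norm_powR.
Qed.

Lemma Lnorm_continuous u (r : R) : 0 < r -> continuous u ->
  'N[mu]_r%:E[EFin \o (u : borel M -> R)]%E = ((\int[mu]_p (`|u p| `^ r)) `^ r^-1)%:E.
Proof.
move=> r0 cu; rewrite LnormE /Rintegral -poweR_EFin fineK//.
apply: integrable_fin_num => //.
exact: (integrable_continuous n_gt0 mu_volume M_compact (continuous_powR_norm r0 cu)).
Qed.

Lemma Rintegral_sum_continuous (I : Type) (s : seq I) (f : I -> M -> R) :
  (forall i, continuous (f i)) ->
  \int[mu]_p (\sum_(i <- s) f i p) = \sum_(i <- s) \int[mu]_p f i p.
Proof.
move=> cf; have int_ := fun i => integrable_continuous n_gt0 mu_volume M_compact (cf i).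
elim: s => [|i s IH].
  by rewrite big_nil; under eq_Rintegral do rewrite big_nil; rewrite Rintegral_cst// mul0r.
rewrite big_cons -IH; under eq_Rintegral do rewrite big_cons.
rewrite RintegralD//.
have := @integrable_sum _ _ _ mu setT measurableT _ s xpredT _ (fun i _ => int_ i).
by under eq_fun do rewrite sumEFin.
Qed.

(* Minkowski's inequality in [L^(P / 2)] for the functions [eta_i^2 u^2]. *)
Lemma sum_norm_le (I : Type) (s : seq I) (eta : I -> M -> R) u :
  (forall i, continuous (eta i)) -> (forall p, \sum_(i <- s) eta i p ^+ 2 = 1) ->
  continuous u ->
  (\int[mu]_p (`|u p| `^ P)) `^ (2 / P) <=
  \sum_(i <- s) (\int[mu]_p (`|eta i p * u p| `^ P)) `^ (2 / P).
Proof.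
move=> ceta eta1 cu.
have q1 : 1 <= P / 2 by rewrite ler_pdivlMr// mul1r ltW.
have q0 : 0 < P / 2 by rewrite (lt_le_trans ltr01).
have qE (y : R) : `|y ^+ 2| `^ (P / 2) = `|y| `^ P.
  by rewrite normrX -powR_mulrn// -powRrM mulrC divfK.
have ce i : continuous (fun p => (eta i p * u p) ^+ 2).
  by have h := continuous_mul (ceta i) cu; exact: continuous_mul.
have cu2 : continuous (fun p => u p ^+ 2).
  exact: continuous_mul.
have := @minkowski_sum R _ (borel M) mu _ s (fun i p => (eta i p * u p) ^+ 2) (P / 2) q1
  (fun i => continuous_measurable_borel (ce i)).
rewrite (_ : (fun q => \sum_(i <- s) (eta i q * u q) ^+ 2) = (fun p => u p ^+ 2)); last first.
  apply/funext => p; under eq_bigr do rewrite exprMn.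
  by rewrite -mulr_suml eta1 mul1r.
rewrite Lnorm_continuous//.
under eq_bigr => i _ do rewrite Lnorm_continuous//.
rewrite sumEFin lee_fin invf_div.
under eq_Rintegral do rewrite qE.
by under [X in _ <= X -> _]eq_bigr => i _ do under eq_Rintegral do rewrite qE.
Qed.

(** Division by the root of the sum of squares, the normalisation for which the squares add up to
    [1]; the lower bound keeps the base in the range where powers are smooth. *)
Lemma smooth_norm_sq_inv (I : Type) (s : seq I) (b : I -> M -> R) :
  (forall i, smooth (b i)) -> (forall p, 1 <= \sum_(i <- s) b i p ^+ 2) ->
  forall i, smooth (fun p => b i p * (\sum_(j <- s) b j p ^+ 2) `^ (- 2^-1)).
Proof.
move=> sb b1 i a; have oa := @open_chart_im _ _ M a.
apply: (smooth_onM oa); first exact: sb.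
apply: (smooth_on_powR oa (g := fun x => \sum_(j <- s) b j (chart_inv a x) ^+ 2)).
  by apply: smooth_on_sum => // j _; apply: smooth_onX2 => //; exact: sb.
by move=> x _; apply: lt_le_trans (b1 _).
Qed.

Lemma norm_sq_inv_sum (I : Type) (s : seq I) (b : I -> M -> R) p :
  1 <= \sum_(i <- s) b i p ^+ 2 ->
  \sum_(i <- s) (b i p * (\sum_(j <- s) b j p ^+ 2) `^ (- 2^-1)) ^+ 2 = 1.
Proof.
move=> b1; under eq_bigr do rewrite exprMn.
rewrite -mulr_suml -[X in _ * X]powR_mulrn ?powR_ge0// -powRrM mulNr mulVf//.
have b0 : 0 < \sum_(i <- s) b i p ^+ 2 by apply: lt_le_trans b1.
by rewrite powR_inv1 ?ltW// mulfV// gt_eqF.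
Qed.

Lemma energy_cutoff_le l (b : M -> R) : continuous b -> exists2 D : R, 0 <= D &
  forall u, smooth u ->
    \int[mu]_p (b p ^+ 2 * manifold_half_laplacian_sq l u p) <= D * energy mu l u.
Proof.
move=> cb.
have : compact (b @` setT) by apply: continuous_compact => //; exact: continuous_subspaceT.
move=> /compact_bounded[C [Cr hC]].
pose D := (`|C| + 1) ^+ 2; exists D; first exact: sqr_ge0.
move=> u su; have sq := smooth_manifold_half_laplacian n_gt0 mu_volume l su.
have iq := integrable_energy n_gt0 mu_volume M_compact l su.
rewrite /energy -RintegralZl//; apply: le_Rintegral => //.
- apply: (integrable_continuous n_gt0 mu_volume M_compact).
  exact: continuous_sq_mul (continuous_smooth sq).
- by have := integrableZl measurableT D iq.
- move=> p _; apply: ler_wpM2r.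
    exact: (manifold_half_laplacian_ge0 n_gt0 mu_volume).
  have bp : `|b p| <= `|C| + 1.
    by apply: hC; [rewrite (le_lt_trans (ler_norm _))// ltrDl|exists p].
  by rewrite -[b p ^+ 2]real_normK ?num_real// lerXn2r ?nnegrE.
Qed.

(** [local_inequality] transported to [M]. Its localised lower order integrals are bounded by global
    energies, the bump being bounded on the compact [M]. *)
Lemma local_inequality_chart (i : chart_index M) x0 e : chart_im i x0 -> 0 < e ->
  exists2 r0 : R, 0 < r0 & closed_rball x0 r0 `<=` chart_im i /\
  forall (r : R) (eta : M -> R), r < r0 -> smooth eta ->
    (forall p, chart_dom i p -> r < `|chart i p - x0| -> eta p = 0) ->
    (forall p, ~ chart_dom i p -> eta p = 0) ->
  exists2 C : R, 0 <= C & forall u, smooth u ->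
    (\int[mu]_p (`|eta p * u p| `^ P)) `^ (2 / P) <=
    (K0 n k + e) * \int[mu]_p (eta p ^+ 2 * manifold_half_laplacian_sq k u p) +
    C * \sum_(a < k) energy mu a u.
Proof.
move=> ix e0; have oi := @open_chart_im _ _ M i.
have [r0 r00 [r0U hloc]] := local_inequality oi ix (smooth_metric_chart i) k_gt0 lt_2k_n e0.
exists r0 => //; split=> // r eta rr0 seta eta0 etaD.
have rU : closed_rball x0 r `<=` chart_im i.
  by move=> x xr; apply: r0U; exact: le_trans xr (ltW rr0).
have sV : supported_in x0 r (chart_rep i eta).
  move=> x xr; have [jx|jx] := pselect (chart_im i x); last by rewrite chart_rep0.
  have [ixD ixE] := chart_imP jx.
  by rewrite chart_repE// eta0// ixE.
have tV : test (chart_rep i eta).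
  by apply: (test_supported oi rU) => //; exact: smooth_chart_rep.
have [C C0 hC] := hloc _ _ rr0 tV sV.
pose b := chart_ext i (bump x0 r0).
have sbump : supported_in x0 r0 (bump x0 r0) := supported_bump n_gt0 (ltW r00).
have sb : smooth b.
  apply: (smooth_chart_ext_ball r0U) => //.
  apply: (@test_supported _ _ setT x0 r0) => //; first exact: openT.
  exact: smooth_bump openT.
have /choice[D hD] : forall a, exists D : R, 0 <= D /\ forall u, smooth u ->
    \int[mu]_p (b p ^+ 2 * manifold_half_laplacian_sq a u p) <= D * energy mu a u.
  by move=> a; have [D D0 hD] := energy_cutoff_le a (continuous_smooth sb); exists D.
exists (C * \sum_(a < k) D a).
  by rewrite mulr_ge0// sumr_ge0// => a _; case: (hD a).
move=> u su; have := hC (u \o chart_inv i) (su i).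
have mq a (f : M -> R) : continuous f ->
    measurable_fun [set: borel M] (fun p => f p ^+ 2 * manifold_half_laplacian_sq a u p).
  move=> cf; apply: continuous_measurable_borel; apply: (continuous_sq_mul cf).
  exact: continuous_smooth (smooth_manifold_half_laplacian n_gt0 mu_volume a su).
rewrite -(integral_chart_rV (i := i) mu_volume (u := fun p => `|eta p * u p| `^ P)); last 4 first.
- apply: continuous_measurable_borel; apply: continuous_powR_norm => //.
  exact: continuous_mul (continuous_smooth seta) (continuous_smooth su).
- by move=> p ip; rewrite etaD// mul0r normr0 powR0// gt_eqF.
- by move=> x jx; rewrite chart_repE.
- by move=> x jx; rewrite chart_rep0// mul0r normr0 powR0 ?mul0r// gt_eqF.
rewrite -(integral_chart_rV (i := i) mu_volume (mq k _ (continuous_smooth seta))); last 3 first.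
- by move=> p ip; rewrite etaD// expr0n mul0r.
- move=> x jx; rewrite chart_repE// (manifold_half_laplacian_chart n_gt0 mu_volume)//.
  by rewrite mulrA.
- by move=> x jx; rewrite chart_rep0// expr0n mul0r.
move=> h; apply: (le_trans h); rewrite lerD2l -mulrA; apply: ler_wpM2l => //.
rewrite mulr_sumr; apply: ler_sum => a _.
rewrite -(integral_chart_rV (i := i) mu_volume (mq a _ (continuous_smooth sb))); last 3 first.
- by move=> p ip; rewrite /b chart_ext0// expr0n mul0r.
- move=> x jx; rewrite /b chart_ext_inv// (manifold_half_laplacian_chart n_gt0 mu_volume)//.
  by rewrite mulrA.
- move=> x jx; rewrite sbump ?expr0n ?mul0r// ltNge; apply/negP => xr.
  by apply: jx; exact: r0U.
have [D0 hDa] := hD a; apply: (le_trans (hDa _ su)); apply: ler_wpM2r.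
  exact: (energy_ge0 n_gt0 mu_volume).
rewrite (bigD1 a)//= lerDl sumr_ge0// => c _; by case: (hD c).
Qed.

Lemma smooth_inequality e : 0 < e -> exists2 B : R, 0 <= B & forall u, smooth u ->
  (\int[mu]_p (`|u p| `^ P)) `^ (2 / P) <=
  (K0 n k + e) * energy mu k u + B * sobolev_sqnorm mu k.-1 u.
Proof.
move=> e0.
have hr p := local_inequality_chart (chart_im_chart (chart_at_dom p)) e0.
pose r0 p := sval (cid2 (hr p)).
have r00 p : 0 < r0 p by rewrite /r0; case: cid2.
have h0 p := svalP (cid2 (hr p)).
pose r p := r0 p / 2.
have r_gt0 p : 0 < r p by rewrite divr_gt0.
have rr0 p : r p < r0 p by rewrite ltr_pdivrMr// ltr_pMr// ltr1n.
have rU p : closed_rball (chart (chart_at p) p) (r p) `<=` chart_im (chart_at p).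
  by move=> x xr; case: (h0 p) => _ [U _]; apply: U; exact: le_trans xr (ltW (rr0 p)).
have [s hs] := bump_cover n_gt0 M_compact (@chart_at_dom _ _ M) r_gt0 rU.
pose b p := chart_bump (chart_at p) p (r p).
have sb p : smooth (b p) by apply: smooth_chart_bump => //; exact: ltW.
pose eta p q := b p q * (\sum_(j <- s) b j q ^+ 2) `^ (- 2^-1).
have seta p : smooth (eta p) by exact: smooth_norm_sq_inv.
have eta1 q : \sum_(p <- s) eta p q ^+ 2 = 1 by exact: (norm_sq_inv_sum (hs q)).
have /choice[C hC] : forall p, exists C : R, 0 <= C /\ forall u, smooth u ->
    (\int[mu]_q (`|eta p q * u q| `^ P)) `^ (2 / P) <=
    (K0 n k + e) * \int[mu]_q (eta p q ^+ 2 * manifold_half_laplacian_sq k u q) +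
    C * \sum_(a < k) energy mu a u.
  move=> p; case: (h0 p) => _ [_ /(_ (r p) (eta p) (rr0 p) (seta p))] [||C C0 hC].
  - move=> q iq qr; rewrite /eta /b /chart_bump chart_extE//.
    by rewrite (supported_rV_bump n_gt0 (ltW (r_gt0 p)) qr) mul0r.
  - by move=> q iq; rewrite /eta /b /chart_bump chart_ext0// mul0r.
  - by exists C.
exists (\sum_(p <- s) C p); first by apply: sumr_ge0 => p _; case: (hC p).
move=> u su; have cu := continuous_smooth su.
apply: (le_trans (@sum_norm_le _ s eta u (fun p => continuous_smooth (seta p)) eta1 cu)).
have -> : energy mu k u =
    \sum_(p <- s) \int[mu]_q (eta p q ^+ 2 * manifold_half_laplacian_sq k u q).
  rewrite -Rintegral_sum_continuous.
    by apply: eq_Rintegral => q _; rewrite -mulr_suml eta1 mul1r.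
  move=> p; apply: (continuous_sq_mul (continuous_smooth (seta p))).
  exact: continuous_smooth (smooth_manifold_half_laplacian n_gt0 mu_volume k su).
have -> : sobolev_sqnorm mu k.-1 u = \sum_(a < k) energy mu a u.
  by rewrite /sobolev_sqnorm prednK.
rewrite mulr_sumr mulr_suml -big_split/=; apply: ler_sum => p _.
by case: (hC p) => _; exact.
Qed.

End main_inequality.

(** * Passage to the completion *)

Section truncation.
Context {R : realType} d (T : measurableType d) (mu : {measure set T -> \bar R}).
Context (P : R) (P2 : 2 <= P).

Let P0 : 0 < P. Proof. by rewrite (lt_le_trans _ P2). Qed.

Let powR_mono (r y z : R) : 0 <= r -> 0 <= y -> y <= z -> y `^ r <= z `^ r.
Proof.
by move=> r0 y0 yz; apply: ge0_ler_powR => //; rewrite nnegrE// (le_trans y0 yz).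
Qed.

(** Truncates the absolute value, which is all that a norm sees; the truncations then increase with
    [m]. *)
Definition truncation (m : nat) (f : T -> R) : T -> R := fun x => Num.min `|f x| m%:R.

Lemma truncation_ge0 m f x : 0 <= truncation m f x.
Proof. by rewrite /truncation le_min normr_ge0 ler0n. Qed.

Lemma measurable_truncation m f : measurable_fun setT f -> measurable_fun setT (truncation m f).
Proof.
move=> mf; apply: measurable_minr => //; exact: measurableT_comp.
Qed.

(** The difference is at most [m] and at most [|f - g|]; the first bound is raised to [P - 2], the
    second to [2]. *)
Lemma truncation_dist m f g x :
  `|truncation m f x - truncation m g x| `^ P <=
  (m%:R) `^ (P - 2) * (f x - g x) ^+ 2.
Proof.
set a := `|_ - _|.
have min_le (M y z : R) : 0 <= M -> 0 <= y -> 0 <= z -> `|Num.min y M - Num.min z M| <= M.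
  by move=> M0 y0 z0; rewrite ler_norml; case: (leP y M) => ?; case: (leP z M) => ?; lra.
have min_dist (M y z : R) : `|Num.min y M - Num.min z M| <= `|y - z|.
  have := ler_norm (y - z); have := ler_norm (z - y); rewrite [ `|z - y| ]distrC.
  by rewrite ler_norml; case: (leP y M) => ?; case: (leP z M) => ?; lra.
have am : a <= m%:R by apply: min_le.
have ad : a <= `|f x - g x| by apply: le_trans (min_dist _ _ _) (ler_dist_dist _ _).
have -> : a `^ P = a `^ (P - 2) * a ^+ 2.
  rewrite -powR_mulrn; last exact: normr_ge0.
  by rewrite -powRD; rewrite subrK// (gt_eqF P0).
apply: ler_pM; rewrite ?powR_ge0 ?sqr_ge0//.
  by apply: powR_mono; rewrite ?subr_ge0//; exact: normr_ge0.
have sq_le (y z : R) : 0 <= y -> y <= `|z| -> y ^+ 2 <= z ^+ 2.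
  by move=> y0 yz; rewrite -[leRHS]real_normK ?num_real// lerXn2r ?nnegrE.
by apply: sq_le ad; exact: normr_ge0.
Qed.

Lemma Lnorm_truncation_le m f : measurable_fun setT f ->
  ('N[mu]_P%:E[EFin \o truncation m f] <= 'N[mu]_P%:E[EFin \o f])%E.
Proof.
move=> mf; rewrite !LnormE; apply: gt0_ler_poweR.
- by rewrite invr_ge0 ltW.
- by rewrite in_itv/= leey andbT integral_ge0// => x _; rewrite lee_fin powR_ge0.
- by rewrite in_itv/= leey andbT integral_ge0// => x _; rewrite lee_fin powR_ge0.
have mP (g : T -> R) : measurable_fun setT g -> measurable_fun setT (fun x => (`|g x| `^ P)%:E).
  move=> mg; apply/measurable_EFinP; apply: (measurableT_comp (measurable_powR P)).
  exact: measurableT_comp.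
apply: ge0_le_integral => //.
- exact/mP/measurable_truncation.
- exact: mP.
- move=> x _; rewrite lee_fin; apply: powR_mono => //; first exact: ltW.
  by rewrite ger0_norm ?truncation_ge0// /truncation ge_min lexx.
Qed.

(* Truncations at a fixed level converge in [L^P], since [P >= 2]. *)
Lemma Lnorm_cvg_sq_le (f_ : nat -> T -> R) (f : T -> R) (c : nat -> R) (l : R) :
  (forall i, measurable_fun setT (f_ i)) -> measurable_fun setT f ->
  (\int[mu]_x ((f_ i x - f x) ^+ 2)%:E)%E @[i --> \oo] --> 0%E ->
  (forall i, ('N[mu]_P%:E[EFin \o f_ i] <= (c i)%:E)%E) ->
  c i @[i --> \oo] --> l ->
  ('N[mu]_P%:E[EFin \o f] <= l%:E)%E.
Proof.
move=> mf_ mf f0 fc cl.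
have bound m : ('N[mu]_P%:E[EFin \o truncation m f] <= l%:E)%E.
  apply: (@Lnorm_cvg_le R _ T mu P _ (fun i => truncation m (f_ i)) _ c) => //.
  - by rewrite (le_trans _ P2)// ler1n.
  - by move=> i; exact: measurable_truncation.
  - exact: measurable_truncation.
  - pose C := ((m%:R : R) `^ (P - 2)).
    have : (C%:E * \int[mu]_x ((f_ i x - f x) ^+ 2)%:E)%E @[i --> \oo] --> (C%:E * 0)%E.
      exact: cvgeZl.
    rewrite mule0; apply: squeeze_cvge; last exact: cvg_cst.
    apply: nearW => i; apply/andP; split.
      by apply: integral_ge0 => x _; rewrite lee_fin powR_ge0.
    rewrite -ge0_integralZl//; last 3 first.
    + by apply/measurable_EFinP; apply: measurable_funX; exact: measurable_funB.
    + by move=> x _; rewrite lee_fin sqr_ge0.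
    + by rewrite lee_fin powR_ge0.
    apply: ge0_le_integral => //.
    + apply/measurable_EFinP; apply: (measurableT_comp (measurable_powR P)).
      apply: measurableT_comp => //; apply: measurable_funB; exact: measurable_truncation.
    + apply/measurable_EFinP; apply: measurable_funM => //.
      by apply: measurable_funX; exact: measurable_funB.
    + by move=> x _; rewrite -EFinM lee_fin; exact: truncation_dist.
  - by move=> i; apply: le_trans (fc i); exact: Lnorm_truncation_le.
(* At each point the truncations increase and equal [|f|] from some level on, so monotone
   convergence carries the uniform bound to [f], whose norm is not known to be finite beforehand. *)
have mono x : {homo (fun m => (`|truncation m f x| `^ P)%:E) : a b / (a <= b)%N >-> (a <= b)%E}.
  move=> a b ab; rewrite lee_fin; apply: powR_mono => //; first exact: ltW.
  rewrite !ger0_norm ?truncation_ge0// /truncation le_min ge_min lexx/=.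
  by rewrite ge_min ler_nat ab orbT.
have mP m : measurable_fun setT (fun x => (`|truncation m f x| `^ P)%:E).
  apply/measurable_EFinP; apply: (measurableT_comp (measurable_powR P)).
  by apply: measurableT_comp => //; exact: measurable_truncation.
have l0 : 0 <= l by rewrite -lee_fin (le_trans _ (bound 0))// Lnorm_ge0.
have lP : (l%:E = (l%:E `^ P) `^ P^-1)%E by rewrite -poweRrM divff ?gt_eqF// poweRe1.
rewrite LnormE [leRHS]lP; apply: gt0_ler_poweR.
- by rewrite invr_ge0 ltW.
- by rewrite in_itv/= leey andbT integral_ge0// => x _; rewrite lee_fin powR_ge0.
- by rewrite in_itv/= leey andbT lee_fin powR_ge0.
have -> : (\int[mu]_x (`|f x| `^ P)%:E =
    \int[mu]_x limn (fun m => (`|truncation m f x| `^ P)%:E))%E.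
  apply: eq_integral => x _; apply/esym/lim_near_cst => //.
  have := nbhs_infty_ger `|f x|; apply: filterS => m fm.
  by rewrite /truncation min_l// normr_id.
have cI := @cvg_monotone_convergence _ _ _ mu setT measurableT _ mP
  (fun m x _ => ltac:(by rewrite lee_fin powR_ge0)) (fun x _ => mono x).
rewrite -(cvg_lim _ cI)//; apply: lime_le; first by apply/cvg_ex; eexists; exact: cI.
apply: nearW => m; rewrite -[X in (X <= _)%E]poweRe1; last first.
  by apply: integral_ge0 => x _; rewrite lee_fin powR_ge0.
have Pn0 : P != 0 by rewrite gt_eqF.
rewrite -(mulVf Pn0) poweRrM -LnormE.
apply: gt0_ler_poweR; [exact: ltW| | |exact: bound].
  by rewrite in_itv/= leey andbT Lnorm_ge0.
by rewrite in_itv/= leey andbT lee_fin.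
Qed.

End truncation.

Section sobolev_elements.
Context {R : realType} {n : nat} (M : riemannian_manifold R n).
Context (mu : {measure set (borel M) -> \bar R}).
Hypothesis mu_volume : is_riemannian_volume mu.
Hypothesis M_compact : compact [set: M].
Context (k : nat) (k_gt0 : (0 < k)%N) (lt_2k_n : (2 * k < n)%N).
Local Notation rho i := (volume_density (metric i)).
Local Notation P := (critical_exponent R n k).

Let n_gt0 : (0 < n)%N := leq_ltn_trans (leq0n _) lt_2k_n.

Let P_gt2 : 2 < P. Proof. exact: critical_exponent_gt2. Qed.

Let P_gt0 : 0 < P. Proof. by rewrite (lt_trans _ P_gt2). Qed.

Lemma smoothB (u v : M -> R) : smooth u -> smooth v -> smooth (fun p => u p - v p).
Proof. by move=> su sv i; apply: smooth_onB; [exact: open_chart_im|exact: su|exact: sv]. Qed.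

(** Gives meaning to the [limn] in [sobolev_energy]: the energy of order [k] is one of the terms of
    the norm in which the sequence is Cauchy. *)
Lemma is_cvg_sobolev_energy (u : sobolev mu k) :
  cvgn (fun i => energy mu k (sobolev_seq u i)).
Proof.
apply: (cauchy_energies_cvg (d := fun i j => energy mu k
  (fun p => sobolev_seq u i p - sobolev_seq u j p))).
- by move=> i; apply: (energy_ge0 n_gt0 mu_volume); exact: sobolev_smooth.
- by move=> i j; apply: (energy_ge0 n_gt0 mu_volume); apply: smoothB; exact: sobolev_smooth.
- move=> i j e e0.
  have := energyD_le n_gt0 mu_volume M_compact k (sobolev_smooth u j)
    (smoothB (sobolev_smooth u i) (sobolev_smooth u j)) e0.
  by under eq_fun do rewrite addrC subrK.
- move=> e e0; have [N hN] := sobolev_cauchy u e0; exists N => i j Ni Nj.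
  apply: le_lt_trans (hN i j Ni Nj); rewrite /sobolev_sqnorm big_ord_recr/= lerDr.
  apply: sumr_ge0 => a _; apply: (energy_ge0 n_gt0 mu_volume).
  by apply: smoothB; exact: sobolev_smooth.
Qed.

Lemma is_cvg_sobolev_sqnorm (u : sobolev mu k) :
  cvgn (fun i => sobolev_sqnorm mu k.-1 (sobolev_seq u i)).
Proof.
apply: (cauchy_energies_cvg (d := fun i j => sobolev_sqnorm mu k.-1
  (fun p => sobolev_seq u i p - sobolev_seq u j p))).
- by move=> i; apply: (sobolev_sqnorm_ge0 n_gt0 mu_volume); exact: sobolev_smooth.
- by move=> i j; apply: (sobolev_sqnorm_ge0 n_gt0 mu_volume); apply: smoothB; exact: sobolev_smooth.
- move=> i j e e0.
  have := sobolev_sqnormD_le n_gt0 mu_volume M_compact k.-1 (sobolev_smooth u j)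
    (smoothB (sobolev_smooth u i) (sobolev_smooth u j)) e0.
  by under eq_fun do rewrite addrC subrK.
- move=> e e0; have [N hN] := sobolev_cauchy u e0; exists N => i j Ni Nj.
  apply: le_lt_trans (hN i j Ni Nj); rewrite /sobolev_sqnorm prednK// big_ord_recr/= lerDl.
  by apply: (energy_ge0 n_gt0 mu_volume); apply: smoothB; exact: sobolev_smooth.
Qed.

Lemma sobolev_inequality e : 0 < e -> exists B : R, forall u : sobolev mu k,
  ('N[mu]_P%:E [EFin \o (u : borel M -> R)] ^+ 2 <=
   ((K0 n k + e) * sobolev_energy k u + B * completion_sqnorm k.-1 u)%:E)%E.
Proof.
move=> e0; have [B B0 hB] := smooth_inequality mu_volume M_compact k_gt0 lt_2k_n e0.
exists B => u.
pose c i := (K0 n k + e) * energy mu k (sobolev_seq u i) +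
  B * sobolev_sqnorm mu k.-1 (sobolev_seq u i).
set l := (X in (_ <= X%:E)%E).
have cl : c i @[i --> \oo] --> l.
  apply: cvgD; apply: cvgM; first exact: cvg_cst.
  - exact: is_cvg_sobolev_energy.
  - exact: cvg_cst.
  - exact: is_cvg_sobolev_sqnorm.
have su i := continuous_smooth (sobolev_smooth u i).
pose a i := \int[mu]_p (`|sobolev_seq u i p| `^ P).
have a0 i : 0 <= a i by apply: Rintegral_ge0 => p _; exact: powR_ge0.
have ac i : a i `^ (2 / P) <= c i by apply: hB; exact: sobolev_smooth.
(* Needed before taking square roots; read off the inequality itself. *)
have c0 i : 0 <= c i by apply: le_trans (ac i); exact: powR_ge0.
have l0 : 0 <= l.
  rewrite -(cvg_lim (@Rhausdorff R) cl); apply: limr_ge; last exact: nearW.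
  by apply/cvg_ex; exists l.
have Nc i : ('N[mu]_P%:E [EFin \o (sobolev_seq u i : borel M -> R)] <= (Num.sqrt (c i))%:E)%E.
  rewrite (Lnorm_continuous mu_volume M_compact lt_2k_n)// lee_fin -/(a i).
  rewrite -[leLHS]ger0_norm ?powR_ge0// -sqrtr_sqr ler_wsqrtr// -powR_mulrn ?powR_ge0//.
  by rewrite -powRrM mulrC.
have Nl : ('N[mu]_P%:E [EFin \o (u : borel M -> R)] <= (Num.sqrt l)%:E)%E.
  apply: (@Lnorm_cvg_sq_le R _ (borel M) mu P (ltW P_gt2) (sobolev_seq u) u
    (fun i => Num.sqrt (c i))) => //.
  - by move=> i; exact: continuous_measurable_borel.
  - exact: sobolev_measurable.
  - exact: sobolev_cvg.
  - by apply: continuous_cvg => //; exact: sqrt_continuous.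
apply: (@le_trans _ _ ((Num.sqrt l)%:E ^+ 2)%E).
  by rewrite !expeS !expe0 !mule1; apply: lee_pmul => //; exact: Lnorm_ge0.
by rewrite -EFin_expe sqr_sqrtr.
Qed.

(** Valid also when the integral is infinite, since elements of [sobolev] carry no a priori [L^P]
    bound. *)
Lemma poweR_Lnorm_sq (u : borel M -> R) :
  ((\int[mu]_p (`|u p| `^ P)%:E) `^ (2 / P) = 'N[mu]_P%:E [EFin \o u] ^+ 2)%E.
Proof.
rewrite LnormE; set x := (\int[mu]_p _)%E.
have x0 : (0 <= x)%E by apply: integral_ge0 => p _; rewrite lee_fin powR_ge0.
rewrite mulrC poweRrM; set y := (x `^ _)%E.
have : (0 <= y)%E by exact: poweR_ge0.
case: y => [y| |]//; last by rewrite poweRyr// expeS expe1 mulyy.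
by rewrite lee_fin => y0; rewrite poweR_EFin powR_mulrn// EFin_expe.
Qed.

Lemma energy0 l : energy mu l (fun=> 0) = 0.
Proof.
transitivity (\int[mu]_(p in [set: borel M]) (0 : R)).
  apply: eq_Rintegral => p _; have [i ip] := chart_dom_cover p.
  rewrite -(chartK ip) (manifold_half_laplacian_chart n_gt0 mu_volume); last 2 first.
  - by move=> j; apply: smooth_on_cst; exact: open_chart_im.
  - exact: chart_im_chart.
  exact: metric_square0.
by rewrite Rintegral_cst// mul0r.
Qed.

Lemma sobolev_of_smooth (v : M -> R) : smooth v -> exists2 u : sobolev mu k,
  (u : M -> R) = v &
  sobolev_energy k u = energy mu k v /\ completion_sqnorm k.-1 u = sobolev_sqnorm mu k.-1 v.
Proof.
move=> sv.
have cauchy (e : R) : 0 < e -> exists N : nat, forall i j : nat,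
    (N <= i)%N -> (N <= j)%N -> sobolev_sqnorm mu k (fun p => v p - v p) < e.
  move=> e0; exists 0 => i j _ _; rewrite /sobolev_sqnorm big1// => a _.
  by under eq_fun do rewrite subrr; exact: energy0.
have mv := continuous_measurable_borel (continuous_smooth sv).
have cv : (\int[mu]_p ((v p - v p) ^+ 2)%:E)%E @[_ --> \oo] --> 0%E.
  under eq_integral do rewrite subrr expr0n.
  by rewrite integral0; exact: cvg_cst.
exists (@Sobolev R n M mu k v (fun=> v) (fun=> sv) cauchy mv cv) => //.
by split; apply: (cvg_lim (@Rhausdorff R)) => /=; apply: cvg_cst.
Qed.

Lemma energy_chart_ext (i : chart_index M) x0 r (v : 'rV[R]_n -> R) l :
  closed_rball x0 r `<=` chart_im i -> test v -> supported_in x0 r v ->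
  energy mu l (chart_ext i v) =
  integral_rV (fun x => metric_square (metric i) l v x * rho i x).
Proof.
move=> rU tv sv; have sw := smooth_chart_ext_ball rU tv sv.
have oi := @open_chart_im _ _ M i.
apply: (integral_chart_rV (i := i) mu_volume).
- apply: continuous_measurable_borel; apply: continuous_smooth.
  exact: (smooth_manifold_half_laplacian n_gt0 mu_volume).
- move=> p ip; have [j jp] := chart_dom_cover p.
  (* The energy density involves derivatives, so vanishing at [p] alone is not enough: [W] is a
     neighbourhood of [p] where the extension is [0]. *)
  pose W := chart_dom j `&` ~` (chart_inv i @` closed_rball x0 r).
  have Wp : W p.
    split=> // -[x xr xp]; apply: ip; rewrite -xp.
    by case: (chart_imP (rU _ xr)).
  have oW : open W.
    apply: openI; first exact: chart_dom_open.
    rewrite openC; apply: compact_closed; first exact: manifold_hausdorff.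
    by apply: compact_chart_inv => //; exact: compact_closed_ball_rV.
  have oWj : open (chart j @` W) by apply: open_chart_image => // q [].
  rewrite -(chartK jp) (manifold_half_laplacian_chart n_gt0 mu_volume)//; last exact: chart_im_chart.
  have Wjp : (chart j @` W) (chart j p) by exists p.
  rewrite (@eq_metric_square R n _ (chart j @` W) l _ (fun=> 0) (chart j p) oWj Wjp).
    exact: metric_square0.
  move=> _ [q [jq qK] <-] /=; rewrite chartK//.
  have [iq|iq] := pselect (chart_dom i q); last by rewrite chart_ext0.
  rewrite chart_extE// sv// ltNge; apply/negP => qr; apply: qK.
  by exists (chart i q) => //; rewrite chartK.
- move=> x ix; rewrite (manifold_half_laplacian_chart n_gt0 mu_volume)//; congr (_ * _).
  apply: (@eq_metric_square R n _ (chart_im i) l _ _ x oi ix) => y iy /=.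
  by rewrite chart_ext_inv.
- move=> x ix; rewrite (supported_metric_square _ l sv) ?mul0r//.
  by rewrite ltNge; apply/negP => xr; apply: ix; exact: rU.
Qed.

Lemma K0_lower_bound (A B : R) : (forall u : sobolev mu k,
    ('N[mu]_P%:E [EFin \o (u : borel M -> R)] ^+ 2 <=
     (A * sobolev_energy k u + B * completion_sqnorm k.-1 u)%:E)%E) ->
  K0 n k <= A.
Proof.
(* Any point can serve as centre of concentration; [M] is pointed, hence nonempty. *)
move=> hA; have [i ip] := chart_dom_cover (point : M).
have oi := @open_chart_im _ _ M i; have ix := chart_im_chart ip.
have [r r0 rU] := @near_closed_rball R n _ _ (open_nbhs_nbhs (conj oi ix)).
apply: (concentration oi ix (smooth_metric_chart i) k_gt0 lt_2k_n (A := A) (B := B) r0 rU).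
move=> v tv sv; have sw := smooth_chart_ext_ball rU tv sv.
have cw := continuous_smooth sw.
have [u uE [EE SE]] := sobolev_of_smooth sw.
have := hA u; rewrite uE EE SE -poweR_Lnorm_sq.
have -> : (\int[mu]_p (`|chart_ext i v p| `^ P)%:E =
    (integral_rV (fun x => `|v x| `^ P * rho i x))%:E)%E.
  rewrite -(integral_chart_rV (i := i) mu_volume (u := fun p => `|chart_ext i v p| `^ P)).
  - rewrite /Rintegral fineK//; apply: integrable_fin_num => //.
    exact: (integrable_continuous n_gt0 mu_volume M_compact (continuous_powR_norm P_gt0 cw)).
  - by apply: continuous_measurable_borel; exact: continuous_powR_norm.
  - by move=> p jp; rewrite chart_ext0// normr0 powR0// gt_eqF.
  - by move=> x jx; rewrite chart_ext_inv.
  - move=> x jx; rewrite sv ?normr0 ?powR0 ?mul0r// ?gt_eqF//.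
    by rewrite ltNge; apply/negP => xr; apply: jx; exact: rU.
rewrite poweR_EFin lee_fin (energy_chart_ext k rU tv sv) /sobolev_sqnorm prednK//.
by under eq_bigr => a _ do rewrite (energy_chart_ext a rU tv sv).
Qed.

End sobolev_elements.

Theorem theorem2 (R : realType) (n k : nat) (M : riemannian_manifold R n)
    (mu : {measure set (borel M) -> \bar R})
    (mu_volume : is_riemannian_volume mu)
    (M_compact : compact [set: M])
    (k_gt0 : (0 < k)%N) (lt_2k_n : (2 * k < n)%N) :
  best_constant mu k = K0 n k /\ 0 < K0 (R := R) n k /\
  (forall eps : R, 0 < eps -> exists B : R, forall u : sobolev mu k,
    ((\int[mu]_p (`|u p| `^ critical_exponent R n k)%:E)
       `^ (2 / critical_exponent R n k)
     <= ((K0 n k + eps) * sobolev_energy k u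
         + B * completion_sqnorm k.-1 u)%:E)%E).
Proof.
have ineq e := @sobolev_inequality R n M mu mu_volume M_compact k k_gt0 lt_2k_n e.
split; last split.
- rewrite /best_constant; set S := [set A | _].
  (* With the membership of [K0 + 1] below, this shows that [S] is nonempty and bounded below, so
     [inf] does not take its default value. *)
  have lbS : lbound S (K0 n k).
    by move=> A [B hB]; exact: (K0_lower_bound mu_volume M_compact k_gt0 lt_2k_n hB).
  apply/eqP; rewrite eq_le; apply/andP; split.
    apply/ler_addgt0Pr => e e0; apply: ge_inf; first by exists (K0 n k).
    exact: ineq.
  by apply: lb_le_inf => //; exists (K0 n k + 1); exact: ineq.
- exact: K0_gt0.
- move=> e e0; have [B hB] := ineq e e0; exists B => u.
  by rewrite poweR_Lnorm_sq.
Qed.
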